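(* Let $m>0$, let $1\le p\le\infty$, and let $\alpha=\gamma^0$ or $\alpha=-i\gamma^1$. Consider the Cauchy problem for the one-dimensional Chern–Simons–Dirac system $$ \begin{cases} i\gamma^\mu(\partial_\mu-iA_\mu)\psi=m\psi, & t>0,\ x\in\mathbb{R},\\ \partial_tA_1-\partial_xA_0=\psi^*\alpha\psi, & t>0,\ x\in\mathbb{R},\\ \partial_tA_0-\partial_xA_1=0, & t>0,\ x\in\mathbb{R},\\ \psi(0,x)=\psi_0(x),\quad \mathbb{A}(0,x)=\mathbb{A}_0(x), & x\in\mathbb{R}, \end{cases} $$ for the unknowns $\psi={}^t(\psi_1,\psi_2)$ with values in $\mathbb{C}^2$ and $\mathbb{A}={}^t(A_0,A_1)$ with values in $\mathbb{R}^2$. For any $\psi_0\in L^p(\mathbb{R})$ and $\mathbb{A}_0\in L^p(\mathbb{R})$ there exists a global weak solution $(\psi,\mathbb{A})\in C([0,\infty);L^p)\times C([0,\infty);L^p)$ such that: (1) the solution is unique in the class $$\psi\in C([0,\infty);L^p),\quad \mathbb{A}\in C([0,\infty);L^p),\quad \psi^*\alpha\psi\in L^p_{loc}([0,\infty);L^p),\quad \mathbb{A}\psi\in L^p_{loc}([0,\infty);L^p);$$ (2) the map from the data $(\psi_0,\mathbb{A}_0)$ to the solution $(\psi,\mathbb{A})$ is Lipschitz continuous from $L^p\times L^p$ to $C([0,\infty);L^p)\times C([0,\infty);L^p)$.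
   Context: The index $\mu$ is summed over $\mu=0,1$, with $\partial_0=\partial_t$, $\partial_1=\partial_x$. The Dirac matrices are $\gamma^0=\begin{pmatrix}1&0\\0&-1\end{pmatrix}$ and $\gamma^1=\begin{pmatrix}0&1\\-1&0\end{pmatrix}$. For $\psi={}^t(\psi_1,\psi_2)$, $\psi^*={}^t\overline{\psi}=(\overline{\psi}_1,\overline{\psi}_2)$. $L^p=L^p(\mathbb{R})$ is the Lebesgue space in $x$; $\psi_0$ is $\mathbb{C}^2$-valued and $\mathbb{A}_0$ is $\mathbb{R}^2$-valued. The notation $\mathbb{A}\psi$ denotes the gauge coupling term $\gamma^\mu A_\mu\psi$ of the Dirac equation. Equivalently, setting $\psi_\pm=\psi_1\pm\psi_2$ and $A_\pm=A_0\mp A_1$, the condition $\mathbb{A}\psi\in L^p_{loc}([0,\infty);L^p)$ means $A_-\psi_+,\ A_+\psi_-\in L^p_{loc}([0,\infty);L^p)$. In these variables the system is equivalent to $\partial_t\psi_\pm\pm\partial_x\psi_\pm=iA_\mp\psi_\pm-im\psi_\mp$, $\ \partial_tA_\pm\pm\partial_xA_\pm=\mp\psi^*\alpha\psi$. A weak solution is a pair whose nonlinear terms $A_\mp\psi_\pm$ and $\psi^*\alpha\psi$ are locally integrable on $[0,\infty)\times\mathbb{R}$ and which satisfies the integral equations $$\psi_\pm(t,x)=\psi_\pm(0,x\mp t)+i\int_0^t(A_\mp\psi_\pm-m\psi_\mp)(s,x\mp(t-s))\,ds,$$ $$A_\pm(t,x)=A_\pm(0,x\mp t)\mp\int_0^t(\psi^*\alpha\psi)(s,x\mp(t-s))\,ds,$$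 with $\psi_\pm(0,\cdot)$, $A_\pm(0,\cdot)$ determined by $\psi_0,\mathbb{A}_0$.
   Formalization: For p=∞, continuity in time with values in L^∞ is taken in the weak-* topology (norm continuity fails for discontinuous data), and the Lipschitz continuity in (2) holds on each bounded set of data, uniformly on compact time intervals (no global constant exists). *)

(* Defs.v *)
From HB Require Import structures.
From mathcomp Require Import all_boot all_order all_algebra.
From mathcomp Require Import all_classical all_reals all_analysis.
From mathcomp Require Import complex.
Import Order.TTheory GRing.Theory Num.Theory numFieldNormedType.Exports.
Set Implicit Arguments.
Unset Strict Implicit.
Unset Printing Implicit Defensive.

Local Open Scope classical_set_scope.
Local Open Scope ring_scope.
Local Open Scope complex_scope.

Section DiracAlgebra.
Context {R : realType}.
Implicit Types (psi : 'cV[R[i]]_2) (A : 'cV[R]_2).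

Definition mat2 (a b c d : R[i]) : 'M[R[i]]_2 :=
  \matrix_(i < 2, j < 2)
    (if i == 0 then (if j == 0 then a else b) else (if j == 0 then c else d)).

Definition gamma0 : 'M[R[i]]_2 := mat2 1 0 0 (-1).
Definition gamma1 : 'M[R[i]]_2 := mat2 0 1 (-1) 0.

(* [psi^* alpha psi], kept as a 1 x 1 complex matrix; it is real when
   [alpha] is Hermitian *)
Definition quadf (alpha : 'M[R[i]]_2) psi : 'cV[R[i]]_1 :=
  map_mx conjc psi^T *m alpha *m psi.

(* [gamma^mu A_mu psi] *)
Definition gauge_coupling A psi : 'cV[R[i]]_2 :=
  (A 0 0)%:C *: (gamma0 *m psi) + (A 1 0)%:C *: (gamma1 *m psi).

(* Signs are encoded by booleans, [false] standing for + and [true] for -, so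
   that [sgn s] is (-1)^s and [~~ s] is the opposite sign. *)
Definition sgn (s : bool) : R := (-1) ^+ s.

(* psi_+- = psi_1 +- psi_2 *)
Definition psi_pm (s : bool) psi : R[i] := psi 0 0 + (sgn s)%:C * psi 1 0.

(* A_+- = A_0 -+ A_1 *)
Definition A_pm (s : bool) A : R := A 0 0 - sgn s * A 1 0.

Definition cvec (n : nat) (v : 'cV[R]_n) : 'cV[R[i]]_n :=
  map_mx (real_complex R) v.

Definition enorm (n : nat) (v : 'cV[R[i]]_n) : R :=
  Num.sqrt (\sum_(i < n) (complex.Re (v i 0) ^+ 2 + complex.Im (v i 0) ^+ 2)).

End DiracAlgebra.

Section FunctionSpaces.
Context {R : realType}.
Local Notation mu := (@lebesgue_measure R).
Local Notation rT := (measurableTypeR R).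

Definition cRintegral (D : set rT) (f : rT -> R[i]) : R[i] :=
  (\int[mu]_(x in D) complex.Re (f x)) +i*
  (\int[mu]_(x in D) complex.Im (f x)).

Definition cmeasurable d (T : measurableType d) (n : nat) (D : set T)
    (f : T -> 'cV[R[i]]_n) : Prop :=
  forall i : 'I_n, measurable_fun D (fun x => complex.Re (f x i 0)) /\
                   measurable_fun D (fun x => complex.Im (f x i 0)).

Definition Lpnorm (p : \bar R) (n : nat) (f : rT -> 'cV[R[i]]_n) : \bar R :=
  Lnorm mu p (fun x => (enorm (f x))%:E).

Definition inLp (p : \bar R) (n : nat) (f : rT -> 'cV[R[i]]_n) : Prop :=
  cmeasurable setT f /\ (Lpnorm p f < +oo)%E.

(* Functions of (t, x) in [0, oo[ x R are curried; their values at t < 0 are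
   never used. *)
Definition halfspace : set (rT * rT) := `[0, +oo[ `*` setT.

Definition jmeasurable (n : nat) (f : rT -> rT -> 'cV[R[i]]_n) : Prop :=
  cmeasurable halfspace (fun z => f z.1 z.2).

Definition strong_continuous (p : \bar R) (n : nat)
    (f : rT -> rT -> 'cV[R[i]]_n) : Prop :=
  forall t0 : R, 0 <= t0 ->
    Lpnorm p (fun x => f t x - f t0 x)
      @[t --> within `[0, +oo[ (nbhs (t0 : R))] --> 0%E.

(* Continuity for the weak-* topology of L^oo, as the dual of L^1, together
   with boundedness on compact time intervals (which weak-* continuity
   implies, by the uniform boundedness principle). *)
Definition weakstar_continuous (n : nat)
    (f : rT -> rT -> 'cV[R[i]]_n) : Prop :=
  (forall T : R, exists M : R, forall t : R, 0 <= t <= T ->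
     (Lpnorm +oo (f t) <= M%:E)%E) /\
  (forall (i : 'I_n) (g : rT -> R), mu.-integrable setT (EFin \o g) ->
     {within `[0, +oo[, continuous
        ((fun t => \int[mu]_x (complex.Re (f t x i 0) * g x)) : R -> R)} /\
     {within `[0, +oo[, continuous
        ((fun t => \int[mu]_x (complex.Im (f t x i 0) * g x)) : R -> R)}).

(* C([0, oo[; L^p), through jointly measurable representatives. Translations
   are not norm-continuous on L^oo, so that even the free evolution of a
   discontinuous datum is not norm-continuous in time: for p = oo, L^oo
   carries its weak-* topology. *)
Definition CLp (p : \bar R) (n : nat) (f : rT -> rT -> 'cV[R[i]]_n) : Prop :=
  [/\ jmeasurable f,
      forall t : R, 0 <= t -> inLp p (f t) &
      if p is +oo%E then weakstar_continuous f else strong_continuous p f].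

(* L^p_loc([0, oo[; L^p) *)
Definition LplocLp (p : \bar R) (n : nat)
    (f : rT -> rT -> 'cV[R[i]]_n) : Prop :=
  jmeasurable f /\
  forall T : R, 0 < T ->
    (Lnorm mu p ((fun t : rT => Lpnorm p (f t)) \_ `[0%R, T]) < +oo)%E.

(* local integrability on [0, oo[ x R *)
Definition loc_integrable (f : rT -> rT -> R[i]) : Prop :=
  forall T r : R, 0 < T -> 0 < r ->
    (mu \x mu)%E.-integrable (`[0, T] `*` `[- r, r])
      (fun z : rT * rT => (complex.Re (f z.1 z.2))%:E) /\
    (mu \x mu)%E.-integrable (`[0, T] `*` `[- r, r])
      (fun z : rT * rT => (complex.Im (f z.1 z.2))%:E).

End FunctionSpaces.

Section ChernSimonsDirac.
Context {R : realType}.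
Local Notation mu := (@lebesgue_measure R).
Local Notation rT := (measurableTypeR R).
Implicit Types (psi : rT -> rT -> 'cV[R[i]]_2) (A : rT -> rT -> 'cV[R]_2).

(* The nonlinear terms are locally integrable and the Duhamel form of
     d_t psi_+- +- d_x psi_+- = i A_-+ psi_+- - i m psi_-+,
     d_t A_+-   +- d_x A_+-   = -+ psi^* alpha psi
   holds along the characteristics, at every time t >= 0 and for almost every
   x; at t = 0 it gives back the initial data. *)
Definition weak_solution (m : R) (alpha : 'M[R[i]]_2)
    (psi0 : rT -> 'cV[R[i]]_2) (A0 : rT -> 'cV[R]_2) psi A : Prop :=
  [/\ forall s : bool,
        loc_integrable
          (fun t x => (A_pm (~~ s) (A t x))%:C * psi_pm s (psi t x)),
      loc_integrable (fun t x => quadf alpha (psi t x) 0 0),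
      forall (s : bool) (t : R), 0 <= t ->
        {ae mu, forall x,
          psi_pm s (psi t x) =
            psi_pm s (psi0 (x - sgn s * t)) +
            'i%C * cRintegral `[0, t]
              (fun r => let y := x - sgn s * (t - r) in
                 (A_pm (~~ s) (A r y))%:C * psi_pm s (psi r y)
                 - m%:C * psi_pm (~~ s) (psi r y))} &
      forall (s : bool) (t : R), 0 <= t ->
        {ae mu, forall x,
          (A_pm s (A t x))%:C =
            (A_pm s (A0 (x - sgn s * t)))%:C -
            (sgn s)%:C * cRintegral `[0, t]
              (fun r => quadf alpha (psi r (x - sgn s * (t - r))) 0 0)}].

Definition uniqueness_class (p : \bar R) (alpha : 'M[R[i]]_2) psi A : Prop :=
  [/\ CLp p psi,
      CLp p (fun t x => cvec (A t x)),
      LplocLp p (fun t x => quadf alpha (psi t x)) &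
      LplocLp p (fun t x => gauge_coupling (A t x) (psi t x))].

(* equality as functions of t >= 0 with values in the space of classes of
   almost everywhere equal functions of x *)
Definition same_evolution (V : Type) (f g : rT -> rT -> V) : Prop :=
  forall t : R, 0 <= t -> {ae mu, forall x, f t x = g t x}.

Definition dist_Lp (p : \bar R) (psi0 psi0' : rT -> 'cV[R[i]]_2)
    (A0 A0' : rT -> 'cV[R]_2) : \bar R :=
  (Lpnorm p (fun x => psi0 x - psi0' x)%R
   + Lpnorm p (fun x => cvec (A0 x - A0' x)%R))%E.

(* Lipschitz continuity, on every bounded set of data, into C([0, oo[; L^p)
   with its topology of uniform convergence on compact time intervals. *)
Definition lipschitz_solution_map (p : \bar R)
    (Psi : (rT -> 'cV[R[i]]_2) -> (rT -> 'cV[R]_2) -> rT -> rT -> 'cV[R[i]]_2)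
    (AA : (rT -> 'cV[R[i]]_2) -> (rT -> 'cV[R]_2) -> rT -> rT -> 'cV[R]_2)
    : Prop :=
  forall T M : R, exists L : R,
  forall (psi0 psi0' : rT -> 'cV[R[i]]_2) (A0 A0' : rT -> 'cV[R]_2),
    inLp p psi0 -> inLp p (fun x => cvec (A0 x)) ->
    inLp p psi0' -> inLp p (fun x => cvec (A0' x)) ->
    (Lpnorm p psi0 + Lpnorm p (fun x => cvec (A0 x)) <= M%:E)%E ->
    (Lpnorm p psi0' + Lpnorm p (fun x => cvec (A0' x)) <= M%:E)%E ->
    forall t : R, 0 <= t <= T ->
      (dist_Lp p (Psi psi0 A0 t) (Psi psi0' A0' t)
                 (AA psi0 A0 t) (AA psi0' A0' t)
       <= L%:E * dist_Lp p psi0 psi0' A0 A0')%E.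

End ChernSimonsDirac.

(* Main.v *)
(* In the variables psi_s, A_s and along the characteristics x = y + sgn s * t,
   labelled by y, the system reads
     psi_s' = i A_{-s} psi_s - i m psi_{-s},   A_s' = - sgn s (psi^* alpha psi).
   Since A is real, it does not contribute to the growth of |psi_s|, whence
     |psi_s|(t, y + sgn s t) <= 2 h(y) + 4 m int_0^t |psi_{-s}|(r, y + sgn s r) dr,
   where h bounds the data. In terms of labels |psi_{-s}| is evaluated at
   y + 2 sgn s r, and iterating gives |psi_s| <= C(t) (h(y) + int_{|z-x|<t} h).
   Hence psi^* alpha psi is at most a product h(x - t) h(x + t) plus better terms,
   and its integral along a characteristic is bounded by h(y) times an integral
   of h over an interval, so that A satisfies the same pointwise bound.

   A difference of two solutions obeys a Gronwall inequality along the
   characteristics whose coefficients depend on h alone, with an explicit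
   supersolution: if e bounds the difference of the data, then
     |difference| <= exp(2 int B) (e(y) + B(y) int e),   B = c (h + h' + 1).
   Taking L^p norms of these pointwise bounds gives everything for all p at once:
   translations are isometries, window integrals act boundedly on L^p and map it
   to L^oo, and by Tonelli h(x - t) h(x + t) belongs to L^p_{t,x}. Existence
   follows from a Picard iteration for a truncated nonlinearity; truncating
   radially keeps the phase structure, so that the a priori bound applies and
   shows that the truncation is never active. *)

Require Import Defs.
From mathcomp Require Import all_boot all_order all_algebra.
From mathcomp Require Import all_classical all_reals all_analysis.
From mathcomp Require Import measurable_realfun ess_sup_inf.
From mathcomp Require Import complex.
From mathcomp Require Import ring lra.
Import Order.TTheory GRing.Theory Num.Theory numFieldNormedType.Exports.
Set Implicit Arguments.
Unset Strict Implicit.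
Unset Printing Implicit Defensive.

Local Open Scope classical_set_scope.
Local Open Scope ring_scope.

(** * Integrals on the line and along characteristics *)

(** What helps is that each quadratic term has exactly one factor from each family: along a
    characteristic the factor of the same family is controlled by the fixed label, while the other
    one runs over the labels crossed. Measured against the weight [B y * expR (2 * win B t x)], the
    Duhamel operator is a contraction by 1/2 on every time interval. This mechanism drives the
    Picard convergence, the a priori bound and the stability estimate, and the 2 in the exponent is
    chosen to produce that 1/2. A solution of the uniqueness class comes with no pointwise bound and
    satisfies its equation at each time for almost every [x] only. Tonelli exchanges this for almost
    every characteristic, and the phase rotation inequality, inserted once into itself, turns bounds
    on integrals in space into a pointwise bound; from there on the same Gronwall lemma applies. *)

Section LineIntegrals.
Context {R : realType}.
Local Notation mu := (@lebesgue_measure R).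
Local Notation rT := (measurableTypeR R).
Implicit Types (f g : R -> R) (a b c t x y : R).

Lemma measurable_affine a b : measurable_fun [set: rT] (fun x : rT => a * x + b : rT).
Proof. by apply: measurable_funD => //; exact: mulrl_measurable. Qed.

(** [|a|] times the image of Lebesgue measure under [x |-> a x + b] gives every []c, d]] its length,
    so by uniqueness it is Lebesgue measure; what remains is integration against an image measure.
    The sign of [a] only decides which end of the preimage interval is closed. *)
Lemma ge0_integral_affine a b (f : rT -> \bar R) : a != 0 ->
  measurable_fun setT f -> (forall x, (0 <= f x)%E) ->
  (\int[mu]_x f (a * x + b)%R = (`|a|^-1)%:E * \int[mu]_x f x)%E.
Proof.
move=> a0 mf f0.
have ia0 : 0 <= `|a| by [].
pose phi : rT -> rT := fun x => a * x + b.
have mphi : measurable_fun setT phi by exact: measurable_affine.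
pose pmu : {measure set rT -> \bar R} :=
  pushforward mu phi.
pose nu : {measure set rT -> \bar R} := mscale (NngNum ia0) (pmu mphi).
have nuE : forall A, measurable A -> mu A = nu A.
  apply: lebesgue_measure_unique => _ [[c d] /= _ <-].
  rewrite /nu /mscale /= /pushforward.
  have [a_gt0|a_le0] := ltP 0 a.
    have -> : phi @^-1` `]c, d] = `](c - b) / a, (d - b) / a]%classic.
      apply/seteqP; split => x /=; rewrite !in_itv /= /phi ltr_pdivrMr// ler_pdivlMr//;
        by rewrite [x * a]mulrC ltrBlDr lerBrDr.
    rewrite !lebesgue_measure_itv /= !lte_fin ltr_pM2r ?invr_gt0// ltrD2r.
    case: ifPn => _; last by rewrite mule0.
    by rewrite -!EFinD -EFinM gtr0_norm//; congr (_%:E); field.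
  have a_lt0 : a < 0 by rewrite lt_neqAle a0.
  have -> : phi @^-1` `]c, d] = `[(d - b) / a, (c - b) / a[%classic.
    apply/seteqP; split => x /=; rewrite !in_itv /= /phi ltr_ndivlMr// ler_ndivrMr//;
      by rewrite [x * a]mulrC ltrBlDr lerBrDr andbC.
  rewrite !lebesgue_measure_itv /= !lte_fin ltr_nM2r ?invr_lt0// ltrD2r.
  case: ifPn => _; last by rewrite mule0.
  by rewrite -!EFinD -EFinM ltr0_norm//; congr (_%:E); field.
have -> : (\int[mu]_x f x = \int[nu]_x f x)%E.
  by apply: eq_measure_integral => A mA _; exact: nuE.
rewrite ge0_integral_mscale// ge0_integral_pushforward//.
by rewrite muleA -EFinM /= mulVf ?mul1e// normr_eq0.
Qed.

Definition locint f := measurable_fun setT f /\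
  forall a b, mu.-integrable `[a, b] (EFin \o f).

Lemma locint_measurable f : locint f -> measurable_fun setT f.
Proof. by case. Qed.

Lemma locint_itv f a b : locint f -> mu.-integrable `[a, b] (EFin \o f).
Proof. by case. Qed.

Lemma integrable_itv_cst a b c : mu.-integrable `[a, b] (EFin \o cst c).
Proof.
apply: measurable_bounded_integrable => //.
  by apply: compact_finite_measure; exact: segment_compact.
exists `|c|; split; first exact: num_real.
by move=> M cM x _ /=; exact: ltW.
Qed.

Lemma integrable_addr (D : set rT) f g : measurable D ->
  mu.-integrable D (EFin \o f) -> mu.-integrable D (EFin \o g) ->
  mu.-integrable D (EFin \o (fun x => f x + g x)).
Proof. by move=> mD If Ig; have := integrableD mD If Ig; exact. Qed.

Lemma integrable_subr (D : set rT) f g : measurable D ->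
  mu.-integrable D (EFin \o f) -> mu.-integrable D (EFin \o g) ->
  mu.-integrable D (EFin \o (fun x => f x - g x)).
Proof. by move=> mD If Ig; have := integrableB mD If Ig; exact. Qed.

Lemma integrable_mulr (D : set rT) c f : measurable D ->
  mu.-integrable D (EFin \o f) ->
  mu.-integrable D (EFin \o (fun x => c * f x)).
Proof. by move=> mD If; have := integrableZl mD c If; exact. Qed.

Lemma integrable_le (D : set rT) (f g : rT -> R) : measurable D ->
  measurable_fun D f -> (forall x, D x -> `|f x| <= g x) ->
  mu.-integrable D (EFin \o g) -> mu.-integrable D (EFin \o f).
Proof.
move=> mD mf fg; apply: le_integrable => //; first exact/measurable_EFinP.
by move=> x Dx /=; rewrite lee_fin (le_trans (fg x Dx))// ler_norm.
Qed.

Lemma locint_cst c : locint (cst c).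
Proof. by split => // a b; exact: integrable_itv_cst. Qed.

Lemma locintD f g : locint f -> locint g -> locint (fun x => f x + g x).
Proof.
move=> [mf If] [mg Ig]; split; first exact: measurable_funD.
by move=> a b; exact: integrable_addr.
Qed.

Lemma locintZ c f : locint f -> locint (fun x => c * f x).
Proof.
move=> [mf If]; split; first exact: measurable_funM.
by move=> a b; exact: integrable_mulr.
Qed.

Lemma locint_affine a b f : a != 0 -> locint f -> locint (fun x => f (a * x + b)).
Proof.
move=> a0 [mf If].
have mfa : measurable_fun setT (fun x => f (a * x + b)).
  by apply: (@measurableT_comp _ _ _ _ _ _ f) => //; exact: measurable_affine.
split => // c d; apply/integrableP; split.
  by apply/measurable_EFinP; exact: measurable_funTS.
(* The affine map sends [[c, d]] into [[- K, K]], so the integral is dominated by one over the whole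
   line, to which the change of variables applies. *)
pose K := `|a| * (`|c| + `|d|) + `|b|.
pose g : rT -> \bar R := (fun x => `|(f x)%:E|)%E \_ `[- K, K].
have mg : measurable_fun setT g.
  apply/(measurable_restrictT _ _).1; first exact: measurable_itv.
  by apply: measurable_funTS; apply: measurableT_comp => //; exact/measurable_EFinP.
have g0 x : (0 <= g x)%E by apply: erestrict_ge0.
apply: (@le_lt_trans _ _ (\int[mu]_x g (a * x + b)%R)%E).
  rewrite integral_mkcond; apply: ge0_le_integral => //.
  - by move=> x _; apply: erestrict_ge0.
  - apply/(measurable_restrictT _ _).1; first exact: measurable_itv.
    by apply: measurable_funTS; apply: measurableT_comp => //; exact/measurable_EFinP.
  - by apply: (@measurableT_comp _ _ _ _ _ _ g) => //; exact: measurable_affine.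
  - move=> x _; rewrite patchE; case: ifPn => [|_]; last exact: g0.
    rewrite inE /= in_itv /= => /andP[cx xd].
    rewrite /g patchE mem_set//= in_itv /= -ler_norml /K.
    rewrite (le_trans (ler_normD _ _))// lerD2r normrM ler_wpM2l//.
    have := ler_norm d; have := lerNnormlW (lexx `|c|); have := normr_ge0 c.
    have := normr_ge0 d.
    by rewrite ler_norml => *; apply/andP; split; lra.
rewrite ge0_integral_affine// lte_mul_pinfty ?lee_fin ?invr_ge0//.
by rewrite -integral_mkcond; case/integrableP : (If (- K) K).
Qed.

Lemma Rint_add f a b c : a <= b -> b <= c -> mu.-integrable `[a, c] (EFin \o f) ->
  \int[mu]_(x in `[a, c]) f x =
  \int[mu]_(x in `[a, b]) f x + \int[mu]_(x in `[b, c]) f x.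
Proof.
move=> ab bc If.
have := @Rintegral_itvB _ f (BLeft a) (BRight c) b If.
rewrite !bnd_simp => /(_ ab bc).
rewrite Rintegral_itv_obnd_cbnd; last first.
  apply: integrableS If => //; apply: subset_itv; rewrite bnd_simp//.
by move=> <-; rewrite addrC subrK.
Qed.

(** The base of the backward light cone with apex [(t, x)]; it is empty for negative [t]. *)
Definition win f t x := \int[mu]_(y in `[x - t, x + t]) f y.

(** At time [r] the characteristic of family [s] labelled [y] crosses the one of the opposite family
    labelled [y + 2 sgn s r]. As [r] runs over [[0, t]] these labels sweep the base of the cone at
    speed 2, whence the factor 1/2. *)
Lemma Rint_char (s : bool) t y f : locint f -> (forall x, 0 <= f x) -> 0 <= t ->
  \int[mu]_(r in `[0, t]) f (y + sgn s * r + sgn s * r) =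
  2^-1 * win f t (y + sgn s * t).
Proof.
move=> lf f0 t0; rewrite /win /Rintegral.
pose x := y + sgn s * t.
pose g : rT -> \bar R := (EFin \o f) \_ `[x - t, x + t].
have g0 z : (0 <= g z)%E by apply: erestrict_ge0 => z' _; rewrite lee_fin.
have mg : measurable_fun setT g.
  apply/(measurable_restrictT _ _).1; first exact: measurable_itv.
  by apply: measurable_funTS; apply/measurable_EFinP; exact: locint_measurable.
have s2 : 2 * sgn s != 0 :> R by rewrite mulf_neq0// signr_eq0.
have E := @ge0_integral_affine _ y g s2 mg g0.
rewrite -/x integral_mkcond.
rewrite (_ : (\int[mu]_x0 _ = \int[mu]_z g ((2 * sgn s) * z + y)%R)%E); last first.
  apply: eq_integral => z _; rewrite /g !patchE /=.
  have -> : (z \in `[0, t]%classic) =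
      ((2 * sgn s * z + y) \in `[x - t, x + t]%classic).
    apply/idP/idP; rewrite !inE /= !in_itv /= /x /sgn;
      case: s {x g g0 mg s2 E} => /=; rewrite ?expr1 ?expr0 => /andP[? ?];
      apply/andP; split; lra.
  have e (u : R) : 2 * sgn s * u + y = y + sgn s * u + sgn s * u by ring.
  by rewrite e.
rewrite E /g -integral_mkcond fineM//; last first.
  have := locint_itv (x - t) (x + t) lf => /integrable_fin_num.
  by apply; exact: measurable_itv.
by rewrite /= normrM normr_sign mulr1 ger0_norm.
Qed.

End LineIntegrals.

(** * Calculus of absolutely continuous primitives *)

Section PrimitiveCalculus.
Context {R : realType}.
Local Notation mu := (@lebesgue_measure R).
Local Notation rT := (measurableTypeR R).
Implicit Types (f g H L : R -> R) (a b c t x y : R).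

(* Bisecting along level sets of [L] halves the constant [K]. *)
Lemma le_of_quadratic_increment H L t (K : R) : 0 <= t -> 0 <= K ->
  {within `[0, t], continuous L} ->
  (forall a b, 0 <= a -> a <= b -> b <= t -> L a <= L b) ->
  (forall a b, 0 <= a -> a <= b -> b <= t ->
    - (K * (L b - L a) ^+ 2) <= H b - H a) ->
  H 0 <= H t.
Proof.
move=> t0 K0 cL ndL incr.
have step n a b : 0 <= a -> a <= b -> b <= t ->
    - (K / 2 ^+ n * (L b - L a) ^+ 2) <= H b - H a.
  elim: n a b => [|n IH] a b a0 ab bt; first by rewrite expr0 divr1; exact: incr.
  have cLab : {within `[a, b], continuous L}.
    by apply: continuous_subspaceW cL; apply: subset_itv; rewrite bnd_simp.
  have Lab := ndL _ _ a0 ab bt.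
  have [|c] := @IVT _ L a b ((L a + L b) / 2) ab cLab.
    by rewrite min_l// max_r//; apply/andP; split; lra.
  rewrite in_itv /= => /andP[ac cb] Lc.
  have := IH _ _ a0 ac (le_trans cb bt).
  have := IH _ _ (le_trans a0 ac) cb bt.
  rewrite Lc (exprS _ n) invfM.
  set k := (2 ^+ n)^-1; lra.
have Lt := ndL _ _ (lexx 0) t0 (lexx t).
rewrite leNgt; apply/negP => Ht.
pose d := H 0 - H t; have d0 : 0 < d by rewrite subr_gt0.
pose C := K * (L t - L 0) ^+ 2.
pose n := (Num.truncn (C / d)).+1.
have := step n _ _ (lexx 0) t0 (lexx t).
apply/negP; rewrite -ltNge -opprB ltrN2 -/d mulrAC -/C.
rewrite ltr_pdivrMr ?exprn_gt0// mulrC -ltr_pdivrMr//.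
apply: (lt_trans (truncnS_gt _)).
by rewrite -natrX ltr_nat ltn_expl.
Qed.

Lemma prim_diff f a b t : 0 <= a -> a <= b -> b <= t ->
  mu.-integrable `[0, t] (EFin \o f) ->
  \int[mu]_(x in `[0, b]) f x - \int[mu]_(x in `[0, a]) f x =
  \int[mu]_(x in `[a, b]) f x.
Proof.
move=> a0 ab bt If; rewrite (@Rint_add _ f 0 a b)//; last first.
  by apply: integrableS If => //; apply: subset_itv; rewrite bnd_simp.
by rewrite addrAC subrr add0r.
Qed.

Lemma integrable_sub_itv f a b t : 0 <= a -> b <= t ->
  mu.-integrable `[0, t] (EFin \o f) -> mu.-integrable `[a, b] (EFin \o f).
Proof.
by move=> a0 bt If; apply: integrableS If => //; apply: subset_itv; rewrite bnd_simp.
Qed.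

Lemma prim_nd f a b t : 0 <= a -> a <= b -> b <= t ->
  (forall x, 0 <= x <= t -> 0 <= f x) ->
  mu.-integrable `[0, t] (EFin \o f) ->
  \int[mu]_(x in `[0, a]) f x <= \int[mu]_(x in `[0, b]) f x.
Proof.
move=> a0 ab bt f0 If; rewrite -subr_ge0 (prim_diff _ _ bt)//.
apply: Rintegral_ge0 => x /=; rewrite in_itv /= => /andP[ax xb].
by apply: f0; rewrite (le_trans a0 ax) (le_trans xb bt).
Qed.

Lemma prim_measurable f t : 0 <= t -> mu.-integrable `[0, t] (EFin \o f) ->
  measurable_fun `[0, t] (fun s : rT => \int[mu]_(x in `[0, s]) f x).
Proof.
move=> t0 If; apply: subspace_continuous_measurable_fun => //.
exact: parameterized_integral_continuous.
Qed.

Lemma integrable_mul_bounded (D : set rT) f g (M : R) : measurable D ->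
  measurable_fun D g -> (forall x, D x -> `|g x| <= M) ->
  mu.-integrable D (EFin \o f) ->
  mu.-integrable D (EFin \o (fun x => f x * g x)).
Proof.
move=> mD mg gM If.
have mf : measurable_fun D f by apply/measurable_EFinP; exact: measurable_int If.
apply: (@integrable_le _ D _ (fun x => M * `|f x|)) => //.
- exact: measurable_funM.
- by move=> x Dx; rewrite normrM mulrC ler_wpM2r// gM.
- by apply: integrable_mulr => //; exact: integrable_norm.
Qed.

Lemma Rint_le f g a b : mu.-integrable `[a, b] (EFin \o f) ->
  mu.-integrable `[a, b] (EFin \o g) ->
  (forall x, a <= x <= b -> f x <= g x) ->
  \int[mu]_(x in `[a, b]) f x <= \int[mu]_(x in `[a, b]) g x.
Proof.
by move=> If Ig fg; apply: le_Rintegral => // x /=; rewrite in_itv /=; exact: fg.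
Qed.

(** One increment of [expR (k F) - k G]: [d] is the increment of [F], [ea] and [eb] are the
    exponentials at its ends, [ga] and [gb] the values of the primitive [G] of [f expR (k F)]. Using
    [1 + x <= expR x] at both ends cancels the first order terms and leaves a quadratic error. *)
Let expR_increment (k d ea eb et ga gb : R) : 0 <= k -> 0 <= d ->
  ea * (1 + k * d) <= eb -> eb * (1 - k * d) <= ea -> eb <= et ->
  gb - ga <= eb * d ->
  - (k ^+ 2 * et * d ^+ 2) <= (eb - k * gb) - (ea - k * ga).
Proof.
move=> k0 d0 e1 e2 e3 g.
have kd : 0 <= k * d by rewrite mulr_ge0.
have h1 : k * (gb - ga) <= k * (eb * d) by rewrite ler_wpM2l.
have h2 : (k * d) * (eb * (1 - k * d)) <= (k * d) * ea by rewrite ler_wpM2l.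
have h3 : (k * d) ^+ 2 * eb <= (k * d) ^+ 2 * et by rewrite ler_wpM2l// sqr_ge0.
lra.
Qed.

(** The chain rule for an absolutely continuous [F], as an inequality: [expR (k F) - k G] can
    decrease at most by a multiple of the squared increment of [F], and bisection along the level
    sets of [F] removes that error. No derivative is taken at any point. *)
Lemma Rint_expR f (F : R -> R) t : 0 <= t -> (forall x, 0 <= x <= t -> 0 <= f x) ->
  mu.-integrable `[0, t] (EFin \o f) -> forall k : R, 0 <= k ->
  (forall s, 0 <= s <= t -> F s = \int[mu]_(x in `[0, s]) f x) ->
  mu.-integrable `[0, t] (EFin \o (fun s => f s * expR (k * F s))) /\
  k * \int[mu]_(s in `[0, t]) (f s * expR (k * F s)) <= expR (k * F t) - 1.
Proof.
move=> t0 f0 If k k0 FE.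
pose F' s := \int[mu]_(x in `[0, s]) f x.
have EE : {in `[0, t]%classic, F =1 F'}.
  by move=> s; rewrite inE /= in_itv /= => /FE.
suff [I1 I2] : mu.-integrable `[0, t] (EFin \o (fun s => f s * expR (k * F' s))) /\
    k * \int[mu]_(s in `[0, t]) (f s * expR (k * F' s)) <= expR (k * F' t) - 1.
  have -> : F t = F' t by rewrite EE// inE /= in_itv /= t0 lexx.
  split; [apply: eq_integrable I1 => //|rewrite (@eq_Rintegral _ _ _ mu _ (fun s => f s * expR (k * F' s)))//];
  by move=> s /EE /= ->.
clear FE EE F; rename F' into F.
have F0 : F 0 = 0 by rewrite /F set_itv1 Rintegral_set1.
have ndF a b : 0 <= a -> a <= b -> b <= t -> F a <= F b.
  by move=> a0 ab bt; exact: (prim_nd a0 ab bt).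
have mF : measurable_fun `[0, t] (fun s : rT => expR (k * F s)).
  apply: measurableT_comp => //; apply: measurable_funM => //.
  exact: prim_measurable.
have cF : {within `[0, t], continuous F} by exact: parameterized_integral_continuous.
have dF a b : 0 <= a -> a <= b -> b <= t ->
    F b - F a = \int[mu]_(x in `[a, b]) f x.
  by move=> a0 ab bt; exact: (prim_diff a0 ab bt).
clearbody F.
have Ife : mu.-integrable `[0, t] (EFin \o (fun s => f s * expR (k * F s))).
  apply: (@integrable_mul_bounded _ _ _ (expR (k * F t))) => //.
  move=> x /=; rewrite in_itv /= => /andP[x0 xt].
  by rewrite ger0_norm ?expR_ge0// ler_expR ler_wpM2l// ndF.
split => //.
have If' a b : 0 <= a -> b <= t -> mu.-integrable `[a, b] (EFin \o f).
  by move=> a0 bt; exact: integrable_sub_itv If.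
have Ife' a b : 0 <= a -> b <= t ->
    mu.-integrable `[a, b] (EFin \o (fun s => f s * expR (k * F s))).
  by move=> a0 bt; exact: integrable_sub_itv Ife.
pose G s := \int[mu]_(x in `[0, s]) (f x * expR (k * F x)).
have G0 : G 0 = 0 by rewrite /G set_itv1 Rintegral_set1.
have dG a b : 0 <= a -> a <= b -> b <= t ->
    G b - G a = \int[mu]_(x in `[a, b]) (f x * expR (k * F x)).
  by move=> a0 ab bt; exact: (prim_diff a0 ab bt).
rewrite -/(G t); clearbody G.
have : expR (k * F 0) - k * G 0 <= expR (k * F t) - k * G t; last first.
  by rewrite F0 G0 mulr0 expR0; lra.
apply: (@le_of_quadratic_increment (fun s => expR (k * F s) - k * G s) F t
  (k ^+ 2 * expR (k * F t))) => //.
  by rewrite mulr_ge0 ?expR_ge0// sqr_ge0.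
move=> a b a0 ab bt.
have b0 := le_trans a0 ab.
have Fab := ndF _ _ a0 ab bt; have Fbt := ndF _ _ b0 bt (lexx t).
apply: expR_increment => //.
- by rewrite subr_ge0.
- rewrite (_ : k * F b = k * F a + k * (F b - F a)); last by ring.
  by rewrite expRD ler_wpM2l ?expR_ge0// expR_ge1Dx.
- rewrite (_ : k * F a = k * F b + (- (k * (F b - F a)))); last by ring.
  by rewrite expRD ler_wpM2l ?expR_ge0// expR_ge1Dx.
- by rewrite ler_expR ler_wpM2l.
- rewrite dG// dF// -RintegralZl//; last exact: If'.
  apply: Rint_le; first exact: Ife'.
    by apply: integrable_mulr => //; exact: If'.
  move=> x /andP[ax xb]; rewrite mulrC ler_wpM2r//.
    by rewrite f0// (le_trans a0 ax) (le_trans xb bt).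
  by rewrite ler_expR ler_wpM2l// ndF// (le_trans a0 ax).
Qed.

(** The fundamental theorem of calculus for the square of a merely absolutely continuous function.
    The defect of the formula on [[a, b]] is quadratic in the increment of the primitive [L] of
    [|f|], and the bisection argument is applied to both signs of it. *)
Lemma prim_sqr f t c : 0 <= t -> mu.-integrable `[0, t] (EFin \o f) ->
  let P s := c + \int[mu]_(x in `[0, s]) f x in
  mu.-integrable `[0, t] (EFin \o (fun s => P s * f s)) /\
  (P t) ^+ 2 = c ^+ 2 + 2 * \int[mu]_(s in `[0, t]) (P s * f s).
Proof.
move=> t0 If P.
have P0 : P 0 = c by rewrite /P set_itv1 Rintegral_set1 addr0.
have Inf : mu.-integrable `[0, t] (EFin \o (fun x => `|f x|)).
  exact: integrable_norm.
pose L s := \int[mu]_(x in `[0, s]) `|f x|.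
have L0 : L 0 = 0 by rewrite /L set_itv1 Rintegral_set1.
have ndL a b : 0 <= a -> a <= b -> b <= t -> L a <= L b.
  by move=> a0 ab bt; apply: (prim_nd a0 ab bt).
have dP a b : 0 <= a -> a <= b -> b <= t -> `|P b - P a| <= L b - L a.
  move=> a0 ab bt.
  rewrite /P opprD addrACA subrr add0r (prim_diff a0 ab bt)// (prim_diff a0 ab bt)//.
  by apply: le_normr_Rintegral => //; exact: integrable_sub_itv If.
have mP : measurable_fun `[0, t] P.
  by apply: measurable_funD => //; exact: prim_measurable.
have dPE a b : 0 <= a -> a <= b -> b <= t ->
    P b - P a = \int[mu]_(x in `[a, b]) f x.
  by move=> a0 ab bt; rewrite /P opprD addrACA subrr add0r (prim_diff a0 ab bt).
have dL a b : 0 <= a -> a <= b -> b <= t ->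
    L b - L a = \int[mu]_(x in `[a, b]) `|f x|.
  by move=> a0 ab bt; exact: (prim_diff a0 ab bt).
have cL : {within `[0, t], continuous L}.
  exact: parameterized_integral_continuous.
clearbody P L.
have IPf : mu.-integrable `[0, t] (EFin \o (fun s => P s * f s)).
  rewrite (_ : (fun s => _) = (fun s => f s * P s)); last first.
    by apply/funext => s; rewrite mulrC.
  apply: (@integrable_mul_bounded _ _ _ (`|c| + L t)) => //.
  move=> x /=; rewrite in_itv /= => /andP[x0 xt].
  have := dP _ _ (lexx 0) x0 xt; rewrite P0 L0 subr0 => h.
  have := ndL _ _ x0 xt (lexx t) => h'.
  rewrite -[P x](subrK c) (le_trans (ler_normD _ _))// addrC lerD2l.
  exact: le_trans h h'.
split => //.
have If' a b : 0 <= a -> b <= t -> mu.-integrable `[a, b] (EFin \o f).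
  by move=> a0 bt; exact: integrable_sub_itv If.
have IPf' a b : 0 <= a -> b <= t ->
    mu.-integrable `[a, b] (EFin \o (fun s => P s * f s)).
  by move=> a0 bt; exact: integrable_sub_itv IPf.
pose G s := \int[mu]_(x in `[0, s]) (P x * f x).
have G0 : G 0 = 0 by rewrite /G set_itv1 Rintegral_set1.
have dG a b : 0 <= a -> a <= b -> b <= t ->
    G b - G a = \int[mu]_(x in `[a, b]) (P x * f x).
  by move=> a0 ab bt; exact: (prim_diff a0 ab bt).
rewrite -/(G t); clearbody G.
have key a b : 0 <= a -> a <= b -> b <= t ->
    `|P b ^+ 2 - P a ^+ 2 - 2 * (G b - G a)| <= 2 * (L b - L a) ^+ 2.
  move=> a0 ab bt.
  have -> : P b ^+ 2 - P a ^+ 2 - 2 * (G b - G a) =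
      \int[mu]_(x in `[a, b]) ((P a + P b) * f x - 2 * (P x * f x)).
    rewrite RintegralB//; last 2 first.
      by apply: integrable_mulr => //; exact: If'.
      by apply: integrable_mulr => //; exact: IPf'.
    rewrite RintegralZl//; last exact: If'.
    rewrite RintegralZl//; last exact: IPf'.
    by rewrite -dG// -dPE//; ring.
  have II : mu.-integrable `[a, b]
      (EFin \o (fun x => (P a + P b) * f x - 2 * (P x * f x))).
    apply: integrable_subr => //; apply: integrable_mulr => //.
      exact: If'.
    exact: IPf'.
  rewrite (le_trans (le_normr_Rintegral _ II))//.
  have -> : 2 * (L b - L a) ^+ 2 =
      \int[mu]_(x in `[a, b]) (2 * (L b - L a) * `|f x|).
    rewrite RintegralZl//; last exact: integrable_sub_itv Inf.
    by rewrite -dL//; ring.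
  apply: Rint_le; first exact: integrable_norm.
    by apply: integrable_mulr => //; exact: integrable_sub_itv Inf.
  move=> x /andP[ax xb].
  (* The factor of [f x] is a difference of two increments of [P], each at most an increment of [L];
     this is where the error becomes quadratic. *)
  have -> : (P a + P b) * f x - 2 * (P x * f x) = ((P b - P x) - (P x - P a)) * f x.
    by ring.
  rewrite normrM ler_wpM2r//.
  have x0 := le_trans a0 ax; have xt := le_trans xb bt.
  have h1 := dP _ _ x0 xb bt; have h2 := dP _ _ a0 ax xt.
  have h3 := ndL _ _ x0 xb bt; have h4 := ndL _ _ a0 ax xt.
  rewrite (le_trans (ler_normB _ _))//; lra.
have e1 := @le_of_quadratic_increment (fun s => P s ^+ 2 - 2 * G s) L t 2 t0 (ler0n _ 2) cL ndL.
have e2 := @le_of_quadratic_increment (fun s => 2 * G s - P s ^+ 2) L t 2 t0 (ler0n _ 2) cL ndL.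
move: e1 e2; rewrite /= P0 G0 => e1 e2.
apply/eqP; rewrite eq_le; apply/andP; split.
  have : 2 * 0 - c ^+ 2 <= 2 * G t - P t ^+ 2; last by lra.
  apply: e2 => a b a0 ab bt; have := key _ _ a0 ab bt.
  by rewrite ler_norml => /andP[]; lra.
have : c ^+ 2 - 2 * 0 <= P t ^+ 2 - 2 * G t; last by lra.
apply: e1 => a b a0 ab bt; have := key _ _ a0 ab bt.
by rewrite ler_norml => /andP[]; lra.
Qed.

End PrimitiveCalculus.

(** * Gronwall inequality along characteristics *)

Section Gronwall.
Context {R : realType}.
Local Notation mu := (@lebesgue_measure R).
Local Notation rT := (measurableTypeR R).
Implicit Types (f g B e : R -> R) (r t x y : R) (s : bool).

Lemma sgnN s : sgn (~~ s) = - sgn s :> R.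
Proof. by case: s; rewrite /sgn /= ?expr1 ?expr0 ?opprK. Qed.

(** Both crossing characteristics pass through the same point at time [r], so they see the same
    cone. *)
Lemma win_opp f s r y :
  win f r (y + sgn s * r + sgn s * r + sgn (~~ s) * r) = win f r (y + sgn s * r).
Proof. by congr win; rewrite sgnN; ring. Qed.

Lemma sgn_neq0 s : sgn s != 0 :> R. Proof. by rewrite /sgn signr_eq0. Qed.

Lemma locint_char s y f : locint f -> locint (fun r => f (y + sgn s * r + sgn s * r)).
Proof.
move=> lf; rewrite (_ : (fun r => _) = (fun r => f ((2 * sgn s) * r + y))).
  by apply: locint_affine => //; rewrite mulf_neq0 ?sgn_neq0.
by apply/funext => r; congr f; ring.
Qed.

Lemma win_ge0 f t x : (forall z, 0 <= f z) -> 0 <= win f t x.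
Proof. by move=> f0; apply: Rintegral_ge0. Qed.

(** Along a characteristic the windows are nested: one end stays at the label [y]. *)
Lemma win_nd f s r t y : locint f -> (forall z, 0 <= f z) -> 0 <= r -> r <= t ->
  win f r (y + sgn s * r) <= win f t (y + sgn s * t).
Proof.
move=> lf f0 r0 rt.
have := @prim_nd _ (fun r => f (y + sgn s * r + sgn s * r)) r t t r0 rt (lexx t) _ _.
rewrite !Rint_char//; last exact: le_trans rt.
rewrite ler_pM2l//; apply => //.
exact/locint_itv/locint_char.
Qed.

Lemma lim_halving (a c : R) : 0 <= c -> (forall n, a <= c / 2 ^+ n) -> a <= 0.
Proof.
move=> c0 h; rewrite leNgt; apply/negP => a0.
pose n := (Num.truncn (c / a)).+1.
have := h n; apply/negP; rewrite -ltNge.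
rewrite ltr_pdivrMr ?exprn_gt0// mulrC -ltr_pdivrMr//.
by apply: (lt_trans (truncnS_gt _)); rewrite -natrX ltr_nat ltn_expl.
Qed.

Let supersolution_arith (E Er D Dr b by' ey eη k : R) :
  1 <= Er -> Er <= E -> 0 <= Dr -> Dr <= D -> 0 <= b -> 0 <= by' -> 0 <= ey ->
  0 <= eη -> 0 <= k ->
  b * (Er * (ey + by' * Dr) + k * (by' * Er)) +
  by' * (Er * (eη + b * Dr) + k * (b * Er)) <=
  (ey + 2 * by' * D + 2 * k * by') * (b * Er) + by' * E * eη.
Proof.
move=> Er1 ErE Dr0 DrD b0 by0 ey0 eη0 k0.
have h1 : 0 <= b * by' * Er * (D - Dr).
  by rewrite !mulr_ge0 ?subr_ge0//; lra.
have h2 : 0 <= by' * eη * (E - Er) by rewrite !mulr_ge0 ?subr_ge0.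
lra.
Qed.

(** Origin of the 2 in the exponent: it makes the weight integral [I] at most a quarter of [E - 1],
    so the two contributions [k * by' * I] together stay below half of [k * by' * E], and the source
    terms still fit into [E * (ey + by' * D)]. *)
Let supersolution_arith2 (E D I by' ey k : R) :
  1 <= E -> 0 <= D -> 0 <= by' -> 0 <= ey -> 0 <= k -> 4 * I <= E - 1 ->
  ey + ((ey + 2 * by' * D + 2 * k * by') * I + by' * E * (2^-1 * D)) <=
  E * (ey + by' * D) + k / 2 * (by' * E).
Proof.
move=> E1 D0 by0 ey0 k0 I4.
have : (ey + 2 * by' * D + 2 * k * by') * (4 * I) <=
       (ey + 2 * by' * D + 2 * k * by') * (E - 1).
  by rewrite ler_wpM2l// !addr_ge0// !mulr_ge0.
have h1 : 0 <= by' * D by rewrite mulr_ge0.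
have h2 : 0 <= k * by' by rewrite mulr_ge0.
have h3 : 0 <= ey * (E - 1) by rewrite mulr_ge0// subr_ge0.
lra.
Qed.

Variables (B e : R -> R).
Hypotheses (lB : locint B) (B0 : forall z, 0 <= B z).
Hypotheses (le : locint e) (e0 : forall z, 0 <= e z).

Let E s t y := expR (2 * win B t (y + sgn s * t)).
Let D s t y := win e t (y + sgn s * t).
Let W (k : R) s t y := E s t y * (e y + B y * D s t y) + k * (B y * E s t y).

(** By [Rint_char] the exponent [2 * win B] is 4 times the primitive of [B] over the crossed labels,
    so this is [Rint_expR] with [k = 4]. *)
Lemma Rint_weight s t y : 0 <= t ->
  mu.-integrable `[0, t] (EFin \o (fun r => B (y + sgn s * r + sgn s * r) * E s r y)) /\
  4 * \int[mu]_(r in `[0, t]) (B (y + sgn s * r + sgn s * r) * E s r y)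
    <= E s t y - 1.
Proof.
move=> t0; pose b r := B (y + sgn s * r + sgn s * r).
have lb : mu.-integrable `[0, t] (EFin \o b) by exact/locint_itv/locint_char.
have h (r : R) : 0 <= r <= t -> 2^-1 * win B r (y + sgn s * r) =
    \int[mu]_(x in `[0, r]) b x.
  by move=> /andP[r0 _]; rewrite Rint_char.
have [] := Rint_expR t0 (fun x _ => B0 _ : 0 <= b x) lb (ler0n _ 4) h.
have EE r : expR (4 * (2^-1 * win B r (y + sgn s * r))) = E s r y.
  by congr expR; field.
have EEf : (fun r => b r * expR (4 * (2^-1 * win B r (y + sgn s * r)))) =
    (fun r => B (y + sgn s * r + sgn s * r) * E s r y).
  by apply/funext => r; rewrite EE.
by cbv beta; rewrite EEf EE.
Qed.

(* The function [W k] with [k = 0] is a supersolution, and the weight [B E] is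
   halved by the homogeneous operator; the hypothesis on [u] is the integral
   inequality
     u s t y <= e y + int_0^t B(y + 2 sgn s r) u s r y
                            + B y * u (~~ s) r (y + 2 sgn s r) dr
   in the label y = x - sgn s t, with the integrand replaced by integrable
   majorants so that nothing has to be assumed measurable. *)
Lemma gronwall_characteristics (T : R) (u : bool -> R -> R -> R) (K : R) :
  (forall s t y, 0 <= t <= T -> u s t y <= K * B y) ->
  (forall V : bool -> R -> R -> R,
     (forall s t y, 0 <= t <= T -> u s t y <= V s t y) ->
     forall s t y (G : R -> R), 0 <= t <= T ->
       mu.-integrable `[0, t] (EFin \o G) ->
       (forall r, 0 <= r <= t ->
          B (y + sgn s * r + sgn s * r) * V s r y +
          B y * V (~~ s) r (y + sgn s * r + sgn s * r) <= G r) ->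
       u s t y <= e y + \int[mu]_(r in `[0, t]) G r) ->
  forall s t y, 0 <= t <= T ->
    u s t y <= expR (2 * win B t (y + sgn s * t)) *
               (e y + B y * win e t (y + sgn s * t)).
Proof.
move=> uK uI.
have E1 s t y : 1 <= E s t y.
  by rewrite -expR0 ler_expR mulr_ge0// win_ge0.
have D0 s t y : 0 <= D s t y by exact: win_ge0.
have ndE s r t y : 0 <= r -> r <= t -> E s r y <= E s t y.
  by move=> r0 rt; rewrite ler_expR ler_wpM2l// win_nd.
have ndD s r t y : 0 <= r -> r <= t -> D s r y <= D s t y.
  by move=> r0 rt; rewrite win_nd.
have Eopp s r y : E (~~ s) r (y + sgn s * r + sgn s * r) = E s r y.
  by rewrite /E win_opp.
have Dopp s r y : D (~~ s) r (y + sgn s * r + sgn s * r) = D s r y.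
  by rewrite /D win_opp.
(* The crude bound [uK] starts the iteration at [k = |K|], each insertion of [W k] into the integral
   inequality halves [k], and letting [n] grow leaves [W 0]. *)
suff main n s t y : 0 <= t <= T -> u s t y <= W (`|K| / 2 ^+ n) s t y.
  move=> s t y tT; rewrite -/(E s t y) -/(D s t y) -subr_le0.
  apply: (@lim_halving _ (`|K| * (B y * E s t y))) => [|n].
    by rewrite !mulr_ge0// (le_trans ler01).
  have := main n s t y tT; rewrite /W; set k := (2 ^+ n)^-1; lra.
elim: n s t y => [|n IH] s t y /[dup] tT /andP[t0 t1].
  rewrite expr0 divr1 (le_trans (uK _ _ _ tT))//.
  have h1 : 0 <= E s t y * (e y + B y * D s t y).
    by rewrite mulr_ge0 ?addr_ge0 ?mulr_ge0// (le_trans ler01).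
  have h2 : `|K| * B y <= `|K| * (B y * E s t y).
    by rewrite ler_wpM2l// ler_peMr.
  have h3 : K * B y <= `|K| * B y by rewrite ler_wpM2r// ler_norm.
  rewrite /W; lra.
have [I1 I2] := Rint_weight s y t0.
have k0 : 0 <= `|K| / 2 ^+ n by rewrite divr_ge0// exprn_ge0.
have kS : `|K| / 2 ^+ n.+1 = `|K| / 2 ^+ n / 2.
  by rewrite exprS invfM mulrAC mulrA.
rewrite kS; move: (`|K| / 2 ^+ n) k0 IH {kS} => k k0 IH.
(* An explicit integrable majorant: everything is frozen at its value at time [t] except the weight
   [B E], whose integral is given by [Rint_weight], and [e], whose integral is half a window. *)
pose G r := (e y + 2 * B y * D s t y + 2 * k * B y) *
    (B (y + sgn s * r + sgn s * r) * E s r y) +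
  B y * E s t y * e (y + sgn s * r + sgn s * r).
have Ie : mu.-integrable `[0, t] (EFin \o (fun r => e (y + sgn s * r + sgn s * r))).
  exact/locint_itv/locint_char.
have IG : mu.-integrable `[0, t] (EFin \o G).
  by apply: integrable_addr => //; exact: integrable_mulr.
have bound r : 0 <= r <= t ->
    B (y + sgn s * r + sgn s * r) * W k s r y +
    B y * W k (~~ s) r (y + sgn s * r + sgn s * r) <= G r.
  move=> /andP[r0 rt]; rewrite /W Eopp Dopp /G.
  apply: (@supersolution_arith (E s t y) (E s r y) (D s t y) (D s r y)
    (B (y + sgn s * r + sgn s * r)) (B y) (e y) (e (y + sgn s * r + sgn s * r)) k);
    rewrite ?E1 ?D0 ?B0 ?e0//.
    exact: ndE.
  exact: ndD.
have := uI _ IH s t y G tT IG bound; move=> /le_trans; apply.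
rewrite /G RintegralD//; [|exact: integrable_mulr|exact: integrable_mulr].
rewrite !RintegralZl// Rint_char// -/(D s t y).
exact: supersolution_arith2.
Qed.

End Gronwall.

(** * Existence *)

Section JointMeasurability.
Context {R : realType}.
Local Notation mu := (@lebesgue_measure R).
Local Notation rT := (measurableTypeR R).
Implicit Types (f : R -> R) (F : R -> R -> R) (s : bool) (a b t x y : R).

(** Measurability is asked on the whole plane, negative times included, so that shears, limits and
    Tonelli need no restriction of the domain. *)
Definition jm F := measurable_fun [set: rT * rT] (fun z => F z.1 z.2).

Lemma jm_comp F (d : measure_display) (T : measurableType d)
    (g h : T -> rT) : jm F ->
  measurable_fun setT g -> measurable_fun setT h ->
  measurable_fun setT (fun z => F (g z) (h z)).
Proof.
move=> mF mg mh.
apply: (@measurableT_comp _ _ _ _ _ _ (fun z : rT * rT => F z.1 z.2) _ (fun z => (g z, h z))) => //.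
exact: measurable_fun_pair.
Qed.

Lemma jm_label F s : jm F -> jm (fun t y => F t (y + sgn s * t)).
Proof.
move=> mF; apply: (@jm_comp F _ (rT * rT)%type) => //.
by apply: measurable_funD => //; apply: measurable_funM.
Qed.

Lemma jm_pos F s : jm F -> jm (fun t x => F t (x - sgn s * t)).
Proof.
move=> mF; apply: (@jm_comp F _ (rT * rT)%type) => //.
by apply: measurable_funB => //; apply: measurable_funM.
Qed.

Lemma jm_cst2 f : measurable_fun setT f -> jm (fun _ x => f x).
Proof.
by move=> mf; apply: (@measurableT_comp _ _ _ _ _ _ f _ snd).
Qed.

Lemma jm_char F s y : jm F -> measurable_fun setT (fun r => F r (y + sgn s * r)).
Proof.
move=> mF; apply: (@jm_comp F) => //.
by apply: measurable_funD => //; exact: measurable_funM.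
Qed.

Let ge0_measurable_param (h : rT * rT -> rT -> \bar R) :
  measurable_fun [set: (rT * rT) * rT] (fun z => h z.1 z.2) ->
  (forall z r, (0 <= h z r)%E) ->
  measurable_fun setT (fun z => (\int[mu]_r h z r)%E).
Proof.
move=> mh h0.
exact: (@measurable_fun_fubini_tonelli_F _ _ _ _ _ mu (fun z => h z.1 z.2)).
Qed.

(** The moving domain [[0, t]] is moved into the integrand as a cut-off, and the positive and
    negative parts are measurable in the parameters by Tonelli. No integrability enters, because
    [fine] is measurable on all extended reals. *)
Lemma jm_Rint F s : jm F ->
  jm (fun t y => \int[mu]_(r in `[0, t]) F r (y + sgn s * r)).
Proof.
move=> mF.
pose h (z : rT * rT) (r : rT) : \bar R :=
  if (0 <= r) && (r <= z.1) then (F r (z.2 + sgn s * r))%:E else 0%E.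
have mh : measurable_fun [set: (rT * rT) * rT] (fun z => h z.1 z.2).
  have m11 : measurable_fun [set: (rT * rT) * rT] (fun z => z.1.1).
    exact: (@measurableT_comp _ _ _ _ _ _ fst _ fst).
  have m12 : measurable_fun [set: (rT * rT) * rT] (fun z => z.1.2).
    exact: (@measurableT_comp _ _ _ _ _ _ snd _ fst).
  have m2 : measurable_fun [set: (rT * rT) * rT] snd by [].
  apply: measurable_fun_ifT => //.
    apply: measurable_and.
      exact: measurable_fun_ler.
    exact: measurable_fun_ler.
  apply/measurable_EFinP; apply: (@jm_comp F _ ((rT * rT) * rT)%type) => //.
  by apply: measurable_funD => //; exact: measurable_funM.
rewrite /jm /Rintegral.
apply: (@measurableT_comp _ _ _ _ _ _ (@fine R)) => //.
have hE (z : rT * rT) :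
    integral mu `[0, z.1 : R] (fun r => (F r (z.2 + sgn s * r))%:E) =
    integral mu setT (h z).
  rewrite integral_mkcond; apply: eq_integral => r _; rewrite patchE /h.
  by rewrite (_ : (r \in _) = ((0 <= r) && (r <= z.1))) ?inE//= ?in_itv//=;
    apply/idP/idP; rewrite inE /= in_itv.
under eq_fun do rewrite hE integralE.
apply: emeasurable_funB.
  apply: (ge0_measurable_param (h := fun z => (h z)^\+%E)).
    by rewrite unlock; apply: measurable_maxe.
  by move=> z r; exact: funepos_ge0.
apply: (ge0_measurable_param (h := fun z => (h z)^\-%E)).
  rewrite unlock; apply: measurable_maxe => //.
  exact: (@measurableT_comp _ _ _ _ _ _ (@oppe R)).
by move=> z r; exact: funeneg_ge0.
Qed.

End JointMeasurability.

(** * Sequences with geometric increments *)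

Section GeometricLimit.
Context {R : realType}.

Lemma halving_lim (a : nat -> R) (C : R) :
  (forall n, `|a n.+1 - a n| <= C / 2 ^+ n) ->
  a @ \oo --> limn a /\ forall n, `|limn a - a n| <= 2 * C / 2 ^+ n.
Proof.
move=> aC.
have C0 : 0 <= C by have := aC 0%N; rewrite expr0 divr1; apply: le_trans.
pose w n := 2 * C / 2 ^+ n.
have w0 n : 0 <= w n by rewrite divr_ge0 ?exprn_ge0// mulr_ge0.
have wS n : w n - w n.+1 = C / 2 ^+ n.
  by rewrite /w exprS; field; rewrite expf_neq0.
have nd n m : (n <= m)%N -> a n - w n <= a m - w m /\ a m + w m <= a n + w n.
  elim: m => [|m IH]; first by rewrite leqn0 => /eqP ->.
  rewrite leq_eqVlt => /predU1P[->//|/IH[h1 h2]].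
  by have := aC m; rewrite -wS ler_norml => /andP[h3 h4]; split; lra.
have lohi n m : a n - w n <= a m + w m.
  have [/nd[]|/ltnW/nd[]] := leqP n m; have := w0 n; have := w0 m; lra.
pose l := sup (range (fun n => a n - w n)).
have hs : has_sup (range (fun n => a n - w n)).
  split; first by exists (a 0%N - w 0%N), 0%N.
  by exists (a 0%N + w 0%N) => _ [n _ <-].
have lle n : `|l - a n| <= w n.
  rewrite ler_norml; apply/andP; split.
    rewrite lerBrDl; have : a n - w n <= l; last by lra.
    by apply: sup_upper_bound => //; exists n.
  rewrite lerBlDl; apply: ge_sup; first by case: hs.
  by move=> _ [m _ <-].
have cl : a @ \oo --> l.
  apply/cvgrPdist_le => e e0.
  exists (Num.truncn (2 * C / e)).+1 => // n /= nge.
  rewrite (le_trans (lle n))// /w ler_pdivrMr ?exprn_gt0// [e * _]mulrC -ler_pdivrMr//.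
  apply: (le_trans (ltW (truncnS_gt _))); rewrite -natrX ler_nat.
  by rewrite (leq_trans nge)// ltnW// ltn_expl.
have -> : limn a = l by exact/cvg_lim.
by [].
Qed.

End GeometricLimit.

(** Real unknowns carried by one family of characteristics: [cP] and [cQ] stand for the real and
    imaginary part of psi_s, [cA] for A_s. The whole analysis is done for these; complex numbers
    return only at the end. *)
Variant component := cP | cQ | cA.

(** * Picard iteration in a weighted norm *)

Section Picard.
Context {R : realType}.
Local Notation mu := (@lebesgue_measure R).
Local Notation rT := (measurableTypeR R).
Implicit Types (s : bool) (k : component) (r t x y : R) (v w : component -> R).

Definition n3 v : R := `|v cP| + `|v cQ| + `|v cA|.
Definition d3 v w : R := n3 (fun k => v k - w k).

Lemma n3_ge0 v : 0 <= n3 v.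
Proof. by rewrite /n3 !addr_ge0. Qed.

Lemma le_n3 v k : `|v k| <= n3 v.
Proof.
by case: k; rewrite /n3; have := normr_ge0 (v cP); have := normr_ge0 (v cQ);
  have := normr_ge0 (v cA); lra.
Qed.

Lemma d3C v w : d3 v w = d3 w v.
Proof. by rewrite /d3 /n3 !(distrC (w _)). Qed.

Lemma d3_triangle u v w : d3 u w <= d3 u v + d3 v w.
Proof.
rewrite /d3 /n3.
have := ler_distD (v cP) (u cP) (w cP); have := ler_distD (v cQ) (u cQ) (w cQ).
have := ler_distD (v cA) (u cA) (w cA); lra.
Qed.

Lemma d3_eq0 v w : d3 v w <= 0 -> forall k, v k = w k.
Proof.
move=> h k; apply/eqP; rewrite -subr_eq0 -normr_le0.
exact: le_trans (le_n3 (fun k => v k - w k) k) h.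
Qed.

Lemma n3_Rint t (g : component -> R -> R) (G : R -> R) : 0 <= t ->
  (forall k, measurable_fun `[0, t] (g k)) ->
  mu.-integrable `[0, t] (EFin \o G) ->
  (forall r, 0 <= r <= t -> n3 (g^~ r) <= G r) ->
  n3 (fun k => \int[mu]_(r in `[0, t]) g k r) <= \int[mu]_(r in `[0, t]) G r.
Proof.
move=> t0 mg IG gG.
have Ig k : mu.-integrable `[0, t] (EFin \o g k).
  apply: integrable_le IG => //; first exact: mg.
  move=> r /=; rewrite in_itv /= => rt.
  exact: le_trans (le_n3 (g^~ r) k) (gG _ rt).
have Ing k : mu.-integrable `[0, t] (EFin \o (fun r => `|g k r|)).
  exact: integrable_norm.
apply: (@le_trans _ _ (\int[mu]_(r in `[0, t]) n3 (g^~ r))).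
  rewrite /n3 RintegralD//; last exact: integrable_addr.
  rewrite RintegralD//.
  by rewrite !lerD//; apply: le_normr_Rintegral.
apply: Rint_le => //.
by rewrite /n3; apply: integrable_addr => //; exact: integrable_addr.
Qed.

Variable N : bool -> component -> R -> R -> (bool -> component -> R) -> R.
Variable f : bool -> component -> R -> R.
Hypothesis mf : forall s k, measurable_fun setT (f s k).
Hypothesis mN : forall U : bool -> component -> R -> R -> R,
  (forall s k, jm (U s k)) ->
  forall s k, jm (fun t x => N s k t x (fun s' k' => U s' k' t x)).
(** A Lipschitz condition with unbounded coefficients, in the shape of the Gronwall lemma: the
    difference on the own family is weighted at the crossed label, that on the opposite family at
    the own label. The bound on [N] itself makes all Duhamel integrals finite. *)
Hypothesis hN : forall T, 0 <= T -> exists B : R -> R,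
  [/\ locint B, forall y, 0 <= B y,
      forall s t y (X Y : bool -> component -> R), 0 <= t <= T ->
        d3 (fun k => N s k t (y + sgn s * t) X) (fun k => N s k t (y + sgn s * t) Y)
        <= B (y + sgn s * t + sgn s * t) * d3 (X s) (Y s) +
           B y * d3 (X (~~ s)) (Y (~~ s)) &
      forall s t y X, 0 <= t <= T ->
        n3 (fun k => N s k t (y + sgn s * t) X)
        <= B y * B (y + sgn s * t + sgn s * t)].

Let state := bool -> component -> R -> R -> R.
Let duhamel (U : state) : state := fun s k t x =>
  f s k (x - sgn s * t) + \int[mu]_(r in `[0, t])
    N s k r (x - sgn s * t + sgn s * r)
      (fun s' k' => U s' k' r (x - sgn s * t + sgn s * r)).

Let measurable_duhamel U : (forall s k, jm (U s k)) ->
  forall s k, jm (duhamel U s k).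
Proof.
move=> mU s k; apply: measurable_funD.
  exact: (jm_pos s (jm_cst2 (mf s k))).
exact: (jm_pos s (jm_Rint s (mN mU s k))).
Qed.

(** For the norm weighted by [B E] the Duhamel map is a contraction by 1/2 on any [[0, T]]: both
    families contribute the same integral, which [Rint_weight] bounds by a quarter of [E - 1]. *)
Let duhamel_contraction T B (U V : state) (K : R) : 0 <= T -> 0 <= K ->
  locint B -> (forall y, 0 <= B y) ->
  (forall s t y (X Y : bool -> component -> R), 0 <= t <= T ->
        d3 (fun k => N s k t (y + sgn s * t) X) (fun k => N s k t (y + sgn s * t) Y)
        <= B (y + sgn s * t + sgn s * t) * d3 (X s) (Y s) +
           B y * d3 (X (~~ s)) (Y (~~ s))) ->
  (forall s t y X, 0 <= t <= T ->
        n3 (fun k => N s k t (y + sgn s * t) X)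
        <= B y * B (y + sgn s * t + sgn s * t)) ->
  (forall s k, jm (U s k)) -> (forall s k, jm (V s k)) ->
  let E s t y := expR (2 * win B t (y + sgn s * t)) in
  (forall s t y, 0 <= t <= T ->
     d3 (fun k => U s k t (y + sgn s * t)) (fun k => V s k t (y + sgn s * t))
     <= K * (B y * E s t y)) ->
  forall s t y, 0 <= t <= T ->
     d3 (fun k => duhamel U s k t (y + sgn s * t))
        (fun k => duhamel V s k t (y + sgn s * t))
     <= K / 2 * (B y * E s t y).
Proof.
move=> T0 K0 lB B0 lipN bdN mU mV E hUV s t y /andP[t0 tT].
have mNU W : (forall s k, jm (W s k)) -> forall k, measurable_fun `[0, t]
    (fun r => N s k r (y + sgn s * r) (fun s' k' => W s' k' r (y + sgn s * r))).
  move=> mW k; apply: measurable_funTS.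
  exact: (jm_char s y (mN mW s k)).
have Ib : mu.-integrable `[0, t] (EFin \o (fun r => B y * B (y + sgn s * r + sgn s * r))).
  by apply: integrable_mulr => //; exact/locint_itv/locint_char.
have INU W : (forall s k, jm (W s k)) -> forall k, mu.-integrable `[0, t] (EFin \o
    (fun r => N s k r (y + sgn s * r) (fun s' k' => W s' k' r (y + sgn s * r)))).
  move=> mW k; apply: integrable_le Ib => //; first exact: mNU.
  move=> r /=; rewrite in_itv /= => /andP[r0 rt].
  apply: le_trans (bdN s r y (fun s' k' => W s' k' r (y + sgn s * r)) _).
    exact: (le_n3 (fun k => N s k r (y + sgn s * r) (fun s' k' => W s' k' r (y + sgn s * r)))).
  by rewrite r0 (le_trans rt tT).
pose g k r := N s k r (y + sgn s * r) (fun s' k' => U s' k' r (y + sgn s * r)) -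
              N s k r (y + sgn s * r) (fun s' k' => V s' k' r (y + sgn s * r)).
have -> : d3 (fun k => duhamel U s k t (y + sgn s * t))
   (fun k => duhamel V s k t (y + sgn s * t)) =
   n3 (fun k => \int[mu]_(r in `[0, t]) g k r).
  rewrite /d3; congr n3; apply/funext => k.
  rewrite /duhamel addrK opprD addrACA subrr add0r /g RintegralB//; exact: INU.
have [I1 I2] := Rint_weight lB B0 s y t0.
apply: (@le_trans _ _ (\int[mu]_(r in `[0, t])
    ((2 * K * B y) * (B (y + sgn s * r + sgn s * r) * E s r y)))).
  apply: n3_Rint => //.
  - move=> k; apply: measurable_funB; exact: mNU.
  - exact: integrable_mulr.
  move=> r /andP[r0 rt]; have rT : 0 <= r <= T by rewrite r0 (le_trans rt).
  rewrite /g -/(d3 (fun k => N s k r (y + sgn s * r) (fun s' k' => U s' k' r (y + sgn s * r)))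
    (fun k => N s k r (y + sgn s * r) (fun s' k' => V s' k' r (y + sgn s * r)))).
  apply: (le_trans (lipN _ _ _ _ _ rT)).
  have h1 := hUV s r y rT.
  have := hUV (~~ s) r (y + sgn s * r + sgn s * r) rT.
  have -> : y + sgn s * r + sgn s * r + sgn (~~ s) * r = y + sgn s * r.
    by rewrite sgnN; ring.
  rewrite /E win_opp -/(E s r y) => h2.
  have h3 := ler_wpM2l (B0 (y + sgn s * r + sgn s * r)) h1.
  have h4 := ler_wpM2l (B0 y) h2.
  rewrite -/(E s r y) in h3; move: h3 h4; lra.
rewrite RintegralZl//.
have h : (K * B y / 2) * (4 * \int[mu]_(r in `[0, t]) (B (y + sgn s * r + sgn s * r) * E s r y))
   <= (K * B y / 2) * (E s t y - 1).
  by rewrite ler_wpM2l// divr_ge0// mulr_ge0.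
have h' : 0 <= K * B y by rewrite mulr_ge0.
move: h h'; set J := \int[mu]_(r in `[0, t]) _; move: (E s t y) J.
move=> e J; lra.
Qed.

(** The iterates do not depend on a time horizon; [B] does, but is used only to prove convergence at
    each point and to pass to the limit in the equation. The equation then holds at every point, not
    almost everywhere. *)
Theorem picard : exists U : bool -> component -> R -> R -> R,
  (forall s k, jm (U s k)) /\
  forall s k t y, 0 <= t -> U s k t (y + sgn s * t) = f s k y +
    \int[mu]_(r in `[0, t])
      N s k r (y + sgn s * r) (fun s' k' => U s' k' r (y + sgn s * r)).
Proof.
pose Un n : state := iter n duhamel (fun s k t x => f s k (x - sgn s * t)).
have mUn n s k : jm (Un n s k).
  elim: n s k => [|n IH] s k; last exact: measurable_duhamel.
  exact: (jm_pos s (jm_cst2 (mf s k))).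
pose U : state := fun s k t x => limn (fun n => Un n s k t x).
(* At negative times the integral is over an empty interval and the iteration is stationary, so the
   pointwise limit exists on the whole plane and is measurable there. *)
have neg n s k t x : t < 0 -> Un n s k t x = f s k (x - sgn s * t).
  move=> t0; case: n => [//|n]; rewrite /Un iterS /duhamel.
  by rewrite set_itv_ge ?Rintegral_set0 ?addr0// -ltNge.
have cvgT T : 0 <= T -> exists B : R -> R, [/\ locint B, forall y, 0 <= B y &
    [/\ forall s t y (X Y : bool -> component -> R), 0 <= t <= T ->
        d3 (fun k => N s k t (y + sgn s * t) X) (fun k => N s k t (y + sgn s * t) Y)
        <= B (y + sgn s * t + sgn s * t) * d3 (X s) (Y s) +
           B y * d3 (X (~~ s)) (Y (~~ s)),
      forall s t y X, 0 <= t <= T ->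
        n3 (fun k => N s k t (y + sgn s * t) X)
        <= B y * B (y + sgn s * t + sgn s * t) &
    forall n s t y, 0 <= t <= T ->
      d3 (fun k => Un n.+1 s k t (y + sgn s * t)) (fun k => Un n s k t (y + sgn s * t))
      <= 1 / 2 ^+ n * (B y * expR (2 * win B t (y + sgn s * t)))]].
  move=> T0; have [B [lB B0 lipN bdN]] := hN T0.
  exists B; split => //; split => // n.
  elim: n => [|n IH] s t y /[dup] tT /andP[t0 t1].
    rewrite expr0 divr1 mul1r.
    have Ib : mu.-integrable `[0, t] (EFin \o (fun r => B y * B (y + sgn s * r + sgn s * r))).
      by apply: integrable_mulr => //; exact/locint_itv/locint_char.
    apply: (@le_trans _ _ (B y * (2^-1 * win B t (y + sgn s * t)))).
      rewrite -Rint_char// -RintegralZl//; last exact/locint_itv/locint_char.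
      rewrite /d3 (_ : (fun k => _) = (fun k => \int[mu]_(r in `[0, t])
         N s k r (y + sgn s * r) (fun s' k' => Un 0%N s' k' r (y + sgn s * r)))).
        apply: n3_Rint => //.
          move=> k; apply: measurable_funTS.
          exact: (jm_char s y (mN (mUn 0%N) s k)).
        by move=> r /andP[r0 rt]; rewrite bdN// r0 (le_trans rt).
      by apply/funext => k; rewrite /Un /= /duhamel addrK addrC addKr.
    rewrite ler_wpM2l//.
    have h := expR_ge1Dx (2 * win B t (y + sgn s * t)).
    have h' : 0 <= win B t (y + sgn s * t) by exact: win_ge0.
    lra.
  rewrite exprS invfM mul1r [2^-1 * _]mulrC -[(2 ^+ n)^-1]mul1r.
  exact: (@duhamel_contraction T B (Un n.+1) (Un n) (1 / 2 ^+ n)).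
have Ucvg s k t x : (fun n => Un n s k t x) @ \oo --> U s k t x.
  have [t0|t0] := ltP t 0.
    have -> : (fun n => Un n s k t x) = cst (f s k (x - sgn s * t)).
      by apply/funext => n; exact: neg.
    by rewrite /U; under eq_fun do rewrite neg//; rewrite lim_cst//; exact: cvg_cst.
  have [B [lB B0 [_ _ hB]]] := cvgT t t0.
  have [] := @halving_lim _ (fun n => Un n s k t x)
    (B (x - sgn s * t) * expR (2 * win B t x)) _; last by [].
  move=> n; have := hB n s t (x - sgn s * t); rewrite subrK t0 lexx => /(_ isT).
  rewrite mulrC mul1r; apply: le_trans.
  exact: (le_n3 (fun k => Un n.+1 s k t x - Un n s k t x)).
have mU s k : jm (U s k).
  by apply: (measurable_fun_cvg (fun n => mUn n s k)) => z _; exact: Ucvg.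
exists U; split => // s k t y t0.
have [B [lB B0 [lipN bdN hB]]] := cvgT t t0.
pose E s t y := expR (2 * win B t (y + sgn s * t)).
(* The 6 is the constant 2 of [halving_lim] times three components. *)
have dist n s' t' y' : 0 <= t' <= t ->
    d3 (fun k => U s' k t' (y' + sgn s' * t')) (fun k => Un n s' k t' (y' + sgn s' * t'))
    <= 6 / 2 ^+ n * (B y' * E s' t' y').
  move=> tt'.
  have h k' : `|U s' k' t' (y' + sgn s' * t') - Un n s' k' t' (y' + sgn s' * t')|
      <= 2 * (B y' * E s' t' y') / 2 ^+ n.
    have [] := @halving_lim _ (fun n => Un n s' k' t' (y' + sgn s' * t'))
      (B y' * E s' t' y') _; last by move=> _; exact.
    move=> m; have := hB m s' t' y' tt'; rewrite [1 / _ * _]mulrC mul1r; apply: le_trans.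
    exact: (le_n3 (fun k => Un m.+1 s' k t' (y' + sgn s' * t') -
                           Un m s' k t' (y' + sgn s' * t'))).
  rewrite /d3 /n3.
  have := h cP; have := h cQ; have := h cA.
  rewrite [2 * _ / _]mulrAC; move: (B y' * E s' t' y') (2 ^+ n)^-1 => b c.
  lra.
(* [U] is compared with its own Duhamel image through the iterate [n.+1]; each of the two errors is
   at most [3 / 2 ^ n] times the weight, the second one by the contraction. *)
suff : d3 (fun k => U s k t (y + sgn s * t)) (fun k => duhamel U s k t (y + sgn s * t)) <= 0.
  by move=> /d3_eq0 /(_ k) ->; rewrite /duhamel addrK.
have tt : 0 <= t <= t by rewrite t0 lexx.
apply: (@lim_halving _ _ (6 * (B y * E s t y))) => [|n].
  by rewrite !mulr_ge0// expR_ge0.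
apply: (le_trans (d3_triangle _ (fun k => Un n.+1 s k t (y + sgn s * t)) _)).
have h1 := dist n.+1 s t y tt.
have K0 : 0 <= 6 / 2 ^+ n :> R by rewrite divr_ge0// exprn_ge0.
have h2 := duhamel_contraction t0 K0 lB B0 lipN bdN mU (mUn n) (dist n) s y tt.
have UnS : (fun k => Un n.+1 s k t (y + sgn s * t)) =
  (fun k => duhamel (Un n) s k t (y + sgn s * t)) by [].
rewrite -UnS {UnS} -/(E s t y) in h2.
rewrite d3C in h2; move: h1 h2; rewrite exprS invfM.
move: (B y * E s t y) (2 ^+ n)^-1 => b c; lra.
Qed.

End Picard.

(** * Invariance of the modulus under phase rotation *)

Section PhaseRotation.
Context {R : realType}.
Local Notation mu := (@lebesgue_measure R).
Implicit Types (P Q f g a w al be : R -> R).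

Let quadratic_root (S n0 J : R) : 0 <= n0 -> 0 <= J ->
  S ^+ 2 <= 2 * n0 ^+ 2 + 4 * S * J -> S <= 2 * n0 + 4 * J.
Proof.
move=> n0_ge0 J0 h; rewrite leNgt; apply/negP => hS.
have h1 : 0 < S - 4 * J - 2 * n0 by lra.
have h2 : 0 < S by lra.
have h3 : 0 < S * (S - 4 * J - 2 * n0) by rewrite mulr_gt0.
have h4 : 0 <= n0 * (S - 2 * n0) by rewrite mulr_ge0//; lra.
have h5 : 0 <= n0 ^+ 2 by exact: sqr_ge0.
lra.
Qed.

(* The real potential [a] only rotates the phase of [P + i Q], so it does not
   contribute to the growth of the modulus. *)
Lemma phase_bound t p0 q0 P Q f g a al be w : 0 <= t ->
  mu.-integrable `[0, t] (EFin \o f) -> mu.-integrable `[0, t] (EFin \o g) ->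
  mu.-integrable `[0, t] (EFin \o w) ->
  (forall s, 0 <= s <= t -> P s = p0 + \int[mu]_(x in `[0, s]) f x) ->
  (forall s, 0 <= s <= t -> Q s = q0 + \int[mu]_(x in `[0, s]) g x) ->
  (forall s, 0 <= s <= t -> f s = - a s * Q s + al s) ->
  (forall s, 0 <= s <= t -> g s = a s * P s + be s) ->
  (forall s, 0 <= s <= t -> `|al s| + `|be s| <= w s) ->
  `|P t| + `|Q t| <= 2 * (`|p0| + `|q0|) + 4 * \int[mu]_(x in `[0, t]) w x.
Proof.
move=> t0 If Ig Iw PE QE fE gE albe.
(* [P] and [Q] are prescribed on [[0, t]] only. Replaced by the primitives themselves they are
   continuous there, so that [|P| + |Q|] attains its maximum. *)
wlog : P Q PE QE fE gE / (P = fun s => p0 + \int[mu]_(x in `[0, s]) f x) /\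
    (Q = fun s => q0 + \int[mu]_(x in `[0, s]) g x).
  move=> gen; have tt : 0 <= t <= t by rewrite t0 lexx.
  rewrite (PE t tt) (QE t tt).
  apply: (gen (fun s => p0 + \int[mu]_(x in `[0, s]) f x)
    (fun s => q0 + \int[mu]_(x in `[0, s]) g x)) => // s st.
    by rewrite -QE// fE.
  by rewrite -PE// gE.
move=> [PE' QE'].
have w0 s : 0 <= s <= t -> 0 <= w s.
  by move=> st; rewrite (le_trans _ (albe _ st))// addr_ge0.
have sub s : 0 <= s <= t -> forall f : R -> R, mu.-integrable `[0, t] (EFin \o f) ->
    mu.-integrable `[0, s] (EFin \o f).
  by move=> /andP[s0 st] f' If'; exact: integrable_sub_itv If'.
have sqP s : 0 <= s <= t -> mu.-integrable `[0, s] (EFin \o (fun r => P r * f r)) /\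
    P s ^+ 2 = p0 ^+ 2 + 2 * \int[mu]_(r in `[0, s]) (P r * f r).
  by move=> st; rewrite PE'; apply: prim_sqr; [case/andP: st|exact: sub].
have sqQ s : 0 <= s <= t -> mu.-integrable `[0, s] (EFin \o (fun r => Q r * g r)) /\
    Q s ^+ 2 = q0 ^+ 2 + 2 * \int[mu]_(r in `[0, s]) (Q r * g r).
  by move=> st; rewrite QE'; apply: prim_sqr; [case/andP: st|exact: sub].
have cP : {within `[0, t], continuous P}.
  rewrite PE' => x; apply: cvgD; first exact: cvg_cst.
  exact: parameterized_integral_continuous.
have cQ : {within `[0, t], continuous Q}.
  rewrite QE' => x; apply: cvgD; first exact: cvg_cst.
  exact: parameterized_integral_continuous.
have cS : {within `[0, t], continuous (fun s => `|P s| + `|Q s|)}.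
  move=> x; apply: cvgD.
    by apply: continuous_comp; [exact: cP|exact: norm_continuous].
  by apply: continuous_comp; [exact: cQ|exact: norm_continuous].
(* At a maximum point the energy identity closes: its value [S] also bounds [|P| + |Q|] under the
   integral, which leaves a quadratic inequality for [S]. *)
have [c] := EVT_max t0 cS.
rewrite in_itv /= => ct maxc.
clear PE' QE' cP cQ cS.
pose S := `|P c| + `|Q c|.
have S0 : 0 <= S by rewrite addr_ge0.
apply: (@le_trans _ _ S); first by apply: maxc; rewrite in_itv /= t0 lexx.
have J0 : 0 <= \int[mu]_(x in `[0, t]) w x.
  by apply: Rintegral_ge0 => s /=; rewrite in_itv /=; exact: w0.
apply: quadratic_root => //.
have [I1 E1] := sqP c ct; have [I2 E2] := sqQ c ct.
have key : \int[mu]_(r in `[0, c]) (P r * f r) + \int[mu]_(r in `[0, c]) (Q r * g r)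
    <= S * \int[mu]_(x in `[0, t]) w x.
  rewrite -RintegralD// -RintegralZl//.
  apply: (@le_trans _ _ (\int[mu]_(r in `[0, c]) (S * w r))).
    apply: Rint_le; first exact: integrable_addr.
      by apply: integrable_mulr => //; exact: sub.
    move=> r /andP[r0 rc]; have rt : 0 <= r <= t.
      by rewrite r0 (le_trans rc)//; case/andP : ct.
    rewrite fE// gE//.
    (* The terms with [a] cancel. *)
    rewrite [leLHS](_ : _ = P r * al r + Q r * be r); last by ring.
    have h1 : P r * al r <= `|P r| * `|al r| by rewrite -normrM ler_norm.
    have h2 : Q r * be r <= `|Q r| * `|be r| by rewrite -normrM ler_norm.
    have h3 : (`|P r| + `|Q r|) * w r <= S * w r.
      by rewrite ler_wpM2r ?w0//; apply: maxc; rewrite in_itv.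
    have h4 : (`|P r| + `|Q r|) * (`|al r| + `|be r|) <= (`|P r| + `|Q r|) * w r.
      by rewrite ler_wpM2l ?addr_ge0// albe.
    have h5 : 0 <= `|P r| * `|be r| by rewrite mulr_ge0.
    have h6 : 0 <= `|Q r| * `|al r| by rewrite mulr_ge0.
    lra.
  case/andP : (ct) => c0 ct'.
  apply: (prim_nd c0 ct' (lexx t)); last exact: integrable_mulr.
  by move=> x xt; rewrite mulr_ge0// w0.
have e1 : `|P c| ^+ 2 = P c ^+ 2 by rewrite real_normK// num_real.
have e2 : `|Q c| ^+ 2 = Q c ^+ 2 by rewrite real_normK// num_real.
have e3 : `|p0| ^+ 2 = p0 ^+ 2 by rewrite real_normK// num_real.
have e4 : `|q0| ^+ 2 = q0 ^+ 2 by rewrite real_normK// num_real.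
have e5 : 0 <= (`|P c| - `|Q c|) ^+ 2 by exact: sqr_ge0.
have e6 : 0 <= `|p0| * `|q0| by rewrite mulr_ge0.
rewrite -e1 -e3 in E1; rewrite -e2 -e4 in E2.
have e7 : S ^+ 2 + (`|P c| - `|Q c|) ^+ 2 = 2 * (`|P c| ^+ 2 + `|Q c| ^+ 2).
  by rewrite /S; ring.
have e8 : (`|p0| + `|q0|) ^+ 2 = `|p0| ^+ 2 + `|q0| ^+ 2 + 2 * (`|p0| * `|q0|) by ring.
rewrite e8 -[4 * S * _]mulrA; move: key E1 E2 e5 e6 e7.
move: (S ^+ 2) (S * _) => ? ?; lra.
Qed.

End PhaseRotation.

(** * The nonlinearity and its radial truncation *)

Section Nonlinearity.
Context {R : realType}.
Local Notation mu := (@lebesgue_measure R).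
Local Notation rT := (measurableTypeR R).
Implicit Types (s : bool) (k : component) (r t x y : R) (v w : component -> R)
  (X Y : bool -> component -> R).

(* [psi^* alpha psi] in terms of psi_s = X s cP + i X s cQ: it is the real part
   of psi_+ conj(psi_-) when alpha = gamma^0, and its imaginary part when
   alpha = - i gamma^1. *)
Definition qf (ty : bool) X : R :=
  if ty then X false cQ * X true cP - X false cP * X true cQ
  else X false cP * X true cP + X false cQ * X true cQ.

(** The first two lines are the real and imaginary part of [i A_{-s} psi_s - i m psi_{-s}]. Every
    quadratic term pairs a component of family [s] with one of family [~~ s]; all estimates rest on
    this. *)
Definition csd (m : R) (ty : bool) s k X : R :=
  match k with
  | cP => - X (~~ s) cA * X s cQ + m * X (~~ s) cQ
  | cQ => X (~~ s) cA * X s cP - m * X (~~ s) cP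
  | cA => - sgn s * qf ty X
  end.

Let prod_diff (x y x' y' a b : R) : `|x| <= b -> `|y'| <= a ->
  `|x * y - x' * y'| <= b * `|y - y'| + a * `|x - x'|.
Proof.
move=> xb ya; rewrite (_ : _ - _ = x * (y - y') + (x - x') * y'); last by ring.
rewrite (le_trans (ler_normD _ _))// !normrM lerD//; first exact: ler_wpM2r.
by rewrite mulrC ler_wpM2r.
Qed.

Lemma norm_sgn s : `|sgn s| = 1 :> R.
Proof. by rewrite /sgn normr_sign. Qed.

Lemma qf_le ty s X :
  `|qf ty X| <= (`|X s cP| + `|X s cQ|) * (`|X (~~ s) cP| + `|X (~~ s) cQ|).
Proof.
have h1 := mulr_ge0 (normr_ge0 (X false cP)) (normr_ge0 (X true cP)).
have h2 := mulr_ge0 (normr_ge0 (X false cP)) (normr_ge0 (X true cQ)).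
have h3 := mulr_ge0 (normr_ge0 (X false cQ)) (normr_ge0 (X true cP)).
have h4 := mulr_ge0 (normr_ge0 (X false cQ)) (normr_ge0 (X true cQ)).
apply: (@le_trans _ _ ((`|X false cP| + `|X false cQ|) * (`|X true cP| + `|X true cQ|))).
  rewrite /qf; case: ty.
    by rewrite (le_trans (ler_normB _ _))// !normrM; lra.
  by rewrite (le_trans (ler_normD _ _))// !normrM; lra.
by case: s; rewrite // [leLHS]mulrC.
Qed.

Lemma csd_bound m ty s X : 0 <= m ->
  n3 (fun k => csd m ty s k X) <= (2 * n3 (X s) + m) * n3 (X (~~ s)).
Proof.
move=> m0; have := qf_le ty s X; rewrite /n3 /csd.
rewrite [`|- sgn s * _|]normrM normrN norm_sgn mul1r.
have := ler_normD (- X (~~ s) cA * X s cQ) (m * X (~~ s) cQ).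
have := ler_normB (X (~~ s) cA * X s cP) (m * X (~~ s) cP).
rewrite !normrM normrN (ger0_norm m0).
have := mulr_ge0 (normr_ge0 (X (~~ s) cA)) (normr_ge0 (X s cA)).
have := mulr_ge0 (normr_ge0 (X (~~ s) cP)) (normr_ge0 (X s cP)).
have := mulr_ge0 (normr_ge0 (X (~~ s) cP)) (normr_ge0 (X s cQ)).
have := mulr_ge0 (normr_ge0 (X (~~ s) cP)) (normr_ge0 (X s cA)).
have := mulr_ge0 (normr_ge0 (X (~~ s) cQ)) (normr_ge0 (X s cP)).
have := mulr_ge0 (normr_ge0 (X (~~ s) cQ)) (normr_ge0 (X s cQ)).
have := mulr_ge0 (normr_ge0 (X (~~ s) cQ)) (normr_ge0 (X s cA)).
have := mulr_ge0 (normr_ge0 (X (~~ s) cA)) (normr_ge0 (X s cP)).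
have := mulr_ge0 (normr_ge0 (X (~~ s) cA)) (normr_ge0 (X s cQ)).
have := mulr_ge0 m0 (normr_ge0 (X (~~ s) cA)).
lra.
Qed.

(** The splitting [x y - x' y' = x (y - y') + (x - x') y'] bounds [X] on the opposite family and [Y]
    on the own one, so that the two coefficients land where the Gronwall lemma expects them. *)
Lemma qf_lip ty s X Y a b : n3 (Y s) <= a -> n3 (X (~~ s)) <= b ->
  `|qf ty X - qf ty Y| <= b * d3 (X s) (Y s) + a * d3 (X (~~ s)) (Y (~~ s)).
Proof.
move=> Ya Xb.
have a0 := le_trans (n3_ge0 _) Ya; have b0 := le_trans (n3_ge0 _) Xb.
have hX k : `|X (~~ s) k| <= b by exact: le_trans (le_n3 _ _) Xb.
have hY k : `|Y s k| <= a by exact: le_trans (le_n3 _ _) Ya.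
have h k k' := @prod_diff (X (~~ s) k) (X s k') (Y (~~ s) k) (Y s k') a b (hX k) (hY k').
have hA := mulr_ge0 b0 (normr_ge0 (X s cA - Y s cA)).
have hA' := mulr_ge0 a0 (normr_ge0 (X (~~ s) cA - Y (~~ s) cA)).
have h1 := h cP cQ; have h2 := h cQ cP; have h3 := h cP cP; have h4 := h cQ cQ.
rewrite /d3 /n3 /qf; move: h1 h2 h3 h4 hA hA'.
case: s {hX hY h Ya Xb} => /=; case: ty => /= h1 h2 h3 h4 hA hA'.
- rewrite (_ : _ - _ = (X false cQ * X true cP - Y false cQ * Y true cP) -
     (X false cP * X true cQ - Y false cP * Y true cQ)); last by ring.
  rewrite (le_trans (ler_normB _ _))//; lra.
- rewrite (_ : _ - _ = (X false cP * X true cP - Y false cP * Y true cP) +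
     (X false cQ * X true cQ - Y false cQ * Y true cQ)); last by ring.
  rewrite (le_trans (ler_normD _ _))//; lra.
- rewrite (_ : _ - _ = (X true cP * X false cQ - Y true cP * Y false cQ) -
     (X true cQ * X false cP - Y true cQ * Y false cP)); last by ring.
  rewrite (le_trans (ler_normB _ _))//; lra.
- rewrite (_ : _ - _ = (X true cP * X false cP - Y true cP * Y false cP) +
     (X true cQ * X false cQ - Y true cQ * Y false cQ)); last by ring.
  rewrite (le_trans (ler_normD _ _))//; lra.
Qed.

Lemma csd_lip m ty s X Y a b : 0 <= m ->
  n3 (Y s) <= a -> n3 (X (~~ s)) <= b ->
  d3 (fun k => csd m ty s k X) (fun k => csd m ty s k Y) <=
  2 * b * d3 (X s) (Y s) + (2 * a + m) * d3 (X (~~ s)) (Y (~~ s)).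
Proof.
move=> m0 Ya Xb.
have a0 := le_trans (n3_ge0 _) Ya; have b0 := le_trans (n3_ge0 _) Xb.
have hX k : `|X (~~ s) k| <= b by exact: le_trans (le_n3 _ _) Xb.
have hY k : `|Y s k| <= a by exact: le_trans (le_n3 _ _) Ya.
have := @qf_lip ty s X Y a b Ya Xb; rewrite /d3.
set dA := `|X (~~ s) cA - Y (~~ s) cA|.
have YPQ : (`|Y s cP| + `|Y s cQ|) * dA <= a * dA.
  apply: ler_wpM2r; first exact: normr_ge0.
  apply: le_trans Ya; rewrite /n3.
  by have := normr_ge0 (Y s cA); lra.
rewrite {3}/n3 /csd -mulrBr normrM normrN norm_sgn mul1r.
have hP : `|- X (~~ s) cA * X s cQ + m * X (~~ s) cQ -
    (- Y (~~ s) cA * Y s cQ + m * Y (~~ s) cQ)| <=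
    b * `|X s cQ - Y s cQ| + `|Y s cQ| * dA + m * `|X (~~ s) cQ - Y (~~ s) cQ|.
  rewrite (_ : _ - _ = m * (X (~~ s) cQ - Y (~~ s) cQ) -
    (X (~~ s) cA * X s cQ - Y (~~ s) cA * Y s cQ)); last by ring.
  rewrite (le_trans (ler_normB _ _))// normrM (ger0_norm m0) addrC lerD2r.
  exact: prod_diff.
have hQ : `|X (~~ s) cA * X s cP - m * X (~~ s) cP -
    (Y (~~ s) cA * Y s cP - m * Y (~~ s) cP)| <=
    b * `|X s cP - Y s cP| + `|Y s cP| * dA + m * `|X (~~ s) cP - Y (~~ s) cP|.
  rewrite (_ : _ - _ = (X (~~ s) cA * X s cP - Y (~~ s) cA * Y s cP) -
    m * (X (~~ s) cP - Y (~~ s) cP)); last by ring.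
  rewrite (le_trans (ler_normB _ _))// normrM (ger0_norm m0) lerD2r.
  exact: prod_diff.
move: hP hQ YPQ.
have n1 := mulr_ge0 b0 (normr_ge0 (X s cA - Y s cA)).
have n2 := mulr_ge0 a0 (normr_ge0 (X (~~ s) cP - Y (~~ s) cP)).
have n3' := mulr_ge0 a0 (normr_ge0 (X (~~ s) cQ - Y (~~ s) cQ)).
have n4 := mulr_ge0 m0 (normr_ge0 (X (~~ s) cA - Y (~~ s) cA)).
rewrite -/dA in n4.
rewrite /n3 -/dA => hP hQ hA hq.
apply: le_trans (lerD (lerD hP hQ) hq) _.
have n5 := mulr_ge0 a0 (normr_ge0 (X (~~ s) cA - Y (~~ s) cA)).
rewrite -/dA in n5.
lra.
Qed.

(* Radial truncation: it multiplies [v] by a real factor, so the phase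
   rotation structure of the Dirac equation survives. *)
Definition trunc (rho : R) v : component -> R := fun k => rho / Num.max rho (n3 v) * v k.

Lemma n3Z (c : R) v : n3 (fun k => c * v k) = `|c| * n3 v.
Proof. by rewrite /n3 !normrM !mulrDr. Qed.

Let trunc_factor (rho : R) v : 0 < rho ->
  [/\ 0 < Num.max rho (n3 v), rho <= Num.max rho (n3 v) & n3 v <= Num.max rho (n3 v)].
Proof. by move=> r0; rewrite lt_max r0 !le_max !lexx orbT. Qed.

Lemma trunc_le (rho : R) v : 0 < rho -> n3 (trunc rho v) <= rho.
Proof.
move=> r0; have [m0 h1 h2] := @trunc_factor rho v r0.
rewrite n3Z ger0_norm; last by rewrite divr_ge0// ltW.
by rewrite mulrAC ler_pdivrMr// ler_wpM2l// ltW.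
Qed.

Lemma trunc_id (rho : R) v : 0 < rho -> n3 v <= rho -> trunc rho v = v.
Proof.
move=> r0 h; apply/funext => k; rewrite /trunc max_l// divff ?mul1r//.
by rewrite gt_eqF.
Qed.

Lemma n3_dist v w : `|n3 v - n3 w| <= d3 v w.
Proof.
rewrite /d3 /n3 ler_norml.
have h (a b : R) := conj (lerB_dist a b) (lerB_dist b a).
have [] := h (v cP) (w cP); have [] := h (v cQ) (w cQ); have [] := h (v cA) (w cA).
rewrite ![`|w _ - _|]distrC => *; apply/andP; split; lra.
Qed.

Let max_dist (r a b : R) : `|Num.max r a - Num.max r b| <= `|a - b|.
Proof.
case: (leP r a) => ra; case: (leP r b) => rb //.
- by rewrite !ger0_norm; lra.
- by rewrite !ler0_norm; lra.
- by rewrite subrr normr0.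
Qed.

(** Radial retractions are 2-Lipschitz for any norm: the difference is a contraction of [v - w] plus
    a multiple of [w] that measures the difference of the norms, each at most [d3 v w]. *)
Lemma trunc_lip (rho : R) v w : 0 < rho ->
  d3 (trunc rho v) (trunc rho w) <= 2 * d3 v w.
Proof.
move=> r0.
have [M0 M1 M2] := @trunc_factor rho v r0; have [L0 L1 L2] := @trunc_factor rho w r0.
have dm : `|Num.max rho (n3 w) - Num.max rho (n3 v)| <= d3 v w.
  by apply: le_trans (n3_dist v w); rewrite [leRHS]distrC; exact: max_dist.
rewrite /d3.
rewrite (_ : (fun k => _) = (fun k => rho / Num.max rho (n3 v) * (v k - w k) +
   rho / Num.max rho (n3 v) / Num.max rho (n3 w) *
    (Num.max rho (n3 w) - Num.max rho (n3 v)) * w k)); last first.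
  apply/funext => k; rewrite /trunc; field.
  by rewrite !gt_eqF.
have n3D (u u' : component -> R) : n3 (fun k => u k + u' k) <= n3 u + n3 u'.
  rewrite /n3; have := ler_normD (u cP) (u' cP); have := ler_normD (u cQ) (u' cQ).
  by have := ler_normD (u cA) (u' cA); lra.
rewrite (le_trans (n3D _ _))// n3Z n3Z (mulrDl 1 1) !mul1r.
have f1 : 0 <= rho / Num.max rho (n3 v) by rewrite divr_ge0// ltW.
have f2 : rho / Num.max rho (n3 v) <= 1 by rewrite ler_pdivrMr// mul1r.
rewrite lerD//; first by rewrite ger0_norm// ler_piMl// n3_ge0.
rewrite normrM normrM (ger0_norm f1) normfV (gtr0_norm L0).
apply: le_trans dm; rewrite [leLHS](_ : _ = (rho / Num.max rho (n3 v)) *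
  (n3 w / Num.max rho (n3 w)) * `|Num.max rho (n3 w) - Num.max rho (n3 v)|).
  apply: ler_piMl => //; rewrite mulr_ile1// ?divr_ge0 ?n3_ge0//; first exact: ltW.
  by rewrite ler_pdivrMr// mul1r.
by ring.
Qed.

End Nonlinearity.

(** * Solutions of the truncated system *)

Section Existence.
Context {R : realType}.
Local Notation mu := (@lebesgue_measure R).
Local Notation rT := (measurableTypeR R).
Implicit Types (s : bool) (k : component) (r t x y : R) (v w : component -> R)
  (U V : bool -> component -> R -> R -> R).

Lemma jm_csd (m : R) ty U : (forall s k, jm (U s k)) ->
  forall s k, jm (fun t x => csd m ty s k (fun s' k' => U s' k' t x)).
Proof.
move=> mU s k; case: k => /=.
- apply: measurable_funD; last by apply: measurable_funM => //; exact: mU.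
  by apply: measurable_funM; [apply: measurableT_comp => //|]; exact: mU.
- apply: measurable_funB; last by apply: measurable_funM => //; exact: mU.
  by apply: measurable_funM; exact: mU.
- apply: measurable_funM => //; rewrite /qf; case: ty.
    by apply: measurable_funB; apply: measurable_funM; exact: mU.
  by apply: measurable_funD; apply: measurable_funM; exact: mU.
Qed.

Lemma measurable_n3 (d : measure_display) (T : measurableType d)
    (V : component -> T -> R) : (forall k, measurable_fun setT (V k)) ->
  measurable_fun setT (fun z => n3 (V^~ z)).
Proof.
move=> mV; apply: measurable_funD; first apply: measurable_funD;
  by apply: measurableT_comp => //; exact: mV.
Qed.

Lemma measurable_trunc (d : measure_display) (T : measurableType d)
    (rho : T -> R) (V : component -> T -> R) : (forall z, 0 < rho z) ->
  measurable_fun setT rho -> (forall k, measurable_fun setT (V k)) ->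
  forall k, measurable_fun setT (fun z => trunc (rho z) (V^~ z) k).
Proof.
move=> r0 mr mV k; apply: measurable_funM; last exact: mV.
apply: measurable_funM => //.
rewrite (_ : (fun z => _) = (fun z => Num.max (rho z) (n3 (V^~ z)) `^ (-1))).
  apply: (@measurableT_comp _ _ _ _ _ _ (@powR R ^~ (-1))) => //.
  by apply: measurable_maxr => //; exact: measurable_n3.
by apply/funext => z; rewrite powR_inv1// le_max ltW.
Qed.

(** Truncation level, with [H] read at the label of the characteristic through [(t, x)]. Time is
    clamped at 0 because [c] is controlled for nonnegative times only, and the level must be
    positive and measurable on the whole plane. *)
Let level (c H : R -> R) s t x := c (Num.max 0 t) * H (x - sgn s * t).

Let csd_lip_bound (m c H H' a b d d' T : R) : 0 <= m -> 1 <= c -> c <= T ->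
  1 <= H -> 1 <= H' -> a = c * H -> b = c * H' -> 0 <= d -> 0 <= d' ->
  2 * b * (2 * d) + (2 * a + m) * (2 * d') <=
  (4 * T + 2 * m) * H' * d + (4 * T + 2 * m) * H * d'.
Proof.
move=> m0 c1 cT H1 H1' -> -> d0 d0'.
have h1 : 0 <= (T - c) * (H' * d) by rewrite !mulr_ge0 ?subr_ge0//; lra.
have h2 : 0 <= (T - c) * (H * d') by rewrite !mulr_ge0 ?subr_ge0//; lra.
have h3 : 0 <= m * (H' * d) by rewrite !mulr_ge0//; lra.
have h4 : 0 <= m * d' * (H - 1) by rewrite !mulr_ge0 ?subr_ge0//; lra.
lra.
Qed.

Let csd_bound_bound (m c H H' a b T : R) : 0 <= m -> 1 <= c -> c <= T ->
  1 <= H -> 1 <= H' -> 0 <= a -> a <= c * H -> 0 <= b -> b <= c * H' ->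
  (2 * a + m) * b <= (4 * T + 2 * m) * H * ((4 * T + 2 * m) * H').
Proof.
move=> m0 c1 cT H1 H1' a0 aH b0 bH.
have Hp : 0 <= H by lra. have Hp' : 0 <= H' by lra.
have h1 : c * H <= T * H by rewrite ler_wpM2r.
have h2 : c * H' <= T * H' by rewrite ler_wpM2r.
have h5 : 0 <= T * H by rewrite mulr_ge0//; lra.
have h6 : 0 <= m * H by rewrite mulr_ge0.
have h7 : 0 <= m * H' by rewrite mulr_ge0.
have h8 : m * 1 <= m * H by rewrite ler_wpM2l.
by apply: ler_pM => //; lra.
Qed.

(** [W] is the truncated state that feeds the nonlinearity. It is [U] times a real factor [la] in
    [[0, 1]], which phase rotation tolerates, and equals [U] wherever [U] stays below the level. *)
Lemma truncated_solution (m : R) ty (c H : R -> R)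
    (f : bool -> component -> R -> R) : 0 <= m ->
  locint H -> (forall y, 1 <= H y) ->
  (forall t, 0 <= t -> 1 <= c t) ->
  (forall r t, 0 <= r -> r <= t -> c r <= c t) ->
  (forall s k, measurable_fun setT (f s k)) ->
  exists U, (forall s k, jm (U s k)) /\
    exists (W : bool -> component -> R -> R -> R) (la : bool -> R -> R -> R),
    [/\ forall s k, jm (W s k),
      forall s k t y, 0 <= t -> U s k t (y + sgn s * t) = f s k y +
        \int[mu]_(r in `[0, t])
          csd m ty s k (fun s' k' => W s' k' r (y + sgn s * r)),
      forall s t x, 0 <= la s t x <= 1 /\
        forall k, W s k t x = la s t x * U s k t x,
      forall s t y, 0 <= t -> n3 (fun k => W s k t (y + sgn s * t)) <= c t * H y &
      forall s t y, 0 <= t -> n3 (fun k => U s k t (y + sgn s * t)) <= c t * H y ->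
        forall k, W s k t (y + sgn s * t) = U s k t (y + sgn s * t)].
Proof.
move=> m0 lH H1 c1 cnd mf.
have lev0 s t x : 0 < level c H s t x.
  rewrite mulr_gt0//; last exact: lt_le_trans (H1 _).
  by rewrite (lt_le_trans ltr01)// c1// le_max lexx.
have levE s t y : 0 <= t -> level c H s t (y + sgn s * t) = c t * H y.
  by move=> t0; rewrite /level max_r// addrK.
have levE' s t y : 0 <= t ->
    level c H (~~ s) t (y + sgn s * t) = c t * H (y + sgn s * t + sgn s * t).
  by move=> t0; rewrite /level max_r// sgnN mulNr opprK.
have mlev s : jm (level c H s).
  apply: measurable_funM; last exact: (jm_pos s (jm_cst2 (locint_measurable lH))).
  apply: (@measurableT_comp _ _ _ _ _ _ (fun t => c (Num.max 0 t)) _ fst) => //.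
  apply: nondecreasing_measurable => //.
  move=> a b ab /=; apply: cnd; first by rewrite le_max lexx.
  by rewrite ge_max !le_max lexx ab orbT.
pose Tr U s k t x := trunc (level c H s t x) (fun k' => U s k' t x) k.
have mTr U : (forall s k, jm (U s k)) -> forall s k, jm (Tr U s k).
  move=> mU s k.
  exact: (@measurable_trunc _ (rT * rT)%type (fun z => level c H s z.1 z.2)
    (fun k z => U s k z.1 z.2) (fun z => lev0 s z.1 z.2) (mlev s) (mU s) k).
have [] := @picard R (fun s k t x X => csd m ty s k (fun s' => trunc (level c H s' t x) (X s'))) f mf.
- by move=> U mU s k; exact: (jm_csd m ty (mTr U mU) s k).
(* The coefficients [2 b] and [2 a + m] of [csd_lip] are doubled by [trunc_lip]; the mass is
   absorbed because [H] is at least 1. *)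
- move=> T T0; exists (fun z => (4 * c T + 2 * m) * H z); split.
  + exact: locintZ.
  + move=> y; have := c1 T T0; have := H1 y => h1 h2; rewrite mulr_ge0//; lra.
  + move=> s t y X Y /andP[t0 tT].
    apply: (le_trans (@csd_lip _ m ty s (fun s' => trunc (level c H s' t (y + sgn s * t)) (X s'))
      (fun s' => trunc (level c H s' t (y + sgn s * t)) (Y s'))
      (level c H s t (y + sgn s * t)) (level c H (~~ s) t (y + sgn s * t)) m0 _ _)).
    * exact: trunc_le.
    * exact: trunc_le.
    apply: le_trans (csd_lip_bound m0 (c1 t t0) (cnd _ _ t0 tT) (H1 y)
      (H1 (y + sgn s * t + sgn s * t)) (levE s t y t0) (levE' s t y t0) _ _).
    * apply: lerD; apply: ler_wpM2l; try exact: trunc_lip.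
        by rewrite mulr_ge0// ltW.
      by rewrite addr_ge0// mulr_ge0// ltW.
    * exact: n3_ge0.
    * exact: n3_ge0.
  + move=> s t y X /andP[t0 tT].
    apply: (le_trans (csd_bound _ _ _ m0)).
    apply: (csd_bound_bound m0 (c1 t t0) (cnd _ _ t0 tT) (H1 y)
      (H1 (y + sgn s * t + sgn s * t))); try exact: n3_ge0.
      by rewrite -(levE s)//; exact: trunc_le.
    by rewrite -(levE' s)//; exact: trunc_le.
move=> U [mU eqU]; exists U; split => //; exists (Tr U).
exists (fun s t x => level c H s t x / Num.max (level c H s t x) (n3 (fun k' => U s k' t x))).
split.
- exact: mTr.
- exact: eqU.
- move=> s t x; split => //.
  have l0 := lev0 s t x.
  apply/andP; split; first by rewrite divr_ge0 ?le_max ?(ltW l0).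
  by rewrite ler_pdivrMr ?mul1r ?le_max ?lexx// lt_max l0.
- by move=> s t y t0; rewrite -(levE s)//; exact: trunc_le.
- by move=> s t y t0 h k; rewrite /Tr trunc_id// levE.
Qed.

End Existence.

(** * A priori bound for the modulus of the spinor *)

Section APriori.
Context {R : realType}.
Local Notation mu := (@lebesgue_measure R).
Local Notation rT := (measurableTypeR R).
Implicit Types (s : bool) (k : component) (r t x y : R) (f g h : R -> R).

Lemma winZ (c : R) f t x : locint f -> win (fun z => c * f z) t x = c * win f t x.
Proof. by move=> lf; rewrite /win RintegralZl//; exact: locint_itv. Qed.

Lemma winD f g t x : locint f -> locint g ->
  win (fun z => f z + g z) t x = win f t x + win g t x.
Proof. by move=> lf lg; rewrite /win RintegralD//; exact: locint_itv. Qed.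

Lemma win_add1 f t x : locint f -> 0 <= t ->
  win (fun z => f z + 1) t x = win f t x + 2 * t.
Proof.
move=> lf t0; rewrite winD//; last exact: locint_cst.
congr (_ + _); rewrite /win Rintegral_cst//= lebesgue_measure_itv /= lte_fin.
case: ifPn => [_|]; first by rewrite mul1r -EFinD /=; ring.
by rewrite -leNgt => ?; rewrite mulr0; lra.
Qed.

Lemma norm_Rint_le t f g : measurable_fun `[0, t] f ->
  mu.-integrable `[0, t] (EFin \o g) ->
  (forall r, 0 <= r <= t -> `|f r| <= g r) ->
  `|\int[mu]_(r in `[0, t]) f r| <= \int[mu]_(r in `[0, t]) g r.
Proof.
move=> mf Ig fg.
have If : mu.-integrable `[0, t] (EFin \o f).
  by apply: integrable_le Ig => // r /=; rewrite in_itv /=; exact: fg.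
rewrite (le_trans (le_normr_Rintegral _ If))//.
by apply: Rint_le => //; exact: integrable_norm.
Qed.

(** Uniform local integrability: window integrals grow at most linearly in the length. An [L^p]
    majorant satisfies it with a constant given by its norm, so the pointwise theory does not depend
    on [p]. The summand 1 prepares the weight [h + 1], which dominates the mass term. *)
Definition uloc (M : R) h := [/\ locint h, forall y, 0 <= h y, 1 <= M &
  forall t x, 0 <= t -> win (fun z => h z + 1) t x <= M * (1 + 2 * t)].

Lemma uloc_win (M : R) h t x : uloc M h -> 0 <= t -> win h t x <= M * (1 + 2 * t).
Proof.
move=> [lh h0 _ hM] t0; have := hM t x t0; rewrite win_add1//; lra.
Qed.

(** The Gronwall factor for [B = 4 m (h + 1)] and [e = 2 h], with the windows replaced by
    [w = M (1 + 2 t)]. The second factor adds the coefficient [2 + 8 m w] of [h] to the coefficient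
    [8 m] of its window. *)
Definition gam (m M t : R) : R :=
  expR (8 * m * (M * (1 + 2 * t))) * (2 + 8 * m + 8 * m * (M * (1 + 2 * t))).

Lemma gam_nd (m M r t : R) : 0 <= m -> 0 <= M -> 0 <= r -> r <= t ->
  gam m M r <= gam m M t.
Proof.
move=> m0 M0 r0 rt.
have h : 8 * m * (M * (1 + 2 * r)) <= 8 * m * (M * (1 + 2 * t)).
  by rewrite !ler_wpM2l ?mulr_ge0//; lra.
have h' : 0 <= 8 * m * (M * (1 + 2 * r)) by rewrite !mulr_ge0//; lra.
by apply: ler_pM; rewrite ?expR_ge0 ?ler_expR//; lra.
Qed.

Lemma gam_ge1 (m M t : R) : 0 <= m -> 0 <= M -> 0 <= t -> 1 <= gam m M t.
Proof.
move=> m0 M0 t0.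
have h' : 0 <= 8 * m * (M * (1 + 2 * t)) by rewrite !mulr_ge0//; lra.
have h1 : 1 <= expR (8 * m * (M * (1 + 2 * t))) by rewrite -[leLHS]expR0 ler_expR.
have h2 : 1 <= 2 + 8 * m + 8 * m * (M * (1 + 2 * t)) by lra.
by rewrite /gam -[leLHS]mulr1; apply: ler_pM.
Qed.

(** Phase rotation leaves a linear inequality that sees only the opposite family, with constant
    [4 m]. Since [h + 1] is at least 1, the weight [4 m (h + 1)] puts it in Gronwall form, and the
    crude constant [K] disappears from the conclusion. *)
Lemma modulus_apriori (m M T K : R) h (v : bool -> R -> R -> R) :
  0 < m -> uloc M h ->
  (forall s t y, 0 <= t <= T -> 0 <= v s t y <= K * (h y + 1)) ->
  (forall s t y, 0 <= t <= T ->
    measurable_fun `[0, t] (fun r => v (~~ s) r (y + sgn s * r + sgn s * r))) ->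
  (forall s t y, 0 <= t <= T -> v s t y <= 2 * h y +
     4 * \int[mu]_(r in `[0, t]) (m * v (~~ s) r (y + sgn s * r + sgn s * r))) ->
  forall s t y, 0 <= t <= T ->
    v s t y <= gam m M t * (h y + win h t (y + sgn s * t)).
Proof.
move=> m0 [lh h0 M1 hM] vK mv vI s t y tT.
have [t0 _] := andP tT.
pose H z := h z + 1.
have lH : locint H by apply: locintD => //; exact: locint_cst.
have H0 z : 0 <= H z by rewrite addr_ge0.
have lB : locint (fun z => 4 * m * H z) by exact: locintZ.
have B0 z : 0 <= 4 * m * H z by rewrite !mulr_ge0// ltW.
have le2 : locint (fun z => 2 * h z) by exact: locintZ.
have e0 z : 0 <= 2 * h z by rewrite mulr_ge0.
have vK' s' t' y' : 0 <= t' <= T -> v s' t' y' <= K / (4 * m) * (4 * m * H y').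
  move=> /(vK s' t' y')/andP[_]; congr (_ <= _); rewrite /H; field.
  by rewrite gt_eqF.
have step (V : bool -> R -> R -> R) :
    (forall s t y, 0 <= t <= T -> v s t y <= V s t y) ->
    forall s t y (G : R -> R), 0 <= t <= T -> mu.-integrable `[0, t] (EFin \o G) ->
    (forall r, 0 <= r <= t ->
       4 * m * H (y + sgn s * r + sgn s * r) * V s r y +
       4 * m * H y * V (~~ s) r (y + sgn s * r + sgn s * r) <= G r) ->
    v s t y <= 2 * h y + \int[mu]_(r in `[0, t]) G r.
  move=> vV s' t' y' G tT' IG VG.
  have vG r : 0 <= r <= t' -> 4 * (m * v (~~ s') r (y' + sgn s' * r + sgn s' * r)) <= G r.
    move=> /andP[r0 rt]; have rT : 0 <= r <= T.
      by rewrite r0 (le_trans rt)//; case/andP : tT'.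
    apply: le_trans (VG r _); last by rewrite r0.
    have /andP[v1 _] := vK s' r y' rT.
    have /andP[v2 _] := vK (~~ s') r (y' + sgn s' * r + sgn s' * r) rT.
    have v3 := vV s' r y' rT.
    have v4 := vV (~~ s') r (y' + sgn s' * r + sgn s' * r) rT.
    move: v1 v2 v3 v4; move: (v (~~ s') r _) (V (~~ s') r _) => a a'.
    move: (v s' r y') (V s' r y') => b b' b0 a0 bb' aa'.
    have h1 : 0 <= 4 * m * H (y' + sgn s' * r + sgn s' * r) * b'.
      by rewrite mulr_ge0// (le_trans b0).
    have h2 : 0 <= 4 * m * h y' * a'.
      by rewrite !mulr_ge0//; [exact: ltW|exact: le_trans aa'].
    have h3 : 4 * m * a <= 4 * m * a' by rewrite ler_wpM2l// mulr_ge0// ltW.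
    rewrite /H in h1 *; lra.
  have mvm : measurable_fun `[0, t'] (fun r => m * v (~~ s') r (y' + sgn s' * r + sgn s' * r)).
    by apply: measurable_funM => //; exact: mv.
  have Iv : mu.-integrable `[0, t'] (EFin \o (fun r =>
      4 * (m * v (~~ s') r (y' + sgn s' * r + sgn s' * r)))).
    apply: integrable_le IG => //; first exact: measurable_funM.
    move=> r /=; rewrite in_itv /= => rt; rewrite ger0_norm ?vG//.
    rewrite !mulr_ge0//; first exact: ltW.
    have rT : 0 <= r <= T.
      by case/andP : rt => -> rt; rewrite (le_trans rt)//; case/andP : tT'.
    by have /andP[] := vK (~~ s') r (y' + sgn s' * r + sgn s' * r) rT.
  have Iv' : mu.-integrable `[0, t'] (EFin \o (fun r =>
      m * v (~~ s') r (y' + sgn s' * r + sgn s' * r))).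
    rewrite (_ : (fun r => _) = (fun r => 4^-1 *
      (4 * (m * v (~~ s') r (y' + sgn s' * r + sgn s' * r))))).
      exact: integrable_mulr.
    by apply/funext => r; rewrite mulKf// pnatr_eq0.
  apply: (le_trans (vI s' t' y' tT')); rewrite lerD2l -RintegralZl//.
  by apply: Rint_le.
have := gronwall_characteristics lB B0 le2 e0 vK' step s y tT.
move=> /le_trans; apply.
have x0 := uloc_win (y + sgn s * t) (And4 lh h0 M1 hM) t0.
have x1 := hM t (y + sgn s * t) t0.
rewrite winZ// winZ// /gam.
set W := win h t _; set w := M * (1 + 2 * t).
have W0 : 0 <= W by exact: win_ge0.
rewrite -/(H) -/W -/w in x0 x1 *.
have hy := h0 y.
apply: (@le_trans _ _ (expR (8 * m * w) * (2 * h y + 4 * m * H y * (2 * W)))).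
  apply: ler_wpM2r.
    by rewrite addr_ge0// mulr_ge0// mulr_ge0.
  rewrite ler_expR; have := ler_wpM2l (ltW m0) x1; rewrite -/H; lra.
rewrite -[leRHS]mulrA ler_wpM2l ?expR_ge0// /H.
have h1 : 8 * m * h y * W <= 8 * m * h y * w.
  by rewrite ler_wpM2l// !mulr_ge0// ltW.
have w0 : 0 <= w by exact: le_trans x0.
have h2 : 0 <= m * W by rewrite mulr_ge0// ltW.
have h3 : 0 <= m * w * W := mulr_ge0 (mulr_ge0 (ltW m0) w0) W0.
have h4 : 0 <= m * h y by rewrite mulr_ge0// ltW.
lra.
Qed.

End APriori.

(** * Global solutions of the full system *)

Section Global.
Context {R : realType}.
Local Notation mu := (@lebesgue_measure R).
Local Notation rT := (measurableTypeR R).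
Implicit Types (s : bool) (k : component) (r t x y : R) (h : R -> R)
  (U V W : bool -> component -> R -> R -> R).

(** The summands bound, in this order, the datum of A_s, the modulus of psi_s, and the integral
    along a characteristic of the product of the two moduli. *)
Definition Gam (m M t : R) : R :=
  1 + gam m M t + gam m M t ^+ 2 * ((1 + t) * (M * (1 + 2 * t))).

Lemma Gam_ge (m M t : R) : 0 <= m -> 0 <= M -> 0 <= t ->
  0 <= gam m M t ^+ 2 * ((1 + t) * (M * (1 + 2 * t))).
Proof.
by move=> m0 M0 t0; rewrite mulr_ge0 ?sqr_ge0// mulr_ge0 ?mulr_ge0//; lra.
Qed.

Lemma Gam_ge1 (m M t : R) : 0 <= m -> 0 <= M -> 0 <= t -> 1 <= Gam m M t.
Proof.
move=> m0 M0 t0; have := Gam_ge m0 M0 t0; have := gam_ge1 m0 M0 t0.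
rewrite /Gam; lra.
Qed.

Lemma Gam_nd (m M r t : R) : 0 <= m -> 0 <= M -> 0 <= r -> r <= t ->
  Gam m M r <= Gam m M t.
Proof.
move=> m0 M0 r0 rt; have g := gam_nd m0 M0 r0 rt.
have g1 := gam_ge1 m0 M0 r0.
have g0 : 0 <= gam m M r by lra.
rewrite /Gam; apply: lerD; first by rewrite lerD2l.
have h1 : 0 <= M * (1 + 2 * r) by rewrite mulr_ge0//; lra.
have h2 : M * (1 + 2 * r) <= M * (1 + 2 * t) by rewrite ler_wpM2l//; lra.
apply: ler_pM; first exact: sqr_ge0.
- by rewrite mulr_ge0//; lra.
- by rewrite lerXn2r// nnegrE//; lra.
- by apply: ler_pM => //; lra.
Qed.

(* The truncation level is the a priori bound itself, so that the truncation
   is never active. *)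
Lemma csd_exists (m M : R) ty h (f : bool -> component -> R -> R) :
  0 < m -> uloc M h -> (forall s k, measurable_fun setT (f s k)) ->
  (forall s y, n3 (fun k => f s k y) <= h y) ->
  exists U, [/\ forall s k, jm (U s k),
    forall s k t y, 0 <= t -> U s k t (y + sgn s * t) = f s k y +
        \int[mu]_(r in `[0, t])
          csd m ty s k (fun s' k' => U s' k' r (y + sgn s * r)) &
    forall s t y, 0 <= t -> n3 (fun k => U s k t (y + sgn s * t)) <=
      Gam m M t * (h y + win h t (y + sgn s * t))].
Proof.
move=> m0 uh mf fh; have [lh h0 M1 hM] := uh.
have m0' := ltW m0; have M0 : 0 <= M by lra.
pose H z := h z + 1.
have lH : locint H by apply: locintD => //; exact: locint_cst.
have H1 y : 1 <= H y by rewrite lerDr.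
have H0 y : 0 <= H y by exact: le_trans (H1 y).
(* The a priori bound with its window replaced by [M (1 + 2 t)]: the level becomes a function of
   time times [H] at the label, as [truncated_solution] requires. *)
pose c t := Gam m M t * (1 + M * (1 + 2 * t)).
have w0 t : 0 <= t -> 0 <= M * (1 + 2 * t) by move=> t0; rewrite mulr_ge0//; lra.
have c1 t : 0 <= t -> 1 <= c t.
  move=> t0; have := Gam_ge1 m0' M0 t0; have := w0 t t0 => h1 h2.
  by rewrite -[leLHS]mulr1; apply: ler_pM => //; lra.
have cnd r t : 0 <= r -> r <= t -> c r <= c t.
  move=> r0 rt; have := Gam_ge1 m0' M0 r0; have := w0 r r0 => h1 h2.
  apply: ler_pM; [lra|lra|exact: Gam_nd|].
  by rewrite lerD2l ler_wpM2l//; lra.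
have [U [mU [W [la [mW eqU laU bW WU]]]]] :=
  truncated_solution ty m0' lH H1 c1 cnd mf.
have cle t : 0 <= t -> forall s y, Gam m M t * (h y + win h t (y + sgn s * t)) <= c t * H y.
  move=> t0 s y; rewrite -mulrA ler_wpM2l//.
    by have := Gam_ge1 m0' M0 t0; lra.
  have h1 := uloc_win (y + sgn s * t) uh t0; have h2 := w0 t t0.
  have h3 : 0 <= M * (1 + 2 * t) * h y by rewrite mulr_ge0.
  rewrite /H; lra.
suff main s t y : 0 <= t -> n3 (fun k => U s k t (y + sgn s * t)) <=
      Gam m M t * (h y + win h t (y + sgn s * t)).
  exists U; split => // s k t y t0; rewrite eqU//; congr (_ + _).
  apply: eq_Rintegral => r; rewrite inE /= in_itv /= => /andP[r0 rt].
  congr csd; apply/funext => s'; apply/funext => k'.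
  have [->|ss'] := eqVneq s' s.
    by apply: WU => //; exact: le_trans (main _ _ _ _) (cle _ _ _ _).
  have {ss'} -> : s' = ~~ s by case: s s' ss' => -[].
  have -> : y + sgn s * r = y + sgn s * r + sgn s * r + sgn (~~ s) * r.
    by rewrite sgnN; ring.
  by apply: WU => //; exact: le_trans (main _ _ _ _) (cle _ _ _ _).
move=> {cle WU} t0; clearbody c.
pose T := t; have T0 : 0 <= T by [].
have opp s' r y' : y' + sgn s' * r = y' + sgn s' * r + sgn s' * r + sgn (~~ s') * r.
  by rewrite sgnN; ring.
have bW' s' r y' : 0 <= r <= T -> n3 (fun k => W s' k r (y' + sgn s' * r)) <= c T * H y'.
  move=> /andP[r0 rT]; apply: (le_trans (bW _ _ _ r0)).
  by rewrite ler_wpM2r// cnd.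
have bN s' r y' : 0 <= r <= T ->
    n3 (fun k => csd m ty s' k (fun s'' k' => W s'' k' r (y' + sgn s' * r))) <=
    (2 * (c T * H y') + m) * (c T * H (y' + sgn s' * r + sgn s' * r)).
  move=> rT; apply: (le_trans (csd_bound _ _ _ m0')).
  have h1 := bW' s' r y' rT.
  have h2 := bW' (~~ s') r (y' + sgn s' * r + sgn s' * r) rT; rewrite -opp in h2.
  by apply: ler_pM; rewrite ?n3_ge0//; have := n3_ge0 (fun k => W s' k r (y' + sgn s' * r)); lra.
have mN s' y' k : measurable_fun setT
    (fun r => csd m ty s' k (fun s'' k' => W s'' k' r (y' + sgn s' * r))).
  exact: (jm_char s' y' (jm_csd m ty mW s' k)).
have c0 : 0 <= c T by exact: le_trans (c1 T T0).
have lG s' y' t' : mu.-integrable `[0, t'] (EFin \o (fun r =>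
    (2 * (c T * H y') + m) * (c T * H (y' + sgn s' * r + sgn s' * r)))).
  by do 2 apply: integrable_mulr => //; exact/locint_itv/locint_char.
have IN s' y' t' k : 0 <= t' <= T -> mu.-integrable `[0, t'] (EFin \o
    (fun r => csd m ty s' k (fun s'' k' => W s'' k' r (y' + sgn s' * r)))).
  move=> /andP[t'0 t'T]; apply: integrable_le (lG s' y' t') => //.
    by apply: measurable_funTS; exact: mN.
  move=> r /=; rewrite in_itv /= => /andP[r0 rt].
  apply: (le_trans _ (bN s' r y' _)); last by rewrite r0 (le_trans rt).
  exact: (le_n3 (fun k => csd m ty s' k (fun s'' k' => W s'' k' r (y' + sgn s' * r)))).
(* A crude bound that depends on the truncation level; it serves as the qualitative hypothesis of
   [modulus_apriori], whose conclusion is free of [K]. *)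
pose K := 1 + (2 * c T + m) * (c T * (M * (1 + 2 * T))).
have UK s' t' y' : 0 <= t' <= T -> n3 (fun k => U s' k t' (y' + sgn s' * t')) <= K * H y'.
  move=> /[dup] tT' /andP[t'0 t'T].
  rewrite (_ : (fun k => _) = (fun k => f s' k y' + \int[mu]_(r in `[0, t'])
    csd m ty s' k (fun s'' k' => W s'' k' r (y' + sgn s' * r)))); last first.
    by apply/funext => k; exact: eqU.
  apply: (@le_trans _ _ (h y' + \int[mu]_(r in `[0, t'])
    ((2 * (c T * H y') + m) * (c T * H (y' + sgn s' * r + sgn s' * r))))).
    apply: (@le_trans _ _ (n3 (fun k => f s' k y') + n3 (fun k => \int[mu]_(r in `[0, t'])
       csd m ty s' k (fun s'' k' => W s'' k' r (y' + sgn s' * r))))).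
      rewrite /n3.
      have := ler_normD (f s' cP y') (\int[mu]_(r in `[0, t'])
         csd m ty s' cP (fun s'' k' => W s'' k' r (y' + sgn s' * r))).
      have := ler_normD (f s' cQ y') (\int[mu]_(r in `[0, t'])
         csd m ty s' cQ (fun s'' k' => W s'' k' r (y' + sgn s' * r))).
      have := ler_normD (f s' cA y') (\int[mu]_(r in `[0, t'])
         csd m ty s' cA (fun s'' k' => W s'' k' r (y' + sgn s' * r))).
      move: (\int[mu]_(r in _) _) (\int[mu]_(r in _) _) (\int[mu]_(r in _) _) => a b d.
      by move=> ? ? ?; lra.
    apply: lerD; first exact: fh.
    apply: n3_Rint => //; first by move=> k; apply: measurable_funTS; exact: mN.
    by move=> r /andP[r0 rt]; apply: bN; rewrite r0 (le_trans rt).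
  rewrite RintegralZl//; last first.
    by apply: integrable_mulr => //; exact/locint_itv/locint_char.
  rewrite RintegralZl//; last exact/locint_itv/locint_char.
  rewrite Rint_char//.
  have h1 := hM t' (y' + sgn s' * t') t'0; rewrite -/H in h1.
  have h2 : M * (1 + 2 * t') <= M * (1 + 2 * T) by rewrite ler_wpM2l//; lra.
  have h3 : 0 <= win H t' (y' + sgn s' * t') by exact: win_ge0.
  have h4 : c T * (2^-1 * win H t' (y' + sgn s' * t')) <= c T * (M * (1 + 2 * T)).
    by rewrite ler_wpM2l//; lra.
  have h5 : (2 * (c T * H y') + m) * (c T * (2^-1 * win H t' (y' + sgn s' * t')))
     <= ((2 * c T + m) * H y') * (c T * (M * (1 + 2 * T))).
    apply: ler_pM => //.
    - by rewrite addr_ge0// !mulr_ge0.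
    - by rewrite !mulr_ge0.
    - by have := ler_wpM2l m0' (H1 y'); lra.
  have h6 : h y' <= H y' by rewrite lerDl.
  rewrite (_ : K * H y' = H y' + ((2 * c T + m) * H y') * (c T * (M * (1 + 2 * T)))).
    exact: lerD.
  by rewrite /K; ring.
clearbody K.
pose v s' t' y' := `|U s' cP t' (y' + sgn s' * t')| + `|U s' cQ t' (y' + sgn s' * t')|.
have v0 s' t' y' : 0 <= v s' t' y' by rewrite addr_ge0.
have v_n3 s' t' y' : v s' t' y' <= n3 (fun k => U s' k t' (y' + sgn s' * t')).
  by rewrite /n3 /v lerDl.
have vopp s' y' r : v (~~ s') r (y' + sgn s' * r + sgn s' * r) =
    `|U (~~ s') cP r (y' + sgn s' * r)| + `|U (~~ s') cQ r (y' + sgn s' * r)|.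
  by rewrite /v -opp.
have mv s' y' : measurable_fun setT (fun r => v (~~ s') r (y' + sgn s' * r + sgn s' * r)).
  under eq_fun do rewrite vopp.
  by apply: measurable_funD; apply: measurableT_comp => //; exact: jm_char.
have vK s' t' y' : 0 <= t' <= T -> 0 <= v s' t' y' <= K * (h y' + 1).
  by move=> tT; rewrite v0 (le_trans (v_n3 _ _ _))// UK.
have vI s' t' y' : 0 <= t' <= T -> v s' t' y' <= 2 * h y' +
    4 * \int[mu]_(r in `[0, t']) (m * v (~~ s') r (y' + sgn s' * r + sgn s' * r)).
  move=> /[dup] tT' /andP[t'0 t'T].
  apply: (@le_trans _ _ (2 * (`|f s' cP y'| + `|f s' cQ y'|) +
    4 * \int[mu]_(r in `[0, t']) (m * v (~~ s') r (y' + sgn s' * r + sgn s' * r)))).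
    (* Truncation multiplies both parts of psi_s by the same real factor [la s], which can be moved
       into the potential; the rotation is then by the real potential [W (~~ s) cA * la s]. *)
    apply: (@phase_bound _ t' (f s' cP y') (f s' cQ y')
      (fun r => U s' cP r (y' + sgn s' * r)) (fun r => U s' cQ r (y' + sgn s' * r))
      (fun r => csd m ty s' cP (fun s'' k' => W s'' k' r (y' + sgn s' * r)))
      (fun r => csd m ty s' cQ (fun s'' k' => W s'' k' r (y' + sgn s' * r)))
      (fun r => W (~~ s') cA r (y' + sgn s' * r) * la s' r (y' + sgn s' * r))
      (fun r => m * W (~~ s') cQ r (y' + sgn s' * r))
      (fun r => - m * W (~~ s') cP r (y' + sgn s' * r))) => //.
    - exact: IN.
    - exact: IN.
    - apply: integrable_mulr => //.
      apply: (@integrable_le _ _ _ (fun r => K * H (y' + sgn s' * r + sgn s' * r))) => //.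
      + by apply: measurable_funTS; exact: mv.
      + move=> r /=; rewrite in_itv /= => /andP[r0 rt].
        rewrite ger0_norm//.
        have rT : 0 <= r <= T by rewrite r0 (le_trans rt).
        by have /andP[_] := vK (~~ s') r (y' + sgn s' * r + sgn s' * r) rT.
      + by apply: integrable_mulr => //; exact/locint_itv/locint_char.
    - by move=> r /andP[r0 _]; exact: eqU.
    - by move=> r /andP[r0 _]; exact: eqU.
    - move=> r _ /=; have [_ ->] := laU s' r (y' + sgn s' * r); ring.
    - move=> r _ /=; have [_ ->] := laU s' r (y' + sgn s' * r); ring.
    - move=> r _; rewrite vopp !normrM normrN (ger0_norm m0') -mulrDr ler_wpM2l//.
      have [/andP[l0 l1] WE] := laU (~~ s') r (y' + sgn s' * r).
      by rewrite !WE !normrM (ger0_norm l0) addrC lerD// ler_piMl.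
  rewrite lerD2r ler_wpM2l//; apply: le_trans (fh s' y').
  by rewrite /n3 lerDl.
have vg := modulus_apriori m0 uh vK (fun s' t' y' _ => measurable_funTS (mv s' y')) vI.
have tT : 0 <= t <= T by rewrite t0 lexx.
set g := gam m M t; set w := M * (1 + 2 * t).
have g1 : 1 <= g by exact: gam_ge1.
pose Wt := win h t (y + sgn s * t).
have Wt0 : 0 <= Wt by exact: win_ge0.
have Wtw : Wt <= w by exact: uloc_win.
have vP : v s t y <= g * (h y + Wt) by exact: vg.
have vPr r : 0 <= r <= t -> v s r y <= g * (h y + Wt).
  move=> /andP[r0 rt]; apply: (le_trans (vg s r y _)); first by rewrite r0.
  apply: ler_pM.
  - by have := gam_ge1 m0' M0 r0; lra.
  - by rewrite addr_ge0// win_ge0.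
  - exact: gam_nd.
  - by rewrite lerD2l win_nd.
have vMr r : 0 <= r <= t -> v (~~ s) r (y + sgn s * r + sgn s * r)
    <= g * (h (y + sgn s * r + sgn s * r) + Wt).
  move=> /andP[r0 rt]; apply: (le_trans (vg (~~ s) r _ _)); first by rewrite r0.
  rewrite -opp; apply: ler_pM.
  - by have := gam_ge1 m0' M0 r0; lra.
  - by rewrite addr_ge0// win_ge0.
  - exact: gam_nd.
  - by rewrite lerD2l win_nd.
have Ih : mu.-integrable `[0, t] (EFin \o (fun r => h (y + sgn s * r + sgn s * r) + Wt)).
  apply: integrable_addr => //; first exact/locint_itv/locint_char.
  exact: integrable_itv_cst.
(* The own modulus is bounded by a constant along the characteristic; the crossing one integrates to
   half a window plus [t] times a window, whence [(1 + t) * w]. *)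
have A_le : `|U s cA t (y + sgn s * t)| <= h y + (g ^+ 2 * (h y + Wt)) * ((1 + t) * w).
  rewrite eqU// (le_trans (ler_normD _ _))// lerD//.
    by apply: le_trans (fh s y); exact: (le_n3 (fun k => f s k y)).
  apply: (@le_trans _ _ (\int[mu]_(r in `[0, t])
      ((g ^+ 2 * (h y + Wt)) * (h (y + sgn s * r + sgn s * r) + Wt)))).
    apply: norm_Rint_le.
    - by apply: measurable_funTS; exact: mN.
    - exact: integrable_mulr.
    - move=> r rt; rewrite /= normrM normrN norm_sgn mul1r.
      apply: (le_trans (qf_le ty s _)).
      rewrite (_ : _ * (h _ + _) = (g * (h y + Wt)) *
        (g * (h (y + sgn s * r + sgn s * r) + Wt))); last by ring.
      apply: ler_pM; rewrite ?addr_ge0//.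
        apply: le_trans (vPr r rt); rewrite /v.
        have [/andP[l0 l1] WE] := laU s r (y + sgn s * r).
        by rewrite !WE !normrM (ger0_norm l0) lerD// ler_piMl.
      apply: le_trans (vMr r rt); rewrite vopp.
      have [/andP[l0 l1] WE] := laU (~~ s) r (y + sgn s * r).
      by rewrite !WE !normrM (ger0_norm l0) lerD// ler_piMl.
  rewrite RintegralZl//; apply: ler_wpM2l.
    by rewrite mulr_ge0 ?sqr_ge0// addr_ge0.
  rewrite RintegralD//; last 2 first.
    exact/locint_itv/locint_char.
    exact: integrable_itv_cst.
  rewrite Rint_char// -/Wt Rintegral_cst//= lebesgue_measure_itv /= lte_fin.
  have h1 : t * Wt <= t * w by rewrite ler_wpM2l.
  case: ifPn => [_|_]; rewrite ?mulr0 ?addr0 -?EFinD /= ?subr0; last first.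
    by have := mulr_ge0 t0 Wt0; lra.
  lra.
have n3E : n3 (fun k => U s k t (y + sgn s * t)) = v s t y + `|U s cA t (y + sgn s * t)|.
  by [].
rewrite n3E /Gam -/g -/w -/Wt.
have h1 : 0 <= g ^+ 2 * ((1 + t) * w) * Wt.
  rewrite mulr_ge0// mulr_ge0 ?sqr_ge0// mulr_ge0//; first lra.
  exact: w0.
move: vP A_le; move: (v s t y) `|U s cA t _| => a b hP hA.
lra.
Qed.

End Global.

(** * Stability *)

Section Stability.
Context {R : realType}.
Local Notation mu := (@lebesgue_measure R).
Local Notation rT := (measurableTypeR R).
Implicit Types (s : bool) (k : component) (r t x y : R) (h H e : R -> R)
  (U V a b : bool -> component -> R -> R -> R).

(* The state at time [r] on the [s]-characteristic labelled [y], for unknowns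
   given as functions of time and of the label of their own characteristic. *)
Definition lstate a s r y : bool -> component -> R := fun s' k =>
  if s' == s then a s k r y else a (~~ s) k r (y + sgn s * r + sgn s * r).

Lemma lstate_same a s r y k : lstate a s r y s k = a s k r y.
Proof. by rewrite /lstate eqxx. Qed.

Lemma lstate_opp a s r y k :
  lstate a s r y (~~ s) k = a (~~ s) k r (y + sgn s * r + sgn s * r).
Proof. by rewrite /lstate; case: s. Qed.

Lemma lstateE U s r y s' k :
  lstate (fun s k t y => U s k t (y + sgn s * t)) s r y s' k = U s' k r (y + sgn s * r).
Proof.
have [->|ss'] := eqVneq s' s; first by rewrite lstate_same.
have {ss'} -> : s' = ~~ s by case: s s' ss' => -[].
by rewrite lstate_opp; congr U; rewrite sgnN; ring.
Qed.

(** [a] and [b] are arbitrary functions of time and label, without measurability: the Duhamel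
    inequality is asked against integrable majorants [G]. It therefore applies to constructed
    solutions as well as to weak solutions corrected on a null set of labels. *)
Lemma label_stability (m c T : R) ty H e a b : 0 <= m -> 0 <= c ->
  locint H -> (forall y, 1 <= H y) -> locint e -> (forall y, 0 <= e y) ->
  (forall s t y, 0 <= t <= T -> n3 (fun k => a s k t y) <= c * H y) ->
  (forall s t y, 0 <= t <= T -> n3 (fun k => b s k t y) <= c * H y) ->
  (forall s t y, 0 <= t <= T -> forall G : R -> R,
     mu.-integrable `[0, t] (EFin \o G) ->
     (forall r, 0 <= r <= t ->
        d3 (fun k => csd m ty s k (lstate a s r y))
           (fun k => csd m ty s k (lstate b s r y)) <= G r) ->
     d3 (fun k => a s k t y) (fun k => b s k t y) <=
       e y + \int[mu]_(r in `[0, t]) G r) ->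
  forall s t y, 0 <= t <= T ->
    d3 (fun k => a s k t y) (fun k => b s k t y) <=
    expR (2 * ((2 * c + m) * win H t (y + sgn s * t))) *
    (e y + (2 * c + m) * H y * win e t (y + sgn s * t)).
Proof.
move=> m0 c0 lH H1 le e0 ha hb hI s t y tT.
have H0 z : 0 <= H z by exact: le_trans (H1 z).
have lB : locint (fun z => (2 * c + m) * H z) by exact: locintZ.
have B0 z : 0 <= (2 * c + m) * H z.
  by rewrite mulr_ge0// addr_ge0// mulr_ge0.
rewrite -winZ//.
apply: (gronwall_characteristics lB B0 le e0 (T := T)
  (u := fun s t y => d3 (fun k => a s k t y) (fun k => b s k t y)) (K := 1)) => //.
- move=> s' t' y' tT'; have h1 := ha s' t' y' tT'; have h2 := hb s' t' y' tT'.
  have h3 : d3 (fun k => a s' k t' y') (fun k => b s' k t' y') <=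
      n3 (fun k => a s' k t' y') + n3 (fun k => b s' k t' y').
    rewrite /d3 /n3; have := ler_normB (a s' cP t' y') (b s' cP t' y').
    have := ler_normB (a s' cQ t' y') (b s' cQ t' y').
    by have := ler_normB (a s' cA t' y') (b s' cA t' y'); lra.
  have h4 : 0 <= m * H y' by rewrite mulr_ge0.
  lra.
- move=> V aV s' t' y' G tT' IG VG; apply: hI => // r /andP[r0 rt].
  have rT : 0 <= r <= T by rewrite r0 (le_trans rt)//; case/andP: tT'.
  apply: le_trans (VG r _); last by rewrite r0.
  have e1 : lstate a s' r y' s' = (fun k => a s' k r y').
    by apply/funext => k; rewrite lstate_same.
  have e2 : lstate b s' r y' s' = (fun k => b s' k r y').
    by apply/funext => k; rewrite lstate_same.
  have e3 : lstate a s' r y' (~~ s') = (fun k => a (~~ s') k r (y' + sgn s' * r + sgn s' * r)).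
    by apply/funext => k; rewrite lstate_opp.
  have e4 : lstate b s' r y' (~~ s') = (fun k => b (~~ s') k r (y' + sgn s' * r + sgn s' * r)).
    by apply/funext => k; rewrite lstate_opp.
  have := @csd_lip _ m ty s' (lstate a s' r y') (lstate b s' r y') (c * H y')
    (c * H (y' + sgn s' * r + sgn s' * r)) m0.
  rewrite e1 e2 e3 e4 => /(_ (hb _ _ _ rT) (ha _ _ _ rT)) /le_trans; apply.
  have d1 := aV s' r y' rT.
  have d2 := aV (~~ s') r (y' + sgn s' * r + sgn s' * r) rT.
  apply: lerD.
    apply: ler_pM => //.
    - by rewrite mulr_ge0// mulr_ge0.
    - exact: n3_ge0.
    - by have := mulr_ge0 m0 (H0 (y' + sgn s' * r + sgn s' * r)); lra.
  apply: ler_pM => //.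
  - by rewrite addr_ge0// !mulr_ge0.
  - exact: n3_ge0.
  - by have := ler_wpM2l m0 (H1 y'); lra.
Qed.

Lemma csd_char_bound (m c T : R) ty H U s r y : 0 <= m -> 0 <= c ->
  (forall y, 0 <= H y) ->
  (forall s t y, 0 <= t <= T -> n3 (fun k => U s k t (y + sgn s * t)) <= c * H y) ->
  0 <= r <= T ->
  n3 (fun k => csd m ty s k (fun s' k' => U s' k' r (y + sgn s * r))) <=
    (2 * (c * H y) + m) * c * H (y + sgn s * r + sgn s * r).
Proof.
move=> m0 c0 H0 hU rT; apply: (le_trans (csd_bound _ _ _ m0)).
rewrite -[leRHS]mulrA.
have h1 := hU s r y rT.
have h2 := hU (~~ s) r (y + sgn s * r + sgn s * r) rT.
have e1 : y + sgn s * r + sgn s * r + sgn (~~ s) * r = y + sgn s * r.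
  by rewrite sgnN; ring.
rewrite e1 in h2.
by apply: ler_pM; rewrite ?n3_ge0//; have := n3_ge0 (fun k => U s k r (y + sgn s * r)); lra.
Qed.

Lemma csd_char_integrable (m c T : R) ty H U s t y k : 0 <= m -> 0 <= c ->
  locint H -> (forall y, 0 <= H y) -> (forall s k, jm (U s k)) ->
  (forall s t y, 0 <= t <= T -> n3 (fun k => U s k t (y + sgn s * t)) <= c * H y) ->
  t <= T ->
  mu.-integrable `[0, t] (EFin \o
    (fun r => csd m ty s k (fun s' k' => U s' k' r (y + sgn s * r)))).
Proof.
move=> m0 c0 lH H0 mU hU tT.
apply: (@integrable_le _ _ _ (fun r => (2 * (c * H y) + m) * c *
    H (y + sgn s * r + sgn s * r))) => //.
- by apply: measurable_funTS; exact: (jm_char s y (jm_csd m ty mU s k)).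
- move=> r /=; rewrite in_itv /= => /andP[r0 rt].
  apply: (le_trans _ (csd_char_bound ty s y m0 c0 H0 hU _)).
    exact: (le_n3 (fun k => csd m ty s k (fun s' k' => U s' k' r (y + sgn s * r)))).
  by rewrite r0 (le_trans rt).
- by apply: integrable_mulr => //; exact/locint_itv/locint_char.
Qed.

Lemma csd_stability (m c T : R) ty H e U V (f g : bool -> component -> R -> R) :
  0 <= m -> 0 <= c ->
  locint H -> (forall y, 1 <= H y) -> locint e -> (forall y, 0 <= e y) ->
  (forall s k, jm (U s k)) -> (forall s k, jm (V s k)) ->
  (forall s k t y, 0 <= t -> U s k t (y + sgn s * t) = f s k y +
     \int[mu]_(r in `[0, t])
       csd m ty s k (fun s' k' => U s' k' r (y + sgn s * r))) ->
  (forall s k t y, 0 <= t -> V s k t (y + sgn s * t) = g s k y +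
     \int[mu]_(r in `[0, t])
       csd m ty s k (fun s' k' => V s' k' r (y + sgn s * r))) ->
  (forall s t y, 0 <= t <= T -> n3 (fun k => U s k t (y + sgn s * t)) <= c * H y) ->
  (forall s t y, 0 <= t <= T -> n3 (fun k => V s k t (y + sgn s * t)) <= c * H y) ->
  (forall s y, d3 (fun k => f s k y) (fun k => g s k y) <= e y) ->
  forall s t y, 0 <= t <= T ->
    d3 (fun k => U s k t (y + sgn s * t)) (fun k => V s k t (y + sgn s * t)) <=
    expR (2 * ((2 * c + m) * win H t (y + sgn s * t))) *
    (e y + (2 * c + m) * H y * win e t (y + sgn s * t)).
Proof.
move=> m0 c0 lH H1 le e0 mU mV eU eV bU bV fg.
have H0 y : 0 <= H y by exact: le_trans (H1 y).
apply: (@label_stability m c T ty H e (fun s k t y => U s k t (y + sgn s * t))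
  (fun s k t y => V s k t (y + sgn s * t))) => // s t y /andP[t0 tT] G IG hG.
have IU k := csd_char_integrable ty s y k m0 c0 lH H0 mU bU tT.
have IV k := csd_char_integrable ty s y k m0 c0 lH H0 mV bV tT.
apply: (@le_trans _ _ (d3 (fun k => f s k y) (fun k => g s k y) +
  n3 (fun k => \int[mu]_(r in `[0, t])
    (csd m ty s k (fun s' k' => U s' k' r (y + sgn s * r)) -
     csd m ty s k (fun s' k' => V s' k' r (y + sgn s * r)))))).
  have e1 k : U s k t (y + sgn s * t) - V s k t (y + sgn s * t) = (f s k y - g s k y) +
     \int[mu]_(r in `[0, t])
       (csd m ty s k (fun s' k' => U s' k' r (y + sgn s * r)) -
        csd m ty s k (fun s' k' => V s' k' r (y + sgn s * r))).
    by rewrite eU// eV// RintegralB//; ring.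
  rewrite /d3 /n3 !e1; move: (\int[mu]_(r in _) _) (\int[mu]_(r in _) _)
    (\int[mu]_(r in _) _) => i1 i2 i3.
  have := ler_normD (f s cP y - g s cP y) i3; have := ler_normD (f s cQ y - g s cQ y) i2.
  by have := ler_normD (f s cA y - g s cA y) i1; lra.
apply: lerD; first exact: fg.
apply: n3_Rint => //.
- move=> k; apply: measurable_funTS; apply: measurable_funB.
    exact: (jm_char s y (jm_csd m ty mU s k)).
  exact: (jm_char s y (jm_csd m ty mV s k)).
- move=> r rt; apply: le_trans (hG r rt).
  rewrite /d3 le_eqVlt; apply/orP; left; apply/eqP; congr n3; apply/funext => k.
  by congr (_ - _); congr csd; apply/funext => s'; apply/funext => k'; rewrite lstateE.
Qed.

End Stability.

(** * Lebesgue norms *)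

Section LpNorms.
Context {R : realType}.
Local Notation mu := (@lebesgue_measure R).
Local Notation rT := (measurableTypeR R).
Implicit Types (F G : rT -> R) (p : \bar R) (c d t : R).

Definition nm p F : \bar R := Lnorm mu p (EFin \o F).

Lemma nm_ge0 p F : (0 <= nm p F)%E. Proof. exact: Lnorm_ge0. Qed.

Lemma mu_setT_gt0 : (0 < mu [set: rT])%E.
Proof.
apply: (@lt_le_trans _ _ (mu `[0, 1]%classic)).
  by rewrite /= lebesgue_measure_itv /= lte_fin ltr01 oppr0 adde0 lte_fin.
by apply: le_measure; rewrite ?inE.
Qed.

Lemma nmyE F : nm +oo%E F = ess_sup mu (fun x => (`|F x|)%:E).
Proof. by rewrite /nm unlock mu_setT_gt0. Qed.

Lemma nmrE (r : R) F : nm r%:E F = ((\int[mu]_x (`|F x| `^ r)%:E) `^ r^-1)%E.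
Proof. by rewrite /nm unlock. Qed.

Lemma nmy_leP F c : (nm +oo%E F <= c%:E)%E <-> {ae mu, forall x, `|F x| <= c}.
Proof.
rewrite nmyE; split=> [/ess_supP|h].
  by apply: filterS => x; rewrite lee_fin.
have h' : {ae mu, forall x, (`|F x|%:E <= c%:E)%E}.
  by move: h; apply: filterS => x; rewrite lee_fin.
exact/ess_supP.
Qed.

Lemma nmr_leP (r : R) F c : 1 <= r -> 0 <= c ->
  (nm r%:E F <= c%:E)%E <-> (\int[mu]_x (`|F x| `^ r)%:E <= (c `^ r)%:E)%E.
Proof.
move=> r1 c0; have r0 : 0 < r by lra.
have I0 : (0 <= \int[mu]_x (`|F x| `^ r)%:E)%E.
  by apply: integral_ge0 => x _; rewrite lee_fin powR_ge0.
rewrite nmrE; split => h.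
  have := @gt0_ler_poweR R r (ltW r0) _ _ _ _ h.
  rewrite -poweRrM mulVf ?gt_eqF// poweRe1// poweR_EFin; apply.
    by rewrite in_itv /= poweR_ge0 leey.
  by rewrite in_itv /= lee_fin c0 leey.
have ri : 0 <= r^-1 by rewrite invr_ge0 ltW.
have := @gt0_ler_poweR R r^-1 ri _ _ _ _ h.
rewrite poweR_EFin -powRrM mulfV ?gt_eqF// powRr1//; apply.
  by rewrite in_itv /= I0 leey.
by rewrite in_itv /= lee_fin powR_ge0 leey.
Qed.

Lemma measurable_absX F (r : R) : measurable_fun setT F ->
  measurable_fun setT (fun x => (`|F x| `^ r)%:E).
Proof.
move=> mF; apply/measurable_EFinP.
apply: (@measurableT_comp _ _ _ _ _ _ (@powR R ^~ r)) => //.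
exact: measurableT_comp.
Qed.

Lemma nm_mono p F G : (1 <= p)%E -> measurable_fun setT F ->
  measurable_fun setT G -> {ae mu, forall x, `|F x| <= `|G x|} ->
  (nm p F <= nm p G)%E.
Proof.
move=> p1 mF mG FG; case: p p1 => [r||] //= p1.
  rewrite lee_fin in p1; have r0 : 0 < r by lra.
  have I0 H : (0 <= \int[mu]_x (`|H x| `^ r)%:E)%E.
    by apply: integral_ge0 => x _; rewrite lee_fin powR_ge0.
  rewrite !nmrE; apply: gt0_ler_poweR.
  - by rewrite invr_ge0 ltW.
  - by rewrite in_itv /= I0 leey.
  - by rewrite in_itv /= I0 leey.
  apply: ae_ge0_le_integral => //.
  - exact: measurable_absX.
  - exact: measurable_absX.
  - move: FG; apply: filterS => x FG _; rewrite lee_fin ge0_ler_powR ?nnegrE//; exact: ltW.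
have FG' : {ae mu, forall x, (`|F x|%:E <= `|G x|%:E)%E}.
  by move: FG; apply: filterS => x; rewrite lee_fin.
by rewrite !nmyE; exact: le_ess_sup.
Qed.

Lemma nmD p F G : (1 <= p)%E -> measurable_fun setT F -> measurable_fun setT G ->
  (nm p (fun x => F x + G x)%R <= nm p F + nm p G)%E.
Proof. by move=> p1 mF mG; have := eminkowski mu mF mG p1. Qed.

Lemma nmZ_le p F c d : (1 <= p)%E -> 0 <= c -> 0 <= d ->
  measurable_fun setT F -> (nm p F <= d%:E)%E ->
  (nm p (fun x => c * F x)%R <= (c * d)%:E)%E.
Proof.
move=> p1 c0 d0 mF; case: p p1 => [r||] //= p1.
  rewrite lee_fin in p1.
  move=> /(nmr_leP _ p1 d0) h; apply/nmr_leP; rewrite ?mulr_ge0//.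
  under eq_integral do rewrite normrM (ger0_norm c0) powRM// EFinM.
  rewrite ge0_integralZl_EFin ?powR_ge0//; last exact: measurable_absX.
  by rewrite powRM// EFinM lee_wpmul2l// lee_fin powR_ge0.
move=> /nmy_leP h; apply/nmy_leP; move: h; apply: filterS => x h.
by rewrite normrM (ger0_norm c0) ler_wpM2l.
Qed.

Lemma ge0_integral_shift c (f : rT -> \bar R) :
  measurable_fun setT f -> (forall x, (0 <= f x)%E) ->
  (\int[mu]_x f (x + c)%R = \int[mu]_x f x)%E.
Proof.
move=> mf f0; have := @ge0_integral_affine R 1 c f (oner_neq0 _) mf f0.
rewrite normr1 invr1 mul1e => <-.
by apply: eq_integral => x _; rewrite mul1r.
Qed.

Lemma measurable_shift c (f : rT -> R) : measurable_fun setT f ->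
  measurable_fun setT (fun x : rT => f (x + c)).
Proof.
move=> mf; apply: (@measurableT_comp _ _ _ _ _ _ f) => //.
exact: measurable_funD.
Qed.

Lemma ae_shift c (P : rT -> Prop) : {ae mu, forall x, P x} ->
  {ae mu, forall x, P (x + c)}.
Proof.
move=> [N [mN N0 PN]].
pose N' : set rT := (fun x : rT => x + c) @^-1` N.
have mN' : measurable N'.
  rewrite -[X in measurable X]setTI.
  by apply: (@measurable_funD _ _ _ setT id (cst c)).
exists N'; split => //; last by move=> x /= nP; apply: PN.
have mI : measurable_fun setT (fun x : rT => (\1_N x : R)%:E).
  exact/measurable_EFinP.
have I0 (x : rT) : (0 <= (\1_N x : R)%:E)%E by rewrite lee_fin.
have h := @ge0_integral_shift c _ mI I0.
have e1 : (\int[mu]_x (\1_N' x : R)%:E = mu N')%E by rewrite integral_indic// setIT.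
have e2 : (\int[mu]_x (\1_N x : R)%:E = mu N)%E by rewrite integral_indic// setIT.
by rewrite -e1 -N0 -e2 -h.
Qed.

Lemma nm_shift p F c : (1 <= p)%E -> measurable_fun setT F ->
  nm p (fun x => F (x + c)%R) = nm p F.
Proof.
move=> p1 mF; case: p p1 => [r||] //= p1.
  rewrite !nmrE -[in RHS](@ge0_integral_shift c (fun x => (`|F x| `^ r)%:E))//.
  exact: measurable_absX.
(* For the essential supremum one inequality, valid for all functions and all translations, gives
   equality by translating back. *)
have gen (c' : R) (G : rT -> R) : (nm +oo%E (fun x => G (x + c')%R) <= nm +oo%E G)%E.
  rewrite !nmyE; set S := ess_sup mu (fun x => `|G x|%:E).
  have h : {ae mu, forall x : rT, (`|G x|%:E <= S)%E} := ess_sup_ge _ _.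
  have h' : {ae mu, forall x : rT, (`|G (x + c')%R|%:E <= S)%E} := ae_shift c' h.
  exact/ess_supP.
apply/eqP; rewrite eq_le gen /=.
have := gen (- c) (fun x => F (x + c)%R).
by under eq_fun do rewrite subrK.
Qed.

(* [y <= 1 + y^r] replaces Hoelder's inequality, at the cost of a constant. *)
Lemma integral_nm_le p F c d (D : set rT) : (1 <= p)%E -> 0 < c -> 0 <= d ->
  measurable D -> (mu D <= d%:E)%E -> measurable_fun setT F ->
  (nm p F <= c%:E)%E -> (\int[mu]_(x in D) `|F x|%:E <= ((1 + d) * c)%:E)%E.
Proof.
move=> p1 c0 d0 mD Dd mF; case: p p1 => [r||] //= p1.
  rewrite lee_fin in p1; have r0 : 0 < r by lra.
  move=> /(nmr_leP _ p1 (ltW c0)) h.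
  (* Dividing by [c] first makes the estimate linear in [c]: [|F| <= c + c (|F| / c) ^ r], and the
     last term has integral at most [c]. *)
  have h' : (\int[mu]_x (c * (`|F x| / c) `^ r)%:E <= c%:E)%E.
    have -> : (fun x => (c * (`|F x| / c) `^ r)%:E) =
        (fun x => (c * c^-1 `^ r)%:E * (`|F x| `^ r)%:E)%E.
      apply/funext => x; rewrite powRM//; last by rewrite invr_ge0 ltW.
      by rewrite -EFinM mulrA mulrAC.
    rewrite ge0_integralZl_EFin//; last 2 first.
    - exact: measurable_absX.
    - by rewrite mulr_ge0 ?powR_ge0// ltW.
    apply: (@le_trans _ _ ((c * c^-1 `^ r)%:E * (c `^ r)%:E)%E).
      by rewrite lee_wpmul2l// lee_fin mulr_ge0 ?powR_ge0// ltW.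
    rewrite -EFinM lee_fin -mulrA -powRM ?invr_ge0 ?(ltW c0)//.
    by rewrite mulVf ?gt_eqF// powR1 mulr1.
  have mG : measurable_fun setT (fun x => (c * (`|F x| / c) `^ r)%:E).
    apply/measurable_EFinP; apply: measurable_funM => //.
    apply: (@measurableT_comp _ _ _ _ _ _ (@powR R ^~ r)) => //.
    by apply: measurable_funM => //; exact: measurableT_comp.
  have G0 x : (0 <= (c * (`|F x| / c) `^ r)%:E)%E.
    by rewrite lee_fin mulr_ge0 ?powR_ge0// ltW.
  apply: (@le_trans _ _ (\int[mu]_(x in D) (c%:E + (c * (`|F x| / c) `^ r)%:E))%E).
    apply: ge0_le_integral => //.
    - by apply/measurable_EFinP; apply: measurableT_comp => //; exact: measurable_funTS.
    - apply: emeasurable_funD => //; exact: measurable_funTS.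
    - move=> x _; rewrite -EFinD lee_fin.
      have [Fc|cF] := leP `|F x| c.
        by rewrite (le_trans Fc)// lerDl mulr_ge0 ?powR_ge0// ltW.
      have y1 : 1 <= `|F x| / c by rewrite ler_pdivlMr// mul1r ltW.
      have y2 : `|F x| / c <= (`|F x| / c) `^ r.
        by have := ler_powR y1 p1; rewrite powRr1// divr_ge0// ltW.
      have y3 := ler_wpM2l (ltW c0) y2.
      rewrite mulrCA divff ?gt_eqF// mulr1 in y3.
      by rewrite (le_trans y3)// lerDr ltW.
  rewrite ge0_integralD//; last 2 first.
  - by move=> x _; rewrite lee_fin ltW.
  - exact: measurable_funTS.
  have -> : (((1 + d) * c)%:E = (c * d)%:E + c%:E)%E.
    by rewrite -EFinD; congr (_%:E); ring.
  rewrite integral_cst//; apply: leeD.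
    by rewrite EFinM lee_wpmul2l// lee_fin ltW.
  by apply: le_trans h'; apply: ge0_subset_integral.
move=> /nmy_leP h.
apply: (@le_trans _ _ (\int[mu]_(x in D) c%:E)%E).
  apply: ae_ge0_le_integral => //.
  - by apply/measurable_EFinP; apply: measurableT_comp => //; exact: measurable_funTS.
  - by move=> x _; rewrite lee_fin ltW.
  - by move: h; apply: filterS => x h _; rewrite lee_fin.
rewrite integral_cst// muleC; apply: (@le_trans _ _ (d%:E * c%:E)%E).
  by rewrite lee_wpmul2r// lee_fin ltW.
by rewrite -EFinM lee_fin ler_wpM2r ?ltW//; lra.
Qed.

Lemma mu_itv_le a b : a <= b -> (mu `[a, b]%classic = (b - a)%:E)%E.
Proof.
move=> ab; rewrite /= lebesgue_measure_itv /= lte_fin; case: ltP => // ba.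
by have -> : b - a = 0 by lra.
Qed.

Lemma nm_locint p F c : (1 <= p)%E -> measurable_fun setT F ->
  (nm p F <= c%:E)%E -> locint F.
Proof.
move=> p1 mF Fc; split => // a b; have [ab|ba] := leP a b; last first.
  by rewrite set_itv_ge ?bnd_simp -?ltNge//; exact: integrable_set0.
apply/integrableP; split; first by apply/measurable_EFinP; exact: measurable_funTS.
have c0 : 0 <= c by rewrite -lee_fin (le_trans (nm_ge0 p F)).
apply: (@le_lt_trans _ _ ((1 + (b - a)) * (c + 1))%:E); last exact: ltry.
apply: (@integral_nm_le p) => //.
- by lra.
- by lra.
- by rewrite mu_itv_le.
- by rewrite (le_trans Fc)// lee_fin; lra.
Qed.

Lemma win_nm p F c t x : (1 <= p)%E -> measurable_fun setT F -> (forall z, 0 <= F z) ->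
  (nm p F <= c%:E)%E -> 0 <= t -> win F t x <= (1 + 2 * t) * c.
Proof.
move=> p1 mF F0 Fc t0.
have c0 : 0 <= c by rewrite -lee_fin (le_trans (nm_ge0 p F)).
have lF := nm_locint p1 mF Fc.
apply/ler_addgt0Pr => e e0.
(* [integral_nm_le] asks for a positive bound, so [c] is enlarged by a margin that costs exactly [e]
   in the conclusion. *)
pose c' := c + e / (1 + 2 * t).
have d0 : 0 < 1 + 2 * t by lra.
have ec : 0 < e / (1 + 2 * t) by rewrite divr_gt0.
have -> : (1 + 2 * t) * c + e = (1 + 2 * t) * c' by rewrite /c'; field; rewrite gt_eqF.
rewrite -lee_fin /win /Rintegral fineK; last first.
  by apply: integrable_fin_num => //; exact: locint_itv.
under eq_integral => z _ do rewrite -(ger0_norm (F0 z)).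
apply: (@integral_nm_le p) => //.
- by rewrite /c'; lra.
- by lra.
- by rewrite mu_itv_le ?lee_fin; lra.
- by rewrite (le_trans Fc)// lee_fin /c'; lra.
Qed.

End LpNorms.

(** * Window integrals and transverse products *)

Section LpWindows.
Context {R : realType}.
Local Notation mu := (@lebesgue_measure R).
Local Notation rT := (measurableTypeR R).
Implicit Types (F G : rT -> R) (p : \bar R) (c d t : R).

(** As an integral over [[0, t]] the window becomes accessible to [jm_Rint]; for negative [t] both
    sides are integrals over empty sets. *)
Lemma winE F t (x : R) : locint F -> (forall z, 0 <= F z) ->
  win F t x = 2 * \int[mu]_(r in `[0, t]) F (x - sgn false * t + sgn false * r + sgn false * r).
Proof.
move=> lF F0; have [t0|t0] := leP 0 t.
  by rewrite Rint_char// subrK mulrA mulfV// mul1r.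
rewrite /win !set_itv_ge ?Rintegral_set0 ?mulr0// ?bnd_simp -ltNge//.
by lra.
Qed.

Lemma jm_win F : locint F -> (forall z, 0 <= F z) -> jm (win F).
Proof.
move=> lF F0; rewrite /jm; under eq_fun do rewrite winE//.
apply: measurable_funM => //.
have mF : jm (fun r z => F (z + sgn false * r)).
  by apply: jm_label (jm_cst2 (locint_measurable lF)).
exact: (jm_pos false (jm_Rint false mF)).
Qed.

Lemma measurable_win F t : locint F -> (forall z, 0 <= F z) ->
  measurable_fun setT (win F t).
Proof.
by move=> lF F0; apply: (jm_comp (jm_win lF F0) (g := cst t) (h := id)).
Qed.

Let measurable_near_diag (f : rT -> \bar R) t : measurable_fun setT f ->
  measurable_fun setT (fun z : rT * rT =>
    if (z.1 - t <= z.2) && (z.2 <= z.1 + t) then f z.2 else 0%E).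
Proof.
move=> mf; apply: measurable_fun_ifT => //.
  apply: measurable_and; apply: measurable_fun_ler => //.
    by apply: measurable_funB.
  by apply: measurable_funD.
exact: (@measurableT_comp _ _ _ _ _ _ f _ snd).
Qed.

(** Tonelli: a point [y] is counted for the centres [x] in [[y - t, y + t]], a set of measure
    [2 t]. *)
Lemma integral_window (f : rT -> \bar R) t : 0 <= t -> measurable_fun setT f ->
  (forall x, (0 <= f x)%E) ->
  (\int[mu]_x integral mu `[(x - t)%R, (x + t)%R] f = (2 * t)%:E * \int[mu]_x f x)%E.
Proof.
move=> t0 mf f0.
pose h (z : rT * rT) := if (z.1 - t <= z.2) && (z.2 <= z.1 + t) then f z.2 else 0%E.
have mh : measurable_fun setT h by exact: measurable_near_diag.
have h0 z : (0 <= h z)%E by rewrite /h; case: ifP.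
rewrite (_ : (fun x : rT => _) = (fun x => integral mu setT (fun y => h (x, y)))); last first.
  apply/funext => x; rewrite integral_mkcond; apply: eq_integral => y _.
  rewrite patchE /h /=; congr (if _ then _ else _).
  by apply/idP/idP; rewrite inE /= in_itv.
rewrite (fubini_tonelli h mh h0).
rewrite -ge0_integralZl//; last by rewrite lee_fin mulr_ge0.
apply: eq_integral => y _.
rewrite (_ : (fun x : rT => h (x, y)) = (fun x => f y * (\1_(`[(y - t)%R, (y + t)%R]%classic) x)%:E)%E).
  rewrite ge0_integralZl//; last exact/measurable_EFinP.
  have yt : y - t <= y + t by lra.
  have m2 : mu `[(y - t), (y + t)]%classic = (2 * t)%:E.
    rewrite mu_itv_le//; congr (_%:E).
    by rewrite opprD opprK addrACA subrr add0r mulr_natl mulr2n.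
  by rewrite integral_indic// setIT muleC; congr (_ * _)%E.
apply/funext => x; rewrite /h /= indicE.
have -> : (x \in `[(y - t), (y + t)]%classic) = (x - t <= y) && (y <= x + t).
  by apply/idP/idP; rewrite inE /= in_itv /= => /andP[? ?]; apply/andP; split; lra.
by case: ifP => _; rewrite ?mule1 ?mule0.
Qed.

(** One factor [1 + 2 t] comes from the substitute for Hoelder's inequality on each window, the
    other from Tonelli, which contributes [2 t <= (1 + 2 t) ^ r]. For [p = +oo] the supremum bound
    [win_nm] is enough. *)
Lemma nm_win p F c t : (1 <= p)%E -> measurable_fun setT F -> (forall z, 0 <= F z) ->
  0 <= c -> (nm p F <= c%:E)%E -> 0 <= t ->
  (nm p (win F t) <= ((1 + 2 * t) ^+ 2 * c)%:E)%E.
Proof.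
move=> p1 mF F0 c0 Fc t0.
have lF := nm_locint p1 mF Fc.
have w0 x : 0 <= win F t x by exact: win_ge0.
have d1 : 1 <= 1 + 2 * t by lra.
have d0 : 0 <= 1 + 2 * t by lra.
case: p p1 Fc => [r||] //= p1 Fc; last first.
  apply/nmy_leP/aeW => x; rewrite ger0_norm//.
  rewrite (le_trans (win_nm x p1 mF F0 Fc t0))// expr2 ler_wpM2r//.
  by rewrite ler_peMl.
have p1e := p1; rewrite lee_fin in p1; have r0 : 0 < r by lra.
pose f x := (F x `^ r)%:E.
have mf : measurable_fun setT f.
  have := measurable_absX r mF; rewrite (_ : (fun x => _) = f)//.
  by apply/funext => x; rewrite ger0_norm.
have f0 x : (0 <= f x)%E by rewrite lee_fin powR_ge0.
have If : (\int[mu]_x f x <= (c `^ r)%:E)%E.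
  move/(nmr_leP F p1 c0) : Fc; apply: le_trans.
  by under [leRHS]eq_integral => x _ do rewrite ger0_norm//.
have Iw (x : R) : (integral mu `[(x - t)%R, (x + t)%R] f <= (c `^ r)%:E)%E.
  by apply: le_trans If; apply: ge0_subset_integral => // z _; rewrite lee_fin powR_ge0.
have Iw0 x : (0 <= integral mu `[(x - t)%R, (x + t)%R] f)%E.
  by apply: integral_ge0 => z _; rewrite lee_fin powR_ge0.
have Ifin x : integral mu `[(x - t)%R, (x + t)%R] f \is a fin_num.
  by rewrite ge0_fin_numE// (le_lt_trans (Iw x))// ltry.
have key x : ((win F t x `^ r)%:E <=
    ((1 + 2 * t) `^ r)%:E * integral mu `[(x - t)%R, (x + t)%R] f)%E.
  (* Cutting [F] to the window leaves the window integral unchanged and replaces the norm of [F] by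
     the local one, [cx], whose power can be integrated in [x]. *)
  pose G : rT -> R := F \_ `[x - t, x + t].
  have mG : measurable_fun setT G.
    by apply/(measurable_restrictT _ _).1 => //; exact: measurable_funTS.
  have G0 z : 0 <= G z by rewrite /G patchE; case: ifP.
  pose cx := fine (integral mu `[(x - t)%R, (x + t)%R] f) `^ r^-1.
  have Gc : (nm r%:E G <= cx%:E)%E.
    apply/nmr_leP; rewrite ?powR_ge0//.
    rewrite -powRrM mulVf ?gt_eqF// powRr1 ?fine_ge0// fineK//.
    rewrite [leRHS]integral_mkcond le_eqVlt; apply/orP; left; apply/eqP.
    apply: eq_integral => z _; rewrite /G !patchE; case: ifP => _.
      by rewrite ger0_norm.
    by rewrite normr0 powR0// gt_eqF.
  have -> : win F t x = win G t x.
    by apply: eq_Rintegral => z zx; rewrite /G patchE zx.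
  rewrite -(fineK (Ifin x)) -EFinM lee_fin.
  apply: (@le_trans _ _ (((1 + 2 * t) * cx) `^ r)).
    by rewrite ge0_ler_powR ?nnegrE ?mulr_ge0 ?powR_ge0 ?(ltW r0)// ?win_ge0//; exact: (win_nm x p1e mG G0 Gc t0).
  by rewrite powRM ?powR_ge0// /cx -powRrM mulVf ?gt_eqF// powRr1 ?fine_ge0.
have mw : measurable_fun setT (fun x : rT => integral mu `[(x - t)%R, (x + t)%R] f).
  rewrite (_ : (fun x : rT => _) = (fun x => integral mu setT (fun y =>
    if (x - t <= y) && (y <= x + t) then f y else 0%E))); last first.
    apply/funext => x; rewrite integral_mkcond; apply: eq_integral => y _.
    rewrite patchE; congr (if _ then _ else _).
    by apply/idP/idP; rewrite inE /= in_itv.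
  apply: (measurable_fun_fubini_tonelli_F (fun z : rT * rT =>
    if (z.1 - t <= z.2) && (z.2 <= z.1 + t) then f z.2 else 0%E)).
    exact: measurable_near_diag.
  by move=> z; case: ifP.
apply/nmr_leP; rewrite ?mulr_ge0 ?exprn_ge0//.
apply: (@le_trans _ _ (\int[mu]_x (((1 + 2 * t) `^ r)%:E *
    integral mu `[(x - t)%R, (x + t)%R] f))%E).
  apply: ge0_le_integral => //.
  - by apply: measurable_absX; exact: measurable_win.
  - exact: measurable_funeM.
  - by move=> x _; rewrite ger0_norm.
rewrite ge0_integralZl_EFin ?powR_ge0// integral_window//.
apply: (@le_trans _ _ (((1 + 2 * t) `^ r)%:E * ((2 * t)%:E * (c `^ r)%:E))%E).
  by rewrite lee_wpmul2l ?lee_fin ?powR_ge0// lee_wpmul2l// lee_fin mulr_ge0.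
rewrite -!EFinM lee_fin powRM ?exprn_ge0// mulrA ler_wpM2r ?powR_ge0//.
rewrite expr2 powRM// ler_wpM2l ?powR_ge0//.
apply: (@le_trans _ _ (1 + 2 * t)); first lra.
by rewrite -[leLHS]powRr1// ler_powR.
Qed.

(** The change of variables from [(t, x)] to [(x - t, x + t)], done in one dimension at a time: a
    translation in [x] at fixed [t], Tonelli, then a dilation by 2 in [t], which gives the factor
    1/2. *)
Lemma integral_transverse_product F G :
  measurable_fun setT F -> measurable_fun setT G ->
  (forall z, 0 <= F z) -> (forall z, 0 <= G z) ->
  (\int[mu]_t \int[mu]_x (F (x - t)%R * G (x + t)%R)%:E =
   (2^-1)%:E * (\int[mu]_x (F x)%:E * \int[mu]_x (G x)%:E))%E.
Proof.
move=> mF mG F0 G0.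
have mG2 t : measurable_fun setT (fun x : rT => G (x + t)) by exact: measurable_shift.
have e1 (t : rT) : (\int[mu]_x (F (x - t)%R * G (x + t)%R)%:E =
    \int[mu]_x (F x * G (x + 2 * t)%R)%:E)%E.
  rewrite -(@ge0_integral_shift _ t (fun x => (F (x - t)%R * G (x + t)%R)%:E)).
  - apply: eq_integral => x _; rewrite addrK.
    by congr (_ * G _)%:E; ring.
  - apply/measurable_EFinP; apply: measurable_funM => //.
    exact: (@measurable_shift _ (- t) F).
  - by move=> x; rewrite lee_fin mulr_ge0.
under eq_integral do rewrite e1.
pose h (z : rT * rT) := (F z.2 * G (z.2 + 2 * z.1)%R)%:E.
have mh : measurable_fun setT h.
  apply/measurable_EFinP; apply: measurable_funM.
    exact: (@measurableT_comp _ _ _ _ _ _ F _ snd).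
  apply: (@measurableT_comp _ _ _ _ _ _ G) => //.
  by apply: measurable_funD => //; apply: measurable_funM.
have h0 z : (0 <= h z)%E by rewrite lee_fin mulr_ge0.
rewrite (fubini_tonelli h mh h0) /h /=.
have IG0 : (0 <= \int[mu]_x (G x)%:E)%E by apply: integral_ge0 => x _; rewrite lee_fin.
transitivity (\int[mu]_x (((2^-1)%:E * \int[mu]_x (G x)%:E) * (F x)%:E))%E.
  apply: eq_integral => x _.
  under eq_integral do rewrite EFinM.
  rewrite ge0_integralZl_EFin//; last 2 first.
  - by move=> t _; rewrite lee_fin.
  - apply/measurable_EFinP; apply: (@measurableT_comp _ _ _ _ _ _ G) => //.
    by apply: measurable_funD => //; apply: measurable_funM.
  rewrite [RHS]muleC; congr (_ * _)%E.
  have n20 : (2 : R) != 0 by rewrite pnatr_eq0.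
  have mG' : measurable_fun setT (EFin \o G) by exact/measurable_EFinP.
  have G0' z : (0 <= (EFin \o G) z)%E by rewrite lee_fin.
  have := @ge0_integral_affine R 2 x (EFin \o G) n20 mG' G0'.
  rewrite (ger0_norm (ler0n _ 2)) => <-.
  by apply: eq_integral => t _ /=; rewrite addrC.
rewrite ge0_integralZl//; last 3 first.
- exact/measurable_EFinP.
- by move=> x _; rewrite lee_fin.
- by rewrite mule_ge0// lee_fin.
by rewrite -muleA; congr (_ * _)%E; rewrite muleC.
Qed.

End LpWindows.

(** * Continuity of translations in the norm *)

Section TranslationContinuity.
Context {R : realType}.
Local Notation mu := (@lebesgue_measure R).
Local Notation rT := (measurableTypeR R).
Implicit Types (F G : rT -> R) (p : \bar R) (c d t : R).

(** Dominated convergence speaks about sequences. A failing [e] would produce shifts [a n] of size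
    below [1 / (n + 1)] along which [phi] stays above [e]. *)
Lemma eps_delta_of_seq (phi : R -> \bar R) :
  (forall a : nat -> R, a @ \oo --> 0 -> forall e : R, 0 < e ->
     exists n, (phi (a n) <= e%:E)%E) ->
  forall e : R, 0 < e -> exists2 d : R, 0 < d &
    forall a, `|a| < d -> (phi a <= e%:E)%E.
Proof.
move=> hs e e0; apply: contrapT => nd.
have ex n : exists a : R, `|a| < n.+1%:R^-1 /\ (e%:E < phi a)%E.
  apply: contrapT => na; apply: nd; exists n.+1%:R^-1; first by rewrite invr_gt0.
  move=> a an; rewrite leNgt; apply/negP => ea; apply: na; by exists a.
have [a ha] := choice ex.
have a0 : a @ \oo --> 0.
  apply/cvgr0Pnorm_le => d d0.
  exists (Num.truncn d^-1).+1 => // n /= nd'.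
  apply: (le_trans (ltW (proj1 (ha n)))).
  rewrite invf_ple ?posrE//.
  apply: (le_trans (ltW (truncnS_gt _))); rewrite ler_nat.
  exact: leqW.
have [n] := hs a a0 e e0; apply/negP; rewrite -ltNge.
by case: (ha n).
Qed.

Let dominated_translation (g : rT -> R) (k : R) (a : nat -> R) : 0 <= k ->
  continuous (g : R -> R) -> a @ \oo --> 0 -> (forall n, `|a n| <= 1) ->
  (\int[mu]_(x in `[(- k)%R, k]) `|g (x + a n)%R - g x|%:E)%E @[n --> \oo] --> 0%E.
Proof.
move=> k0 cg a0 a1.
have mg : measurable_fun setT g by exact: continuous_measurable_fun.
have [M hM] : exists M : R, forall x : R, `|x| <= k + 1 -> `|g x| <= M.
  have := @compact_bounded _ R^o _ (continuous_compact
    (continuous_subspaceT cg) (@segment_compact R (- (k + 1)) (k + 1))).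
  move=> [M [_ hM]]; exists (M + 1) => x xk; apply: hM; first by rewrite ltrDl.
  by exists x => //=; rewrite in_itv /= -ler_norml.
have mD n : measurable_fun `[(- k)%R, k] (fun x : rT => (`|g (x + a n) - g x|)%:E).
  apply/measurable_EFinP/measurableT_comp => //; apply: measurable_funTS.
  by apply: measurable_funB => //; exact: measurable_shift.
have cst0 : measurable_fun `[(- k)%R, k] (cst 0%E : rT -> \bar R) by [].
have cv : {ae mu, forall x : rT, `[(- k)%R, k]%classic x ->
    (`|g (x + a n)%R - g x|%:E)%E @[n --> \oo] --> 0%E}.
  apply: aeW => x _; apply: cvg_EFin; first by near=> n.
  have gx : (fun n => g (x + a n)) @ \oo --> g x.
    apply: (cvg_comp (fun n => x + a n) g); last exact: cg.
    have : (fun n => x + a n) @ \oo --> x + 0 by apply: cvgD => //; exact: cvg_cst.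
    by rewrite addr0.
  rewrite (_ : fine \o _ = (fun n => `|g (x + a n) - g x|))//.
  rewrite -(normr0 R) -(subrr (g x)); apply: cvg_norm.
  by apply: cvgB => //; exact: cvg_cst.
have IM : mu.-integrable `[(- k)%R, k] (fun _ : rT => (M + M)%:E).
  exact: (integrable_itv_cst (- k) k (M + M)).
have dom : {ae mu, forall x : rT, forall n, `[(- k)%R, k]%classic x ->
    (`| (`|g (x + a n)%R - g x|%:E) | <= (M + M)%:E)%E}.
  apply: aeW => x n /=; rewrite in_itv /= => /andP[x1 x2].
  rewrite lee_fin normr_id (le_trans (ler_normB _ _))// lerD//; apply: hM.
    rewrite (le_trans (ler_normD _ _))// lerD// ler_norml x2 andbT//.
  by rewrite ler_norml; apply/andP; split; lra.
have [_ h _] := @dominated_convergence _ _ _ mu _ (measurable_itv _)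
  (fun n x => (`|g (x + a n)%R - g x|)%:E) (cst 0%E) _ mD cst0 cv IM dom.
apply: cvg_trans h; apply: near_eq_cvg; near=> n => /=.
by apply: eq_integral => x _ /=; rewrite subr0 normr_id.
Unshelve. all: by end_near. Qed.

Let shift_continuous_bounded F (k : R) (a : nat -> R) : 0 <= k ->
  measurable_fun setT F -> (forall x, `|F x| <= k) ->
  (forall x : R, k < `|x| -> F x = 0) ->
  a @ \oo --> 0 -> forall e : R, 0 < e ->
  exists n, (\int[mu]_x `|F (x + a n)%R - F x|%:E <= e%:E)%E.
Proof.
move=> k0 mF Fk Fs a0 e e0.
(* For shifts of size at most 1, [F] and its translates vanish outside radius [k + 1], and
   translating that interval stays within radius [k + 2], where the continuous approximation is
   made. *)
pose E : set rT := `[- (k + 2), k + 2]%classic.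
have mE : measurable E by exact: measurable_itv.
have IF : mu.-integrable E (EFin \o F).
  apply: (@integrable_le _ _ _ (fun _ => k)) => //; first by apply: measurable_funTS; exact: mF.
  exact: integrable_itv_cst.
have Efin : (mu E < +oo)%E.
  by rewrite /E mu_itv_le ?ltry//; lra.
have [g_ [cg Ig hg]] := approximation_continuous_integrable mE Efin IF.
have e3 : 0 < e / 3 by rewrite divr_gt0.
have [j hj] : exists j, (\int[mu]_(z in E) `|(F z - g_ j z)%:E| <= (e / 3)%:E)%E.
  have := hg => /fine_cvgP[[N _ hN] /cvgr0Pnorm_le/(_ _ e3)[N' _ hN']].
  exists (maxn N N').
  have h1 := hN (maxn N N') (leq_maxl _ _).
  have h2 := hN' (maxn N N') (leq_maxr _ _).
  rewrite -(fineK h1) lee_fin (le_trans _ h2)//= ler_norm//.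
pose g := g_ j.
have mg : measurable_fun setT g by exact: (continuous_measurable_fun (cg j)).
(* Large early shifts are replaced by 0, so that [dominated_translation] applies to the whole
   sequence. *)
pose a' n := if `|a n| <= 1 then a n else 0.
have a'1 n : `|a' n| <= 1 by rewrite /a'; case: ifP => //; rewrite normr0.
have [N _ hN] : \forall n \near \oo, `|a n| <= 1.
  by move/cvgr0Pnorm_le : a0 => /(_ 1 ltr01).
have a'0 : a' @ \oo --> 0.
  apply: cvg_trans a0; apply: near_eq_cvg; exists N => // n /= Nn.
  by rewrite /a' hN.
have k10 : 0 <= k + 1 by lra.
have := dominated_translation k10 (cg j) a'0 a'1.
move=> /fine_cvgP[[N1 _ hN1] /cvgr0Pnorm_le/(_ _ e3)[N2 _ hN2]].
pose n := maxn N (maxn N1 N2); exists n.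
have n1 : (N <= n)%N by rewrite leq_maxl.
have n2 : (N1 <= n)%N by rewrite /n leq_max leq_maxl orbT.
have n3 : (N2 <= n)%N by rewrite /n !leq_max leqnn !orbT.
have an1 := hN n n1.
have a'E : a' n = a n by rewrite /a' an1.
pose D : set rT := `[- (k + 1), k + 1]%classic.
have mD : measurable D by exact: measurable_itv.
have mid : (\int[mu]_(x in D) `|g (x + a n)%R - g x|%:E <= (e / 3)%:E)%E.
  have h1 := hN1 n n2; have h2 := hN2 n n3.
  rewrite /= a'E in h1 h2. rewrite -(fineK h1) lee_fin. by rewrite (le_trans _ h2)// ler_norm.
have Ex (x : R) : D x -> E (x + a n).
  rewrite /D /E /= !in_itv /= => /andP[x1 x2].
  by move: an1; rewrite ler_norml => /andP[? ?]; apply/andP; split; lra.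
have DE : D `<=` E.
  by move=> x; rewrite /D /E /= !in_itv /= => /andP[x1 x2]; apply/andP; split; lra.
have mFg : measurable_fun setT (fun x : rT => (`|F x - g x|)%:E).
  by apply/measurable_EFinP/measurableT_comp => //; exact: measurable_funB.
have mFa : measurable_fun setT (fun x : rT => F (x + a n)) by exact: measurable_shift.
have mga : measurable_fun setT (fun x : rT => g (x + a n)) by exact: measurable_shift.
have last1 : (\int[mu]_(x in D) `|F x - g x|%:E <= (e / 3)%:E)%E.
  apply: le_trans hj; apply: ge0_subset_integral => //.
  exact: measurable_funTS.
have first1 : (\int[mu]_(x in D) `|F (x + a n)%R - g (x + a n)%R|%:E <= (e / 3)%:E)%E.
  apply: le_trans hj; rewrite integral_mkcond [leRHS]integral_mkcond.
  pose f : rT -> \bar R := (fun x => `|(F x - g x)%:E|%E) \_ E.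
  have f0 x : (0 <= f x)%E by apply: erestrict_ge0.
  have mf : measurable_fun setT f.
    apply/(measurable_restrictT _ _).1 => //.
    exact: measurable_funTS.
  rewrite -/f -(@ge0_integral_shift _ (a n) f)//.
  apply: ge0_le_integral => //.
  - by move=> x _; apply: erestrict_ge0.
  - apply/(measurable_restrictT _ _).1 => //.
    apply: measurable_funTS.
    by apply/measurable_EFinP/measurableT_comp => //; exact: measurable_funB.
  - apply: (@measurableT_comp _ _ _ _ _ _ f) => //; exact: measurable_funD.
  - move=> x _; rewrite patchE; case: ifPn => [|_]; last exact: f0.
    by rewrite inE => Dx; rewrite /f patchE mem_set//; exact: Ex.
have -> : (\int[mu]_x `|F (x + a n)%R - F x|%:E = \int[mu]_(x in D) `|F (x + a n)%R - F x|%:E)%E.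
  rewrite [RHS]integral_mkcond; apply: eq_integral => x _.
  rewrite patchE; case: ifPn => // /negP nD.
  have hx : k + 1 < `|x|.
    rewrite ltNge; apply/negP => xk; apply: nD.
    by rewrite inE /D /= in_itv /= -ler_norml.
  rewrite (Fs x) ?(Fs (x + a n)) ?subrr ?normr0//; last lra.
  have := ler_normB (x + a n) (a n); rewrite addrK; lra.
apply: (@le_trans _ _ (\int[mu]_(x in D) (`|F (x + a n)%R - g (x + a n)%R|%:E +
   (`|g (x + a n)%R - g x|%:E + `|F x - g x|%:E)))%E).
  apply: ge0_le_integral => //.
  - apply: measurable_funTS; apply/measurable_EFinP/measurableT_comp => //.
    exact: measurable_funB.
  - apply: measurable_funTS; apply/measurable_EFinP; apply: measurable_funD.
      by apply: measurableT_comp => //; exact: measurable_funB.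
    by apply: measurable_funD; apply: measurableT_comp => //; exact: measurable_funB.
  - move=> x _; rewrite -!EFinD lee_fin.
    have := ler_normD (F (x + a n) - g (x + a n)) (g (x + a n) - F x).
    have := ler_normB (g (x + a n) - g x) (F x - g x).
    rewrite (_ : g (x + a n) - g x - (F x - g x) = g (x + a n) - F x); last by ring.
    rewrite (_ : F (x + a n) - g (x + a n) + _ = F (x + a n) - F x); last by ring.
    lra.
have mDf (f : rT -> R) : measurable_fun setT f -> measurable_fun D (fun x : rT => `|f x|%:E).
  by move=> mf; apply: measurable_funTS; apply/measurable_EFinP/measurableT_comp.
have m1 := mDf _ (measurable_funB mFa mga).
have m2 := mDf _ (measurable_funB mga mg).
have m3 := mDf _ (measurable_funB mF mg).
rewrite (ge0_integralD mu mD) //; last exact: emeasurable_funD.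
rewrite (ge0_integralD mu mD) //.
have -> : e = e / 3 + (e / 3 + e / 3) by field.
by rewrite !EFinD; apply: leeD => //; apply: leeD.
Unshelve. by move=> x _; rewrite adde_ge0.
Qed.

(** The truncations [Fk], bounded and of bounded support, converge to [F] in [L^r] by dominated
    convergence. A difference [z] of two values of [Fk] satisfies [|z| ^ r <= (2 k) ^ (r - 1) |z|],
    which reduces them to the [L^1] case. *)
Lemma nm_shift_continuous (r : R) F : 1 <= r -> measurable_fun setT F ->
  (nm r%:E F < +oo)%E -> forall e : R, 0 < e -> exists2 d : R, 0 < d &
    forall a, `|a| < d -> (nm r%:E (fun x => F (x + a)%R - F x)%R <= e%:E)%E.
Proof.
move=> r1 mF nF e e0.
have r0 : 0 < r by lra.
pose Fk (k : nat) x := if (`|x| <= k%:R) && (`|F x| <= k%:R) then F x else 0.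
have mFk k : measurable_fun setT (Fk k).
  have mb : measurable_fun setT (fun x : rT => (`|x| <= k%:R) && (`|F x| <= k%:R)).
    apply: measurable_and; apply: measurable_fun_ler => //.
    exact: measurableT_comp.
  exact: (measurable_fun_ifT mb mF).
have FkF k x : `|F x - Fk k x| <= `|F x|.
  by rewrite /Fk; case: ifP => _; rewrite ?subr0// subrr normr0.
have m1 k : measurable_fun setT (fun x : rT => (`|F x - Fk k x| `^ r)%:E).
  exact: (measurable_absX r (measurable_funB mF (mFk k))).
have I1 : mu.-integrable setT (fun x : rT => (`|F x| `^ r)%:E).
  apply/integrableP; split; first exact: measurable_absX.
  have nF' : nm r%:E F = (fine (nm r%:E F))%:E.
    by rewrite fineK// ge0_fin_numE// nm_ge0.
  have := lexx (nm r%:E F); rewrite {2}nF' => /(nmr_leP F r1 _) h.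
  apply: (@le_lt_trans _ _ (fine (nm r%:E F) `^ r)%:E); last exact: ltry.
  apply: le_trans (h _); last exact: fine_ge0 (nm_ge0 _ _).
  rewrite le_eqVlt; apply/orP; left; apply/eqP.
  by apply: eq_integral => x _; rewrite gee0_abs// lee_fin powR_ge0.
have cv : {ae mu, forall x : rT, setT x ->
    ((`|F x - Fk k x| `^ r)%:E) @[k --> \oo] --> cst 0%E x}.
  apply: aeW => x _; apply: cvg_near_cst.
  near=> k; rewrite /Fk.
  have -> : (`|x| <= k%:R) && (`|F x| <= k%:R).
    by apply/andP; split; near: k; exact: nbhs_infty_ger.
  by rewrite subrr normr0 powR0 ?gt_eqF.
have dom : {ae mu, forall (x : rT) (k : nat), setT x ->
    (`|(`|F x - Fk k x| `^ r)%:E| <= (`|F x| `^ r)%:E)%E}.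
  apply: aeW => x k _; rewrite gee0_abs ?lee_fin ?powR_ge0//.
  by apply: ge0_ler_powR; rewrite ?nnegrE ?normr_ge0// ltW.
have cst0 : measurable_fun setT (cst 0%E : rT -> \bar R) by [].
have [_ h _] := @dominated_convergence _ _ _ mu _ measurableT
  (fun k x => (`|F x - Fk k x| `^ r)%:E) (cst 0%E) _ m1 cst0 cv I1 dom.
have e3 : 0 < e / 3 by rewrite divr_gt0.
have er : 0 < (e / 3) `^ r by exact: powR_gt0.
have [k k1 hk] : exists2 k : nat, (0 < k)%N &
    (nm r%:E (fun x => F x - Fk k x)%R <= (e / 3)%:E)%E.
  move: h => /fine_cvgP[[N _ hN] /cvgr0Pnorm_le/(_ _ er)[N' _ hN']].
  pose k := (maxn N N').+1.
  have := hN k (leq_trans (leq_maxl _ _) (leqnSn _)).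
  have := hN' k (leq_trans (leq_maxr _ _) (leqnSn _)).
  rewrite /= => h2 h1; exists k => //; apply/nmr_leP => //; first exact: ltW.
  apply: (@le_trans _ _ (fine (\int[mu]_x `|(`|F x - Fk k x| `^ r)%:E - cst 0 x|)%E)%:E).
    rewrite fineK//; apply: ge0_le_integral => //.
      by apply: measurableT_comp => //; apply: emeasurable_funB => //.
    by move=> x _; rewrite sube0 lee_abs.
  by rewrite lee_fin (le_trans (ler_norm _)).
pose c : R := (2 * k%:R) `^ (r - 1).
have c0 : 0 < c by rewrite powR_gt0// mulr_gt0// ltr0n.
have Fkk x : `|Fk k x| <= k%:R.
  by rewrite /Fk; case: ifP => [/andP[]//|_]; rewrite normr0 ler0n.
have Fks x : k%:R < `|x| -> Fk k x = 0.
  by move=> kx; rewrite /Fk leNgt kx.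
have [d d0 hd] := eps_delta_of_seq (phi := fun b =>
  (\int[mu]_x `|Fk k (x + b)%R - Fk k x|%:E)%E) (fun a a0 e e0 =>
  shift_continuous_bounded (ler0n _ k) (mFk k) Fkk Fks a0 e0) (divr_gt0 er c0).
exists d => // a ad.
have mA : measurable_fun setT (fun x : rT => F (x + a)) by exact: measurable_shift.
have mAk : measurable_fun setT (fun x : rT => Fk k (x + a)) by exact: (measurable_shift a (mFk k)).
have q1 : (nm r%:E (fun x => F (x + a)%R - Fk k (x + a)%R)%R <= (e / 3)%:E)%E.
  rewrite (@nm_shift _ r%:E (fun x => F x - Fk k x) a) ?lee_fin//.
  exact: (measurable_funB mF (mFk k)).
have q3 : (nm r%:E (fun x => Fk k x - F x)%R <= (e / 3)%:E)%E.
  apply: le_trans hk; apply: nm_mono; rewrite ?lee_fin//.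
  - exact: (measurable_funB (mFk k) mF).
  - exact: (measurable_funB mF (mFk k)).
  - by apply: aeW => x; rewrite distrC.
have q2 : (nm r%:E (fun x => Fk k (x + a)%R - Fk k x)%R <= (e / 3)%:E)%E.
  apply/nmr_leP => //; first exact: ltW.
  have mk : measurable_fun setT (fun x : rT => Fk k (x + a) - Fk k x).
    exact: (measurable_funB mAk (mFk k)).
  apply: (@le_trans _ _ (\int[mu]_x (c%:E * (`|Fk k (x + a)%R - Fk k x|)%:E))%E).
    apply: ge0_le_integral => //.
    - exact: (measurable_absX r mk).
    - apply: measurable_funeM; apply/measurable_EFinP.
      exact: measurableT_comp.
    - move=> x _; rewrite -EFinM lee_fin.
      have : `|Fk k (x + a) - Fk k x| <= 2 * k%:R.
        rewrite (le_trans (ler_normB _ _))//.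
        by have := Fkk (x + a); have := Fkk x; lra.
      set z := `|_| => zk.
      have [->|z0] := eqVneq z 0; first by rewrite powR0 ?gt_eqF// mulr0.
      rewrite -[in leLHS](subrK 1 r) powRD; last by rewrite z0 implybT.
      rewrite powRr1 ?normr_ge0// ler_wpM2r ?normr_ge0//.
      by apply: ge0_ler_powR; rewrite ?nnegrE ?normr_ge0 ?mulr_ge0 ?ler0n//; lra.
  rewrite ge0_integralZl//; last 2 first.
  - by apply/measurable_EFinP; exact: measurableT_comp.
  - by rewrite lee_fin ltW.
  apply: (@le_trans _ _ (c%:E * ((e / 3) `^ r / c)%:E)%E).
    by apply: lee_wpmul2l; [rewrite lee_fin ltW|exact: hd].
  by rewrite -EFinM mulrC divfK// gt_eqF.
have -> : (fun x => F (x + a) - F x) = (fun x => (F (x + a) - Fk k (x + a)) +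
   ((Fk k (x + a) - Fk k x) + (Fk k x - F x))).
  by apply/funext => x; ring.
have r1' : (1 <= r%:E)%E by rewrite lee_fin.
have s1 := measurable_funB mA mAk.
have s2 := measurable_funB mAk (mFk k).
have s3 := measurable_funB (mFk k) mF.
apply: le_trans (nmD r1' s1 (measurable_funD s2 s3)) _.
have -> : e = e / 3 + (e / 3 + e / 3) by field.
rewrite EFinD; apply: leeD => //.
apply: le_trans (nmD r1' s2 s3) _.
by rewrite EFinD; apply: leeD.
Unshelve. all: by end_near. Qed.

End TranslationContinuity.

(** * Uniqueness of weak solutions in real variables *)

Section LabelApriori.
Context {R : realType}.
Local Notation mu := (@lebesgue_measure R).
Local Notation rT := (measurableTypeR R).
Implicit Types (s : bool) (k : component) (r t y : R).
Variables (m M T C : R) (ty : bool) (h : R -> R).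
Variables (f : bool -> component -> R -> R) (a : bool -> component -> R -> R -> R).
(** The labels on which Duhamel's formula and integrability along the characteristic are known. On
    the others [a] is set to 0, so that the estimates below hold for every label without
    exception. *)
Variable good : bool -> R -> Prop.
Hypotheses (m0 : 0 < m) (T0 : 0 <= T) (C0 : 0 <= C) (uh : uloc M h).
Hypothesis fh : forall s y, n3 (fun k => f s k y) <= h y.
Hypothesis ja : forall s k, jm (a s k).
Let v s t y : R := `|a s cP t y| + `|a s cQ t y|.
Hypothesis vC : forall s r y, 0 <= r <= T ->
  (\int[mu]_(z in `[(y - 2 * T)%R, (y + 2 * T)%R]) (v s r z)%:E <= C%:E)%E.
Hypothesis aI : forall s y, good s y -> forall k,
  mu.-integrable `[0, T] (EFin \o (fun r => csd m ty s k (lstate a s r y))).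
Hypothesis aE : forall s y, good s y -> forall k t, 0 <= t <= T ->
  a s k t y = f s k y + \int[mu]_(r in `[0, t]) csd m ty s k (lstate a s r y).
Hypothesis vI : forall s y, good s y ->
  mu.-integrable `[0, T] (EFin \o (fun r => v (~~ s) r (y + sgn s * r + sgn s * r))).
Hypothesis abad : forall s y, ~ good s y -> forall k t, a s k t y = 0.

Let v0 s t y : 0 <= v s t y. Proof. by rewrite addr_ge0. Qed.

Let jv s : jm (v s).
Proof. by apply: measurable_funD; apply: measurableT_comp => //; exact: ja. Qed.

Let mvc s y : measurable_fun setT (fun r : rT => v (~~ s) r (y + sgn s * r + sgn s * r)).
Proof.
apply: (jm_comp (jv (~~ s))) => //.
by do 2 apply: measurable_funD => //; apply: measurable_funM.
Qed.

Let v_duhamel s t y : 0 <= t <= T -> v s t y <= 2 * h y +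
  4 * \int[mu]_(r in `[0, t]) (m * v (~~ s) r (y + sgn s * r + sgn s * r)).
Proof.
move=> /andP[t0 tT].
have [lh h0 _ _] := uh; have m0' := ltW m0.
have [gd|bd] := pselect (good s y); last first.
  rewrite /v !abad// !normr0 addr0 addr_ge0 ?mulr_ge0//.
  by apply: Rintegral_ge0 => r _; rewrite mulr_ge0.
have sub : (`[0, t]%classic : set R) `<=` `[0, T].
  by move=> r /=; rewrite !in_itv /= => /andP[-> /le_trans->].
apply: (@le_trans _ _ (2 * (`|f s cP y| + `|f s cQ y|) +
    4 * \int[mu]_(r in `[0, t]) (m * v (~~ s) r (y + sgn s * r + sgn s * r)))).
  apply: (@phase_bound _ t (f s cP y) (f s cQ y) (a s cP ^~ y) (a s cQ ^~ y)
      (fun r => csd m ty s cP (lstate a s r y))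
      (fun r => csd m ty s cQ (lstate a s r y))
      (fun r => a (~~ s) cA r (y + sgn s * r + sgn s * r))
      (fun r => m * a (~~ s) cQ r (y + sgn s * r + sgn s * r))
      (fun r => - m * a (~~ s) cP r (y + sgn s * r + sgn s * r))) => //.
  - by apply: integrableS (aI gd cP).
  - by apply: integrableS (aI gd cQ).
  - by apply: integrable_mulr => //; apply: integrableS (vI gd).
  - by move=> r /andP[r0 rt]; apply: aE; rewrite // r0 (le_trans rt).
  - by move=> r /andP[r0 rt]; apply: aE; rewrite // r0 (le_trans rt).
  - by move=> r _ /=; rewrite !lstate_same !lstate_opp; ring.
  - by move=> r _ /=; rewrite !lstate_same !lstate_opp; ring.
  - by move=> r _; rewrite /v !normrM normrN (ger0_norm m0') -mulrDr addrC.
rewrite lerD2r ler_wpM2l//; apply: le_trans (fh s y).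
by rewrite /n3 lerDl.
Qed.

(** In extended reals the inequality survives an infinite right-hand side, so it can be inserted
    into itself at every crossed label without knowing which integrals are finite. *)
Let v_duhamel_ereal s t y : 0 <= t <= T -> ((v s t y)%:E <= (2 * h y)%:E +
  (4 * m)%:E * \int[mu]_(r in `[0%R, t]) (v (~~ s) r (y + sgn s * r + sgn s * r)%R)%:E)%E.
Proof.
move=> tT; have m0' := ltW m0.
have mD : measurable_fun `[0, t] (fun r : rT => (v (~~ s) r (y + sgn s * r + sgn s * r))%:E).
  by apply/measurable_EFinP; apply: measurable_funTS; exact: mvc.
have D0 r : `[0, t]%classic r -> (0 <= (v (~~ s) r (y + sgn s * r + sgn s * r))%:E)%E.
  by move=> _; rewrite lee_fin.
have [->|fin] := eqVneq (\int[mu]_(r in `[0%R, t]) (v (~~ s) r (y + sgn s * r + sgn s * r)%R)%:E)%E +oo%E.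
  by rewrite gt0_muley ?lte_fin ?mulr_gt0// addeC leey.
have vIt : mu.-integrable `[0, t] (EFin \o (fun r => v (~~ s) r (y + sgn s * r + sgn s * r))).
  apply/integrableP; split => //.
  rewrite ltey; apply: contra_neq fin => <-.
  by apply: eq_integral => r _; rewrite /= ger0_norm.
have := v_duhamel s y tT.
rewrite RintegralZl// (mulrA 4 m) -lee_fin => /le_trans; apply.
rewrite [leLHS]EFinD (EFinM (4 * m)).
rewrite /Rintegral fineK//; exact: integral_fune_fin_num.
Qed.

(** The value of [v s] at the label reached after two crossings: from label [y] to the opposite
    family at time [z.1], and back to family [s] at time [z.2]. *)
Let w s y (z : rT * rT) : \bar R :=
  (v s z.2 (y + sgn s * z.1 + sgn s * z.1 + sgn (~~ s) * z.2 + sgn (~~ s) * z.2))%:E.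

Let mw s y : measurable_fun setT (w s y).
Proof.
apply/measurable_EFinP; apply: (jm_comp (jv s)) => //.
by do ! apply: measurable_funD => //; apply: measurable_funM.
Qed.

Let w0 s y z : (0 <= w s y z)%E. Proof. by rewrite lee_fin. Qed.

Let mwif s y (b : rT * rT -> bool) : measurable_fun setT b ->
  measurable_fun setT (fun z => if b z then w s y z else 0%E).
Proof. by move=> mb; apply: measurable_fun_ifT. Qed.

Let inner_integralE s y r : (\int[mu]_(q in `[0%R, r]) w s y (r, q) =
  \int[mu]_q (if ((0 <= q)%R && (q <= r)%R) then w s y (r, q) else 0))%E.
Proof.
rewrite integral_mkcond; apply: eq_integral => q _; rewrite patchE.
by rewrite (_ : (q \in _) = ((0 <= q) && (q <= r)))//; apply/idP/idP; rewrite inE /= in_itv.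
Qed.

Let measurable_inner s y :
  measurable_fun setT (fun r : rT => \int[mu]_(q in `[0%R, r]) w s y (r, q))%E.
Proof.
under eq_fun do rewrite inner_integralE.
have mb : measurable_fun setT (fun z : rT * rT => (0 <= z.2) && (z.2 <= z.1)).
  by apply: measurable_and; apply: measurable_fun_ler.
apply: (measurable_fun_fubini_tonelli_F _ (mwif s y mb)) => z.
by case: ifP.
Qed.

(** With the inner time [q] fixed, the doubly crossed label is affine in [r] with slope 2 in
    absolute value and stays within [2 T] of [y], so the hypothesis [vC] bounds the integral in [r]
    by [C]; integrating in [q] over [[0, T]] gives [T * C]. *)
Let vv_bound s t y : 0 <= t <= T ->
  (\int[mu]_(r in `[0%R, t]) \int[mu]_(q in `[0%R, r]) w s y (r, q) <= (T * C)%:E)%E.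
Proof.
move=> /andP[t0 tT].
pose b (z : rT * rT) := [&& 0 <= z.1, z.1 <= T, 0 <= z.2 & z.2 <= T].
have mb : measurable_fun setT b.
  by do !(apply: measurable_and; try by apply: measurable_fun_ler).
pose g z := if b z then w s y z else 0%E.
have g0 z : (0 <= g z)%E by rewrite /g; case: ifP.
have mg : measurable_fun setT g by exact: mwif.
apply: (@le_trans _ _ (\int[mu]_r \int[mu]_q g (r, q))%E).
  rewrite integral_mkcond; apply: ge0_le_integral => //.
  - by move=> r _; apply: erestrict_ge0 => q _; exact: integral_ge0.
  - apply/(measurable_restrictT _ _).1 => //.
    by apply: measurable_funTS; exact: measurable_inner.
  - exact: (measurable_fun_fubini_tonelli_F _ mg).
  - move=> r _; rewrite patchE; case: ifPn => [|_]; last exact: integral_ge0.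
    rewrite inE /= in_itv /= => /andP[r0 rt].
    rewrite inner_integralE; apply: ge0_le_integral => //.
    + by move=> q _; case: ifP.
    + have mb' : measurable_fun setT (fun q : rT => (0 <= q) && (q <= r)).
        by apply: measurable_and; apply: measurable_fun_ler.
      have mwr : measurable_fun setT (fun q : rT => w s y (r, q)).
        by apply: (measurableT_comp (mw s y)); exact: measurable_pair1.
      exact: (measurable_fun_ifT mb' mwr (measurable_cst 0%E)).
    + by apply: (measurableT_comp mg); exact: measurable_pair1.
    + move=> q _; case: ifPn => // /andP[q0 qr].
      by rewrite /g /b /= r0 q0 (le_trans rt)// (le_trans qr)// (le_trans rt).
rewrite (fubini_tonelli g mg g0).
apply: (@le_trans _ _ (\int[mu]_(q in `[0%R, T]) C%:E)%E); last first.
  by rewrite integral_cst//= lebesgue_measure_itv /= lte_fin; case: ifPn;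
    rewrite ?mule0 -?EFinD -?EFinM ?lee_fin ?mulr_ge0// subr0 mulrC.
rewrite [leRHS]integral_mkcond; apply: ge0_le_integral => //.
- by move=> q _; exact: integral_ge0.
- exact: (measurable_fun_fubini_tonelli_G _ mg).
- apply/(measurable_restrictT _ _).1 => //.
move=> q _; rewrite patchE; case: ifPn => [|nq]; last first.
  rewrite integral0_eq// => r _; rewrite /g /b /=.
  case: ifPn => // /and4P[_ _ q0 qT]; move: nq.
  by rewrite notin_setE /= in_itv /= q0 qT.
rewrite inE /= in_itv /= => qT; have [q0 qT'] := andP qT.
pose B := `[y - 2 * T, y + 2 * T]%classic : set rT.
have mB : measurable B by exact: measurable_itv.
pose F : rT -> \bar R := (fun z => (v s q z)%:E) \_ B.
have F0 z : (0 <= F z)%E by apply: erestrict_ge0 => ? _; rewrite lee_fin.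
have mvq : measurable_fun setT (fun z : rT => (v s q z)%:E).
  by apply/measurable_EFinP; apply: (jm_comp (jv s)).
have mF : measurable_fun setT F.
  by apply/(measurable_restrictT _ _).1 => //; exact: measurable_funTS.
have s2 : 2 * sgn s != 0 :> R by rewrite mulf_neq0 ?sgn_neq0.
pose c := y + sgn (~~ s) * q + sgn (~~ s) * q.
apply: (@le_trans _ _ (\int[mu]_r F (2 * sgn s * r + c)%R)%E).
  apply: ge0_le_integral => //.
  - by apply: (measurableT_comp mg); exact: measurable_pair2.
  - by apply: (measurableT_comp mF); exact: measurable_affine.
  - move=> r _; rewrite /g; case: ifPn => // /and4P[/= r0 rT _ _].
    rewrite /w /= /F patchE.
    rewrite (_ : 2 * sgn s * r + c = y + sgn s * r + sgn s * r + sgn (~~ s) * q + sgn (~~ s) * q); last first.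
      by rewrite /c; ring.
    rewrite mem_set//; rewrite /B /= in_itv /= sgnN /sgn.
    by case: (s) => /=; rewrite ?expr1 ?expr0; apply/andP; split; lra.
rewrite (ge0_integral_affine c s2 mF F0).
have -> : `|2 * sgn s|^-1 = 2^-1 :> R by rewrite normrM norm_sgn mulr1 ger0_norm.
apply: (@le_trans _ _ (1%:E * \int[mu]_z F z)%E).
  apply: lee_wpmul2r; last by rewrite lee_fin invf_le1//; lra.
  exact: integral_ge0.
by rewrite mul1e -integral_mkcond; exact: vC.
Qed.

(* Inserting the inequality [v_duhamel] into itself leaves a double integral of
   [v s], which after a change of variables is controlled by the integrals
   [vC] over windows in space; this bounds [v] by a multiple of [h + 1], as
   required by [modulus_apriori]. *)
Lemma label_apriori : exists2 c : R, 0 <= c &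
  forall s t y, 0 <= t <= T -> n3 (fun k => a s k t y) <= c * (h y + 1).
Proof.
have [lh h0 M1 hM] := uh; have m0' := ltW m0.
have M0 : 0 <= M by lra.
pose W := M * (1 + 2 * T).
have W1 : 1 <= W by have := mulr_ge0 M0 T0; rewrite /W; lra.
have wt t : 0 <= t <= T -> M * (1 + 2 * t) <= W.
  by move=> /andP[t0 tT]; rewrite ler_wpM2l//; lra.
have lchar s y : locint (fun r => h (y + sgn s * r + sgn s * r)) by exact: locint_char.
(* The three terms come from the datum, from the data at the crossed labels with weight [4 m], and
   from the double integral with weight [(4 m) ^ 2]. *)
pose K := 2 + 4 * m * W + 16 * m ^+ 2 * (T * C).
have vK s t y : 0 <= t <= T -> 0 <= v s t y <= K * (h y + 1).
  move=> /[dup] tT /andP[t0 tT']; rewrite v0/=.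
  have step : ((v s t y)%:E <= (2 * h y)%:E + (4 * m)%:E * ((2 * (2^-1 * W))%:E + (4 * m)%:E * (T * C)%:E))%E.
    apply: (le_trans (v_duhamel_ereal s y tT)); apply: leeD => //.
    apply: lee_wpmul2l; first by rewrite lee_fin mulr_ge0.
    have mD : measurable_fun `[0, t] (fun r : rT => (2 * h (y + sgn s * r + sgn s * r))%:E).
      apply/measurable_EFinP; apply: measurable_funTS; apply: measurable_funM => //.
      exact: locint_measurable.
    pose q r : \bar R := (\int[mu]_(q in `[0%R, r]) w s y (r, q))%E.
    have mq : measurable_fun `[0, t] q by apply: measurable_funTS; exact: measurable_inner.
    have q0 r : (0 <= q r)%E by apply: integral_ge0 => *; rewrite lee_fin.
    apply: (@le_trans _ _ (\int[mu]_(r in `[0%R, t]) ((2 * h (y + sgn s * r + sgn s * r)%R)%:E + (4 * m)%:E * q r))%E).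
      apply: ge0_le_integral => //.
      - by move=> r _; rewrite lee_fin.
      - by apply/measurable_EFinP; apply: measurable_funTS; exact: mvc.
      - by apply: emeasurable_funD => //; exact: measurable_funeM.
      - move=> r; rewrite /= in_itv /= => /andP[r0 rt].
        apply: (le_trans (v_duhamel_ereal _ _ _)); first by rewrite r0 (le_trans rt).
        by rewrite negbK.
    rewrite ge0_integralD//; last 3 first.
    - by move=> r _; rewrite lee_fin mulr_ge0.
    - by move=> r _; rewrite mule_ge0// lee_fin mulr_ge0.
    - exact: measurable_funeM.
    apply: leeD.
      have I : mu.-integrable `[0, t] (EFin \o (fun r => 2 * h (y + sgn s * r + sgn s * r))).
        by apply: integrable_mulr => //; exact: locint_itv.
      rewrite -(fineK (integral_fune_fin_num _ I))// lee_fin.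
      rewrite -/(Rintegral mu `[0, t] (fun r => 2 * h (y + sgn s * r + sgn s * r))).
      rewrite RintegralZl//; last exact: locint_itv.
      rewrite Rint_char// ler_wpM2l// ler_wpM2l//.
      exact: (le_trans (uloc_win _ uh t0) (wt _ tT)).
    rewrite ge0_integralZl//; last by rewrite lee_fin mulr_ge0.
    by apply: lee_wpmul2l; [rewrite lee_fin mulr_ge0|exact: vv_bound].
  move: step; rewrite -[((4 * m)%:E * (T * C)%:E)%E]EFinM -[((2 * (2^-1 * W))%:E + _)%E]EFinD -EFinM -EFinD lee_fin => /le_trans; apply.
  have h1 := h0 y; have mW : 0 <= 4 * m * W by rewrite !mulr_ge0//; lra.
  have TC : 0 <= 16 * m ^+ 2 * (T * C) by rewrite !mulr_ge0// sqr_ge0.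
  have := mulr_ge0 mW h1; have := mulr_ge0 TC h1; rewrite /K; lra.
have mvt s t y (_ : 0 <= t <= T) :
    measurable_fun `[0, t] (fun r => v (~~ s) r (y + sgn s * r + sgn s * r)).
  by apply: measurable_funTS; exact: mvc.
have vg := modulus_apriori m0 uh vK mvt (fun s t y tT => v_duhamel s y tT).
pose K2 := gam m M T * W.
have K20 : 0 <= K2.
  by rewrite mulr_ge0//; [have := gam_ge1 m0' M0 T0; lra|lra].
have vK2 s t y : 0 <= t <= T -> v s t y <= K2 * (h y + 1).
  move=> /[dup] tT /andP[t0 tT']; apply: (le_trans (vg s t y tT)).
  rewrite /K2 -mulrA; apply: ler_pM.
  - by have := gam_ge1 m0' M0 t0; lra.
  - by rewrite addr_ge0// win_ge0.
  - exact: gam_nd.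
  - have := le_trans (uloc_win (y + sgn s * t) uh t0) (wt _ tT).
    have : 0 <= (W - 1) * h y by rewrite mulr_ge0//; lra.
    move: (win _ _ _) => b; lra.
(* [K2] bounds the modulus, 1 the datum of [cA], and [K2 ^ 2 * W] the integral of the product of the
   two moduli. *)
exists (K2 + 1 + K2 ^+ 2 * W).
  by rewrite !addr_ge0// mulr_ge0 ?sqr_ge0//; lra.
move=> s t y /[dup] tT /andP[t0 tT'].
have h1 := h0 y.
have nE : n3 (fun k => a s k t y) = v s t y + `|a s cA t y| by [].
have [gd|bd] := pselect (good s y); last first.
  rewrite /n3 !abad// !normr0 !addr0 mulr_ge0//; last lra.
  by rewrite !addr_ge0// mulr_ge0 ?sqr_ge0//; lra.
have A1 : `|a s cA t y| <= h y + K2 * (h y + 1) * (K2 * (2^-1 * W)).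
  rewrite aE// (le_trans (ler_normD _ _))// lerD//.
    by apply: le_trans (fh s y); exact: (le_n3 (fun k => f s k y)).
  have lH : locint (fun z => h z + 1) by apply: locintD => //; exact: locint_cst.
  have H0 z : 0 <= h z + 1 by have := h0 z; lra.
  have I : mu.-integrable `[0, t] (EFin \o (fun r => K2 * (h (y + sgn s * r + sgn s * r) + 1))).
    apply: integrable_mulr => //.
    exact: (locint_itv 0 t (locint_char s y lH)).
  apply: (@le_trans _ _ (\int[mu]_(r in `[0, t])
      ((K2 * (h y + 1)) * (K2 * (h (y + sgn s * r + sgn s * r) + 1))))).
    apply: norm_Rint_le.
    - case/integrableP : (aI gd cA) => /measurable_EFinP + _.
      apply: measurable_funS => //.
      by move=> r /=; rewrite !in_itv /= => /andP[-> /le_trans->].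
    - exact: integrable_mulr.
    - move=> r /andP[r0 rt]; rewrite /= normrM normrN norm_sgn mul1r.
      have rT : 0 <= r <= T by rewrite r0 (le_trans rt).
      apply: (le_trans (qf_le ty s _)).
      rewrite !lstate_same !lstate_opp.
      by apply: ler_pM; rewrite ?addr_ge0//; exact: vK2.
  rewrite RintegralZl//.
  rewrite RintegralZl//; last exact: (locint_itv 0 t (locint_char s y lH)).
  rewrite (@Rint_char _ s t y (fun z => h z + 1))//.
  apply: ler_wpM2l; first by rewrite mulr_ge0.
  rewrite ler_wpM2l// ler_wpM2l//.
  exact: (le_trans (hM _ _ t0) (wt _ tT)).
rewrite nE.
have := vK2 s t y tT.
have W0 : 0 <= W by lra.
have hy0 : 0 <= h y + 1 by lra.
have := mulr_ge0 (mulr_ge0 (sqr_ge0 K2) W0) hy0.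
move: A1; move: (v s t y) `|a s cA t y| => p q.
clearbody K2 W; lra.
Qed.

End LabelApriori.

(** * Null sets and almost every characteristic *)

Section AlmostEverywhere.
Context {R : realType}.
Local Notation mu := (@lebesgue_measure R).
Local Notation rT := (measurableTypeR R).
Implicit Types (s : bool) (f g : rT -> R).

Lemma Rint_ae (D : set rT) f g : measurable D -> measurable_fun D f ->
  measurable_fun D g -> {ae mu, forall x, D x -> f x = g x} ->
  \int[mu]_(x in D) f x = \int[mu]_(x in D) g x.
Proof.
move=> mD mf mg fg; congr fine; apply: ae_eq_integral => //.
- exact/measurable_EFinP.
- exact/measurable_EFinP.
- by apply: filterS fg => x + Dx => /(_ Dx) ->.
Qed.

Lemma integrable_ae_eq (D : set rT) f g : measurable D -> measurable_fun D g ->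
  {ae mu, forall x, D x -> f x = g x} ->
  mu.-integrable D (EFin \o f) -> mu.-integrable D (EFin \o g).
Proof.
move=> mD mg fg /integrableP[mf If]; apply/integrableP; split; first exact/measurable_EFinP.
rewrite (_ : (\int[mu]_(x in D) _)%E = (\int[mu]_(x in D) `|(EFin \o f) x|)%E)//.
apply: ae_eq_integral => //.
- by apply: measurableT_comp => //; exact/measurable_EFinP.
- exact: measurableT_comp.
- by apply: filterS fg => x + Dx => /(_ Dx) /= ->.
Qed.

(** By Tonelli for the indicator of [Z], both iterated integrals vanish, so almost every section in
    the other direction is null. *)
Lemma ae_swap (Z : set (rT * rT)) : measurable Z ->
  (forall t, {ae mu, forall y, ~ Z (t, y)}) ->
  {ae mu, forall y, {ae mu, forall t, ~ Z (t, y)}}.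
Proof.
move=> mZ hZ.
pose g (z : rT * rT) : \bar R := (\1_Z z)%:E.
have mg : measurable_fun setT g by apply/measurable_EFinP; exact: measurable_indic.
have g0 z : (0 <= g z)%E by rewrite lee_fin.
have sec (t : rT) : (\int[mu]_y g (t, y) = 0)%E.
  rewrite (_ : 0%E = \int[mu]_y (cst 0 y))%E; last by rewrite integral0.
  apply: ae_eq_integral => //.
    by apply: (measurableT_comp mg); exact: measurable_pair1.
  have := hZ t; apply: filterS => y nZ _.
  by rewrite /g indicE memNset.
have z0 : (\int[mu]_y \int[mu]_t g (t, y) = 0)%E.
  rewrite -(fubini_tonelli g mg g0).
  by under eq_integral do rewrite sec; rewrite integral0.
pose G (y : rT) := (\int[mu]_t g (t, y))%E.
have G0 y : (0 <= G y)%E by exact: integral_ge0.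
have mG : measurable_fun setT G by exact: (measurable_fun_fubini_tonelli_G _ mg).
have aG : ae_eq mu setT G (cst 0%E).
  apply/(ae_eq_integral_abs mu measurableT mG).
  by rewrite -[RHS]z0; apply: eq_integral => y _; rewrite gee0_abs.
have {}aG : {ae mu, forall y : rT, G y = 0%E} by move: aG; apply: filterS => y /(_ I).
move: aG; apply: filterS => y Gy.
have mgy : measurable_fun setT (fun t : rT => g (t, y)).
  by apply: (measurableT_comp mg); exact: measurable_pair2.
have : ae_eq mu setT (fun t => g (t, y)) (cst 0%E).
  apply/(ae_eq_integral_abs mu measurableT mgy).
  by rewrite -[RHS]Gy; apply: eq_integral => t _; rewrite gee0_abs.
apply: filterS => t /(_ I); rewrite /g indicE => + Zt; rewrite mem_set// => /eqP.
by rewrite eqe oner_eq0.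
Qed.

(** The crossed label is an affine function of time with nonzero slope, and such a map pulls null
    sets back to null sets. *)
Lemma ae_char s (y : R) (N : set rT) : measurable N -> mu N = 0%E ->
  {ae mu, forall r : rT, ~ N (y + sgn s * r + sgn s * r)}.
Proof.
move=> mN N0.
have s2 : 2 * sgn s != 0 :> R by rewrite mulf_neq0 ?sgn_neq0.
exists ((fun r : rT => 2 * sgn s * r + y : rT) @^-1` N); split.
- rewrite -[X in measurable X]setTI.
  by apply: (measurable_affine (2 * sgn s) y).
- rewrite -[X in mu X]setIT -integral_indic//=; last first.
    rewrite -[X in measurable X]setTI.
    by apply: (measurable_affine (2 * sgn s) y).
  pose F : rT -> \bar R := fun x => (\1_N x)%:E.
  transitivity (\int[mu]_r F (2 * sgn s * r + y)%R)%E => //.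
  rewrite ge0_integral_affine//.
  + rewrite (_ : (\int[mu]_x F x)%E = 0%E) ?mule0//.
    by rewrite /F integral_indic// setIT.
  + by apply/measurable_EFinP; exact: measurable_indic.
  + by move=> x; rewrite lee_fin.
- move=> r /=; rewrite (_ : 2 * sgn s * r + y = y + sgn s * r + sgn s * r).
    by move=> nn; apply: contrapT => nn'; apply: nn => /nn'.
  by ring.
Qed.

(** Tonelli after the shear [(t, y) |-> (t, y + sgn s t)]: the integrals along characteristics are
    integrable over bounded sets of labels, hence finite for almost every label. *)
Lemma ae_char_integrable s T (g : R -> R -> R) : 0 <= T -> jm g ->
  (forall t x, 0 <= g t x) ->
  (forall n : nat, (\int[mu]_(t in `[0%R, T]) \int[mu]_(x in `[(- n%:R)%R, n%:R])
     (g t x)%:E < +oo)%E) ->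
  {ae mu, forall y : rT, mu.-integrable `[0, T] (EFin \o (fun r => g r (y + sgn s * r)))}.
Proof.
move=> T0 jg g0 gn.
pose w (z : rT * rT) : \bar R :=
  if (0 <= z.1) && (z.1 <= T) then (g z.1 (z.2 + sgn s * z.1))%:E else 0%E.
have w0 z : (0 <= w z)%E by rewrite /w; case: ifP => //; rewrite lee_fin.
have mw : measurable_fun setT w.
  have mb : measurable_fun setT (fun z : rT * rT => (0 <= z.1) && (z.1 <= T)).
    by apply: measurable_and; apply: measurable_fun_ler.
  have mg : measurable_fun setT (fun z : rT * rT => (g z.1 (z.2 + sgn s * z.1))%:E).
    by apply/measurable_EFinP; exact: jm_label.
  exact: (measurable_fun_ifT mb mg (measurable_cst 0%E)).
pose F (y : rT) := (\int[mu]_t w (t, y))%E.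
have F0 y : (0 <= F y)%E by exact: integral_ge0.
have mF : measurable_fun setT F by exact: (measurable_fun_fubini_tonelli_G _ mw).
have FE y : F y = (\int[mu]_(r in `[0%R, T]) (g r (y + sgn s * r)%R)%:E)%E.
  rewrite [RHS]integral_mkcond; apply: eq_integral => t _; rewrite patchE /w /=.
  by rewrite (_ : (t \in _) = ((0 <= t) && (t <= T)))//; apply/idP/idP; rewrite inE /= in_itv.
have Fn (n : nat) : {ae mu, forall y : rT, `[- n%:R, n%:R]%classic y -> F y \is a fin_num}.
  pose B := `[(- n%:R : R), n%:R]%classic : set rT.
  have mB : measurable B by exact: measurable_itv.
  have inB y : (y \in B) = (- n%:R <= y) && (y <= n%:R).
    by apply/idP/idP; rewrite inE /B /= in_itv.
  (* Characteristics with labels in [[- n, n]] stay in [[- n', n']] up to time [T]. *)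
  pose n' := (n + (Num.truncn T).+1)%N.
  have nT : n%:R + T <= n'%:R by rewrite /n' natrD lerD2l ltW// truncnS_gt.
  have IF : mu.-integrable B F.
    apply/integrableP; split; first exact: measurable_funTS.
    under eq_integral do rewrite gee0_abs//.
    apply: le_lt_trans (gn n').
    pose wB (z : rT * rT) : \bar R := if (- n%:R <= z.2) && (z.2 <= n%:R) then w z else 0%E.
    have wB0 z : (0 <= wB z)%E by rewrite /wB; case: ifP.
    have mwB : measurable_fun setT wB.
      have mb : measurable_fun setT (fun z : rT * rT => (- n%:R <= z.2) && (z.2 <= n%:R)).
        by apply: measurable_and; apply: measurable_fun_ler.
      exact: (measurable_fun_ifT mb mw (measurable_cst 0%E)).
    rewrite integral_mkcond.
    rewrite (_ : (\int[mu]_x _)%E = \int[mu]_y \int[mu]_t wB (t, y))%E; last first.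
      apply: eq_integral => y _; rewrite patchE /wB /= inB.
      by case: ifP => // _; rewrite integral0.
    apply: (@le_trans _ _ (\int[mu]_t \int[mu]_x wB (t, x))%E).
      by rewrite (fubini_tonelli wB mwB wB0).
    rewrite [leRHS]integral_mkcond.
    apply: ge0_le_integral => //.
    - by move=> t _; exact: integral_ge0.
    - exact: (measurable_fun_fubini_tonelli_F _ mwB).
    - apply/(measurable_restrictT _ _).1 => //; apply: measurable_funTS.
      pose f (z : rT * rT) : \bar R :=
        if (- n'%:R <= z.2) && (z.2 <= n'%:R) then (g z.1 z.2)%:E else 0%E.
      have mf : measurable_fun setT f.
        have mb : measurable_fun setT (fun z : rT * rT => (- n'%:R <= z.2) && (z.2 <= n'%:R)).
          by apply: measurable_and; apply: measurable_fun_ler.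
        by apply: (measurable_fun_ifT mb _ (measurable_cst 0%E)); exact/measurable_EFinP.
      rewrite (_ : (fun t => _) = (fun t : rT => \int[mu]_x f (t, x))%E).
        apply: (measurable_fun_fubini_tonelli_F f mf) => z.
        by rewrite /f; case: ifP; rewrite ?lee_fin.
      apply/funext => t; rewrite integral_mkcond; apply: eq_integral => x _.
      rewrite patchE /f /=; congr (if _ then _ else _).
      by apply/idP/idP; rewrite inE /= in_itv.
    - move=> t _; rewrite patchE; case: ifPn => [|nt]; last first.
        rewrite integral0_eq// => x _; rewrite /wB /w /=; case: ifP => // _.
        case: ifP => // /andP[t0 tT]; move: nt.
        by rewrite notin_setE /= in_itv /= t0 tT.
      rewrite inE /= in_itv /= => /andP[t0 tT].
      rewrite [leRHS]integral_mkcond.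
      pose f : rT -> \bar R := (fun x => (g t x)%:E) \_ `[(- n'%:R), n'%:R].
      have f0 x : (0 <= f x)%E by apply: erestrict_ge0 => ? _; rewrite lee_fin.
      have mf : measurable_fun setT f.
        apply/(measurable_restrictT _ _).1 => //.
        apply: measurable_funTS; apply/measurable_EFinP.
        exact: (jm_comp jg).
      rewrite -/f -(@ge0_integral_shift _ (sgn s * t) f)//.
      apply: ge0_le_integral => //.
      + by apply: (measurableT_comp mwB); exact: measurable_pair1.
      + by apply: (measurableT_comp mf); exact: measurable_funD.
      + move=> x _; rewrite /wB /=; case: ifP => // /andP[x1 x2].
        rewrite /w /= t0 tT /= /f patchE mem_set//= in_itv /=.
        by rewrite /sgn; case: (s) => /=; rewrite ?expr1 ?expr0; apply/andP; split; lra.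
  have h : {ae mu, forall y : rT, B y -> F y \is a fin_num} := integrable_ae mB IF.
  by move: h; apply: filterS => y.
have {}Fn : {ae mu, forall y : rT, forall n : nat, `[- n%:R, n%:R]%classic y -> F y \is a fin_num}.
  exact: ae_foralln.
move: Fn; apply: filterS => y yn.
apply/integrableP; split.
  by apply/measurable_EFinP; apply: measurable_funTS; exact: jm_char.
have {yn}: F y \is a fin_num.
  apply: (yn (Num.truncn `|y|).+1) => /=.
  by rewrite in_itv /= -ler_norml ltW// truncnS_gt.
rewrite ge0_fin_numE// FE; congr (_ < _)%E.
by apply: eq_integral => r _; rewrite /= ger0_norm.
Qed.

Lemma ae_component (P : component -> rT -> Prop) :
  (forall k, {ae mu, forall y, P k y}) -> {ae mu, forall y, forall k, P k y}.
Proof.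
by move=> h; move: (h cP) (h cQ) (h cA); apply: filterS3 => y ? ? ? [].
Qed.

End AlmostEverywhere.

(** * Weak solutions as functions on characteristics *)

Section WeakUniqueness.
Context {R : realType}.
Local Notation mu := (@lebesgue_measure R).
Local Notation rT := (measurableTypeR R).
Implicit Types (s : bool) (k : component) (r t y : R).
Variables (m M T C : R) (ty : bool) (h : R -> R).
Variables (f : bool -> component -> R -> R) (U V : bool -> component -> R -> R -> R).
Hypotheses (m0 : 0 < m) (T0 : 0 <= T) (C0 : 0 <= C) (uh : uloc M h).
Hypothesis mf : forall s k, measurable_fun setT (f s k).
Hypothesis fh : forall s y, n3 (fun k => f s k y) <= h y.
Hypotheses (jU : forall s k, jm (U s k)) (jV : forall s k, jm (V s k)).
Let FU s k r y := csd m ty s k (fun s' k' => U s' k' r y).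
Hypothesis U_locint : forall s k (n : nat),
  (\int[mu]_(t in `[0%R, T]) \int[mu]_(x in `[(- n%:R)%R, n%:R]) `|U s k t x|%:E < +oo)%E.
Hypothesis FU_locint : forall s k (n : nat),
  (\int[mu]_(t in `[0%R, T]) \int[mu]_(x in `[(- n%:R)%R, n%:R]) `|FU s k t x|%:E < +oo)%E.
Hypothesis U_window : forall s t y, 0 <= t <= T ->
  (\int[mu]_(z in `[(y - 2 * T)%R, (y + 2 * T)%R])
    (`|U s cP t (z + sgn s * t)| + `|U s cQ t (z + sgn s * t)|)%:E <= C%:E)%E.
Hypothesis UE : forall s k t, 0 <= t -> {ae mu, forall x : rT,
  U s k t x = f s k (x - sgn s * t) +
    \int[mu]_(r in `[0, t]) FU s k r (x - sgn s * (t - r))}.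
Hypothesis VE : forall s k t y, 0 <= t -> V s k t (y + sgn s * t) = f s k y +
  \int[mu]_(r in `[0, t]) csd m ty s k (fun s' k' => V s' k' r (y + sgn s * r)).
Hypothesis Vle : forall s t y, 0 <= t ->
  n3 (fun k => V s k t (y + sgn s * t)) <= Gam m M t * (h y + win h t (y + sgn s * t)).

Let jFU s k : jm (FU s k). Proof. exact: jm_csd. Qed.

Let W s k t y := f s k y + \int[mu]_(r in `[0, t]) FU s k r (y + sgn s * r).

Let jW s k : jm (W s k).
Proof. by apply: measurable_funD; [exact: jm_cst2|exact: jm_Rint]. Qed.

(** The pairs of time and label at which [U] violates the Duhamel formula. Each time section is null
    by hypothesis; what is needed is null sections at fixed label. *)
Let D s : set (rT * rT) := [set z | 0 <= z.1 <= T /\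
  exists k, U s k z.1 (z.2 + sgn s * z.1) != W s k z.1 z.2].

Let mD s : measurable (D s).
Proof.
have m1 k : measurable [set z : rT * rT | U s k z.1 (z.2 + sgn s * z.1) != W s k z.1 z.2].
  have := measurable_fun_eqr (jm_label s (jU s k)) (jW s k).
  move=> /(measurable_neg (f := _)) mb.
  rewrite (_ : [set z | _] = setT `&` (fun z : rT * rT =>
    U s k z.1 (z.2 + sgn s * z.1) != W s k z.1 z.2) @^-1` [set true]).
    exact: mb.
  by rewrite setTI; apply/seteqP; split => z /=; case: (_ == _).
rewrite (_ : D s = (`[0, T] `*` setT) `&` \bigcup_(k in [set: component])
   [set z | U s k z.1 (z.2 + sgn s * z.1) != W s k z.1 z.2]).
  apply: measurableI; first exact: measurableX.
  rewrite (_ : [set: component] = [set cP] `|` [set cQ] `|` [set cA]).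
    by rewrite !bigcup_setU !bigcup_set1; do 2 apply: measurableU => //.
  by apply/seteqP; split => [[]|] //= _; [left; left|left; right|right].
apply/seteqP; split => z /=.
  by move=> [zT [k zk]]; split; [rewrite in_itv|exists k].
by move=> [[+ _] [k _ zk]]; rewrite in_itv /= => zT; split => //; exists k.
Qed.

Let D_null s t : {ae mu, forall y : rT, ~ D s (t, y)}.
Proof.
have [/andP[t0 tT]|nT] := boolP (0 <= t <= T); last first.
  by apply: aeW => y [/= tT]; rewrite tT in nT.
have h1 : {ae mu, forall y : rT, forall k, U s k t (y + sgn s * t) = W s k t y}.
  have e k : {ae mu, forall y : rT, U s k t (y + sgn s * t) = W s k t y}.
    have hs : {ae mu, forall y : rT, U s k t (y + sgn s * t) = f s k (y + sgn s * t - sgn s * t) +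
        \int[mu]_(r in `[0, t]) FU s k r (y + sgn s * t - sgn s * (t - r))}.
      exact: (ae_shift (sgn s * t) (UE s k t0)).
    move: hs; apply: filterS => y ->.
    rewrite /W addrK; congr (_ + _); apply: eq_Rintegral => r _.
    by congr (FU _ _ _ _); ring.
  exact: ae_component e.
move: h1; apply: filterS => y yk [_ [k]] /=.
by rewrite yk eqxx.
Qed.

(** The exceptional set of the opposite family, seen from the labels of family [s]. *)
Let D' s : set (rT * rT) := [set z | D (~~ s) (z.1, z.2 + sgn s * z.1 + sgn s * z.1)].

Let mD' s : measurable (D' s).
Proof.
rewrite -[X in measurable X]setTI.
have : measurable_fun setT (fun z : rT * rT => (z.1, z.2 + sgn s * z.1 + sgn s * z.1) : rT * rT).
  apply: measurable_fun_pair => //.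
  have m1 : measurable_fun setT (fun z : rT * rT => sgn s * z.1) by apply: measurable_funM.
  by apply: measurable_funD => //; apply: measurable_funD.
by apply.
Qed.

Let D'_null s t : {ae mu, forall y : rT, ~ D' s (t, y)}.
Proof.
have hs : {ae mu, forall y : rT, ~ D (~~ s) (t, y + (sgn s * t + sgn s * t))}.
  exact: (ae_shift (sgn s * t + sgn s * t) (D_null (~~ s) t)).
by move: hs; apply: filterS => y; rewrite addrA.
Qed.

(** On such a characteristic the state formed with [W] agrees with that of [U] at almost every time,
    so the integral defining [W] turns into an equation for [W] alone. *)
Let Good s y := [/\ {ae mu, forall t : rT, ~ D s (t, y)}, {ae mu, forall t : rT, ~ D' s (t, y)},
  forall k, mu.-integrable `[0, T] (EFin \o (fun r => FU s k r (y + sgn s * r))) &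
  forall k, mu.-integrable `[0, T] (EFin \o (fun r => `|U (~~ s) k r (y + sgn s * r)|))].

Let good_ae s : {ae mu, forall y : rT, Good s y}.
Proof.
have h1 : {ae mu, forall y : rT, {ae mu, forall t : rT, ~ D s (t, y)}}.
  exact: ae_swap (mD s) (D_null s).
have h2 : {ae mu, forall y : rT, {ae mu, forall t : rT, ~ D' s (t, y)}}.
  exact: ae_swap (mD' s) (D'_null s).
have h3 k : {ae mu, forall y : rT, mu.-integrable `[0, T]
    (EFin \o (fun r => FU s k r (y + sgn s * r)))}.
  have := @ae_char_integrable _ s T (fun t x => `|FU s k t x|) T0 _ _ (FU_locint s k).
  have jn : jm (fun t x => `|FU s k t x|) by apply: measurableT_comp => //; exact: jFU.
  move=> /(_ jn (fun _ _ => normr_ge0 _)); apply: filterS => y Iy.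
  apply: integrable_le Iy => //; apply: measurable_funTS; exact: jm_char.
have h4 k : {ae mu, forall y : rT, mu.-integrable `[0, T]
    (EFin \o (fun r => `|U (~~ s) k r (y + sgn s * r)|))}.
  apply: (@ae_char_integrable _ s T (fun t x => `|U (~~ s) k t x|)) => //.
  by apply: measurableT_comp => //; exact: jU.
have {}h3 := ae_component h3; have {}h4 := ae_component h4.
have h12 : {ae mu, forall y : rT, {ae mu, forall t : rT, ~ D s (t, y)} /\
    {ae mu, forall t : rT, ~ D' s (t, y)}}.
  by apply: filterS2 h1 h2.
by apply: filterS3 h12 h3 h4 => y [].
Qed.

(** A null set of labels is crossed at a null set of times only, so modifying a function on it does
    not change Duhamel integrals along the remaining characteristics. *)
Let ae_lstate (N : bool -> set rT) (a : bool -> component -> R -> R -> R)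
    (Z : bool -> component -> R -> R -> R) s y :
  (forall s, measurable (N s)) -> (forall s, mu (N s) = 0%E) ->
  (forall s k t y, ~ N s y -> a s k t y = Z s k t y) -> ~ N s y ->
  {ae mu, forall r : rT, lstate a s r y = lstate Z s r y}.
Proof.
move=> mN N0 aZ nN.
have h3 : {ae mu, forall r : rT, ~ N (~~ s) (y + sgn s * r + sgn s * r)}.
  exact: ae_char.
move: h3; apply: filterS => r nr.
apply/funext => s'; apply/funext => k; rewrite /lstate.
by case: ifP => _; rewrite aZ.
Qed.

Let ae_lstate_W s y : Good s y -> {ae mu, forall r : rT, 0 <= r <= T ->
  lstate W s r y = (fun s' k' => U s' k' r (y + sgn s * r))}.
Proof.
case=> h1 h2 _ _; apply: filterS2 h1 h2 => r d1 d2 rT; apply/funext => s'; apply/funext => k'; rewrite /lstate.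
have e1 k : U s k r (y + sgn s * r) = W s k r y.
  by apply: contrapT => /eqP ne; apply: d1; split => //; exists k.
have e2 k : U (~~ s) k r (y + sgn s * r) = W (~~ s) k r (y + sgn s * r + sgn s * r).
  apply: contrapT => /eqP ne; apply: d2; split => //; exists k => /=.
  by rewrite (_ : y + sgn s * r + sgn s * r + sgn (~~ s) * r = y + sgn s * r)// sgnN; ring.
case: eqP => [->|/eqP ne]; first by rewrite e1.
have -> : s' = ~~ s by move: ne; case: (s); case: (s').
by rewrite e2.
Qed.

Let measurable_lstate (a : bool -> component -> R -> R -> R) s k y :
  (forall s k, jm (a s k)) ->
  measurable_fun setT (fun r : rT => csd m ty s k (lstate a s r y)).
Proof.
move=> ja.
have jl s' k' : jm (fun t x => lstate a s t x s' k').
  rewrite /lstate; case: eqP => _; first exact: ja.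
  apply: (jm_comp (ja (~~ s) k')) => //.
  have m1 : measurable_fun setT (fun z : rT * rT => sgn s * z.1) by apply: measurable_funM.
  by apply: measurable_funD => //; apply: measurable_funD.
by apply: (jm_comp (jm_csd m ty jl s k)).
Qed.

(* [W] is the right-hand side of the Duhamel formula, defined for every label.
   By Fubini it solves the system on almost every characteristic; setting it to
   zero on the exceptional labels [N] yields a function to which the pointwise
   estimates for label functions apply. *)
Theorem weak_uniqueness s k t : 0 <= t <= T ->
  {ae mu, forall x : rT, U s k t x = V s k t x}.
Proof.
have [lh h0 M1 hM] := uh; have m0' := ltW m0; have M0 : 0 <= M by lra.
(* The set of bad labels need not be measurable; it is enlarged to a measurable null set. *)
have exN s' : exists N : set rT, [/\ measurable N, mu N = 0%E &
    forall y : rT, ~ N y -> Good s' y].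
  have [A [mA A0 sub]] := good_ae s'; exists A; split => // y nA.
  by apply: contrapT => nG; exact: nA (sub _ nG).
have [N hN] := choice exN.
have mN s' : measurable (N s') by case: (hN s').
have N0 s' : mu (N s') = 0%E by case: (hN s').
have gN s' y : ~ N s' y -> Good s' y by case: (hN s') => _ _; apply.
pose cut (Z : bool -> component -> R -> R -> R) s' k' t' (y : R) : R :=
  Z s' k' t' y * \1_(~` N s') y.
have cut_good Z s' k' t' y : ~ N s' y -> cut Z s' k' t' y = Z s' k' t' y.
  by move=> nN; rewrite /cut indicE mem_set// mulr1.
have cut_bad Z s' k' t' y : ~ ~ N s' y -> cut Z s' k' t' y = 0.
  by move=> /contrapT nN; rewrite /cut indicE memNset ?mulr0//= => /(_ nN).
have jcut Z : (forall s' k', jm (Z s' k')) -> forall s' k', jm (cut Z s' k').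
  move=> jZ s' k'; apply: measurable_funM; first exact: jZ.
  exact: (jm_cst2 (measurable_indic (measurableC (mN s')))).
pose a := cut W.
pose Vl s' k' t' y := V s' k' t' (y + sgn s' * t').
have jVl s' k' : jm (Vl s' k') by exact: jm_label.
pose b := cut Vl.
have ja s' k' : jm (a s' k') by exact: jcut.
have jb s' k' : jm (b s' k') by exact: jcut.
have la s' y : ~ N s' y -> {ae mu, forall r : rT, 0 <= r <= T ->
    lstate a s' r y = (fun s'' k' => U s'' k' r (y + sgn s' * r))}.
  move=> nN.
  have h1 : {ae mu, forall r : rT, lstate a s' r y = lstate W s' r y}.
    exact: (ae_lstate mN N0 (cut_good W)).
  have h2 := ae_lstate_W (gN _ _ nN).
  by apply: filterS2 h1 h2 => r -> hr /hr.
have lb s' y : ~ N s' y -> {ae mu, forall r : rT, 0 <= r <= T ->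
    lstate b s' r y = (fun s'' k' => V s'' k' r (y + sgn s' * r))}.
  move=> nN.
  have h1 : {ae mu, forall r : rT, lstate b s' r y = lstate Vl s' r y}.
    exact: (ae_lstate mN N0 (cut_good Vl)).
  move: h1; apply: filterS => r -> _.
  by apply/funext => s''; apply/funext => k'; rewrite /Vl lstateE.
have mUc s' k' y : measurable_fun setT (fun r : rT => FU s' k' r (y + sgn s' * r)).
  exact: jm_char.
have mla s' k' y : measurable_fun setT (fun r : rT => csd m ty s' k' (lstate a s' r y)).
  exact: measurable_lstate.
have mlb s' k' y : measurable_fun setT (fun r : rT => csd m ty s' k' (lstate b s' r y)).
  exact: measurable_lstate.
have laF s' k' y : ~ N s' y -> {ae mu, forall r : rT, `[0, T]%classic r ->
    FU s' k' r (y + sgn s' * r) = csd m ty s' k' (lstate a s' r y)}.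
  move=> /la; apply: filterS => r + rT; rewrite /= in_itv /= in rT.
  by move=> /(_ rT) ->.
have aI s' y : ~ N s' y -> forall k',
    mu.-integrable `[0, T] (EFin \o (fun r => csd m ty s' k' (lstate a s' r y))).
  move=> nN k'; have [_ _ I1 _] := gN _ _ nN.
  apply: integrable_ae_eq (laF s' k' y nN) (I1 k') => //.
  exact: measurable_funTS.
have sub t' : 0 <= t' <= T -> (`[0, t']%classic : set R) `<=` `[0, T].
  by move=> /andP[_ tT] r /=; rewrite !in_itv /= => /andP[-> /le_trans->].
have aE s' y : ~ N s' y -> forall k' t', 0 <= t' <= T ->
    a s' k' t' y = f s' k' y + \int[mu]_(r in `[0, t']) csd m ty s' k' (lstate a s' r y).
  move=> nN k' t' tT'; rewrite /a cut_good// /W; congr (_ + _).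
  apply: Rint_ae => //; try exact: measurable_funTS.
  have := laF s' k' y nN; apply: filterS => r + rt.
  by apply; exact: (sub _ tT').
have vI s' y : ~ N s' y -> mu.-integrable `[0, T] (EFin \o (fun r =>
    `|a (~~ s') cP r (y + sgn s' * r + sgn s' * r)| + `|a (~~ s') cQ r (y + sgn s' * r + sgn s' * r)|)).
  move=> nN; have [_ _ _ I2] := gN _ _ nN.
  apply: (integrable_ae_eq _ _ _ (integrable_addr _ (I2 cP) (I2 cQ))) => //.
    apply: measurable_funTS.
    have m1 : measurable_fun setT (fun r : rT => y + sgn s' * r + sgn s' * r).
      by do 2 apply: measurable_funD => //; apply: measurable_funM.
    by apply: measurable_funD; apply: measurableT_comp => //; exact: (jm_comp (ja _ _)).
  have := la s' y nN; apply: filterS => r + rT; rewrite /= in_itv /= in rT.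
  by move=> /(_ rT) hr; rewrite -!(lstate_opp a) hr.
have vC s' r y : 0 <= r <= T ->
    (\int[mu]_(z in `[(y - 2 * T)%R, (y + 2 * T)%R])
      (`|a s' cP r z| + `|a s' cQ r z|)%:E <= C%:E)%E.
  move=> r0T; apply: le_trans (U_window s' y r0T).
  apply: ae_ge0_le_integral => //.
  - apply/measurable_EFinP; apply: measurable_funTS.
    by apply: measurable_funD; apply: measurableT_comp => //; exact: (jm_comp (ja _ _)).
  - apply/measurable_EFinP; apply: measurable_funTS.
    have m1 : measurable_fun setT (fun z : rT => z + sgn s' * r : rT) by apply: measurable_funD.
    by apply: measurable_funD; apply: measurableT_comp => //; exact: (jm_comp (jU _ _)).
  - have := D_null s' r; apply: filterS => z nD _; rewrite lee_fin.
    have [nN|bN] := pselect (~ N s' z); last by rewrite /a !cut_bad// normr0 addr0 addr_ge0.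
    have e k' : W s' k' r z = U s' k' r (z + sgn s' * r).
      by apply: contrapT => /eqP; rewrite eq_sym => ne; apply: nD; split => //; exists k'.
    by rewrite /a !cut_good// !e.
(* This is the pointwise bound that a weak solution lacks at first; from here on it is treated like
   the constructed solution. *)
have [c c0 ca] := label_apriori m0 T0 C0 uh fh ja vC aI aE vI (fun s' y nN k' t' => cut_bad W s' k' t' y nN).
pose cV := Gam m M T * (M * (1 + 2 * T)).
have H1 y : 1 <= h y + 1 by rewrite lerDr.
have Vc s' t' y : 0 <= t' <= T -> n3 (fun k' => V s' k' t' (y + sgn s' * t')) <= cV * (h y + 1).
  move=> /andP[t'0 t'T]; apply: (le_trans (Vle s' y t'0)).
  rewrite /cV -mulrA; apply: ler_pM.
  - by have := Gam_ge1 m0' M0 t'0; lra.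
  - by rewrite addr_ge0// win_ge0.
  - exact: Gam_nd.
  - have h1 := uloc_win (y + sgn s' * t') uh t'0.
    have h2 : M * (1 + 2 * t') <= M * (1 + 2 * T) by rewrite ler_wpM2l//; lra.
    have h3 : 1 <= M * (1 + 2 * T) by have := mulr_ge0 M0 T0; lra.
    have h4 := h0 y.
    have := ler_wpM2r h4 h3; move: h1 h2 h3 h4; move: (win _ _ _) (M * (1 + 2 * T)) => w1 w2; lra.
have cV0 : 0 <= cV.
  by rewrite mulr_ge0//; [have := Gam_ge1 m0' M0 T0; lra|have := mulr_ge0 M0 T0; lra].
have lH : locint (fun z => h z + 1) by apply: locintD => //; exact: locint_cst.
have Hp y : 0 <= h y + 1 by have := H1 y; lra.
have VI s' k' t' y : t' <= T -> mu.-integrable `[0, t'] (EFin \o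
    (fun r => csd m ty s' k' (fun s'' k'' => V s'' k'' r (y + sgn s' * r)))).
  exact: (@csd_char_integrable R m cV T ty (fun z => h z + 1) V s' t' y k' m0' cV0 lH Hp jV Vc).
have lbF s' k' y : ~ N s' y -> {ae mu, forall r : rT, `[0, T]%classic r ->
    csd m ty s' k' (fun s'' k'' => V s'' k'' r (y + sgn s' * r)) =
    csd m ty s' k' (lstate b s' r y)}.
  move=> /lb; apply: filterS => r + rT; rewrite /= in_itv /= in rT.
  by move=> /(_ rT) ->.
have mVc s' k' y : measurable_fun setT
    (fun r : rT => csd m ty s' k' (fun s'' k'' => V s'' k'' r (y + sgn s' * r))).
  exact: (jm_char s' y (jm_csd m ty jV s' k')).
have bI s' y : ~ N s' y -> forall k',
    mu.-integrable `[0, T] (EFin \o (fun r => csd m ty s' k' (lstate b s' r y))).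
  move=> nN k'; apply: integrable_ae_eq (lbF s' k' y nN) (VI s' k' T y (lexx _)) => //.
  exact: measurable_funTS.
have bE s' y : ~ N s' y -> forall k' t', 0 <= t' <= T ->
    b s' k' t' y = f s' k' y + \int[mu]_(r in `[0, t']) csd m ty s' k' (lstate b s' r y).
  move=> nN k' t' /[dup] tT' /andP[t'0 _]; rewrite /b cut_good// /Vl VE//; congr (_ + _).
  apply: Rint_ae => //; try exact: measurable_funTS.
  have := lbF s' k' y nN; apply: filterS => r + rt.
  by apply; exact: (sub _ tT').
pose c' := c + cV.
have c'0 : 0 <= c' by rewrite addr_ge0.
have ac s' t' y : 0 <= t' <= T -> n3 (fun k' => a s' k' t' y) <= c' * (h y + 1).
  by move=> tT; apply: (le_trans (ca s' t' y tT)); rewrite ler_wpM2r// lerDl.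
have bc s' t' y : 0 <= t' <= T -> n3 (fun k' => b s' k' t' y) <= c' * (h y + 1).
  move=> tT; have [nN|bN] := pselect (~ N s' y); last first.
    by rewrite /n3 /b !cut_bad// normr0 !addr0 mulr_ge0.
  rewrite (_ : (fun k' => b s' k' t' y) = (fun k' => V s' k' t' (y + sgn s' * t'))); last first.
    by apply/funext => k'; rewrite /b cut_good.
  by apply: (le_trans (Vc s' t' y tT)); rewrite ler_wpM2r// lerDr.
(* Both solutions have the same data, so stability is used with [e = 0] and yields distance 0. *)
have le0 : locint (cst 0 : R -> R) by exact: locint_cst.
have stab := @label_stability R m c' T ty (fun z => h z + 1) (cst 0) a b m0' c'0 lH H1
  le0 (fun _ => lexx 0) ac bc.
move=> tT.
have ab y : ~ N s y -> a s k t y = b s k t y.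
  move=> nNy; apply: (@d3_eq0 _ (fun k' => a s k' t y) (fun k' => b s k' t y)).
  apply: (le_trans (stab _ s t y tT)).
    move=> s' t' y' tT' G IG hG; rewrite add0r.
    have /andP[t'0 t'T] := tT'.
    have [nN|bN] := pselect (~ N s' y'); last first.
      rewrite (_ : d3 _ _ = 0).
        apply: Rintegral_ge0 => r; rewrite /= in_itv /= => rt.
        exact: (le_trans (n3_ge0 _) (hG r rt)).
      by rewrite /d3 /n3 /a /b !cut_bad// subr0 normr0 !addr0.
    have aI' k' : mu.-integrable `[0, t'] (EFin \o (fun r => csd m ty s' k' (lstate a s' r y'))).
      by apply: integrableS (aI _ _ nN k') => //; exact: sub.
    have bI' k' : mu.-integrable `[0, t'] (EFin \o (fun r => csd m ty s' k' (lstate b s' r y'))).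
      by apply: integrableS (bI _ _ nN k') => //; exact: sub.
    rewrite /d3 (_ : (fun k' => _) = (fun k' => \int[mu]_(r in `[0, t'])
       (csd m ty s' k' (lstate a s' r y') - csd m ty s' k' (lstate b s' r y')))); last first.
      apply/funext => k'; rewrite aE// bE// RintegralB//.
      by rewrite opprD addrACA subrr add0r.
    apply: n3_Rint => //.
    by move=> k'; apply: measurable_funTS; exact: (measurable_funB (mla s' k' y') (mlb s' k' y')).
  rewrite /win Rintegral_cst//= mul0r mulr0 addr0 mulr0//.
have res : {ae mu, forall y : rT, U s k t (y + sgn s * t) = V s k t (y + sgn s * t)}.
  have hNy : {ae mu, forall y : rT, ~ N s y}.
    by exists (N s); split => // y /=; exact: contrapT.
  have hD := D_null s t.
  apply: filterS2 hNy hD => y nN nD.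
  have -> : U s k t (y + sgn s * t) = W s k t y.
    by apply: contrapT => /eqP ne; apply: nD; split => //; exists k.
  by have := ab y nN; rewrite /a /b !cut_good.
(* Back from labels to positions, by a translation at the fixed time [t]. *)
have res' : {ae mu, forall y : rT, U s k t (y - sgn s * t + sgn s * t) = V s k t (y - sgn s * t + sgn s * t)}.
  exact: (ae_shift (- (sgn s * t)) res).
by move: res'; apply: filterS => x; rewrite subrK.
Qed.

End WeakUniqueness.

(** * Norms of the solution *)

Section TransverseProducts.
Context {R : realType}.
Local Notation mu := (@lebesgue_measure R).
Local Notation rT := (measurableTypeR R).
Variables (p : \bar R) (c T K e : R) (h : rT -> R) (F E : R -> R -> R).
Hypotheses (p1 : (1 <= p)%E) (c0 : 0 <= c) (T0 : 0 < T) (K0 : 0 <= K) (e0 : 0 <= e).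
Hypotheses (mh : measurable_fun setT h) (h0 : forall z, 0 <= h z).
Hypotheses (hc : (nm p h <= c%:E)%E) (jF : jm F) (F0 : forall t x, 0 <= F t x).
Hypothesis mE : forall t : R, 0 <= t <= T -> measurable_fun setT (E t).
Hypothesis E0 : forall t x : R, 0 <= t <= T -> 0 <= E t x.
Hypothesis Ee : forall t : R, 0 <= t <= T -> (nm p (E t) <= e%:E)%E.
Hypothesis FE : forall t x : R, 0 <= t <= T ->
  F t x <= K * (h (x - t) * h (x + t)) + E t x.

Let mF t : measurable_fun setT (fun x : rT => (F t x)%:E).
Proof. by apply/measurable_EFinP; apply: (jm_comp jF). Qed.

Let mhh (f : rT -> R) t : measurable_fun setT f ->
  measurable_fun setT (fun x : rT => (f (x - t) * f (x + t))%:E).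
Proof.
by move=> mf; apply/measurable_EFinP; apply: measurable_funM; exact: measurable_shift.
Qed.

Let jhh (f : rT -> R) : measurable_fun setT f ->
  measurable_fun setT (fun z : rT * rT => (f (z.2 - z.1) * f (z.2 + z.1))%:E).
Proof.
move=> mf; apply/measurable_EFinP; apply: measurable_funM.
  by apply: (measurableT_comp mf); exact: measurable_funB.
by apply: (measurableT_comp mf); exact: measurable_funD.
Qed.

Let msec (f : R -> R -> R) (D : set rT) : measurable D -> jm f -> (forall t x, 0 <= f t x) ->
  measurable_fun setT (fun t : rT => \int[mu]_(x in D) (f t x)%:E)%E.
Proof.
move=> mD jf f0.
pose g (z : rT * rT) : \bar R := (f z.1 z.2 * \1_D z.2)%:E.
have mg : measurable_fun setT g.
  apply/measurable_EFinP; apply: measurable_funM => //.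
  by apply: (measurableT_comp (measurable_indic mD)).
rewrite (_ : (fun t => _) = (fun t : rT => \int[mu]_x g (t, x))%E).
  by apply: (measurable_fun_fubini_tonelli_F g mg) => z; rewrite lee_fin mulr_ge0.
apply/funext => t; rewrite integral_mkcond; apply: eq_integral => x _.
by rewrite patchE /g /= indicE; case: (x \in D); rewrite ?mulr1 ?mulr0.
Qed.

Let mhh_int (f : rT -> R) : measurable_fun setT f -> (forall z, 0 <= f z) ->
  measurable_fun setT (fun t : rT => \int[mu]_x (f (x - t)%R * f (x + t)%R)%:E)%E.
Proof.
move=> mf f0.
apply: (@measurable_fun_fubini_tonelli_F _ _ _ _ _ mu
  (fun z : rT * rT => (f (z.2 - z.1) * f (z.2 + z.1))%:E) (jhh mf)).
by move=> z; rewrite lee_fin mulr_ge0.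
Qed.

(** Only values of [h] on [A], the labels of characteristics meeting the rectangle, enter. Cut to
    [A], [h] is integrable whatever [p] is, and the product of two transverse waves is integrable in
    space-time. *)
Lemma transverse_locint (n : nat) :
  (\int[mu]_(t in `[0%R, T]) \int[mu]_(x in `[(- n%:R)%R, n%:R]) (F t x)%:E < +oo)%E.
Proof.
have T0' := ltW T0.
pose B := `[(- n%:R : R), n%:R]%classic : set rT.
have mB : measurable B by exact: measurable_itv.
have n0 : 0 <= n%:R :> R by [].
pose A := `[(- n%:R - T : R), n%:R + T]%classic : set rT.
have mA : measurable A by exact: measurable_itv.
pose g : rT -> R := fun x => h x * \1_A x.
have mg : measurable_fun setT g by apply: measurable_funM => //; exact: measurable_indic.
have g0 z : 0 <= g z by rewrite mulr_ge0.
have c1 : 0 < c + 1 by rewrite ltr_wpDl.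
have e1 : 0 < e + 1 by rewrite ltr_wpDl.
have gI : (\int[mu]_x (g x)%:E <= ((1 + (2 * n%:R + 2 * T)) * (c + 1))%:E)%E.
  rewrite (_ : (\int[mu]_x _)%E = (\int[mu]_(x in A) `|h x|%:E)%E); last first.
    rewrite [RHS]integral_mkcond; apply: eq_integral => x _.
    by rewrite patchE /g indicE; case: (x \in A); rewrite ?mulr1 ?mulr0// ger0_norm.
  apply: (integral_nm_le p1) => //; first lra.
    by rewrite mu_itv_le ?lee_fin; lra.
  by apply: le_trans hc _; rewrite lee_fin lerDl.
have inner (t : rT) : `[0, T]%classic t ->
    (\int[mu]_(x in B) (F t x)%:E <= K%:E * \int[mu]_x (g (x - t)%R * g (x + t)%R)%:E +
      ((1 + 2 * n%:R) * (e + 1))%:E)%E.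
  rewrite /= in_itv /= => tT; have [t0 tT'] := andP tT.
  apply: (@le_trans _ _ (\int[mu]_(x in B) ((K%:E * (g (x - t)%R * g (x + t)%R)%:E) + (E t x)%:E))%E).
    apply: ge0_le_integral => //.
    - by move=> x _; rewrite lee_fin.
    - exact: measurable_funTS.
    - apply: measurable_funTS; apply: emeasurable_funD.
        by apply: measurable_funeM; exact: mhh.
      by apply/measurable_EFinP; exact: mE.
    - move=> x; rewrite /B /= in_itv /= => /andP[x1 x2].
      rewrite -EFinM -EFinD lee_fin; apply: (le_trans (FE _ tT)).
      rewrite /g !indicE !mem_set ?mulr1//; rewrite /A /= in_itv /=; apply/andP; split; lra.
  rewrite (ge0_integralD mu mB) //; first last.
  - by apply: measurable_funTS; apply/measurable_EFinP; exact: mE.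
  - by move=> x _; rewrite lee_fin E0.
  - by apply: measurable_funTS; apply: measurable_funeM; exact: mhh.
  - by move=> x _; rewrite -EFinM lee_fin !mulr_ge0.
  apply: leeD.
    rewrite ge0_integralZl//; last 2 first.
      by apply: measurable_funTS; exact: mhh.
      by move=> x _; rewrite lee_fin mulr_ge0.
    apply: lee_wpmul2l; first by rewrite lee_fin.
    apply: ge0_subset_integral => //; first exact: mhh.
    by move=> x _; rewrite lee_fin mulr_ge0.
  rewrite (_ : (\int[mu]_(x in B) (E t x)%:E)%E = (\int[mu]_(x in B) `|E t x|%:E)%E); last first.
    by apply: eq_integral => x _; rewrite ger0_norm// E0.
  apply: (integral_nm_le p1) => //.
  - by rewrite mu_itv_le ?lee_fin; lra.
  - exact: mE.
  - by apply: le_trans (Ee tT) _; rewrite lee_fin lerDl.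
apply: (@le_lt_trans _ _ (\int[mu]_(t in `[0%R, T])
   (K%:E * \int[mu]_x (g (x - t)%R * g (x + t)%R)%:E + ((1 + 2 * n%:R) * (e + 1))%:E))%E).
  apply: ge0_le_integral => //.
  - by move=> t _; apply: integral_ge0 => x _; rewrite lee_fin.
  - by apply: measurable_funTS; exact: msec.
  - apply: measurable_funTS; apply: emeasurable_funD => //.
    by apply: measurable_funeM; exact: mhh_int.
have k1 : 0 <= (1 + 2 * n%:R) * (e + 1) by rewrite mulr_ge0//; lra.
have gg0 t : (0 <= \int[mu]_x (g (x - t)%R * g (x + t)%R)%:E)%E.
  by apply: integral_ge0 => x _; rewrite lee_fin mulr_ge0.
rewrite (ge0_integralD mu) //; last 2 first.
- by move=> t _; rewrite mule_ge0.
- by apply: measurable_funTS; apply: measurable_funeM; exact: mhh_int.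
apply: lte_add_pinfty.
  rewrite ge0_integralZl//; last by apply: measurable_funTS; exact: mhh_int.
  apply: lte_mul_pinfty => //.
  apply: (@le_lt_trans _ _ (\int[mu]_t \int[mu]_x (g (x - t)%R * g (x + t)%R)%:E)%E).
    by apply: ge0_subset_integral => //; exact: mhh_int.
  rewrite integral_transverse_product//.
  have gfin : (\int[mu]_x (g x)%:E < +oo)%E by apply: le_lt_trans gI _; rewrite ltry.
  have gI0 : (0 <= \int[mu]_x (g x)%:E)%E by apply: integral_ge0 => x _; rewrite lee_fin.
  apply: lte_mul_pinfty => //.
  by apply: lte_mul_pinfty => //; rewrite ge0_fin_numE.
rewrite integral_cst//= mu_itv_le//.
by rewrite -EFinM ltry.
Qed.

(** For finite [p = r], comparing the two summands gives [(a + b) ^ r <= (2 a) ^ r + (2 b) ^ r], and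
    the transverse product formula is applied to [h ^ r]. For [p = +oo] the pointwise bounds
    suffice. *)
Lemma transverse_mixed_norm :
  (Lnorm mu p ((fun t : rT => nm p (F t)) \_ `[0%R, T]) < +oo)%E.
Proof.
have T0' := ltW T0.
have mhh' t : measurable_fun setT (fun x : rT => h (x - t) * h (x + t)).
  by apply: measurable_funM; exact: measurable_shift.
have mF' t : measurable_fun setT (F t) by apply: (jm_comp jF).
case: p p1 hc Ee => [r||] //= r1 hc' Ee'.
- rewrite lee_fin in r1; have r0 : 0 < r by lra.
  rewrite unlock /=; apply: poweR_lty.
  pose hr : rT -> R := fun x => h x `^ r.
  have mhr : measurable_fun setT hr by exact: (measurableT_comp (measurable_powR r) mh).
  have hr0 z : 0 <= hr z by exact: powR_ge0.
  pose K' := (2 * K) `^ r; pose e' := (2 * e) `^ r.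
  have K'0 : 0 <= K' by exact: powR_ge0.
  have e'0 : 0 <= e' by exact: powR_ge0.
  have hrI : (\int[mu]_x (hr x)%:E <= (c `^ r)%:E)%E.
    rewrite (_ : (\int[mu]_x (hr x)%:E)%E = (\int[mu]_x (`|h x| `^ r)%:E)%E).
      exact: (nmr_leP h r1 c0).1 hc'.
    by apply: eq_integral => x _; rewrite ger0_norm.
  have inner (t : rT) : `[0, T]%classic t ->
      (\int[mu]_x (`|F t x| `^ r)%:E <= K'%:E * \int[mu]_x (hr (x - t)%R * hr (x + t)%R)%:E + e'%:E)%E.
    rewrite /= in_itv /= => tT; have mEt := mE tT.
    apply: (@le_trans _ _ (\int[mu]_x ((K'%:E * (hr (x - t)%R * hr (x + t)%R)%:E) +
        ((2 `^ r)%:E * (`|E t x| `^ r)%:E)))%E).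
      apply: ge0_le_integral => //.
      - exact: (measurable_absX r (mF' t)).
      - apply: emeasurable_funD; apply: measurable_funeM; first exact: mhh.
        exact: (measurable_absX r mEt).
      - move=> x _; rewrite -!EFinM -EFinD lee_fin.
        have a0 : 0 <= K * (h (x - t) * h (x + t)) by rewrite !mulr_ge0.
        have b0 := E0 x tT.
        rewrite (ger0_norm (F0 t x)) (ger0_norm b0).
        rewrite /K' /hr -!powRM ?mulr_ge0//.
        move: (FE x tT); move: a0; rewrite -[2 * K * _]mulrA.
        move: (K * _) (E t x) b0 => a b b0 a0 Fab.
        have [ab|ba] := leP a b.
          apply: (@le_trans _ _ ((2 * b) `^ r)); last by rewrite lerDr powR_ge0.
          by apply: ge0_ler_powR; rewrite ?nnegrE ?F0 ?mulr_ge0//; lra.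
        apply: (@le_trans _ _ ((2 * a) `^ r)); last by rewrite lerDl powR_ge0.
        by apply: ge0_ler_powR; rewrite ?nnegrE ?F0 ?mulr_ge0//; lra.
    rewrite ge0_integralD//; first last.
    - by apply: measurable_funeM; exact: (measurable_absX r mEt).
    - by apply: measurable_funeM; exact: mhh.
    - by move=> x _; rewrite -EFinM lee_fin !mulr_ge0.
    rewrite ge0_integralZl//; last 2 first.
    - exact: mhh.
    - by move=> x _; rewrite lee_fin mulr_ge0.
    apply: leeD => //.
    rewrite ge0_integralZl ?lee_fin ?powR_ge0//; last exact: (measurable_absX r mEt).
    have := (nmr_leP (E t) r1 e0).1 (Ee' t tT) => /(lee_wpmul2l (_ : (0 <= (2 `^ r)%:E)%E)) hE.
    by apply: (le_trans (hE _)); rewrite ?lee_fin ?powR_ge0// -powRM.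
  apply: (@le_lt_trans _ _ (\int[mu]_(t in `[0%R, T])
     (K'%:E * \int[mu]_x (hr (x - t)%R * hr (x + t)%R)%:E + e'%:E))%E).
    rewrite (_ : (\int[mu]_t _)%E = (\int[mu]_(t in `[0%R, T]) \int[mu]_x (`|F t x| `^ r)%:E)%E); last first.
      rewrite [RHS]integral_mkcond; apply: eq_integral => t _; rewrite !patchE.
      case: ifPn => [_|_]; last by rewrite abse0 poweR0r// gt_eqF.
      rewrite gee0_abs ?nm_ge0// nmrE -poweRrM mulVf ?gt_eqF// poweRe1//.
      by apply: integral_ge0 => x _; rewrite lee_fin powR_ge0.
    apply: ge0_le_integral => //.
    - by move=> t _; apply: integral_ge0 => x _; rewrite lee_fin powR_ge0.
    - apply: measurable_funTS; apply: (@msec (fun t x => `|F t x| `^ r)) => //.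
      by apply: (measurableT_comp (measurable_powR r)); exact: measurableT_comp.
    - apply: measurable_funTS; apply: emeasurable_funD => //.
      by apply: measurable_funeM; exact: mhh_int.
  have gg0 t : (0 <= \int[mu]_x (hr (x - t)%R * hr (x + t)%R)%:E)%E.
    by apply: integral_ge0 => x _; rewrite lee_fin mulr_ge0.
  rewrite (ge0_integralD mu) //; last 2 first.
  - by move=> t _; rewrite mule_ge0.
  - by apply: measurable_funTS; apply: measurable_funeM; exact: mhh_int.
  apply: lte_add_pinfty.
    rewrite ge0_integralZl//; last by apply: measurable_funTS; exact: mhh_int.
    apply: lte_mul_pinfty => //.
    apply: (@le_lt_trans _ _ (\int[mu]_t \int[mu]_x (hr (x - t)%R * hr (x + t)%R)%:E)%E).
      by apply: ge0_subset_integral => //; exact: mhh_int.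
    rewrite integral_transverse_product//.
    have gfin : (\int[mu]_x (hr x)%:E < +oo)%E by apply: le_lt_trans hrI _; rewrite ltry.
    have gI0 : (0 <= \int[mu]_x (hr x)%:E)%E by apply: integral_ge0 => x _; rewrite lee_fin.
    apply: lte_mul_pinfty => //.
    by apply: lte_mul_pinfty => //; rewrite ge0_fin_numE.
  by rewrite integral_cst//= mu_itv_le// -EFinM ltry.
- apply: (@le_lt_trans _ _ (K * (c * c) + e)%:E); last by rewrite ltry.
  rewrite unlock mu_setT_gt0.
  have bd : {ae mu, forall t : rT, ((abse \o ((fun t : rT => nm +oo%E (F t)) \_ `[0%R, T])) t <= (K * (c * c) + e)%:E)%E}.
    apply: aeW => t /=; rewrite patchE; case: ifPn => [|_]; last first.
      by rewrite abse0 lee_fin addr_ge0// !mulr_ge0.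
    rewrite inE /= in_itv /= => tT; rewrite gee0_abs ?nm_ge0//.
    apply/nmy_leP.
    have hb : {ae mu, forall x : rT, `|h x| <= c} by exact/nmy_leP.
    have h1 : {ae mu, forall x : rT, `|h (x - t)| <= c} by exact: (ae_shift (- t) hb).
    have h2 : {ae mu, forall x : rT, `|h (x + t)| <= c} by exact: (ae_shift t hb).
    have h3 : {ae mu, forall x : rT, `|E t x| <= e} by apply/nmy_leP; exact: Ee'.
    apply: filterS3 h1 h2 h3 => x; rewrite !ger0_norm ?E0// => q1 q2 q3.
    apply: (le_trans (FE x tT)); apply: lerD => //; apply: ler_wpM2l => //.
    exact: ler_pM.
  exact/ess_supP.
Qed.

End TransverseProducts.

(** * Dominated convergence in norm *)

Section DominatedNorm.
Context {R : realType}.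
Local Notation mu := (@lebesgue_measure R).
Local Notation rT := (measurableTypeR R).

Lemma Rint_shift c (F : rT -> R) : measurable_fun setT F ->
  \int[mu]_x F (x + c) = \int[mu]_x F x.
Proof.
move=> mF; rewrite /Rintegral [in LHS]integralE [in RHS]integralE.
have mE : measurable_fun setT (EFin \o F) by exact/measurable_EFinP.
congr (fine (_ - _)).
  rewrite -(@ge0_integral_shift _ c (funepos (EFin \o F)))//; last exact: measurable_funepos.
  by apply: eq_integral => x _; rewrite unlock.
rewrite -(@ge0_integral_shift _ c (funeneg (EFin \o F)))//; last exact: measurable_funeneg.
by apply: eq_integral => x _; rewrite unlock.
Qed.

(** Dominated convergence for the powers; one index suffices, as that is all [eps_delta_of_seq] asks
    for. *)
Lemma nm_dominated (r : R) (G : nat -> rT -> R) (g : rT -> R) : 1 <= r ->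
  (forall n, measurable_fun setT (G n)) -> measurable_fun setT g ->
  (forall n x, `|G n x| <= g x) -> (nm r%:E g < +oo)%E ->
  (forall x, G n x @[n --> \oo] --> 0) ->
  forall e : R, 0 < e -> exists n, (nm r%:E (G n) <= e%:E)%E.
Proof.
move=> r1 mG mg Gg ng cG e e0.
have r0 : 0 < r by lra.
have g0 x : 0 <= g x by exact: le_trans (Gg 0%N x).
have m1 k : measurable_fun setT (fun x : rT => (`|G k x| `^ r)%:E).
  exact: (measurable_absX r (mG k)).
have I1 : mu.-integrable setT (fun x : rT => (`|g x| `^ r)%:E).
  apply/integrableP; split; first exact: measurable_absX.
  have nF' : nm r%:E g = (fine (nm r%:E g))%:E.
    by rewrite fineK// ge0_fin_numE// nm_ge0.
  have := lexx (nm r%:E g); rewrite {2}nF' => /(nmr_leP g r1 (fine_ge0 (nm_ge0 _ _))).1 h.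
  apply: (@le_lt_trans _ _ (fine (nm r%:E g) `^ r)%:E); last exact: ltry.
  apply: le_trans h; rewrite le_eqVlt; apply/orP; left; apply/eqP.
  by apply: eq_integral => x _; rewrite gee0_abs// lee_fin powR_ge0.
have cv : {ae mu, forall x : rT, setT x ->
    ((`|G k x| `^ r)%:E) @[k --> \oo] --> cst 0%E x}.
  apply: aeW => x _; apply: cvg_EFin; first by near=> n.
  apply/cvgr0Pnorm_le => d d0.
  have : \forall k \near \oo, `|G k x| <= d `^ r^-1.
    by move/cvgr0Pnorm_le : (cG x); apply; exact: powR_gt0.
  apply: filterS => k hk; rewrite /= ger0_norm ?powR_ge0//.
  rewrite -[leRHS](powRr1 (ltW d0)) -(mulVf (lt0r_neq0 r0)) powRrM.
  by apply: ge0_ler_powR => //; rewrite ?nnegrE ?powR_ge0// ltW.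
have dom : {ae mu, forall (x : rT) (k : nat), setT x ->
    (`|(`|G k x| `^ r)%:E| <= (`|g x| `^ r)%:E)%E}.
  apply: aeW => x k _; rewrite gee0_abs ?lee_fin ?powR_ge0//.
  by apply: ge0_ler_powR; rewrite ?nnegrE ?normr_ge0 ?(ltW r0)// (ger0_norm (g0 x)).
have cst0 : measurable_fun setT (cst 0%E : rT -> \bar R) by [].
have [_ h _] := @dominated_convergence _ _ _ mu _ measurableT
  (fun k x => (`|G k x| `^ r)%:E) (cst 0%E) _ m1 cst0 cv I1 dom.
have er : 0 < e `^ r by exact: powR_gt0.
move: h => /fine_cvgP[[N _ hN] /cvgr0Pnorm_le/(_ _ er)[N' _ hN']].
pose k := maxn N N'.
have := hN k (leq_maxl _ _).
have := hN' k (leq_maxr _ _).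
rewrite /= => h2 h1; exists k; apply/nmr_leP => //; first exact: ltW.
apply: (@le_trans _ _ (fine (\int[mu]_x `|(`|G k x| `^ r)%:E - cst 0 x|)%E)%:E).
  rewrite fineK//; apply: ge0_le_integral => //.
    by apply: measurableT_comp => //; apply: emeasurable_funB => //.
  by move=> x _; rewrite sube0 lee_abs.
by rewrite lee_fin (le_trans (ler_norm _)).
Unshelve. all: by end_near. Qed.

End DominatedNorm.

Section IntegrableNorm.
Context {R : realType}.
Local Notation mu := (@lebesgue_measure R).
Local Notation rT := (measurableTypeR R).

Lemma nm1E (F : rT -> R) : nm 1%:E F = (\int[mu]_x `|F x|%:E)%E.
Proof. exact: Lnorm1. Qed.

Lemma nm1_integrable (F : rT -> R) : measurable_fun setT F ->
  (nm 1%:E F < +oo)%E -> mu.-integrable setT (EFin \o F).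
Proof.
move=> mF; rewrite nm1E => IF; apply/integrableP; split => //.
exact/measurable_EFinP.
Qed.

Lemma integrable_nm1 (F : rT -> R) : mu.-integrable setT (EFin \o F) ->
  (nm 1%:E F < +oo)%E.
Proof. by rewrite nm1E => /integrableP[]. Qed.

Lemma norm_Rint_nm1 (F : rT -> R) (e : R) : measurable_fun setT F ->
  (nm 1%:E F <= e%:E)%E -> `|\int[mu]_x F x| <= e.
Proof.
move=> mF Fe; have IF : mu.-integrable setT (EFin \o F).
  by apply: nm1_integrable => //; exact: le_lt_trans Fe (ltry _).
rewrite (le_trans (le_normr_Rintegral measurableT IF))//.
rewrite -lee_fin (le_trans _ Fe)// nm1E /Rintegral fineK//.
by have := integrable_abse IF => /integral_fune_fin_num; apply.
Qed.

End IntegrableNorm.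

(** * Norms and time continuity of the constructed solution *)

Section GlobalSolution.
Context {R : realType}.
Local Notation mu := (@lebesgue_measure R).
Local Notation rT := (measurableTypeR R).
Implicit Types (s : bool) (k : component).
Variables (p : \bar R) (m c : R) (ty : bool) (h : rT -> R).
Variables (f : bool -> component -> R -> R) (U : bool -> component -> R -> R -> R).
Hypotheses (p1 : (1 <= p)%E) (m0 : 0 < m) (c0 : 0 <= c).
Hypotheses (mh : measurable_fun setT h) (h0 : forall z, 0 <= h z) (hc : (nm p h <= c%:E)%E).

(** The shift by 1 in [uloc] adds [2 t] to the window bound [(1 + 2 t) * c], which [c + 1] absorbs;
    it also makes the constant at least 1. *)
Lemma uloc_nm : uloc (c + 1) h.
Proof.
have lh : locint h by exact: (nm_locint p1 mh hc).
split => //; first by rewrite lerDr.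
move=> t x t0; rewrite win_add1//.
have := win_nm x p1 mh h0 hc t0; have := mulr_ge0 c0 t0.
by move: (win _ _ _) => w; lra.
Qed.

Hypothesis jU : forall s k, jm (U s k).
Hypothesis UE : forall s k t y, 0 <= t -> U s k t (y + sgn s * t) = f s k y +
  \int[mu]_(r in `[0, t]) csd m ty s k (fun s' k' => U s' k' r (y + sgn s * r)).
Hypothesis Ule : forall s t y, 0 <= t -> n3 (fun k => U s k t (y + sgn s * t)) <=
  Gam m (c + 1) t * (h y + win h t (y + sgn s * t)).

Let lh : locint h. Proof. by case: uloc_nm. Qed.
Let m0' : 0 <= m. Proof. exact: ltW. Qed.
Let M0 : 0 <= c + 1. Proof. exact: addr_ge0. Qed.

Let G T := Gam m (c + 1) T.
Let N T := (c + 1) * (1 + 2 * T).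

Let G1 T : 0 <= T -> 1 <= G T. Proof. exact: Gam_ge1. Qed.

Let G0 T : 0 <= T -> 0 <= G T. Proof. by move=> /G1; exact: le_trans. Qed.

Let winN t T x : 0 <= t <= T -> win h t x <= N T.
Proof.
move=> /andP[t0 tT]; apply: (le_trans (uloc_win x uloc_nm t0)).
by rewrite /N ler_wpM2l//; lra.
Qed.

Lemma sol_le s t T x : 0 <= t <= T ->
  n3 (fun k => U s k t x) <= G T * (h (x - sgn s * t) + win h t x).
Proof.
move=> /andP[t0 tT].
have := Ule s (x - sgn s * t) t0; rewrite subrK => /le_trans; apply.
by rewrite ler_wpM2r ?Gam_nd// addr_ge0// win_ge0.
Qed.

Lemma sol_label_le s t T y : 0 <= t <= T ->
  n3 (fun k => U s k t (y + sgn s * t)) <= G T * (h y + N T).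
Proof.
move=> tT; apply: (le_trans (sol_le s _ tT)); rewrite addrK.
apply: ler_wpM2l; last by rewrite lerD2l; exact: winN.
by case/andP : tT => t0 /(le_trans t0); exact: G0.
Qed.

Let mn3 s t : measurable_fun setT (fun x : rT => n3 (fun k => U s k t x)).
Proof. by apply: measurable_n3 => k; apply: (jm_comp (jU s k)). Qed.

Let jn3 s : jm (fun t x => n3 (fun k => U s k t x)).
Proof. by apply: measurable_n3 => k; exact: jU. Qed.

Let mwin t : measurable_fun setT (fun x : rT => win h t x).
Proof. exact: measurable_win. Qed.

Lemma sol_nm s t T : 0 <= t <= T ->
  (nm p (fun x => n3 (fun k => U s k t x)) <= (G T * (c + (1 + 2 * T) ^+ 2 * c))%:E)%E.
Proof.
move=> tT; have [t0 tT'] := andP tT.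
have T0 : 0 <= T by exact: le_trans tT'.
have g1 := G1 T0.
have mhs : measurable_fun setT (fun x : rT => h (x - sgn s * t)) by exact: measurable_shift.
apply: (@le_trans _ _ (nm p (fun x => G T * (h (x - sgn s * t) + win h t x)))).
  apply: nm_mono => //.
    by apply: measurable_funM => //; exact: measurable_funD.
  apply: aeW => x; rewrite ger0_norm ?n3_ge0// ger0_norm; first exact: sol_le.
  by rewrite mulr_ge0 ?G0 ?addr_ge0 ?win_ge0.
apply: nmZ_le => //; first exact: G0.
- by rewrite addr_ge0// mulr_ge0// sqr_ge0.
- exact: measurable_funD.
apply: (le_trans (nmD p1 mhs (mwin t))); rewrite EFinD; apply: leeD.
  by rewrite (nm_shift _ p1 mh).
apply: (le_trans (nm_win p1 mh h0 c0 hc t0)).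
by rewrite lee_fin ler_wpM2r// ler_sqr ?nnegrE; lra.
Qed.

Let F t x := n3 (fun k => U false k t x) * n3 (fun k => U true k t x).
(** What remains of the product of the two pointwise bounds after [h (x - t) * h (x + t)] is split
    off: each remaining term has a window as a factor, replaced by its bound [N T]. *)
Let E T t x := G T ^+ 2 * N T * (h (x - t) + h (x + t) + win h t x).

Let jF : jm F. Proof. by apply: measurable_funM; exact: jn3. Qed.

Let F0 t x : 0 <= F t x. Proof. by rewrite mulr_ge0// n3_ge0. Qed.

Let N0 T : 0 <= T -> 0 <= N T. Proof. by move=> T0; rewrite mulr_ge0//; lra. Qed.

Let mE T t : measurable_fun setT (E T t).
Proof.
have m12 := measurable_funD (measurable_shift (- t) mh) (measurable_shift t mh).
exact: (measurable_funM (measurable_cst (G T ^+ 2 * N T)) (measurable_funD m12 (mwin t))).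
Qed.

Let E0 T t x : 0 <= t <= T -> 0 <= E T t x.
Proof.
move=> /andP[t0 tT]; have T0 : 0 <= T by exact: le_trans tT.
by rewrite mulr_ge0 ?addr_ge0 ?win_ge0// mulr_ge0 ?sqr_ge0 ?N0.
Qed.

Let e T := G T ^+ 2 * N T * (c + c + (1 + 2 * T) ^+ 2 * c).

Let e0 T : 0 <= T -> 0 <= e T.
Proof.
move=> T0; rewrite mulr_ge0//; first by rewrite mulr_ge0 ?sqr_ge0 ?N0.
by rewrite !addr_ge0// mulr_ge0// sqr_ge0.
Qed.

Let Ee T t : 0 <= t <= T -> (nm p (E T t) <= (e T)%:E)%E.
Proof.
move=> /andP[t0 tT]; have T0 : 0 <= T by exact: le_trans tT.
have mh1 : measurable_fun setT (fun x : rT => h (x - t)) by exact: measurable_shift.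
have mh2 : measurable_fun setT (fun x : rT => h (x + t)) by exact: measurable_shift.
have mh12 := measurable_funD mh1 mh2.
apply: nmZ_le => //.
- by rewrite mulr_ge0 ?sqr_ge0 ?N0.
- by rewrite !addr_ge0// mulr_ge0// sqr_ge0.
- exact: measurable_funD.
apply: (le_trans (nmD p1 mh12 (mwin t))); rewrite EFinD; apply: leeD.
  apply: (le_trans (nmD p1 mh1 mh2)); rewrite EFinD; apply: leeD.
    by rewrite (nm_shift _ p1 mh).
  by rewrite (nm_shift _ p1 mh).
apply: (le_trans (nm_win p1 mh h0 c0 hc t0)).
by rewrite lee_fin ler_wpM2r// ler_sqr ?nnegrE; lra.
Qed.

Let FE T t x : 0 <= t <= T -> F t x <= G T ^+ 2 * (h (x - t) * h (x + t)) + E T t x.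
Proof.
move=> tT; have [t0 tT'] := andP tT.
have T0 : 0 <= T by exact: le_trans tT'.
have h1 := sol_le false x tT; have h2 := sol_le true x tT.
rewrite /sgn expr0 mul1r in h1; rewrite /sgn expr1 mulN1r opprK in h2.
apply: (le_trans (ler_pM (n3_ge0 _) (n3_ge0 _) h1 h2)).
have w1 := winN x tT; have w0 : 0 <= win h t x by exact: win_ge0.
apply: (@le_trans _ _ (G T ^+ 2 * (h (x - t) * h (x + t)) +
    G T ^+ 2 * (win h t x * (h (x - t) + h (x + t) + win h t x)))).
  by rewrite le_eqVlt; apply/orP; left; apply/eqP; ring.
apply: lerD => //; rewrite /E -mulrA; apply: ler_wpM2l; first exact: sqr_ge0.
by apply: ler_wpM2r => //; rewrite !addr_ge0.
Qed.

Lemma sol_product_locint T (n : nat) : 0 < T ->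
  (\int[mu]_(t in `[0%R, T]) \int[mu]_(x in `[(- n%:R)%R, n%:R])
     (n3 (fun k => U false k t x) * n3 (fun k => U true k t x))%:E < +oo)%E.
Proof.
move=> T0; have T0' := ltW T0.
exact: (@transverse_locint _ p c T (G T ^+ 2) (e T) h F (E T) p1 c0 T0 (sqr_ge0 _) (e0 T0')
  mh h0 hc jF F0 (fun t _ => mE T t) (fun t x => @E0 T t x) (fun t => @Ee T t) (fun t x => @FE T t x)).
Qed.

Lemma sol_product_mixed_norm T (Phi : R -> R -> R) : 0 < T -> jm Phi ->
  (forall t x, 0 <= Phi t x) ->
  (forall t x, Phi t x <= 2 * (n3 (fun k => U false k t x) * n3 (fun k => U true k t x))) ->
  (Lnorm mu p ((fun t : rT => nm p (Phi t)) \_ `[0%R, T]) < +oo)%E.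
Proof.
move=> T0 jPhi Phi0 PhiF; have T0' := ltW T0.
apply: (@transverse_mixed_norm _ p c T (2 * G T ^+ 2) (2 * e T) h Phi (fun t x => 2 * E T t x)
  p1 c0 T0 _ _ mh h0 hc jPhi Phi0).
- by rewrite mulr_ge0 ?sqr_ge0.
- by rewrite mulr_ge0 ?e0.
- by move=> t _; apply: measurable_funM; [exact: measurable_cst|exact: mE].
- by move=> t x tT; rewrite mulr_ge0 ?E0.
- by move=> t tT; exact: (nmZ_le p1 (ler0n _ 2) (e0 T0') (mE T t) (Ee tT)).
- move=> t x tT; apply: (le_trans (PhiF t x)).
  by rewrite -mulrA -mulrDr ler_wpM2l// FE.
Qed.

Let VL s k t y := U s k t (y + sgn s * t).

Let mVL s k t : measurable_fun setT (fun y : rT => VL s k t y).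
Proof. by apply: (jm_comp (jm_label s (jU s k))). Qed.

(** At a fixed label the solution is a datum plus a primitive, hence continuous in time. Only the
    passage from labels to positions involves translations. *)
Let label_continuous s k y t0 : 0 <= t0 -> forall e : R, 0 < e ->
  exists2 d : R, 0 < d & forall t, 0 <= t -> `|t - t0| < d -> `|VL s k t y - VL s k t0 y| <= e.
Proof.
move=> t00 eps eps0; pose T := t0 + 1.
have T0 : 0 <= T by rewrite addr_ge0.
have g1 := G1 T0; have n0 := N0 T0.
pose c' := G T * (N T + 1).
have c'0 : 0 <= c' by rewrite mulr_ge0 ?G0 ?addr_ge0.
have bd s' t y' : 0 <= t <= T -> n3 (fun k' => U s' k' t (y' + sgn s' * t)) <= c' * (h y' + 1).
  move=> tT; apply: (le_trans (sol_label_le s' y' tT)).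
  rewrite /c' -mulrA; apply: ler_wpM2l; first exact: G0.
  have := mulr_ge0 n0 (h0 y'); have := h0 y'; lra.
have lH : locint (fun z => h z + 1) by apply: locintD => //; exact: locint_cst.
have Hp z : 0 <= h z + 1 by rewrite addr_ge0.
have I := @csd_char_integrable R m c' T ty (fun z => h z + 1) U s T y k m0' c'0 lH Hp jU bd (lexx T).
have /subspace_continuousP/(_ t0) := parameterized_integral_continuous T0 I.
have t0T : `[0, T]%classic t0 by rewrite /= in_itv /= t00 /=; rewrite /T; lra.
move=> /(_ t0T)/cvgrPdist_le/(_ _ eps0)/nbhs_normP[d /= d0 hd].
exists (Num.min d 1); first by rewrite lt_min d0 ltr01.
move=> t t_0; rewrite lt_min => /andP[td t1].
have tT : `[0, T]%classic t.
  rewrite /= in_itv /= t_0 /= /T; move: t1; rewrite ltr_norml => /andP[_ ?]; lra.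
have := hd t; rewrite /ball_ /= distrC => /(_ td tT).
rewrite /VL !UE// opprD addrACA subrr add0r distrC.
by rewrite /parameterized_integral.
Qed.

(** One function of the label that dominates the solution at all times up to [T], since windows
    along a characteristic are nested; it is the dominating function for the limits in time. *)
Let majorant s T y := G T * (h y + win h T (y + sgn s * T)).

Let majorant_ge0 s T y : 0 <= T -> 0 <= majorant s T y.
Proof.
by move=> T0; rewrite mulr_ge0 ?G0 ?addr_ge0 ?win_ge0.
Qed.

Let VL_le s k t T y : 0 <= t <= T -> `|VL s k t y| <= majorant s T y.
Proof.
move=> tT; have [t0 tT'] := andP tT.
apply: (le_trans (le_n3 (fun k => VL s k t y) k)).
apply: (le_trans (sol_le s _ tT)); rewrite addrK.
rewrite ler_wpM2l ?lerD2l ?win_nd//.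
exact: G0 (le_trans t0 tT').
Qed.

Let mmajorant s T : measurable_fun setT (fun y : rT => majorant s T y).
Proof.
apply: measurable_funM => //; apply: measurable_funD => //.
exact: (measurable_shift (sgn s * T) (mwin T)).
Qed.

Let nm_majorant s T : 0 <= T -> (nm p (fun y => majorant s T y) < +oo)%E.
Proof.
move=> T0.
have mw : measurable_fun setT (fun y : rT => win h T (y + sgn s * T)).
  exact: (measurable_shift (sgn s * T) (mwin T)).
apply: (@le_lt_trans _ _ (G T * (c + (1 + 2 * T) ^+ 2 * c))%:E); last exact: ltry.
apply: nmZ_le => //.
- exact: G0.
- by rewrite addr_ge0// mulr_ge0// sqr_ge0.
- exact: measurable_funD.
apply: (le_trans (nmD p1 mh mw)); rewrite EFinD; apply: leeD => //.
rewrite (nm_shift _ p1 (mwin T)).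
exact: (nm_win p1 mh h0 c0 hc T0).
Qed.

(** Keeps the time [t0 + a] in the domain while the shift [a] tends to 0. *)
Let clamp (t0 a : R) := Num.max 0 (t0 + a).

Let clamp_dist t0 a : 0 <= t0 -> `|clamp t0 a - t0| <= `|a|.
Proof.
move=> t00; rewrite /clamp.
have [h1|h1] := leP 0 (t0 + a); first by rewrite addrAC subrr add0r.
by rewrite sub0r normrN ger0_norm//; have := ler_norm (- a); rewrite normrN; lra.
Qed.

(** The weight [w] covers both topologies: [w = 1] and [r = p] for norm continuity, [r = 1] with [w]
    a translated test function for weak-star continuity. *)
Let label_difference s k t0 (w : rT -> R) (r : R) : 1 <= r -> 0 <= t0 ->
  measurable_fun setT w ->
  (nm r%:E (fun y => majorant s (t0 + 1) y * `|w y|)%R < +oo)%E ->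
  forall eps : R, 0 < eps -> exists2 d : R, 0 < d & forall t, 0 <= t -> `|t - t0| < d ->
    (nm r%:E (fun y => (VL s k t y - VL s k t0 y) * w y)%R <= eps%:E)%E.
Proof.
move=> r1 t00 mw nw eps eps0.
have T0 : 0 <= t0 + 1 by rewrite addr_ge0.
have r1' : (1 <= r%:E)%E by rewrite lee_fin.
have := @eps_delta_of_seq R (fun a => nm r%:E (fun y => (VL s k (clamp t0 a) y - VL s k t0 y) * w y)).
move=> /(_ _ eps eps0); case.
  move=> a a0 e' e'0.
  have [n0 _ hn0] : \forall n \near \oo, `|a n| <= 1.
    by move/cvgr0Pnorm_le : a0 => /(_ 1 ltr01).
  (* Starting the sequence at [n0] keeps all times below [t0 + 1], where a single majorant
     applies. *)
  pose Gn n y := (VL s k (clamp t0 (a (n + n0)%N)) y - VL s k t0 y) * w y.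
  pose g y := 2 * (majorant s (t0 + 1) y * `|w y|).
  have clT n : 0 <= clamp t0 (a (n + n0)%N) <= t0 + 1.
    have := hn0 (n + n0)%N (leq_addl _ _) => /= an.
    rewrite le_max lexx /= ge_max T0 /= lerD2l.
    exact: le_trans (ler_norm _) an.
  have mg : measurable_fun setT g.
    by do 2 apply: measurable_funM => //; apply: measurableT_comp.
  have mG n : measurable_fun setT (Gn n).
    exact: (measurable_funM (measurable_funB (mVL s k _) (mVL s k t0)) mw).
  have Gg n y : `|Gn n y| <= g y.
    rewrite /g /Gn normrM [leRHS]mulrA ler_wpM2r//.
    rewrite (le_trans (ler_normB _ _))//.
    have h1 := VL_le s k y (clT n).
    have h2 : `|VL s k t0 y| <= majorant s (t0 + 1) y by apply: VL_le; rewrite t00 lerDl ler01.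
    lra.
  have ng : (nm r%:E g < +oo)%E.
    have nfin : nm r%:E (fun y => majorant s (t0 + 1) y * `|w y|) \is a fin_num.
      by rewrite ge0_fin_numE// nm_ge0.
    apply: (@le_lt_trans _ _ (2 * fine (nm r%:E (fun y => majorant s (t0 + 1) y * `|w y|)))%:E).
      apply: nmZ_le => //; first exact: fine_ge0 (nm_ge0 _ _).
        by apply: measurable_funM => //; apply: measurableT_comp.
      by rewrite fineK.
    exact: ltry.
  have cG y : Gn n y @[n --> \oo] --> 0.
    apply/cvgr0Pnorm_le => q q0.
    have q'0 : 0 < q / (`|w y| + 1) by rewrite divr_gt0// ltr_wpDl.
    have [d d0 hd] := label_continuous s k y t00 q'0.
    have [n1 _ hn1] : \forall n \near \oo, `|a n| <= d / 2.
      by move/cvgr0Pnorm_le : a0; apply; rewrite divr_gt0.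
    exists n1 => // n /= nn1.
    have an := hn1 (n + n0)%N (leq_trans nn1 (leq_addr _ _)); rewrite /= in an.
    rewrite normrM.
    have cl0 : 0 <= clamp t0 (a (n + n0)%N) by case/andP : (clT n).
    have := hd _ cl0 (le_lt_trans (clamp_dist (a (n + n0)%N) t00) _).
    move=> /(_ _)/(ler_wpM2r (normr_ge0 (w y))) H.
    apply: (le_trans (H _)); first by apply: (le_lt_trans an); lra.
    rewrite mulrAC ler_pdivrMr ?ltr_wpDl// ler_wpM2l ?lerDl//; exact: ltW.
  have [n hn] := nm_dominated r1 mG mg Gg ng cG e'0.
  by exists (n + n0)%N.
move=> d d0 hd; exists d => // t t_0 td.
have := hd (t - t0) td; rewrite /clamp addrC subrK.
by rewrite (elimT max_idPr t_0).
Qed.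

(** The difference splits into a change of value at fixed label, translated, and a translation of
    the fixed function [U s k t0]. Continuity of translations for finite [p] takes care of the
    second part. *)
Lemma sol_strong_continuous (r : R) s k t0 : p = r%:E -> 0 <= t0 ->
  forall eps : R, 0 < eps -> exists2 d : R, 0 < d & forall t, 0 <= t -> `|t - t0| < d ->
    (nm p (fun x => U s k t x - U s k t0 x)%R <= eps%:E)%E.
Proof.
move=> pr t00 eps eps0; have r1 : 1 <= r by move: p1; rewrite pr lee_fin.
have T0 : 0 <= t0 + 1 by rewrite addr_ge0.
have e2 : 0 < eps / 2 by rewrite divr_gt0.
have mU t : measurable_fun setT (fun x : rT => U s k t x) by apply: (jm_comp (jU s k)).
have nw : (nm r%:E (fun y => majorant s (t0 + 1) y * `|1|)%R < +oo)%E.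
  rewrite -pr (_ : (fun y => _) = (fun y => majorant s (t0 + 1) y)); last first.
    by apply/funext => y; rewrite normr1 mulr1.
  exact: nm_majorant.
have [d d0 hd] := @label_difference s k t0 (cst 1) r r1 t00 (measurable_cst _) nw _ e2.
have nU : (nm r%:E (fun x => U s k t0 x) < +oo)%E.
  have t0T : 0 <= t0 <= t0 by rewrite t00 lexx.
  rewrite -pr; apply: le_lt_trans (le_lt_trans (sol_nm s t0T) (ltry _)).
  apply: nm_mono => //; apply: aeW => x.
  by rewrite (ger0_norm (n3_ge0 _)); exact: (le_n3 (fun k => U s k t0 x)).
have [d' d'0 hd'] := nm_shift_continuous r1 (mU t0) nU e2.
exists (Num.min d d'); first by rewrite lt_min d0.
move=> t t_0; rewrite lt_min => /andP[td td'].
have D1 := hd t t_0 td.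
have D2 : (nm r%:E (fun x => U s k t0 (x + sgn s * (t0 - t)) - U s k t0 x)%R <= (eps / 2)%:E)%E.
  by apply: hd'; rewrite normrM norm_sgn mul1r distrC.
have m1 : measurable_fun setT (fun y : rT => (VL s k t y - VL s k t0 y) * 1).
  apply: measurable_funM; last exact: measurable_cst.
  exact: (measurable_funB (mVL s k t) (mVL s k t0)).
have m1' : measurable_fun setT (fun x : rT =>
    (VL s k t (x - sgn s * t) - VL s k t0 (x - sgn s * t)) * 1).
  exact: (measurable_shift (- (sgn s * t)) m1).
have m2 : measurable_fun setT (fun x : rT => U s k t0 (x + sgn s * (t0 - t)) - U s k t0 x).
  by apply: measurable_funB => //; exact: (measurable_shift (sgn s * (t0 - t)) (mU t0)).
rewrite pr (_ : (fun x => _) = (fun x => (VL s k t (x - sgn s * t) - VL s k t0 (x - sgn s * t)) * 1 +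
   (U s k t0 (x + sgn s * (t0 - t)) - U s k t0 x))); last first.
  apply/funext => x; rewrite /VL mulr1 subrK addrA.
  by rewrite (_ : x - sgn s * t + sgn s * t0 = x + sgn s * (t0 - t)) ?subrK//; ring.
have r1' : (1 <= r%:E)%E by rewrite lee_fin.
apply: (le_trans (nmD r1' m1' m2)).
rewrite [in leRHS](splitr eps) EFinD; apply: leeD => //.
by rewrite (nm_shift (- (sgn s * t)) r1' m1).
Qed.

(** Passing to labels moves the translation onto the test function [g], which is in [L^1], where
    translations are norm continuous; the solution itself only has to be bounded. *)
Lemma sol_weak_continuous s k t0 (g : rT -> R) : p = +oo%E -> 0 <= t0 ->
  mu.-integrable setT (EFin \o g) ->
  forall eps : R, 0 < eps -> exists2 d : R, 0 < d & forall t, 0 <= t -> `|t - t0| < d ->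
    `|\int[mu]_x (U s k t x * g x) - \int[mu]_x (U s k t0 x * g x)| <= eps.
Proof.
move=> pr t00 Ig eps eps0.
have T0 : 0 <= t0 + 1 by rewrite addr_ge0.
have e2 : 0 < eps / 2 by rewrite divr_gt0.
have mg : measurable_fun setT g by move/integrableP : Ig => [/measurable_EFinP].
have mU t : measurable_fun setT (fun x : rT => U s k t x) by apply: (jm_comp (jU s k)).
pose B := G (t0 + 1) * (c + N (t0 + 1)).
have B0 : 0 <= B by rewrite mulr_ge0 ?G0 ?addr_ge0 ?N0.
have hb : {ae mu, forall x : rT, `|h x| <= c} by apply/nmy_leP; rewrite -pr.
have majB : {ae mu, forall y : rT, majorant s (t0 + 1) y <= B}.
  move: hb; apply: filterS => y; rewrite ger0_norm// => hy.
  rewrite /majorant /B ler_wpM2l//; first exact: G0.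
  by rewrite lerD// winN// T0 lexx.
pose g' y := g (y + sgn s * t0).
have mg' : measurable_fun setT g' by exact: measurable_shift.
have one : (1 <= 1%:E :> \bar R)%E by [].
have ngfin : nm 1%:E g \is a fin_num by rewrite ge0_fin_numE ?nm_ge0// integrable_nm1.
have nBg (w : rT -> R) (q : R) : measurable_fun setT w -> (nm 1%:E w <= q%:E)%E -> 0 <= q ->
    (nm 1%:E (fun y => majorant s (t0 + 1) y * `|w y|)%R <= (B * q)%:E)%E.
  move=> mw wq q0; apply: (@le_trans _ _ (nm 1%:E (fun y => B * w y))); last exact: nmZ_le.
  apply: nm_mono => //.
  - by apply: measurable_funM => //; apply: measurableT_comp.
  - exact: measurable_funM.
  - move: majB; apply: filterS => y yB.
    rewrite normrM [leRHS]normrM normr_id ler_wpM2r//.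
    by rewrite (ger0_norm (majorant_ge0 s y T0)) (ger0_norm B0).
have nw : (nm 1%:E (fun y => majorant s (t0 + 1) y * `|g' y|)%R < +oo)%E.
  apply: (@le_lt_trans _ _ (B * fine (nm 1%:E g))%:E); last exact: ltry.
  apply: nBg => //; last exact: fine_ge0 (nm_ge0 _ _).
  by rewrite fineK// /g' (nm_shift _ one mg).
have [d d0 hd] := @label_difference s k t0 g' 1 (lexx 1) t00 mg' nw _ e2.
have eB : 0 < eps / 2 / (B + 1) by rewrite divr_gt0// ltr_wpDl.
have [d' d'0 hd'] := nm_shift_continuous (lexx 1) mg (integrable_nm1 Ig) eB.
exists (Num.min (Num.min d d') 1); first by rewrite !lt_min d0 d'0 ltr01.
move=> t t_0; rewrite !lt_min => /andP[/andP[td td'] t1].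
have tT : 0 <= t <= t0 + 1.
  by rewrite t_0 /=; move: t1; rewrite ltr_norml => /andP[_ ?]; lra.
have t0T : 0 <= t0 <= t0 + 1 by rewrite t00 lerDl ler01.
pose gt y := g (y + sgn s * t).
have mgt : measurable_fun setT gt by exact: measurable_shift.
have shiftE t' : 0 <= t' -> \int[mu]_x (U s k t' x * g x) =
    \int[mu]_y (VL s k t' y * g (y + sgn s * t')).
  move=> _; rewrite -(@Rint_shift _ (sgn s * t') (fun x => U s k t' x * g x))//.
  exact: measurable_funM.
have IV t' : 0 <= t' <= t0 + 1 -> mu.-integrable setT (EFin \o (fun y => VL s k t' y * g (y + sgn s * t'))).
  move=> tT'; have mgs : measurable_fun setT (fun y : rT => g (y + sgn s * t')).
    exact: measurable_shift.
  apply: nm1_integrable; first exact: measurable_funM.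
  apply: (@le_lt_trans _ _ (B * fine (nm 1%:E g))%:E); last exact: ltry.
  apply: le_trans (nBg _ (fine (nm 1%:E g)) mgs _ _).
  - apply: nm_mono => //.
    + exact: measurable_funM.
    + by apply: measurable_funM => //; apply: measurableT_comp.
    + apply: aeW => y; rewrite normrM [leRHS]normrM normr_id ler_wpM2r//.
      by rewrite (ger0_norm (majorant_ge0 _ _ T0)); exact: VL_le.
  - by rewrite fineK// (nm_shift _ one mg).
  - exact: fine_ge0 (nm_ge0 _ _).
rewrite !shiftE// -RintegralB//; [|exact: IV|exact: IV].
apply: norm_Rint_nm1.
  by apply: measurable_funB; apply: measurable_funM.
have m1 : measurable_fun setT (fun y : rT => (VL s k t y - VL s k t0 y) * g' y).
  exact: (measurable_funM (measurable_funB (mVL s k t) (mVL s k t0)) mg').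
have md : measurable_fun setT (fun y : rT => gt y - g' y) by exact: measurable_funB.
have m2 : measurable_fun setT (fun y : rT => VL s k t y * (gt y - g' y)).
  exact: measurable_funM.
rewrite (_ : (fun y => _) = (fun y => (VL s k t y - VL s k t0 y) * g' y +
    VL s k t y * (gt y - g' y))); last first.
  by apply/funext => y; rewrite /g' /gt; ring.
apply: (le_trans (nmD one m1 m2)).
rewrite [in leRHS](splitr eps) EFinD; apply: leeD; first exact: hd.
have ndiff : (nm 1%:E (fun y => gt y - g' y)%R <= (eps / 2 / (B + 1))%:E)%E.
  have mgd : measurable_fun setT (fun x : rT => g (x + sgn s * (t - t0)) - g x).
    by apply: measurable_funB => //; exact: measurable_shift.
  have := nm_shift (sgn s * t0) one mgd.
  rewrite (_ : (fun x => _) = (fun y => gt y - g' y)) => [->|].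
    by apply: hd'; rewrite normrM norm_sgn mul1r.
  apply/funext => y; rewrite /gt /g'; congr (g _ - _); ring.
apply: (@le_trans _ _ (B * (eps / 2 / (B + 1)))%:E).
  apply: le_trans (nBg _ _ md ndiff (ltW eB)).
  apply: nm_mono => //.
    by apply: measurable_funM => //; apply: measurableT_comp.
  apply: aeW => y; rewrite normrM [leRHS]normrM normr_id ler_wpM2r//.
  by rewrite (ger0_norm (majorant_ge0 _ _ T0)); exact: VL_le.
rewrite lee_fin mulrA ler_pdivrMr ?ltr_wpDl// mulrC ler_wpM2l//; first exact: ltW.
by rewrite lerDl.
Qed.

End GlobalSolution.

(** * Complex unknowns *)

Local Open Scope complex_scope.

Section RealComponents.
Context {R : realType}.
Implicit Types (s : bool) (k : component) (psi : 'cV[R[i]]_2) (A : 'cV[R]_2)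
  (X : bool -> component -> R).

(* psi_s = cP + i cQ and A_s = cA *)
Definition cmp psi A s k : R :=
  match k with
  | cP => complex.Re (psi_pm s psi)
  | cQ => complex.Im (psi_pm s psi)
  | cA => A_pm s A
  end.

(** Inverse of the passage to psi_+ and psi_-: half sum and half difference. *)
Definition spinor X : 'cV[R[i]]_2 := \col_i
  (if i == 0 then (X false cP + X true cP) / 2 +i* ((X false cQ + X true cQ) / 2)
   else (X false cP - X true cP) / 2 +i* ((X false cQ - X true cQ) / 2)).

(** The second entry is [(A_- - A_+) / 2], in this order because [A_+ = A_0 - A_1]. *)
Definition potential X : 'cV[R]_2 := \col_i
  (if i == 0 then (X false cA + X true cA) / 2 else (X true cA - X false cA) / 2).

Lemma cmpP psi A s : cmp psi A s cP = complex.Re (psi 0 0) + sgn s * complex.Re (psi 1 0).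
Proof. by rewrite /= /psi_pm; case: (psi 0 0) => a b; case: (psi 1 0) => c d /=; rewrite mul0r subr0. Qed.

Lemma cmpQ psi A s : cmp psi A s cQ = complex.Im (psi 0 0) + sgn s * complex.Im (psi 1 0).
Proof. by rewrite /= /psi_pm; case: (psi 0 0) => a b; case: (psi 1 0) => c d /=; rewrite mul0r addr0. Qed.

Lemma cmp_spinor X s k : cmp (spinor X) (potential X) s k = X s k.
Proof.
by case: k; rewrite ?cmpP ?cmpQ /= /A_pm !mxE /sgn /=; case: s => /=;
  rewrite ?expr1 ?expr0; field.
Qed.

Lemma complex_eq (x y : R[i]) : complex.Re x = complex.Re y ->
  complex.Im x = complex.Im y -> x = y.
Proof. by case: x => a b; case: y => c d /= -> ->. Qed.

Lemma spinor_cmp psi A : spinor (cmp psi A) = psi.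
Proof.
apply/matrixP => i j; rewrite (ord1 j) mxE !cmpP !cmpQ /sgn /= expr1 expr0.
case: (unliftP 0 i) => [i' ->|->]; last first.
  by apply: complex_eq => /=; field.
have -> : lift 0 i' = 1 :> 'I_2 by apply/val_inj; case: i' => [[]].
by apply: complex_eq => /=; field.
Qed.

Lemma potential_cmp psi A : potential (cmp psi A) = A.
Proof.
apply/matrixP => i j; rewrite (ord1 j) mxE /= /A_pm /sgn /= expr1 expr0.
case: (unliftP 0 i) => [i' ->|->]; first last.
  by rewrite eqxx; field.
have -> : lift 0 i' = 1 :> 'I_2 by apply/val_inj; case: i' => [[]].
by rewrite /=; field.
Qed.

Lemma cmpB psi psi' A A' s k :
  cmp (psi - psi') (A - A') s k = cmp psi A s k - cmp psi' A' s k.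
Proof.
case: k; rewrite ?cmpP ?cmpQ /= /A_pm ?mxE; last by ring.
  by case: (psi 0 0) (psi 1 0) (psi' 0 0) (psi' 1 0) => ? ? [? ?] [? ?] [? ?] /=; ring.
by case: (psi 0 0) (psi 1 0) (psi' 0 0) (psi' 1 0) => ? ? [? ?] [? ?] [? ?] /=; ring.
Qed.

(** Both matrices are Hermitian, so the quadratic form is real; [ty] records which one is used and
    lets a single argument treat both. *)
Lemma quadf_real (alpha : 'M[R[i]]_2) : alpha = gamma0 \/ alpha = - 'i%C *: gamma1 ->
  exists ty, forall psi A, quadf alpha psi 0 0 = (qf ty (cmp psi A))%:C.
Proof.
case=> ->; [exists false|exists true] => psi A;
rewrite /quadf /qf !cmpP !cmpQ !mxE !big_ord_recl !big_ord0 !mxE !big_ord_recl !big_ord0 !mxE /=.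
- case E: (psi 0 0) => [a b]; case E' : (psi 1 0) => [c d].
  rewrite (_ : lift 0 0 = 1 :> 'I_2) ?E ?E'; last exact/val_inj.
  by apply: complex_eq => /=; rewrite /sgn /= ?expr1 ?expr0; ring.
- case E: (psi 0 0) => [a b]; case E' : (psi 1 0) => [c d].
  rewrite (_ : lift 0 0 = 1 :> 'I_2) ?E ?E'; last exact/val_inj.
  by apply: complex_eq => /=; rewrite /sgn /= ?expr1 ?expr0; ring.
Qed.

(** A product of equations rather than a conjunction, so that it can be used as one rewriting rule
    for all four entries. *)
Lemma gauge_coupling_sum A psi :
  (complex.Re (gauge_coupling A psi 0 0) = (A_pm false A * cmp psi A true cP + A_pm true A * cmp psi A false cP) / 2) *
  (complex.Im (gauge_coupling A psi 0 0) = (A_pm false A * cmp psi A true cQ + A_pm true A * cmp psi A false cQ) / 2) *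
  (complex.Re (gauge_coupling A psi 1 0) = (A_pm false A * cmp psi A true cP - A_pm true A * cmp psi A false cP) / 2) *
  (complex.Im (gauge_coupling A psi 1 0) = (A_pm false A * cmp psi A true cQ - A_pm true A * cmp psi A false cQ) / 2).
Proof.
rewrite !cmpP !cmpQ /A_pm /gauge_coupling !mxE !big_ord_recl !big_ord0 !mxE /=.
case E: (psi 0 0) => [a b]; case E' : (psi 1 0) => [c d].
rewrite (_ : lift 0 0 = 1 :> 'I_2) ?E ?E'; last exact/val_inj.
by do ! split; rewrite /sgn /= ?expr1 ?expr0; field.
Qed.

End RealComponents.

(** * Euclidean norms against sums of components *)

Section EuclideanNorm.
Context {R : realType}.

Lemma enorm_ge0 n (v : 'cV[R[i]]_n) : 0 <= enorm v.
Proof. exact: sqrtr_ge0. Qed.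

Lemma enorm_le n (v : 'cV[R[i]]_n) :
  enorm v <= \sum_(i < n) (`|complex.Re (v i 0)| + `|complex.Im (v i 0)|).
Proof.
rewrite /enorm.
have : 0 <= \sum_(i < n) (`|complex.Re (v i 0)| + `|complex.Im (v i 0)|) /\
    \sum_(i < n) (complex.Re (v i 0) ^+ 2 + complex.Im (v i 0) ^+ 2) <=
    (\sum_(i < n) (`|complex.Re (v i 0)| + `|complex.Im (v i 0)|)) ^+ 2.
  apply: (big_rec2 (fun a b : R => 0 <= b /\ a <= b ^+ 2)); first by rewrite expr0n.
  move=> i a b _ [a0 ab].
  have := normr_ge0 (complex.Re (v i 0)); have := normr_ge0 (complex.Im (v i 0)).
  rewrite -(real_normK (num_real (complex.Re (v i 0)))).
  rewrite -(real_normK (num_real (complex.Im (v i 0)))).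
  move: `|_| `|_| => p q p0 q0; split; first by rewrite !addr_ge0.
  have := mulr_ge0 p0 q0; have := mulr_ge0 p0 a0; have := mulr_ge0 q0 a0.
  by rewrite !expr2 in ab *; nra.
move=> [s0 h]; rewrite -[leRHS]ger0_norm// -sqrtr_sqr.
exact: ler_wsqrtr.
Qed.

Lemma Re_le_enorm n (v : 'cV[R[i]]_n) i : `|complex.Re (v i 0)| <= enorm v.
Proof.
rewrite -sqrtr_sqr /enorm (bigD1 i)//= ler_wsqrtr//.
rewrite -addrA lerDl addr_ge0 ?sqr_ge0//.
by apply: sumr_ge0 => j _; rewrite addr_ge0 ?sqr_ge0.
Qed.

Lemma Im_le_enorm n (v : 'cV[R[i]]_n) i : `|complex.Im (v i 0)| <= enorm v.
Proof.
rewrite -sqrtr_sqr /enorm (bigD1 i)//= ler_wsqrtr//.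
rewrite addrAC [leRHS]addrC lerDl addr_ge0 ?sqr_ge0//.
by apply: sumr_ge0 => j _; rewrite addr_ge0 ?sqr_ge0.
Qed.

Definition tot (X : bool -> component -> R) : R := n3 (X false) + n3 (X true).

Lemma tot_ge0 X : 0 <= tot X. Proof. by rewrite addr_ge0// n3_ge0. Qed.

Lemma n3_le_tot X s : n3 (X s) <= tot X.
Proof. by rewrite /tot; case: s; rewrite ?lerDr ?lerDl n3_ge0. Qed.

Implicit Types (psi : 'cV[R[i]]_2) (A : 'cV[R]_2).

Let sgn_sum s (a b : R) : `|a + sgn s * b| <= `|a| + `|b|.
Proof. by rewrite (le_trans (ler_normD _ _))// normrM norm_sgn mul1r. Qed.

(** Each of the two families involves at most four absolute values of real or imaginary parts of
    [psi], each below its Euclidean norm, whence 8; the share of [A] is smaller. *)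
Lemma tot_cmp_le psi A : tot (cmp psi A) <= 8 * (enorm psi + enorm (cvec A)).
Proof.
have b s : n3 (cmp psi A s) <= 4 * enorm psi + 2 * enorm (cvec A).
  rewrite /n3 cmpP cmpQ.
  have h1 := sgn_sum s (complex.Re (psi 0 0)) (complex.Re (psi 1 0)).
  have h2 := sgn_sum s (complex.Im (psi 0 0)) (complex.Im (psi 1 0)).
  have h3 : `|cmp psi A s cA| <= `|A 0 0| + `|A 1 0|.
    by rewrite /= /A_pm -mulrN -(normrN (A 1 0)); exact: sgn_sum.
  have h4 := Re_le_enorm psi 0; have h5 := Re_le_enorm psi 1.
  have h6 := Im_le_enorm psi 0; have h7 := Im_le_enorm psi 1.
  have h8 := Re_le_enorm (cvec A) 0; have h9 := Re_le_enorm (cvec A) 1.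
  rewrite !mxE /= in h8 h9.
  lra.
have := b false; have := b true; have := enorm_ge0 psi; have := enorm_ge0 (cvec A).
rewrite /tot; lra.
Qed.

Lemma enorm_psi_le psi A : enorm psi <= tot (cmp psi A).
Proof.
apply: (le_trans (enorm_le _)); rewrite !big_ord_recl big_ord0.
rewrite (_ : lift 0 0 = 1 :> 'I_2); last exact/val_inj.
rewrite /tot /n3 !cmpP !cmpQ /sgn expr0 expr1 !mul1r !mulN1r.
have h (a b : R) : `|a| + `|b| <= `|a + b| + `|a - b|.
  have h1 := ler_normD (a + b) (a - b); have h2 := ler_normB (a + b) (a - b).
  rewrite (_ : a + b + (a - b) = 2 * a) in h1; last by ring.
  rewrite (_ : a + b - (a - b) = 2 * b) in h2; last by ring.
  rewrite !normrM (ger0_norm (ler0n _ 2)) in h1 h2; lra.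
have := h (complex.Re (psi 0 0)) (complex.Re (psi 1 0)).
have := h (complex.Im (psi 0 0)) (complex.Im (psi 1 0)).
have := normr_ge0 (cmp psi A true cA); have := normr_ge0 (cmp psi A false cA).
lra.
Qed.

Lemma enorm_A_le psi A : enorm (cvec A) <= tot (cmp psi A).
Proof.
apply: (le_trans (enorm_le _)); rewrite !big_ord_recl big_ord0 !mxE /=.
rewrite (_ : lift 0 0 = 1 :> 'I_2); last exact/val_inj.
rewrite /tot /n3 /= /A_pm /sgn expr0 expr1 !mul1r !mulN1r opprK.
have := normr_ge0 (complex.Re (psi_pm false psi)).
have := normr_ge0 (complex.Im (psi_pm false psi)).
have := normr_ge0 (complex.Re (psi_pm true psi)).
have := normr_ge0 (complex.Im (psi_pm true psi)).
have h1 := ler_normD (A 0 0 + A 1 0) (A 0 0 - A 1 0); have h2 := ler_normB (A 0 0 + A 1 0) (A 0 0 - A 1 0).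
rewrite (_ : A 0 0 + A 1 0 + (A 0 0 - A 1 0) = 2 * A 0 0) in h1; last by ring.
rewrite (_ : A 0 0 + A 1 0 - (A 0 0 - A 1 0) = 2 * A 1 0) in h2; last by ring.
rewrite !normrM (ger0_norm (ler0n _ 2)) in h1 h2.
rewrite !normr0; lra.
Qed.

Lemma enorm_gauge_coupling_le psi A :
  enorm (gauge_coupling A psi) <= 2 * (n3 (cmp psi A false) * n3 (cmp psi A true)).
Proof.
apply: (le_trans (enorm_le _)); rewrite !big_ord_recl big_ord0.
rewrite (_ : lift 0 0 = 1 :> 'I_2); last exact/val_inj.
rewrite !gauge_coupling_sum /n3.
rewrite -/(cmp psi A false cA) -/(cmp psi A true cA).
move: (cmp psi A true) (cmp psi A false) => X Y.
have n2 : `|2^-1| = 2^-1 :> R by rewrite ger0_norm.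
have h (a b c d : R) : `|(a * b + c * d) / 2| <= (`|a| * `|b| + `|c| * `|d|) / 2.
  by rewrite normrM n2 ler_wpM2r// -!normrM ler_normD.
have h' (a b c d : R) : `|(a * b - c * d) / 2| <= (`|a| * `|b| + `|c| * `|d|) / 2.
  by rewrite normrM n2 ler_wpM2r// -!normrM ler_normB.
have := h (Y cA) (X cP) (X cA) (Y cP); have := h (Y cA) (X cQ) (X cA) (Y cQ).
have := h' (Y cA) (X cP) (X cA) (Y cP); have := h' (Y cA) (X cQ) (X cA) (Y cQ).
have := normr_ge0 (X cP); have := normr_ge0 (X cQ); have := normr_ge0 (X cA).
have := normr_ge0 (Y cP); have := normr_ge0 (Y cQ); have := normr_ge0 (Y cA).
move: `|X cP| `|X cQ| `|X cA| `|Y cP| `|Y cQ| `|Y cA| => x1 x2 x3 y1 y2 y3 p1 p2 p3 p4 p5 p6.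
move: `|_| `|_| `|_| `|_| => u1 u2 u3 u4 q1 q2 q3 q4.
have := mulr_ge0 p1 p4; have := mulr_ge0 p1 p5; have := mulr_ge0 p1 p6.
have := mulr_ge0 p2 p4; have := mulr_ge0 p2 p5; have := mulr_ge0 p2 p6.
have := mulr_ge0 p3 p4; have := mulr_ge0 p3 p5; have := mulr_ge0 p3 p6.
nra.
Qed.

Lemma enorm_real (x : R) (v : 'cV[R[i]]_1) : v 0 0 = x%:C -> enorm v = `|x|.
Proof.
move=> e; rewrite /enorm big_ord_recl big_ord0 addr0 e /= expr0n addr0.
exact: sqrtr_sqr.
Qed.

End EuclideanNorm.

(** * Complex and real Duhamel formulas *)

Section ComplexDuhamel.
Context {R : realType}.
Local Notation mu := (@lebesgue_measure R).
Local Notation rT := (measurableTypeR R).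

(** Integrability is not assumed: [fine] sends both infinite values to 0, so the sign comes out in
    every case. Thus the complex and the real formulas are equivalent unconditionally. *)
Lemma Rint_opp (D : set rT) (f : rT -> R) :
  \int[mu]_(x in D) (- f x) = - \int[mu]_(x in D) f x.
Proof.
rewrite /Rintegral [in LHS]integralE [in RHS]integralE.
have -> : (fun x => (- f x)%:E) = (fun x => - (f x)%:E)%E by apply/funext.
rewrite funeposN funenegN.
have p0 : (0 <= \int[mu]_(x in D) (fun x => (f x)%:E)^\+ x)%E by exact: integral_ge0.
have n0 : (0 <= \int[mu]_(x in D) (fun x => (f x)%:E)^\- x)%E by exact: integral_ge0.
move: p0 n0; move: (\int[mu]_(x in D) _)%E (\int[mu]_(x in D) _)%E.
move=> [a||] [b||] //= _ _; by rewrite ?oppr0// opprB.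
Qed.

Lemma Rint_sgn s (D : set rT) (f : rT -> R) :
  \int[mu]_(x in D) (- sgn s * f x) = - sgn s * \int[mu]_(x in D) f x.
Proof.
case: s; rewrite /sgn ?expr1 ?expr0 ?opprK ?mul1r ?mulN1r -?Rint_opp.
  by apply: eq_Rintegral => x _; rewrite mul1r.
by apply: eq_Rintegral => x _; rewrite mulN1r.
Qed.

(** Multiplication by [i] exchanges the two real integrals: [cP] receives minus the imaginary part
    of the complex integral and [cQ] its real part. *)
Lemma duhamel_psi (m : R) ty s t x (psi0 : rT -> 'cV[R[i]]_2) (A0 : rT -> 'cV[R]_2)
    (psi : rT -> rT -> 'cV[R[i]]_2) (A : rT -> rT -> 'cV[R]_2) :
  (psi_pm s (psi t x) = psi_pm s (psi0 (x - sgn s * t)) +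
     'i%C * cRintegral `[0, t]
       (fun r => let y := x - sgn s * (t - r) in
          (A_pm (~~ s) (A r y))%:C * psi_pm s (psi r y)
          - m%:C * psi_pm (~~ s) (psi r y))) <->
  (forall k, k <> cA -> cmp (psi t x) (A t x) s k =
     cmp (psi0 (x - sgn s * t)) (A0 (x - sgn s * t)) s k +
     \int[mu]_(r in `[0, t]) csd m ty s k (fun s' k' =>
       cmp (psi r (x - sgn s * (t - r))) (A r (x - sgn s * (t - r))) s' k')).
Proof.
rewrite /cRintegral /=.
set I1 := \int[mu]_(r in _) _; set I2 := \int[mu]_(r in _) _.
have e1 : \int[mu]_(r in `[0, t]) csd m ty s cP (fun s' k' =>
    cmp (psi r (x - sgn s * (t - r))) (A r (x - sgn s * (t - r))) s' k') = - I2.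
  rewrite /I2 -Rint_opp; apply: eq_Rintegral => r _ /=.
  by case: (psi_pm s _) => a b; case: (psi_pm (~~ s) _) => c d /=; ring.
have e2 : \int[mu]_(r in `[0, t]) csd m ty s cQ (fun s' k' =>
    cmp (psi r (x - sgn s * (t - r))) (A r (x - sgn s * (t - r))) s' k') = I1.
  rewrite /I1; apply: eq_Rintegral => r _ /=.
  by case: (psi_pm s _) => a b; case: (psi_pm (~~ s) _) => c d /=; ring.
split=> [h [] // _|h].
- by rewrite e1 /= h; case: (psi_pm s _) => a b /=; ring.
- by rewrite e2 /= h; case: (psi_pm s _) => a b /=; ring.
- have h1 := h cP; rewrite e1 in h1; have h2 := h cQ; rewrite e2 in h2.
  apply: complex_eq => /=.
    by rewrite [LHS]h1//=; case: (psi_pm s (psi0 _)) => a b /=; ring.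
  by rewrite [LHS]h2//=; case: (psi_pm s (psi0 _)) => a b /=; ring.
Qed.

(** Since the quadratic form is real, the imaginary part of the complex equation is trivial and the
    real part is the equation for [cA]. *)
Lemma duhamel_A (m : R) ty alpha s t x (psi0 : rT -> 'cV[R[i]]_2) (A0 : rT -> 'cV[R]_2)
    (psi : rT -> rT -> 'cV[R[i]]_2) (A : rT -> rT -> 'cV[R]_2) :
  (forall psi A, quadf alpha psi 0 0 = (qf ty (cmp psi A))%:C) ->
  ((A_pm s (A t x))%:C = (A_pm s (A0 (x - sgn s * t)))%:C -
     (sgn s)%:C * cRintegral `[0, t]
       (fun r => quadf alpha (psi r (x - sgn s * (t - r))) 0 0)) <->
  (cmp (psi t x) (A t x) s cA =
     cmp (psi0 (x - sgn s * t)) (A0 (x - sgn s * t)) s cA +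
     \int[mu]_(r in `[0, t]) csd m ty s cA (fun s' k' =>
       cmp (psi r (x - sgn s * (t - r))) (A r (x - sgn s * (t - r))) s' k')).
Proof.
move=> qE; rewrite /cRintegral /=.
set I1 := \int[mu]_(r in _) complex.Re _; set I2 := \int[mu]_(r in _) complex.Im _.
have -> : I2 = 0.
  rewrite /I2 (@eq_Rintegral _ _ _ mu _ (cst 0)); first by rewrite Rintegral_cst//= mul0r.
  by move=> r _; rewrite (qE _ (A r (x - sgn s * (t - r)))).
have -> : \int[mu]_(r in `[0, t]) (- sgn s * qf ty (fun s' k' =>
    cmp (psi r (x - sgn s * (t - r))) (A r (x - sgn s * (t - r))) s' k')) = - sgn s * I1.
  rewrite Rint_sgn; congr (_ * _); apply: eq_Rintegral => r _.
  by rewrite (qE _ (A r (x - sgn s * (t - r)))).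
split=> [[-> _]|->]; first by ring.
by apply: complex_eq => /=; ring.
Qed.

End ComplexDuhamel.

(** * Measurability of the complex unknowns *)

Section ComplexMeasurability.
Context {R : realType}.
Local Notation mu := (@lebesgue_measure R).
Local Notation rT := (measurableTypeR R).
Implicit Types (p : \bar R).

Section Domain.
Context d (T : measurableType d) (D : set T).

Lemma measurable_enorm n (f : T -> 'cV[R[i]]_n) : cmeasurable D f ->
  measurable_fun D (fun z => enorm (f z)).
Proof.
move=> mf; apply: measurableT_comp.
  by apply: continuous_measurable_fun; exact: sqrt_continuous.
apply: measurable_sum => i; apply: measurable_funD; apply: measurable_funX.
  exact: (mf i).1.
exact: (mf i).2.
Qed.

Lemma cmeasurableB n (f g : T -> 'cV[R[i]]_n) : cmeasurable D f -> cmeasurable D g ->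
  cmeasurable D (fun z => f z - g z).
Proof.
move=> mf mg i; split.
  rewrite (_ : (fun z => _) = (fun z => complex.Re (f z i 0) - complex.Re (g z i 0))).
    by apply: measurable_funB; [exact: (mf i).1|exact: (mg i).1].
  by apply/funext => z; rewrite !mxE; case: (f z i 0) => ? ?; case: (g z i 0).
rewrite (_ : (fun z => _) = (fun z => complex.Im (f z i 0) - complex.Im (g z i 0))).
  by apply: measurable_funB; [exact: (mf i).2|exact: (mg i).2].
by apply/funext => z; rewrite !mxE; case: (f z i 0) => ? ?; case: (g z i 0).
Qed.

Lemma measurable_cmp (psi : T -> 'cV[R[i]]_2) (A : T -> 'cV[R]_2) s k :
  cmeasurable D psi -> cmeasurable D (fun z => cvec (A z)) ->
  measurable_fun D (fun z => cmp (psi z) (A z) s k).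
Proof.
move=> mpsi mA.
have mAi i : measurable_fun D (fun z => A z i 0).
  by have := (mA i).1; apply: eq_measurable_fun => z _; rewrite !mxE.
case: k.
- under eq_fun do rewrite cmpP.
  by apply: measurable_funD; [|apply: measurable_funM => //]; exact: (mpsi _).1.
- under eq_fun do rewrite cmpQ.
  by apply: measurable_funD; [|apply: measurable_funM => //]; exact: (mpsi _).2.
- by apply: measurable_funB => //; exact: measurable_funM.
Qed.

Lemma cmeasurable_spinor (X : bool -> component -> T -> R) :
  (forall s k, measurable_fun D (X s k)) ->
  cmeasurable D (fun z => spinor (fun s k => X s k z)).
Proof.
move=> mX i; split.
  rewrite (_ : (fun z => _) = (fun z => if i == 0 then (X false cP z + X true cP z) / 2
    else (X false cP z - X true cP z) / 2)).
    by case: (i == 0); apply: measurable_funM => //;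
      [exact: measurable_funD|exact: measurable_funB].
  by apply/funext => z; rewrite mxE; case: ifP.
rewrite (_ : (fun z => _) = (fun z => if i == 0 then (X false cQ z + X true cQ z) / 2
    else (X false cQ z - X true cQ z) / 2)).
  by case: (i == 0); apply: measurable_funM => //;
    [exact: measurable_funD|exact: measurable_funB].
by apply/funext => z; rewrite mxE; case: ifP.
Qed.

Lemma cmeasurable_potential (X : bool -> component -> T -> R) :
  (forall s k, measurable_fun D (X s k)) ->
  cmeasurable D (fun z => cvec (potential (fun s k => X s k z))).
Proof.
move=> mX i; split; last first.
  by rewrite (_ : (fun z => _) = cst 0)//; apply/funext => z; rewrite !mxE.
rewrite (_ : (fun z => _) = (fun z => if i == 0 then (X false cA z + X true cA z) / 2
    else (X true cA z - X false cA z) / 2)).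
  by case: (i == 0); apply: measurable_funM => //;
    [exact: measurable_funD|exact: measurable_funB].
by apply/funext => z; rewrite !mxE /=; case: ifP.
Qed.

Lemma cmeasurable_gauge_coupling (psi : T -> 'cV[R[i]]_2) (A : T -> 'cV[R]_2) :
  (forall s k, measurable_fun D (fun z => cmp (psi z) (A z) s k)) ->
  cmeasurable D (fun z => gauge_coupling (A z) (psi z)).
Proof.
move=> mX.
have mA s : measurable_fun D (fun z => A_pm s (A z)) by exact: (mX s cA).
move=> i.
case: (unliftP 0 i) => [i' ->|->]; last first.
  split.
    under eq_fun do rewrite gauge_coupling_sum.
    by apply: measurable_funM => //; apply: measurable_funD; apply: measurable_funM.
  under eq_fun do rewrite gauge_coupling_sum.
  by apply: measurable_funM => //; apply: measurable_funD; apply: measurable_funM.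
have -> : lift 0 i' = 1 :> 'I_2 by apply/val_inj; case: i' => [[]].
split.
  under eq_fun do rewrite gauge_coupling_sum.
  by apply: measurable_funM => //; apply: measurable_funB; apply: measurable_funM.
under eq_fun do rewrite gauge_coupling_sum.
by apply: measurable_funM => //; apply: measurable_funB; apply: measurable_funM.
Qed.

End Domain.

Lemma LpnormE p n (f : rT -> 'cV[R[i]]_n) : Lpnorm p f = nm p (fun x => enorm (f x)).
Proof. by []. Qed.

Lemma measurable_tot (d : measure_display) (T : measurableType d) (D : set T)
    (X : bool -> component -> T -> R) :
  (forall s k, measurable_fun D (X s k)) ->
  measurable_fun D (fun z => tot (fun s k => X s k z)).
Proof.
by move=> mX; do !apply: measurable_funD; apply: measurableT_comp => //; exact: mX.
Qed.

End ComplexMeasurability.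

(** * Integrals over space-time rectangles *)

Section SpaceTimeIntegrals.
Context {R : realType}.
Local Notation mu := (@lebesgue_measure R).
Local Notation rT := (measurableTypeR R).
Implicit Types (p : \bar R).

Lemma Gam_ndM (m M M' t : R) : 0 <= m -> 0 <= M -> M <= M' -> 0 <= t ->
  Gam m M t <= Gam m M' t.
Proof.
move=> m0 M0 MM t0; have g1 := gam_ge1 m0 M0 t0.
have w0 : 0 <= M * (1 + 2 * t) by rewrite mulr_ge0//; lra.
have ww : M * (1 + 2 * t) <= M' * (1 + 2 * t) by rewrite ler_wpM2r//; lra.
have g : gam m M t <= gam m M' t.
  have h : 8 * m * (M * (1 + 2 * t)) <= 8 * m * (M' * (1 + 2 * t)).
    by apply: ler_wpM2l => //; lra.
  have h' : 0 <= 8 * m * (M * (1 + 2 * t)) by apply: mulr_ge0 => //; lra.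
  by apply: ler_pM; rewrite ?expR_ge0 ?ler_expR//; lra.
have g0 : 0 <= gam m M t by lra.
rewrite /Gam; apply: lerD; first by rewrite lerD2l.
apply: ler_pM; first exact: sqr_ge0.
- by rewrite mulr_ge0//; lra.
- by rewrite lerXn2r// nnegrE//; lra.
- by apply: ler_pM => //; lra.
Qed.

Lemma integral_rect (A B : set rT) (g : rT * rT -> \bar R) : measurable A -> measurable B ->
  measurable_fun setT g -> (forall z, (0 <= g z)%E) ->
  (\int[(mu \x mu)%E]_(z in A `*` B) g z = \int[mu]_(t in A) \int[mu]_(x in B) g (t, x))%E.
Proof.
move=> mA mB mg g0; have mAB : measurable (A `*` B) by exact: measurableX.
rewrite integral_mkcond fubini_tonelli1//.
- rewrite [RHS]integral_mkcond; apply: eq_integral => t _.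
  rewrite patchE; case: ifPn => tA.
    rewrite [RHS]integral_mkcond; apply: eq_integral => x _.
    by rewrite !patchE in_setX tA.
  by rewrite /fubini_F integral0_eq// => x _; rewrite patchE in_setX (negbTE tA).
- by apply/(measurable_restrictT _ _).1 => //; exact: measurable_funTS.
- by move=> z; exact: erestrict_ge0.
Qed.

Lemma integrable_rect_of_bound (T r : R) (F b : rT -> rT -> R) :
  measurable_fun (halfspace : set (rT * rT)) (fun z => F z.1 z.2) -> jm b ->
  (forall t x, 0 <= t -> `|F t x| <= b t x) -> (forall t x, 0 <= b t x) ->
  (forall n : nat, (\int[mu]_(t in `[0%R, T]) \int[mu]_(x in `[(- n%:R)%R, n%:R])
     (b t x)%:E < +oo)%E) ->
  (mu \x mu)%E.-integrable (`[0, T] `*` `[- r, r]) (fun z : rT * rT => (F z.1 z.2)%:E).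
Proof.
move=> mF jb Fb b0 bn.
pose n := (Num.truncn `|r|).+1.
have rn : `|r| <= n%:R by rewrite ltW// truncnS_gt.
have mR : measurable (`[0, T] `*` `[- r, r] : set (rT * rT)) by exact: measurableX.
have mH : measurable (halfspace : set (rT * rT)) by exact: measurableX.
have sub : (`[0, T] `*` `[- r, r] : set (rT * rT)) `<=` halfspace.
  by move=> [t x] /= [+ _]; rewrite /halfspace /= !in_itv /= andbT => /andP[].
have mg : measurable_fun setT (fun z : rT * rT => (b z.1 z.2)%:E) by exact/measurable_EFinP.
apply/integrableP; split; first by apply/measurable_EFinP; exact: (measurable_funS mH sub mF).
apply: (@le_lt_trans _ _ (\int[(mu \x mu)%E]_(z in `[0%R, T] `*` `[(- n%:R)%R, n%:R]) (b z.1 z.2)%:E)%E).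
  apply: (@le_trans _ _ (\int[(mu \x mu)%E]_(z in `[0%R, T] `*` `[(- r)%R, r]) (b z.1 z.2)%:E)%E).
    apply: ge0_le_integral => //.
    - by apply: measurableT_comp => //; apply/measurable_EFinP; exact: (measurable_funS mH sub mF).
    - exact: measurable_funTS.
    - by move=> [t x] /= []; rewrite in_itv /= => /andP[t0 _] _; rewrite lee_fin Fb.
  apply: ge0_subset_integral => //.
  - exact: measurableX.
  - exact: measurable_funTS.
  - by move=> z _; rewrite lee_fin.
  - move=> [t x] /= []; rewrite !in_itv /= => tT /andP[x1 x2]; split => //.
    by apply/andP; split; have := ler_norm r; lra.
by rewrite integral_rect// => z; rewrite lee_fin.
Qed.

Lemma rect_integral_lty (T : R) (F : rT -> rT -> R) (n : nat) : jm F ->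
  (forall r : R, 0 < r -> (mu \x mu)%E.-integrable (`[0, T] `*` `[- r, r])
     (fun z : rT * rT => (F z.1 z.2)%:E)) ->
  (\int[mu]_(t in `[0%R, T]) \int[mu]_(x in `[(- n%:R)%R, n%:R]) `|F t x|%:E < +oo)%E.
Proof.
move=> jF hF; have n1 : 0 < n%:R + 1 :> R by rewrite ltr_wpDl.
have /integrableP[mF IF] := hF _ n1.
have mg : measurable_fun setT (fun z : rT * rT => `|F z.1 z.2|%:E).
  by apply/measurable_EFinP; exact: measurableT_comp.
rewrite -(@integral_rect _ _ (fun z => `|F z.1 z.2|%:E))//.
apply: le_lt_trans IF; apply: ge0_subset_integral => //.
- exact: measurableX.
- exact: measurableX.
- exact: measurable_funTS.
- move=> [t x] /= []; rewrite !in_itv /= => tT /andP[x1 x2]; split => //.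
  by apply/andP; split; lra.
Qed.

Lemma nm_locint_rect p (T B : R) (F : rT -> rT -> R) (n : nat) : (1 <= p)%E -> jm F ->
  0 <= T -> 0 <= B -> (forall t : R, 0 <= t <= T -> (nm p (F t) <= B%:E)%E) ->
  (\int[mu]_(t in `[0%R, T]) \int[mu]_(x in `[(- n%:R)%R, n%:R]) `|F t x|%:E < +oo)%E.
Proof.
move=> p1 jF T0 B0 hB.
pose C := (1 + 2 * n%:R) * (B + 1).
have mF t : measurable_fun setT (F t) by apply: (jm_comp jF).
apply: (@le_lt_trans _ _ (\int[mu]_(t in `[0%R, T]) C%:E)%E); last first.
  by rewrite integral_cst//= mu_itv_le// -EFinM ltry.
have C0 : 0 <= C by rewrite mulr_ge0// addr_ge0// mulr_ge0.
have inner (t : rT) : `[0, T]%classic t ->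
    (\int[mu]_(x in `[(- n%:R)%R, n%:R]) `|F t x|%:E <= C%:E)%E.
  rewrite /= in_itv /= => tT; apply: (integral_nm_le p1) => //.
  - by rewrite ltr_wpDl.
  - by rewrite mu_itv_le ?lee_fin; have := ler0n R n; lra.
  - by apply: le_trans (hB t tT) _; rewrite lee_fin lerDl.
apply: ge0_le_integral => //.
- by move=> t _; exact: integral_ge0.
- apply: measurable_funTS.
  pose g (z : rT * rT) : \bar R := (`|F z.1 z.2| * \1_`[(- n%:R : R), n%:R] z.2)%:E.
  have mg : measurable_fun setT g.
    apply/measurable_EFinP; apply: measurable_funM; first exact: measurableT_comp.
    by apply: (measurableT_comp (measurable_indic _)).
  rewrite (_ : (fun t => _) = (fun t : rT => \int[mu]_x g (t, x))%E).
    by apply: (measurable_fun_fubini_tonelli_F g mg) => z; rewrite lee_fin mulr_ge0.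
  apply/funext => t; rewrite integral_mkcond; apply: eq_integral => x _.
  by rewrite patchE /g /= indicE; case: (_ \in _); rewrite ?mulr1 ?mulr0.
Qed.

Lemma enormB n (u v : 'cV[R[i]]_n) : enorm u <=
  \sum_(i < n) (`|complex.Re ((u - v) i 0)| + `|complex.Im ((u - v) i 0)|) +
  \sum_(i < n) (`|complex.Re (v i 0)| + `|complex.Im (v i 0)|).
Proof.
apply: (le_trans (enorm_le _)); rewrite -big_split /=; apply: ler_sum => i _.
rewrite !mxE; case: (u i 0) => a b; case: (v i 0) => a' b' /=.
have := ler_normD (a - a') a'; have := ler_normD (b - b') b'.
by rewrite !subrK; lra.
Qed.

End SpaceTimeIntegrals.

(** * Uniqueness in the class *)

Section ClassUniqueness.
Context {R : realType}.
Local Notation mu := (@lebesgue_measure R).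
Local Notation rT := (measurableTypeR R).

(** A triangle inequality with the crude constant [2 n], enough to derive boundedness from
    continuity. *)
Let enorm_quasi n (u v : 'cV[R[i]]_n) :
  enorm u <= (2 * n%:R) * (enorm (u - v) + enorm v).
Proof.
have b (w : 'cV[R[i]]_n) : \sum_(i < n) (`|complex.Re (w i 0)| + `|complex.Im (w i 0)|) <=
    2 * n%:R * enorm w.
  apply: (@le_trans _ _ (\sum_(i < n) (enorm w + enorm w))).
    by apply: ler_sum => i _; rewrite lerD ?Re_le_enorm ?Im_le_enorm.
  by rewrite sumr_const card_ord -mulr2n -mulrnA -[leLHS]mulr_natl natrM.
apply: (le_trans (enormB u v)); rewrite mulrDr.
by apply: lerD; exact: b.
Qed.

(** For finite [p], strong continuity bounds the norm near each time and compactness of [[0, T]]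
    makes the bound uniform. For [p = +oo] boundedness is part of [weakstar_continuous]. *)
Lemma CLp_bounded (p : \bar R) n (f : rT -> rT -> 'cV[R[i]]_n) (T : R) :
  (1 <= p)%E -> CLp p f ->
  exists2 B : R, 0 <= B & forall t : R, 0 <= t <= T -> (Lpnorm p (f t) <= B%:E)%E.
Proof.
move=> p1 [_ fp]; case: p p1 fp => [r||] //= p1 fp; last first.
  move=> [hM _]; have [M hM'] := hM T; exists `|M| => // t tT.
  by apply: le_trans (hM' t tT) _; rewrite lee_fin ler_norm.
move=> sc.
have r1 : 1 <= r by rewrite lee_fin in p1.
have cov := (compact_near_coveringP _).1 (@segment_compact R 0 T).
have near_bound : \forall N \near \oo, (`[0, T]%classic : set R) `<=`
    (fun t : R => 0 <= t -> (Lpnorm r%:E (f t) <= (N%:R)%:E)%E).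
  apply: cov => t0; rewrite /= in_itv /= => /andP[t00 _].
  have [mf0 ft0] := fp t0 t00.
  pose K := fine (Lpnorm r%:E (f t0)).
  have fK : Lpnorm r%:E (f t0) = K%:E by rewrite fineK// ge0_fin_numE ?nm_ge0.
  have K0 : 0 <= K by exact: fine_ge0 (nm_ge0 _ _).
  have loc : \forall t \near (t0 : R), 0 <= t ->
      (Lpnorm r%:E (f t) <= (2 * n%:R * (1 + K))%:E)%E.
    have := sc t0 t00 => /fine_cvgP[h1 /cvgr0Pnorm_le/(_ _ ltr01) h2].
    have h12 : \forall t \near within `[0, +oo[ (nbhs (t0 : R)),
        Lpnorm r%:E (fun x => f t x - f t0 x) \is a fin_num /\
        `|fine (Lpnorm r%:E (fun x => f t x - f t0 x))| <= 1.
      by apply: filterS2 h1 h2.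
    move: h12; rewrite near_withinE; apply: filterS => t ht t_0.
    have [|hfin hle] := ht; first by rewrite /= in_itv /= t_0.
    have [mft _] := fp t t_0.
    have md : cmeasurable setT (fun x => f t x - f t0 x) by exact: cmeasurableB.
    have m1 := measurable_enorm md; have m0 := measurable_enorm mf0.
    have m10 := measurable_funD m1 m0.
    apply: (@le_trans _ _ (nm r%:E (fun x => 2 * n%:R * (enorm (f t x - f t0 x) + enorm (f t0 x))))).
      apply: nm_mono => //.
      - exact: measurable_enorm.
      - by apply: measurable_funM; [exact: measurable_cst|exact: m10].
      - apply: aeW => x; rewrite (ger0_norm (enorm_ge0 _)).
        by apply: le_trans (ler_norm _); exact: enorm_quasi.
    apply: (nmZ_le p1 (mulr_ge0 (ler0n _ 2) (ler0n _ n)) (addr_ge0 ler01 K0) m10).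
    apply: (le_trans (nmD p1 m1 m0)); rewrite EFinD; apply: leeD.
      rewrite -LpnormE -(fineK hfin) lee_fin.
      by apply: le_trans hle; exact: ler_norm.
    by rewrite -LpnormE fK.
  exists ([set t : R | 0 <= t -> (Lpnorm r%:E (f t) <= (2 * n%:R * (1 + K))%:E)%E],
          [set N : nat | 2 * n%:R * (1 + K) <= N%:R]).
    by split => //; exact: nbhs_infty_ger.
  move=> [t N] [/= ht hN] t_0; apply: le_trans (ht t_0) _; rewrite lee_fin//.
have [N _ hN] := near_bound; exists N%:R => // t /[dup] /andP[t_0 _] tT.
by apply: (hN N) => //=; rewrite in_itv.
Qed.

Variables (p : \bar R) (m c : R) (ty : bool) (alpha : 'M[R[i]]_2) (h : rT -> R).
Variables (psi0 : rT -> 'cV[R[i]]_2) (A0 : rT -> 'cV[R]_2).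
Variable V : bool -> component -> R -> R -> R.
Hypotheses (p1 : (1 <= p)%E) (m0 : 0 < m) (c0 : 0 <= c).
Hypothesis qE : forall psi A, quadf alpha psi 0 0 = (qf ty (cmp psi A))%:C.
Hypotheses (mh : measurable_fun setT h) (h0 : forall z, 0 <= h z) (hc : (nm p h <= c%:E)%E).
Let f s k y := cmp (psi0 y) (A0 y) s k.
Hypothesis mf : forall s k, measurable_fun setT (f s k).
Hypothesis fh : forall s y, n3 (fun k => f s k y) <= h y.
Hypothesis jV : forall s k, jm (V s k).
Hypothesis VE : forall s k t y, 0 <= t -> V s k t (y + sgn s * t) = f s k y +
  \int[mu]_(r in `[0, t]) csd m ty s k (fun s' k' => V s' k' r (y + sgn s * r)).
Hypothesis Vle : forall s t y, 0 <= t -> n3 (fun k => V s k t (y + sgn s * t)) <=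
  Gam m (c + 1) t * (h y + win h t (y + sgn s * t)).

Variables (psi : rT -> rT -> 'cV[R[i]]_2) (A : rT -> rT -> 'cV[R]_2).
Hypothesis ws : weak_solution m alpha psi0 A0 psi A.
Hypotheses (cpsi : CLp p psi) (cA' : CLp p (fun t x => cvec (A t x))).

(** Measurability of a member of the class is known on the half-space only; extending by 0 to
    negative times makes the components jointly measurable on the plane. *)
Let U s k (t x : R) : R := if 0 <= t then cmp (psi t x) (A t x) s k else 0.

Let UF t x : 0 <= t -> (fun s k => U s k t x) = cmp (psi t x) (A t x).
Proof. by move=> t0; apply/funext => s; apply/funext => k; rewrite /U t0. Qed.

Let jU s k : jm (U s k).
Proof.
have mb : measurable_fun setT (fun z : rT * rT => 0 <= z.1) by exact: measurable_fun_ler.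
apply: measurable_fun_if => //.
rewrite (_ : _ `&` _ = (halfspace : set (rT * rT))).
  by apply: measurable_cmp; [case: cpsi|case: cA'].
apply/seteqP; split => [[t x]|[t x]] /=; rewrite /halfspace /= in_itv /= andbT.
  by move=> [_ ->].
by move=> [-> _].
Qed.

Let mtot t : measurable_fun setT (fun x : rT => tot (fun s k => U s k t x)).
Proof. by apply: measurable_tot => s k; apply: (jm_comp (jU s k)). Qed.

Let tot_bounded T : exists2 B : R, 0 <= B & forall t, 0 <= t <= T ->
  (nm p (fun x => tot (fun s k => U s k t x)) <= B%:E)%E.
Proof.
have [B1 B10 hB1] := CLp_bounded T p1 cpsi.
have [B2 B20 hB2] := CLp_bounded T p1 cA'.
exists (8 * (B1 + B2)); first by rewrite mulr_ge0// addr_ge0.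
move=> t tT; have /andP[t_0 _] := tT.
have [_ hpsi _] := cpsi; have [mpsi _] := hpsi t t_0.
have [_ hA _] := cA'; have [mA _] := hA t t_0.
have m1 := measurable_enorm mpsi; have m2 := measurable_enorm mA.
have m12 := measurable_funD m1 m2.
apply: (@le_trans _ _ (nm p (fun x => 8 * (enorm (psi t x) + enorm (cvec (A t x)))))).
  apply: nm_mono => //.
    by apply: measurable_funM; [exact: measurable_cst|exact: m12].
  apply: aeW => x; rewrite (ger0_norm (tot_ge0 _)) UF//.
  by apply: le_trans (ler_norm _); exact: tot_cmp_le.
apply: nmZ_le => //; first by rewrite addr_ge0.
apply: (le_trans (nmD p1 m1 m2)); rewrite EFinD.
by apply: leeD; [exact: hB1|exact: hB2].
Qed.

Let U_nm s k T B : (forall t, 0 <= t <= T ->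
    (nm p (fun x => tot (fun s k => U s k t x)) <= B%:E)%E) ->
  forall t : R, 0 <= t <= T -> (nm p (U s k t) <= B%:E)%E.
Proof.
move=> hB t tT; apply: le_trans (hB t tT); apply: nm_mono => //.
  by apply: (jm_comp (jU s k)).
apply: aeW => x; rewrite (ger0_norm (tot_ge0 _)).
apply: (le_trans (le_n3 (fun k => U s k t x) k)).
exact: (n3_le_tot (fun s k => U s k t x)).
Qed.

Let rect_lty_le T n (F a b : R -> R -> R) (K : R) : jm F -> jm a -> jm b -> 0 <= K ->
  (forall t x, `|F t x| <= `|a t x| + K * `|b t x|) ->
  (\int[mu]_(t in `[0%R, T]) \int[mu]_(x in `[(- n%:R)%R, n%:R]) `|a t x|%:E < +oo)%E ->
  (\int[mu]_(t in `[0%R, T]) \int[mu]_(x in `[(- n%:R)%R, n%:R]) `|b t x|%:E < +oo)%E ->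
  (\int[mu]_(t in `[0%R, T]) \int[mu]_(x in `[(- n%:R)%R, n%:R]) `|F t x|%:E < +oo)%E.
Proof.
move=> jF ja jb K0 Fab ha hb.
have mR : measurable (`[0, T] `*` `[(- n%:R : R), n%:R] : set (rT * rT)) by exact: measurableX.
have mg (G : R -> R -> R) : jm G -> measurable_fun setT (fun z : rT * rT => `|G z.1 z.2|%:E).
  by move=> jG; apply/measurable_EFinP; exact: measurableT_comp.
have mF' := mg _ jF; have ma' := mg _ ja; have mb' := mg _ jb.
have rE (G : R -> R -> R) (jG : jm G) := integral_rect (measurable_itv `[0, T])
  (measurable_itv `[- n%:R, n%:R]) (mg G jG) (fun z => normr_ge0 (G z.1 z.2)).
rewrite -(rE _ ja) in ha; rewrite -(rE _ jb) in hb; rewrite -(rE _ jF).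
apply: (@le_lt_trans _ _ (\int[(mu \x mu)%E]_(z in `[0%R, T] `*` `[(- n%:R)%R, n%:R])
   (`|a z.1 z.2|%:E + K%:E * `|b z.1 z.2|%:E))%E).
  apply: ge0_le_integral => //.
  - exact: measurable_funTS.
  - apply: measurable_funTS; apply: emeasurable_funD => //; exact: measurable_funeM.
  - by move=> z _; rewrite -EFinM -EFinD lee_fin.
rewrite ge0_integralD//; first last.
- by apply: measurable_funTS; exact: measurable_funeM.
- by move=> z _; rewrite -EFinM lee_fin mulr_ge0.
- exact: measurable_funTS.
apply: lte_add_pinfty => //; rewrite ge0_integralZl//; last exact: measurable_funTS.
exact: lte_mul_pinfty.
Qed.

(** The hypotheses of [weak_uniqueness] have two sources: the uniform [L^p] bound gives local
    integrability of the unknowns and the window bound, while the definition of a weak solution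
    gives local integrability of the nonlinear terms and the Duhamel formulas. *)
Lemma class_uniqueness s k t : 0 <= t ->
  {ae mu, forall x : rT, cmp (psi t x) (A t x) s k = V s k t x}.
Proof.
move=> t_0; pose T := t + 1.
have T0 : 0 < T by rewrite ltr_wpDl.
have [B B0 hB] := tot_bounded T.
have [li1 li2 eq1 eq2] := ws.
have linear_locint s' k' n : (\int[mu]_(t in `[0%R, T])
    \int[mu]_(x in `[(- n%:R)%R, n%:R]) `|U s' k' t x|%:E < +oo)%E.
  exact: (nm_locint_rect n p1 (jU s' k') (ltW T0) B0 (U_nm s' k' hB)).
have rectE (F G : rT -> rT -> R) (r : R) : (forall t x, 0 <= t -> F t x = G t x) ->
    (mu \x mu)%E.-integrable (`[0, T] `*` `[- r, r]) (fun z : rT * rT => (F z.1 z.2)%:E) ->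
    (mu \x mu)%E.-integrable (`[0, T] `*` `[- r, r]) (fun z : rT * rT => (G z.1 z.2)%:E).
  move=> FG; apply: eq_integrable; first exact: measurableX.
  move=> [t' x]; rewrite inE /= => -[]; rewrite in_itv /= => /andP[t'0 _] _.
  by rewrite FG.
have prodP s' n : (\int[mu]_(t in `[0%R, T]) \int[mu]_(x in `[(- n%:R)%R, n%:R])
    `|U (~~ s') cA t x * U s' cP t x|%:E < +oo)%E.
  apply: (@rect_integral_lty _ T (fun t x => U (~~ s') cA t x * U s' cP t x)).
    exact: (measurable_funM (jU (~~ s') cA) (jU s' cP)).
  move=> r r0; have [hi _] := li1 s' T r T0 r0.
  refine (rectE (fun t x => complex.Re ((A_pm (~~ s') (A t x))%:C * psi_pm s' (psi t x)))
    (fun t x => U (~~ s') cA t x * U s' cP t x) r _ hi) => t' x t'0.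
  by rewrite /U t'0 /=; case: (psi_pm s' _) => a b /=; rewrite mul0r subr0.
have prodQ s' n : (\int[mu]_(t in `[0%R, T]) \int[mu]_(x in `[(- n%:R)%R, n%:R])
    `|U (~~ s') cA t x * U s' cQ t x|%:E < +oo)%E.
  apply: (@rect_integral_lty _ T (fun t x => U (~~ s') cA t x * U s' cQ t x)).
    exact: (measurable_funM (jU (~~ s') cA) (jU s' cQ)).
  move=> r r0; have [_ hi] := li1 s' T r T0 r0.
  refine (rectE (fun t x => complex.Im ((A_pm (~~ s') (A t x))%:C * psi_pm s' (psi t x)))
    (fun t x => U (~~ s') cA t x * U s' cQ t x) r _ hi) => t' x t'0.
  by rewrite /U t'0 /=; case: (psi_pm s' _) => a b /=; rewrite mul0r addr0.
have jq : jm (fun t x => qf ty (fun s' k' => U s' k' t x)).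
  have j s' k' s'' k'' := measurable_funM (jU s' k') (jU s'' k'').
  rewrite /jm /qf; case: ty; [apply: measurable_funB|apply: measurable_funD]; exact: j.
have prodA n : (\int[mu]_(t in `[0%R, T]) \int[mu]_(x in `[(- n%:R)%R, n%:R])
    `|qf ty (fun s' k' => U s' k' t x)|%:E < +oo)%E.
  apply: (@rect_integral_lty _ T (fun t x => qf ty (fun s' k' => U s' k' t x))) => //.
  move=> r r0; have [hi _] := li2 T r T0 r0.
  refine (rectE (fun t x => complex.Re (quadf alpha (psi t x) 0 0))
    (fun t x => qf ty (fun s' k' => U s' k' t x)) r _ hi) => t' x t'0.
  by rewrite (qE _ (A t' x)) UF.
have FU_locint s' k' n : (\int[mu]_(t in `[0%R, T]) \int[mu]_(x in `[(- n%:R)%R, n%:R])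
    `|csd m ty s' k' (fun s'' k'' => U s'' k'' t x)|%:E < +oo)%E.
  have jc := jm_csd m ty jU s' k'; case: k' jc => jc.
  - apply: (rect_lty_le jc _ (jU (~~ s') cQ) (ltW m0) _ (prodQ s' n)) => //.
      exact: (measurable_funM (jU (~~ s') cA) (jU s' cQ)).
    move=> t' x /=; rewrite mulNr (le_trans (ler_normD _ _))// normrN normrM.
    by rewrite [`|m * _|]normrM (ger0_norm (ltW m0)).
  - apply: (rect_lty_le jc _ (jU (~~ s') cP) (ltW m0) _ (prodP s' n)) => //.
      exact: (measurable_funM (jU (~~ s') cA) (jU s' cP)).
    move=> t' x /=; rewrite (le_trans (ler_normB _ _))// normrM.
    by rewrite [`|m * _|]normrM (ger0_norm (ltW m0)).
  - apply: (rect_lty_le jc jq (jU false cP) (lexx 0) _ (prodA n)) => //.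
    by move=> t' x /=; rewrite mul0r addr0 normrM normrN norm_sgn mul1r.
(* The window has length [4 T]; [B + 1] provides the positive bound asked for by
   [integral_nm_le]. *)
pose C := (1 + 4 * T) * (B + 1).
have C0 : 0 <= C by rewrite mulr_ge0// ?addr_ge0// mulr_ge0// ltW.
have U_window s' t' (y : R) : 0 <= t' <= T ->
    (\int[mu]_(z in `[(y - 2 * T)%R, (y + 2 * T)%R])
      (`|U s' cP t' (z + sgn s' * t')| + `|U s' cQ t' (z + sgn s' * t')|)%:E <= C%:E)%E.
  move=> tT; pose g x := `|U s' cP t' x| + `|U s' cQ t' x|.
  have mg : measurable_fun setT g.
    by apply: measurable_funD; apply: measurableT_comp => //; exact: (jm_comp (jU _ _)).
  have mgs : measurable_fun setT (fun x : rT => g (x + sgn s' * t')) by exact: measurable_shift.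
  apply: (@le_trans _ _ (\int[mu]_(z in `[(y - 2 * T)%R, (y + 2 * T)%R]) `|g (z + sgn s' * t')|%:E)%E).
    rewrite le_eqVlt; apply/orP; left; apply/eqP; apply: eq_integral => z _.
    by rewrite /g (ger0_norm (addr_ge0 _ _)).
  apply: (integral_nm_le p1 _ _ _ _ mgs) => //.
  - by rewrite ltr_wpDl.
  - by rewrite mulr_ge0// ltW.
  - by rewrite mu_itv_le ?lee_fin; lra.
  rewrite (nm_shift _ p1 mg); apply: (@le_trans _ _ B%:E); last by rewrite lee_fin lerDl.
  apply: le_trans (hB t' tT); apply: nm_mono => //; apply: aeW => x.
  rewrite (ger0_norm (tot_ge0 _)) /g (ger0_norm (addr_ge0 _ _))//.
  apply: le_trans (n3_le_tot (fun s k => U s k t' x) s').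
  by rewrite /n3 lerDl.
have UE s' k' t' : 0 <= t' -> {ae mu, forall x : rT, U s' k' t' x = f s' k' (x - sgn s' * t') +
    \int[mu]_(r in `[0, t']) csd m ty s' k' (fun s'' k'' => U s'' k'' r (x - sgn s' * (t' - r)))}.
  move=> t'0.
  have e1 : {ae mu, forall x : rT, forall k, k <> cA -> cmp (psi t' x) (A t' x) s' k =
     cmp (psi0 (x - sgn s' * t')) (A0 (x - sgn s' * t')) s' k +
     \int[mu]_(r in `[0, t']) csd m ty s' k (cmp (psi r (x - sgn s' * (t' - r))) (A r (x - sgn s' * (t' - r))))}.
    by have := eq1 s' t' t'0; apply: filterS => x /duhamel_psi; apply.
  have e2 : {ae mu, forall x : rT, cmp (psi t' x) (A t' x) s' cA =
     cmp (psi0 (x - sgn s' * t')) (A0 (x - sgn s' * t')) s' cA +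
     \int[mu]_(r in `[0, t']) csd m ty s' cA (cmp (psi r (x - sgn s' * (t' - r))) (A r (x - sgn s' * (t' - r))))}.
    by have := eq2 s' t' t'0; apply: filterS => x; exact: (duhamel_A m s' t' x psi0 A0 psi A qE).1.
  apply: filterS2 e1 e2 => x h1 h2.
  have -> : U s' k' t' x = cmp (psi t' x) (A t' x) s' k' by rewrite /U t'0.
  have -> : \int[mu]_(r in `[0, t']) csd m ty s' k' (fun s'' k'' => U s'' k'' r (x - sgn s' * (t' - r)))
      = \int[mu]_(r in `[0, t']) csd m ty s' k' (cmp (psi r (x - sgn s' * (t' - r))) (A r (x - sgn s' * (t' - r)))).
    apply: eq_Rintegral => r; rewrite inE /= in_itv /= => /andP[r0 _].
    by rewrite UF.
  by case: k'; [exact: h1|exact: h1|exact: h2].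
have ul := uloc_nm p1 c0 mh h0 hc.
have tT : 0 <= t <= T by rewrite t_0 /T /=; lra.
have res : {ae mu, forall x : rT, U s k t x = V s k t x}.
  exact: (weak_uniqueness m0 (ltW T0) C0 ul mf fh jU jV linear_locint FU_locint U_window UE VE Vle s k tT).
by move: res; apply: filterS => x; rewrite /U t_0.
Qed.

End ClassUniqueness.

(** * The solution map *)

Section SolutionClass.
Context {R : realType}.
Local Notation mu := (@lebesgue_measure R).
Local Notation rT := (measurableTypeR R).
Implicit Types (s : bool) (k : component) (X Y : bool -> component -> R).

Lemma cmp_spinorE X : cmp (spinor X) (potential X) = X.
Proof. by apply/funext => s; apply/funext => k; rewrite cmp_spinor. Qed.

Lemma gauge_product X s :
  (complex.Re ((A_pm (~~ s) (potential X))%:C * psi_pm s (spinor X)) = X (~~ s) cA * X s cP) *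
  (complex.Im ((A_pm (~~ s) (potential X))%:C * psi_pm s (spinor X)) = X (~~ s) cA * X s cQ).
Proof.
have hP := cmp_spinor X s cP; have hQ := cmp_spinor X s cQ.
have hA := cmp_spinor X (~~ s) cA; rewrite /= in hP hQ hA.
move: hP hQ; case: (psi_pm s _) => a b /= <- <-; rewrite hA.
by split; ring.
Qed.

Lemma gauge_product_le X s k : `|X (~~ s) cA * X s k| <= n3 (X false) * n3 (X true).
Proof.
rewrite normrM; case: s => /=; last rewrite mulrC;
  by apply: ler_pM => //; exact: le_n3.
Qed.

Lemma qf_n3_le ty X : `|qf ty X| <= n3 (X false) * n3 (X true).
Proof.
apply: (le_trans (qf_le ty false X)).
by apply: ler_pM; rewrite ?addr_ge0// /n3 lerDl.
Qed.

Lemma enorm_spinorB X Y : enorm (spinor X - spinor Y) <= tot (fun s k => X s k - Y s k).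
Proof.
have := enorm_psi_le (spinor X - spinor Y) (potential X - potential Y).
by rewrite /tot /n3 !cmpB !cmp_spinor.
Qed.

Lemma enorm_potentialB X Y :
  enorm (cvec (potential X - potential Y)) <= tot (fun s k => X s k - Y s k).
Proof.
have := enorm_A_le (spinor X - spinor Y) (potential X - potential Y).
by rewrite /tot /n3 !cmpB !cmp_spinor.
Qed.

Lemma enorm_spinor X : enorm (spinor X) <= tot X.
Proof. by have := enorm_psi_le (spinor X) (potential X); rewrite cmp_spinorE. Qed.

Lemma enorm_potential X : enorm (cvec (potential X)) <= tot X.
Proof. by have := enorm_A_le (spinor X) (potential X); rewrite cmp_spinorE. Qed.

Lemma nm_tot (p : \bar R) (e : R) (X : bool -> component -> rT -> R) : (1 <= p)%E ->
  (forall s k, measurable_fun setT (X s k)) ->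
  (forall s k, (nm p (X s k) <= e%:E)%E) ->
  (nm p (fun x => tot (fun s k => X s k x)) <= (6 * e)%:E)%E.
Proof.
move=> p1 mX Xe.
have ma s k : measurable_fun setT (fun x => `|X s k x|) by exact: measurableT_comp.
have na s k : (nm p (fun x => `|X s k x|%R) <= e%:E)%E.
  by apply: le_trans (Xe s k); apply: nm_mono => //; apply: aeW => x; rewrite normr_id.
have n2 s : (nm p (fun x => n3 (fun k => X s k x)) <= (3 * e)%:E)%E.
  apply: (le_trans (nmD p1 (measurable_funD (ma s cP) (ma s cQ)) (ma s cA))).
  rewrite (_ : 3 * e = e + e + e); last by ring.
  rewrite EFinD; apply: leeD => //; apply: (le_trans (nmD p1 (ma s cP) (ma s cQ))).
  by rewrite EFinD; exact: leeD.
have m3 s : measurable_fun setT (fun x => n3 (fun k => X s k x)).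
  exact: (measurable_funD (measurable_funD (ma s cP) (ma s cQ)) (ma s cA)).
apply: (le_trans (nmD p1 (m3 false) (m3 true))).
by rewrite (_ : 6 * e = 3 * e + 3 * e) ?EFinD ?leeD//; ring.
Qed.

Variables (p : \bar R) (m c : R) (ty : bool) (alpha : 'M[R[i]]_2) (h : rT -> R).
Variables (psi0 : rT -> 'cV[R[i]]_2) (A0 : rT -> 'cV[R]_2).
Variable U : bool -> component -> R -> R -> R.
Hypotheses (p1 : (1 <= p)%E) (m0 : 0 < m) (c0 : 0 <= c).
Hypothesis qE : forall psi A, quadf alpha psi 0 0 = (qf ty (cmp psi A))%:C.
Hypotheses (mh : measurable_fun setT h) (h0 : forall z, 0 <= h z) (hc : (nm p h <= c%:E)%E).
Let f s k y := cmp (psi0 y) (A0 y) s k.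
Hypothesis jU : forall s k, jm (U s k).
Hypothesis UE : forall s k t y, 0 <= t -> U s k t (y + sgn s * t) = f s k y +
  \int[mu]_(r in `[0, t]) csd m ty s k (fun s' k' => U s' k' r (y + sgn s * r)).
Hypothesis Ule : forall s t y, 0 <= t -> n3 (fun k => U s k t (y + sgn s * t)) <=
  Gam m (c + 1) t * (h y + win h t (y + sgn s * t)).

Let psi t x := spinor (fun s k => U s k t x).
Let A t x := potential (fun s k => U s k t x).

Let prod t x := n3 (fun k => U false k t x) * n3 (fun k => U true k t x).

Let jprod : jm prod.
Proof. by apply: measurable_funM; apply: measurable_n3 => k; exact: jU. Qed.

Let prod0 t x : 0 <= prod t x. Proof. by rewrite mulr_ge0// n3_ge0. Qed.

Let mUt s k t : measurable_fun setT (U s k t : rT -> R).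
Proof. by apply: (jm_comp (jU s k)). Qed.

(** The Duhamel formulas hold at every point, so the almost everywhere clauses are immediate; all
    nonlinear terms are dominated by the product of the sizes of the two families, which is locally
    integrable. *)
Lemma solution_weak : weak_solution m alpha psi0 A0 psi A.
Proof.
have key s k t x : 0 <= t -> U s k t x = f s k (x - sgn s * t) +
    \int[mu]_(r in `[0, t]) csd m ty s k (fun s' k' => U s' k' r (x - sgn s * (t - r))).
  move=> t0; have := UE s k (x - sgn s * t) t0; rewrite subrK => ->; congr (_ + _).
  apply: eq_Rintegral => r _; congr (csd _ _ _ _ _).
  by apply/funext => s'; apply/funext => k'; congr (U _ _ _ _); ring.
have loc T r (F : rT -> rT -> R) : 0 < T -> jm F -> (forall t x, `|F t x| <= prod t x) ->
    (mu \x mu)%E.-integrable (`[0, T] `*` `[- r, r]) (fun z : rT * rT => (F z.1 z.2)%:E).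
  move=> T0 jF Fp.
  apply: (integrable_rect_of_bound r (measurable_funTS jF) jprod (fun t x _ => Fp t x) prod0) => n.
  exact: (sol_product_locint p1 m0 c0 mh h0 hc jU Ule n T0).
have jq : jm (fun t x => qf ty (fun s' k' => U s' k' t x)).
  have j s' k' s'' k'' := measurable_funM (jU s' k') (jU s'' k'').
  rewrite /jm /qf; case: ty; [apply: measurable_funB|apply: measurable_funD]; exact: j.
have int0 T r : (mu \x mu)%E.-integrable (`[0, T] `*` `[- r, r]) (fun z : rT * rT => (0 : R)%:E).
  exact: integrable0.
split.
- move=> s T r T0 r0; split.
    rewrite (_ : (fun z => _) = (fun z : rT * rT => (U (~~ s) cA z.1 z.2 * U s cP z.1 z.2)%:E)).
      apply: (loc T r (fun t x => U (~~ s) cA t x * U s cP t x) T0).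
        exact: (measurable_funM (jU (~~ s) cA) (jU s cP)).
      by move=> t x; exact: (gauge_product_le (fun s k => U s k t x)).
    by apply/funext => z; rewrite gauge_product.
  rewrite (_ : (fun z => _) = (fun z : rT * rT => (U (~~ s) cA z.1 z.2 * U s cQ z.1 z.2)%:E)).
    apply: (loc T r (fun t x => U (~~ s) cA t x * U s cQ t x) T0).
      exact: (measurable_funM (jU (~~ s) cA) (jU s cQ)).
    by move=> t x; exact: (gauge_product_le (fun s k => U s k t x)).
  by apply/funext => z; rewrite gauge_product.
- move=> T r T0 r0; split.
    rewrite (_ : (fun z => _) = (fun z : rT * rT => (qf ty (fun s k => U s k z.1 z.2))%:E)).
      apply: (loc T r (fun t x => qf ty (fun s k => U s k t x)) T0 jq) => t x.
      exact: qf_n3_le.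
    by apply/funext => z; rewrite (qE _ (A z.1 z.2)) cmp_spinorE.
  rewrite (_ : (fun z => _) = (fun z : rT * rT => (0 : R)%:E))//.
  by apply/funext => z; rewrite (qE _ (A z.1 z.2)).
- move=> s t t0; apply: aeW => x; apply/(duhamel_psi m ty s t x psi0 A0 psi A) => k _.
  rewrite /psi /A cmp_spinor key//; congr (_ + _); apply: eq_Rintegral => r _.
  by congr (csd _ _ _ _ _); apply/funext => s'; apply/funext => k'; rewrite cmp_spinor.
- move=> s t t0; apply: aeW => x; apply/(duhamel_A m s t x psi0 A0 psi A qE).
  rewrite /psi /A cmp_spinor key//; congr (_ + _); apply: eq_Rintegral => r _.
  by congr (csd _ _ _ _ _); apply/funext => s'; apply/funext => k'; rewrite cmp_spinor.
Qed.

Let U_nm T : exists2 B : R, 0 <= B & forall s k t, 0 <= t <= T -> (nm p (U s k t) <= B%:E)%E.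
Proof.
have [T0|T0] := leP 0 T; last first.
  by exists 0 => // s k t /andP[t0 tT]; have := lt_le_trans T0 (le_trans t0 tT); rewrite ltxx.
pose B := Gam m (c + 1) T * (c + (1 + 2 * T) ^+ 2 * c).
have B0 : 0 <= B.
  rewrite mulr_ge0//; last by rewrite addr_ge0// mulr_ge0// sqr_ge0.
  by apply: le_trans ler01 _; apply: Gam_ge1 => //; [exact: ltW|exact: addr_ge0].
exists B => // s k t tT.
apply: le_trans (sol_nm p1 m0 c0 mh h0 hc jU Ule s tT).
apply: nm_mono => //; first by apply: measurable_n3 => k'; exact: mUt.
apply: aeW => x; rewrite (ger0_norm (n3_ge0 _)).
exact: (le_n3 (fun k => U s k t x)).
Qed.

Let cmpsi t : cmeasurable setT (psi t).
Proof. by apply: (cmeasurable_spinor (X := fun s k => U s k t)) => s k; exact: mUt. Qed.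

Let cmA t : cmeasurable setT (fun x => cvec (A t x)).
Proof. by apply: (cmeasurable_potential (X := fun s k => U s k t)) => s k; exact: mUt. Qed.

Let jpsi : jmeasurable psi.
Proof.
apply: (@cmeasurable_spinor _ _ _ halfspace (fun s k z => U s k z.1 z.2)) => s k.
by apply: measurable_funTS; exact: jU.
Qed.

Let jA : jmeasurable (fun t x => cvec (A t x)).
Proof.
apply: (@cmeasurable_potential _ _ _ halfspace (fun s k z => U s k z.1 z.2)) => s k.
by apply: measurable_funTS; exact: jU.
Qed.

Let nm_enorm_le (X : bool -> component -> rT -> R) (F : rT -> R) e : (forall x, 0 <= F x) ->
  (forall x, F x <= tot (fun s k => X s k x)) -> measurable_fun setT F ->
  (forall s k, measurable_fun setT (X s k)) ->
  (forall s k, (nm p (X s k) <= e%:E)%E) -> (nm p F <= (6 * e)%:E)%E.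
Proof.
move=> F0 FX mF mX Xe; apply: le_trans (nm_tot p1 mX Xe).
apply: nm_mono => //; first exact: measurable_tot.
by apply: aeW => x; rewrite (ger0_norm (F0 x)) (ger0_norm (tot_ge0 _)).
Qed.

Let psi_bounded T : exists2 B : R, 0 <= B & forall t, 0 <= t <= T ->
  (Lpnorm p (psi t) <= B%:E)%E /\ (Lpnorm p (fun x => cvec (A t x)) <= B%:E)%E.
Proof.
have [B B0 hB] := U_nm T; exists (6 * B); first exact: mulr_ge0.
move=> t tT; rewrite !LpnormE; split; apply: (@nm_enorm_le (fun s k => U s k t)).
- by move=> x; exact: enorm_ge0.
- by move=> x; exact: enorm_spinor.
- exact: (measurable_enorm (cmpsi t)).
- by move=> s k; exact: mUt.
- by move=> s k; exact: hB.
- by move=> x; exact: enorm_ge0.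
- by move=> x; exact: enorm_potential.
- exact: (measurable_enorm (cmA t)).
- by move=> s k; exact: mUt.
- by move=> s k; exact: hB.
Qed.

Let within_cvg0 (phi : R -> \bar R) t0 : 0 <= t0 ->
  (forall t, 0 <= t -> phi t \is a fin_num) -> (forall t, (0 <= phi t)%E) ->
  (forall e : R, 0 < e -> exists2 d : R, 0 < d &
     forall t, 0 <= t -> `|t - t0| < d -> (phi t <= e%:E)%E) ->
  phi t @[t --> within `[0, +oo[ (nbhs (t0 : R))] --> 0%E.
Proof.
move=> t00 pf ph0 he; apply/fine_cvgP; split.
  rewrite near_withinE; apply: nearW => t; rewrite /= in_itv /= andbT.
  exact: pf.
apply/cvgr0Pnorm_le => e e0; rewrite near_withinE.
have [d d0 hd] := he e e0; apply/nbhs_normP; exists d => //= t.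
rewrite /ball_ /= distrC => td; rewrite in_itv /= andbT => t_0.
rewrite ger0_norm ?fine_ge0// -lee_fin fineK ?pf//.
exact: hd.
Qed.

Let common_delta t0 (phi : bool -> component -> R -> Prop) :
  (forall s k, exists2 d : R, 0 < d & forall t, 0 <= t -> `|t - t0| < d -> phi s k t) ->
  exists2 d : R, 0 < d & forall t, 0 <= t -> `|t - t0| < d -> forall s k, phi s k t.
Proof.
move=> hphi.
have [d1 d10 h1] := hphi false cP; have [d2 d20 h2] := hphi false cQ.
have [d3 d30 h3] := hphi false cA; have [d4 d40 h4] := hphi true cP.
have [d5 d50 h5] := hphi true cQ; have [d6 d60 h6] := hphi true cA.
exists (Num.min (Num.min (Num.min d1 d2) (Num.min d3 d4)) (Num.min d5 d6)).
  by rewrite !lt_min d10 d20 d30 d40 d50 d60.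
move=> t t_0; rewrite !lt_min => /andP[/andP[/andP[? ?] /andP[? ?]] /andP[? ?]].
by case; case; [exact: h4|exact: h5|exact: h6|exact: h1|exact: h2|exact: h3].
Qed.

Let strong_psi_A (r : R) : p = r%:E ->
  strong_continuous p psi /\ strong_continuous p (fun t x => cvec (A t x)).
Proof.
move=> pr.
have main n (F : rT -> rT -> 'cV[R[i]]_n) : (forall t, cmeasurable setT (F t)) ->
    (forall t t' x, enorm (F t x - F t' x) <= tot (fun s k => U s k t x - U s k t' x)) ->
    (forall T, exists2 B : R, 0 <= B & forall t, 0 <= t <= T -> (Lpnorm p (F t) <= B%:E)%E) ->
    strong_continuous p F.
  move=> mF FU FB t0 t00.
  have md t : cmeasurable setT (fun x => F t x - F t0 x) by exact: cmeasurableB.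
  have mdU s k t : measurable_fun setT (fun x : rT => U s k t x - U s k t0 x).
    exact: (measurable_funB (mUt s k t) (mUt s k t0)).
  apply: within_cvg0 => //.
  - move=> t t_0; rewrite LpnormE ge0_fin_numE ?nm_ge0//.
    have [B B0 hB] := U_nm (Num.max t t0).
    have b s k t' : 0 <= t' <= Num.max t t0 -> (nm p (U s k t') <= B%:E)%E by exact: hB.
    apply: (@le_lt_trans _ _ (6 * (B + B))%:E); last exact: ltry.
    apply: (@nm_enorm_le (fun s k x => U s k t x - U s k t0 x)) => //.
    + by move=> x; exact: enorm_ge0.
    + exact: (measurable_enorm (md t)).
    + move=> s k; have mn : measurable_fun setT (fun x : rT => - U s k t0 x).
        exact: measurableT_comp.
      apply: (le_trans (nmD p1 (mUt s k t) mn)); rewrite EFinD; apply: leeD.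
        by apply: hB; rewrite t_0 le_max lexx.
      apply: (@le_trans _ _ (nm p (U s k t0))).
        by apply: nm_mono => //; apply: aeW => x; rewrite normrN.
      by apply: hB; rewrite t00 le_max lexx orbT.
  - by move=> t; rewrite LpnormE nm_ge0.
  - move=> e e0; have e6 : 0 < e / 6 by rewrite divr_gt0.
    have [d d0 hd] := @common_delta t0 (fun s k t => (nm p (fun x => U s k t x - U s k t0 x)%R <= (e / 6)%:E)%E)
      (fun s k => sol_strong_continuous p1 m0 c0 mh h0 hc jU UE Ule s k pr t00 e6).
    exists d => // t t_0 td.
    rewrite LpnormE (_ : e = 6 * (e / 6)); last by field.
    apply: (@nm_enorm_le (fun s k x => U s k t x - U s k t0 x)) => //.
    + by move=> x; exact: enorm_ge0.
    + exact: (measurable_enorm (md t)).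
    + by move=> s k; exact: hd.
split; apply: main => //.
- by move=> t t' x; exact: enorm_spinorB.
- by move=> T; have [B B0 hB] := psi_bounded T; exists B => // t /hB[].
- by move=> t t' x; rewrite -map_mxB; exact: enorm_potentialB.
- by move=> T; have [B B0 hB] := psi_bounded T; exists B => // t /hB[].
Qed.

(** Entries of the spinor and of the potential are half sums or half differences of the two
    families, so weak-star continuity reaches them through linear combinations. *)
Let weak_combination k (a b : R) (g : rT -> R) : p = +oo%E ->
  mu.-integrable setT (EFin \o g) ->
  {within `[0, +oo[, continuous ((fun t =>
     \int[mu]_x ((a * U false k t x + b * U true k t x) * g x)) : R -> R)}.
Proof.
move=> py Ig; apply/subspace_continuousP => t0; rewrite /= in_itv /= andbT => t00.
have mg : measurable_fun setT g by move/integrableP : Ig => [/measurable_EFinP].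
have one : (1 <= 1%:E :> \bar R)%E by [].
have IU s t : 0 <= t -> mu.-integrable setT (EFin \o (fun x => U s k t x * g x)).
  move=> t_0; have [B B0 hB] := U_nm t.
  have /nmy_leP hU : (nm +oo%E (U s k t) <= B%:E)%E by rewrite -py; apply: hB; rewrite t_0 lexx.
  have mUg : measurable_fun setT (fun x : rT => U s k t x * g x).
    exact: (measurable_funM (mUt s k t) mg).
  have ng : nm 1%:E g \is a fin_num by rewrite ge0_fin_numE ?nm_ge0// integrable_nm1.
  apply: nm1_integrable => //.
  apply: (@le_lt_trans _ _ (B * fine (nm 1%:E g))%:E); last exact: ltry.
  apply: (@le_trans _ _ (nm 1%:E (fun x => B * g x))).
    apply: nm_mono => //; first by apply: measurable_funM.
    by move: hU; apply: filterS => x hx; rewrite !normrM (ger0_norm B0) ler_wpM2r.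
  by apply: nmZ_le; rewrite ?fineK// fine_ge0// nm_ge0.
have lin t : 0 <= t -> \int[mu]_x ((a * U false k t x + b * U true k t x) * g x) =
    a * \int[mu]_x (U false k t x * g x) + b * \int[mu]_x (U true k t x * g x).
  move=> t_0; rewrite -RintegralZl//; last exact: IU.
  rewrite -RintegralZl//; last exact: IU.
  rewrite -RintegralD//; last 2 first.
    exact: (integrable_mulr a measurableT (IU false t t_0)).
    exact: (integrable_mulr b measurableT (IU true t t_0)).
  by apply: eq_Rintegral => x _; ring.
apply/cvgrPdist_le => e e0; rewrite near_withinE.
have eab : 0 < e / (`|a| + `|b| + 1).
  by rewrite divr_gt0// ltr_wpDl// addr_ge0.
have [d d0 hd] := @common_delta t0 (fun s k t =>
    `|\int[mu]_x (U s k t x * g x) - \int[mu]_x (U s k t0 x * g x)| <= e / (`|a| + `|b| + 1))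
  (fun s k => sol_weak_continuous p1 m0 c0 mh h0 hc jU UE Ule s k py t00 Ig eab).
apply/nbhs_normP; exists d => //= t; rewrite /ball_ /= distrC => td.
rewrite in_itv /= andbT => t_0.
rewrite /from_subspace (lin t0 t00) (lin t t_0) distrC.
have q1 := hd t t_0 td false k; have q2 := hd t t_0 td true k.
move: (\int[mu]_x (U false k t x * g x)) (\int[mu]_x (U true k t x * g x)) q1 q2.
move: (\int[mu]_x (U false k t0 x * g x)) (\int[mu]_x (U true k t0 x * g x)) => i1 i2 j1 j2 q1 q2.
rewrite (_ : a * j1 + b * j2 - (a * i1 + b * i2) = a * (j1 - i1) + b * (j2 - i2)); last by ring.
apply: (le_trans (ler_normD _ _)); rewrite !normrM.
have s1 := ler_wpM2l (normr_ge0 a) q1; have s2 := ler_wpM2l (normr_ge0 b) q2.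
apply: (le_trans (lerD s1 s2)).
rewrite -mulrDl mulrA ler_pdivrMr ?ltr_wpDl ?addr_ge0//.
by rewrite mulrC ler_wpM2l ?lerDl// ltW.
Qed.

Let weakstar_psi_A : p = +oo%E ->
  weakstar_continuous psi /\ weakstar_continuous (fun t x => cvec (A t x)).
Proof.
move=> py; split; split.
- by move=> T; have [B B0 hB] := psi_bounded T; exists B => t /hB[]; rewrite py.
- move=> i g Ig; split.
    have := @weak_combination cP 2^-1 (if i == 0 then 2^-1 else - 2^-1) g py Ig.
    rewrite (_ : (fun t => _) = (fun t => \int[mu]_x (complex.Re (psi t x i 0) * g x)))//.
    apply/funext => t; apply: eq_Rintegral => x _; congr (_ * _).
    by rewrite /psi mxE; case: ifP => _ /=; ring.
  have := @weak_combination cQ 2^-1 (if i == 0 then 2^-1 else - 2^-1) g py Ig.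
  rewrite (_ : (fun t => _) = (fun t => \int[mu]_x (complex.Im (psi t x i 0) * g x)))//.
  apply/funext => t; apply: eq_Rintegral => x _; congr (_ * _).
  by rewrite /psi mxE; case: ifP => _ /=; ring.
- by move=> T; have [B B0 hB] := psi_bounded T; exists B => t /hB[]; rewrite py.
- move=> i g Ig; split.
    have := @weak_combination cA (if i == 0 then 2^-1 else - 2^-1) 2^-1 g py Ig.
    rewrite (_ : (fun t => _) = (fun t => \int[mu]_x (complex.Re (cvec (A t x) i 0) * g x)))//.
    apply/funext => t; apply: eq_Rintegral => x _; congr (_ * _).
    by rewrite /A !mxE /=; case: ifP => _ /=; ring.
  have := @weak_combination cA 0 0 g py Ig.
  rewrite (_ : (fun t => _) = (fun t => \int[mu]_x (complex.Im (cvec (A t x) i 0) * g x)))//.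
  apply/funext => t; apply: eq_Rintegral => x _; congr (_ * _).
  by rewrite /A !mxE /=; ring.
Qed.

Let Linf_bounded t : 0 <= t ->
  (Lpnorm p (psi t) < +oo)%E /\ (Lpnorm p (fun x => cvec (A t x)) < +oo)%E.
Proof.
move=> t_0; have [B _ hB] := psi_bounded t.
have [|h1 h2] := hB t; first by rewrite t_0 lexx.
by split; [apply: le_lt_trans h1 _|apply: le_lt_trans h2 _]; exact: ltry.
Qed.

(** Both nonlinear quantities are at most twice the product of the sizes of the two families, whose
    mixed norm is finite by transversality. *)
Lemma solution_class : uniqueness_class p alpha psi A.
Proof.
have jq : jm (fun t x => qf ty (fun s' k' => U s' k' t x)).
  have j s' k' s'' k'' := measurable_funM (jU s' k') (jU s'' k'').
  rewrite /jm /qf; case: ty; [apply: measurable_funB|apply: measurable_funD]; exact: j.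
have qU t x : quadf alpha (psi t x) 0 0 = (qf ty (fun s k => U s k t x))%:C.
  by rewrite (qE _ (A t x)) cmp_spinorE.
split.
- split=> [//|t t_0|]; first by split; [exact: cmpsi|have [] := Linf_bounded t_0].
  by case E : p => [r||]; rewrite -?E; [case: (strong_psi_A E)|case: (weakstar_psi_A E)|
    move: p1; rewrite E].
- split=> [//|t t_0|]; first by split; [exact: cmA|have [] := Linf_bounded t_0].
  by case E : p => [r||]; rewrite -?E; [case: (strong_psi_A E)|case: (weakstar_psi_A E)|
    move: p1; rewrite E].
- split.
    move=> i; rewrite (ord1 i); split.
      rewrite (_ : (fun z => _) = (fun z : rT * rT => qf ty (fun s k => U s k z.1 z.2))).
        by apply: measurable_funTS; exact: jq.
      by apply/funext => z; rewrite qU.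
    by rewrite (_ : (fun z => _) = cst 0)//; apply/funext => z; rewrite qU.
  move=> T T0.
  apply: (@sol_product_mixed_norm _ p m c h U p1 m0 c0 mh h0 hc Ule T
    (fun t x => enorm (quadf alpha (psi t x))) T0).
  + rewrite /jm (_ : (fun z => _) = (fun z : rT * rT => `|qf ty (fun s k => U s k z.1 z.2)|)).
      exact: measurableT_comp.
    by apply/funext => z; rewrite (enorm_real (qU _ _)).
  + by move=> t x; exact: enorm_ge0.
  + move=> t x; rewrite (enorm_real (qU _ _)).
    apply: (le_trans (qf_n3_le _ _)).
    by have := prod0 t x; rewrite /prod; lra.
- have mg : cmeasurable setT (fun z : rT * rT => gauge_coupling (A z.1 z.2) (psi z.1 z.2)).
    apply: cmeasurable_gauge_coupling => s k.
    rewrite (_ : (fun z => _) = (fun z : rT * rT => U s k z.1 z.2)); first exact: jU.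
    by apply/funext => z; rewrite cmp_spinor.
  split; first by move=> i; split; apply: measurable_funTS; [exact: (mg i).1|exact: (mg i).2].
  move=> T T0.
  apply: (@sol_product_mixed_norm _ p m c h U p1 m0 c0 mh h0 hc Ule T
    (fun t x => enorm (gauge_coupling (A t x) (psi t x))) T0).
  + exact: (measurable_enorm mg).
  + by move=> t x; exact: enorm_ge0.
  + move=> t x; apply: (le_trans (enorm_gauge_coupling_le _ _)).
    by rewrite cmp_spinorE.
Qed.

End SolutionClass.

(** * Lipschitz dependence on the data *)

Section LipschitzDependence.
Context {R : realType}.
Local Notation mu := (@lebesgue_measure R).
Local Notation rT := (measurableTypeR R).
Implicit Types (p : \bar R).

Definition datum_majorant (psi0 : rT -> 'cV[R[i]]_2) (A0 : rT -> 'cV[R]_2) (y : R) : R := tot (cmp (psi0 y) (A0 y)).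

(** A bound for the norm of [datum_majorant]; the 8 is the constant of [tot_cmp_le]. *)
Definition datum_size p (psi0 : rT -> 'cV[R[i]]_2) (A0 : rT -> 'cV[R]_2) : R :=
  8 * (fine (Lpnorm p psi0) + fine (Lpnorm p (fun x => cvec (A0 x)))).

Definition csd_solution p (m : R) ty (psi0 : rT -> 'cV[R[i]]_2) (A0 : rT -> 'cV[R]_2) (U : bool -> component -> R -> R -> R) :=
  [/\ forall s k, jm (U s k),
      forall s k t y, 0 <= t -> U s k t (y + sgn s * t) = cmp (psi0 y) (A0 y) s k +
        \int[mu]_(r in `[0, t])
          csd m ty s k (fun s' k' => U s' k' r (y + sgn s * r)) &
      forall s t y, 0 <= t -> n3 (fun k => U s k t (y + sgn s * t)) <=
        Gam m (datum_size p psi0 A0 + 1) t *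
        (datum_majorant psi0 A0 y + win (datum_majorant psi0 A0) t (y + sgn s * t))].

Lemma tot_cmp_nm p (psi0 : rT -> 'cV[R[i]]_2) (A0 : rT -> 'cV[R]_2) a b : (1 <= p)%E -> cmeasurable setT psi0 ->
  cmeasurable setT (fun x => cvec (A0 x)) ->
  (Lpnorm p psi0 <= a%:E)%E -> (Lpnorm p (fun x => cvec (A0 x)) <= b%:E)%E ->
  0 <= a -> 0 <= b ->
  (nm p (fun y => tot (cmp (psi0 y) (A0 y))) <= (8 * (a + b))%:E)%E.
Proof.
move=> p1 mpsi mA ha hb a0 b0.
have m1 := measurable_enorm mpsi; have m2 := measurable_enorm mA.
have m12 := measurable_funD m1 m2.
apply: (@le_trans _ _ (nm p (fun x => 8 * (enorm (psi0 x) + enorm (cvec (A0 x)))))).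
  apply: nm_mono => //.
  - by apply: (measurable_tot (X := fun s k y => cmp (psi0 y) (A0 y) s k)) => s k; exact: measurable_cmp.
  - by apply: measurable_funM; [exact: measurable_cst|exact: m12].
  - apply: aeW => x; rewrite (ger0_norm (tot_ge0 _)).
    by apply: le_trans (ler_norm _); exact: tot_cmp_le.
apply: nmZ_le => //; first by rewrite addr_ge0.
by apply: (le_trans (nmD p1 m1 m2)); rewrite EFinD; apply: leeD.
Qed.

Lemma Lp_datum p (psi0 : rT -> 'cV[R[i]]_2) (A0 : rT -> 'cV[R]_2) : (1 <= p)%E -> inLp p psi0 -> inLp p (fun x => cvec (A0 x)) ->
  [/\ forall s k, measurable_fun setT (fun y : rT => cmp (psi0 y) (A0 y) s k),
      measurable_fun setT (datum_majorant psi0 A0 : rT -> R), 0 <= datum_size p psi0 A0 &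
      (nm p (datum_majorant psi0 A0) <= (datum_size p psi0 A0)%:E)%E].
Proof.
move=> p1 [mpsi fpsi] [mA fA].
have mc s k : measurable_fun setT (fun y : rT => cmp (psi0 y) (A0 y) s k).
  exact: measurable_cmp.
have n1 : 0 <= fine (Lpnorm p psi0) by apply: fine_ge0; exact: nm_ge0.
have n2 : 0 <= fine (Lpnorm p (fun x => cvec (A0 x))) by apply: fine_ge0; exact: nm_ge0.
split => //.
- exact: (measurable_tot (X := fun s k y => cmp (psi0 y) (A0 y) s k)).
- by rewrite mulr_ge0// addr_ge0.
- by apply: tot_cmp_nm; rewrite ?fineK// ge0_fin_numE// nm_ge0.
Qed.

Lemma csd_solution_exists p (m : R) ty (psi0 : rT -> 'cV[R[i]]_2) (A0 : rT -> 'cV[R]_2) : (1 <= p)%E -> 0 < m ->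
  inLp p psi0 -> inLp p (fun x => cvec (A0 x)) ->
  exists U, csd_solution p m ty psi0 A0 U.
Proof.
move=> p1 m0 psiL AL; have [mc mh c0 hc] := Lp_datum p1 psiL AL.
have ul := uloc_nm p1 c0 mh (fun z => tot_ge0 _) hc.
have [U [jU UE Ub]] := @csd_exists R m _ ty _ (fun s k y => cmp (psi0 y) (A0 y) s k) m0 ul mc
  (fun s y => n3_le_tot (cmp (psi0 y) (A0 y)) s).
by exists U.
Qed.

Let size_le p (psi0 : rT -> 'cV[R[i]]_2) (A0 : rT -> 'cV[R]_2) M : inLp p psi0 -> inLp p (fun x => cvec (A0 x)) ->
  (Lpnorm p psi0 + Lpnorm p (fun x => cvec (A0 x)) <= M%:E)%E -> datum_size p psi0 A0 <= 8 * M.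
Proof.
move=> [_ f1] [_ f2] h; rewrite /datum_size ler_wpM2l// -lee_fin EFinD.
by rewrite !fineK// ge0_fin_numE// nm_ge0.
Qed.

(** The pointwise stability bound is integrated: its exponential is controlled through window bounds
    by [M] and [T] alone, so the constant is uniform on bounded sets of data. *)
Theorem csd_solution_lipschitz p (m T M : R) ty : (1 <= p)%E -> 0 < m -> 0 <= T -> 0 <= M ->
  exists2 L : R, 0 <= L &
  forall (psi0 psi0' : rT -> 'cV[R[i]]_2) (A0 A0' : rT -> 'cV[R]_2) (U U' : bool -> component -> R -> R -> R),
    inLp p psi0 -> inLp p (fun x => cvec (A0 x)) ->
    inLp p psi0' -> inLp p (fun x => cvec (A0' x)) ->
    (Lpnorm p psi0 + Lpnorm p (fun x => cvec (A0 x)) <= M%:E)%E ->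
    (Lpnorm p psi0' + Lpnorm p (fun x => cvec (A0' x)) <= M%:E)%E ->
    csd_solution p m ty psi0 A0 U -> csd_solution p m ty psi0' A0' U' ->
    forall (t d : R), 0 <= t <= T -> 0 <= d ->
      (nm p (fun y => tot (cmp (psi0 y - psi0' y) (A0 y - A0' y))%R) <= d%:E)%E ->
      forall s, (nm p (fun x => d3 (fun k => U s k t x) (fun k => U' s k t x)) <= (L * d)%:E)%E.
Proof.
move=> p1 m0 T0 M0; have m0' := ltW m0.
pose S := 8 * M; have S0 : 0 <= S by rewrite mulr_ge0.
have S10 : 0 <= S + 1 by rewrite addr_ge0.
pose N := (S + 1) * (1 + 2 * T).
have N0 : 0 <= N by apply: mulr_ge0 => //; lra.
pose G := Gam m (S + 1) T.
have G1 : 1 <= G by exact: Gam_ge1.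
have G0 : 0 <= G by lra.
pose c := G * (N + 1).
have c0 : 0 <= c by apply: mulr_ge0 => //; lra.
pose Y := 2 * c + m.
have Y0 : 0 <= Y by rewrite /Y; lra.
pose X := expR (2 * (Y * (2 * N + 2 * T))).
have X0 : 0 <= X by exact: expR_ge0.
pose W := 1 + 2 * T.
have W0 : 0 <= W by rewrite /W; lra.
(* [X] bounds the exponential and [Y] is the Gronwall coefficient. The window of [e] is at most
   [W d] pointwise, to be multiplied by the norm [2 S] of [h + h'], and at most [W ^ 2 d] in
   norm. *)
exists (X * (1 + Y * (2 * S * W + W ^+ 2))).
  by rewrite mulr_ge0// addr_ge0// mulr_ge0// addr_ge0// ?sqr_ge0// !mulr_ge0.
move=> psi0 psi0' A0 A0' U U' L1 L2 L1' L2' hM hM' [jU UE Ub] [jU' UE' Ub'] t d tT d0 hd s.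
have [t0 tT'] := andP tT.
have t1 : 0 <= 1 + 2 * t by rewrite addr_ge0// mulr_ge0.
have tW : 1 + 2 * t <= W by rewrite /W lerD2l ler_wpM2l.
have SS : S <= S + 1 by rewrite lerDl.
have [mf mh c1 hc] := Lp_datum p1 L1 L2.
have [mf' mh' c1' hc'] := Lp_datum p1 L1' L2'.
have sS := size_le L1 L2 hM; have sS' := size_le L1' L2' hM'.
set h := datum_majorant psi0 A0 in mh hc Ub *; set h' := datum_majorant psi0' A0' in mh' hc' Ub' *.
have h0 y : 0 <= h y by exact: tot_ge0.
have h0' y : 0 <= h' y by exact: tot_ge0.
have hcS : (nm p h <= S%:E)%E by apply: le_trans hc _; rewrite lee_fin.
have hcS' : (nm p h' <= S%:E)%E by apply: le_trans hc' _; rewrite lee_fin.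
pose e y := tot (cmp (psi0 y - psi0' y) (A0 y - A0' y)).
have eE y : e y = tot (fun s k => cmp (psi0 y) (A0 y) s k - cmp (psi0' y) (A0' y) s k).
  by rewrite /e /tot /n3 !cmpB.
have e0 y : 0 <= e y by exact: tot_ge0.
have me : measurable_fun setT (e : rT -> R).
  rewrite (_ : (e : rT -> R) = (fun y : rT => tot (fun s k => cmp (psi0 y) (A0 y) s k - cmp (psi0' y) (A0' y) s k))).
    apply: (measurable_tot (X := fun s k (y : rT) => cmp (psi0 y) (A0 y) s k - cmp (psi0' y) (A0' y) s k)) => s' k'.
    exact: (measurable_funB (mf s' k') (mf' s' k')).
  by apply/funext => y; exact: eE.
have he : (nm p e <= d%:E)%E by exact: hd.
have le : locint e by exact: (nm_locint p1 me he).
have lh : locint h by exact: (nm_locint p1 mh hc).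
have lh' : locint h' by exact: (nm_locint p1 mh' hc').
pose H y := h y + h' y + 1.
have lhh : locint (fun y => h y + h' y) by exact: locintD.
have lH : locint H by apply: locintD => //; exact: locint_cst.
have H1 y : 1 <= H y by rewrite /H lerDr addr_ge0.
have H0 y : 0 <= H y by rewrite !addr_ge0.
have label (V : bool -> component -> R -> R -> R) (g : rT -> R) (b : R) : measurable_fun setT g ->
    (forall z, 0 <= g z) -> 0 <= b -> b <= S -> (nm p g <= b%:E)%E ->
    (forall y, g y + 1 <= H y) ->
    (forall s t y, 0 <= t -> n3 (fun k => V s k t (y + sgn s * t)) <=
        Gam m (b + 1) t * (g y + win g t (y + sgn s * t))) ->
    forall s t y, 0 <= t <= T -> n3 (fun k => V s k t (y + sgn s * t)) <= c * H y.
  move=> mg g0 b0 bS gb gH Vb s' t' y tT1; have [t'0 _] := andP tT1.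
  apply: (le_trans (sol_label_le p1 m0 b0 mg g0 gb Vb s' y tT1)).
  have w1 : (b + 1) * (1 + 2 * T) <= N by rewrite /N ler_wpM2r// lerD2r.
  have q0 : 0 <= (b + 1) * (1 + 2 * T) by rewrite mulr_ge0// addr_ge0.
  rewrite /c -mulrA; apply: ler_pM.
  - by apply: le_trans ler01 _; apply: Gam_ge1; rewrite ?addr_ge0.
  - by rewrite addr_ge0.
  - by apply: Gam_ndM; rewrite ?addr_ge0 ?lerD2r.
  - have := mulr_ge0 N0 (g0 y); have := gH y; have := ler_wpM2l N0 (gH y).
    move: w1; move: ((b + 1) * (1 + 2 * T)) (H y) (g y) => q z gy; lra.
have UH := label U h _ mh h0 c1 sS hc _ Ub.
have {}UH : forall s t y, 0 <= t <= T -> n3 (fun k => U s k t (y + sgn s * t)) <= c * H y.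
  by apply: UH => y; rewrite lerD2r lerDl.
have UH' : forall s t y, 0 <= t <= T -> n3 (fun k => U' s k t (y + sgn s * t)) <= c * H y.
  by apply: (label U' h' _ mh' h0' c1' sS' hc' _ Ub') => y; rewrite lerD2r lerDr.
have fe s' y : d3 (fun k => cmp (psi0 y) (A0 y) s' k) (fun k => cmp (psi0' y) (A0' y) s' k) <= e y.
  rewrite eE.
  exact: (n3_le_tot (fun s k => cmp (psi0 y) (A0 y) s k - cmp (psi0' y) (A0' y) s k) s').
have stab := csd_stability m0' c0 lH H1 le e0 jU jU' UE UE' UH UH' fe.
have winH x : win H t x <= 2 * N + 2 * T.
  have w1 : win h t x <= N.
    apply: (le_trans (win_nm x p1 mh h0 hcS t0)); rewrite /N mulrC.
    exact: ler_pM.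
  have w2 : win h' t x <= N.
    apply: (le_trans (win_nm x p1 mh' h0' hcS' t0)); rewrite /N mulrC.
    exact: ler_pM.
  rewrite /H win_add1// winD// lerD//; last by rewrite ler_wpM2l.
  by rewrite mulr_natl mulr2n lerD.
have wine x : win e t x <= W * d.
  by apply: (le_trans (win_nm x p1 me e0 he t0)); rewrite ler_wpM2r.
have wine0 x : 0 <= win e t x by exact: win_ge0.
pose es x := e (x - sgn s * t); pose hs x := h (x - sgn s * t); pose hs' x := h' (x - sgn s * t).
have mes : measurable_fun setT (es : rT -> R) by exact: measurable_shift.
have mhs : measurable_fun setT (hs : rT -> R) by exact: measurable_shift.
have mhs' : measurable_fun setT (hs' : rT -> R) by exact: measurable_shift.
have mwin : measurable_fun setT (fun x : rT => win e t x) by exact: measurable_win.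
(* For finite [p] the summand 1 of [H] is not in [L^p]. Against [h + h'] the window of [e] is
   therefore replaced by its supremum, and against 1 it is kept and estimated in norm. *)
pose B x := X * (es x + (Y * ((W * d) * (hs x + hs' x) + win e t x))).
have point x : d3 (fun k => U s k t x) (fun k => U' s k t x) <= B x.
  have := stab s t (x - sgn s * t) tT; rewrite !subrK => /le_trans; apply.
  rewrite /B; apply: ler_pM.
  - exact: expR_ge0.
  - by rewrite addr_ge0// mulr_ge0// mulr_ge0.
  - by rewrite ler_expR ler_wpM2l// ler_wpM2l.
  - rewrite lerD2l -/Y -mulrA ler_wpM2l// /H -/(hs x) -/(hs' x) mulrDl mul1r lerD2r mulrC.
    by rewrite ler_wpM2r// addr_ge0// /hs /hs'.
have mhh := measurable_funD mhs mhs'.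
have mWh : measurable_fun setT (fun x : rT => (W * d) * (hs x + hs' x)).
  by apply: measurable_funM; [exact: measurable_cst|exact: mhh].
have mI := measurable_funD mWh mwin.
have mYI : measurable_fun setT (fun x : rT => Y * ((W * d) * (hs x + hs' x) + win e t x)).
  by apply: measurable_funM; [exact: measurable_cst|exact: mI].
have mB : measurable_fun setT (B : rT -> R).
  by apply: measurable_funM; [exact: measurable_cst|exact: measurable_funD].
have md : measurable_fun setT (fun x : rT => d3 (fun k => U s k t x) (fun k => U' s k t x)).
  apply: (measurable_n3 (V := fun k x => U s k t x - U' s k t x)) => k.
  by apply: measurable_funB; apply: (jm_comp _).
have Wd0 : 0 <= W * d by exact: mulr_ge0.
apply: (@le_trans _ _ (nm p B)).
  apply: nm_mono => //; apply: aeW => x; rewrite (ger0_norm (n3_ge0 _)).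
  exact: le_trans (point x) (ler_norm _).
rewrite -[(X * _) * d]mulrA; apply: (nmZ_le p1 X0 _ (measurable_funD mes mYI)).
  by rewrite mulr_ge0// addr_ge0// mulr_ge0// addr_ge0// ?sqr_ge0// !mulr_ge0.
apply: (le_trans (nmD p1 mes mYI)).
rewrite (_ : (1 + Y * (2 * S * W + W ^+ 2)) * d = d + Y * ((2 * S * W + W ^+ 2) * d)); last by ring.
rewrite EFinD; apply: leeD; first by rewrite (nm_shift _ p1 me).
apply: (nmZ_le p1 Y0 _ mI).
  by rewrite mulr_ge0// addr_ge0// ?sqr_ge0// !mulr_ge0.
apply: (le_trans (nmD p1 mWh mwin)).
rewrite (_ : (2 * S * W + W ^+ 2) * d = (W * d) * (S + S) + W ^+ 2 * d); last by ring.
rewrite EFinD; apply: leeD.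
  apply: (nmZ_le p1 Wd0 (addr_ge0 S0 S0) mhh).
  apply: (le_trans (nmD p1 mhs mhs')); rewrite EFinD; apply: leeD.
    by rewrite (nm_shift _ p1 mh).
  by rewrite (nm_shift _ p1 mh').
apply: (le_trans (nm_win p1 me e0 d0 he t0)).
by rewrite lee_fin ler_wpM2r// ler_sqr.
Qed.

End LipschitzDependence.

Theorem theorem1p1 (R : realType) (m : R) (p : \bar R) (alpha : 'M[R[i]]_2)
    (m_gt0 : 0 < m) (p_ge1 : (1 <= p)%E)
    (alphaE : alpha = gamma0 \/ alpha = - 'i%C *: gamma1) :
  exists (Psi : (measurableTypeR R -> 'cV[R[i]]_2) ->
                (measurableTypeR R -> 'cV[R]_2) ->
                measurableTypeR R -> measurableTypeR R -> 'cV[R[i]]_2)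
         (AA : (measurableTypeR R -> 'cV[R[i]]_2) ->
               (measurableTypeR R -> 'cV[R]_2) ->
               measurableTypeR R -> measurableTypeR R -> 'cV[R]_2),
    (forall (psi0 : measurableTypeR R -> 'cV[R[i]]_2)
            (A0 : measurableTypeR R -> 'cV[R]_2),
       inLp p psi0 -> inLp p (fun x => cvec (A0 x)) ->
       [/\ weak_solution m alpha psi0 A0 (Psi psi0 A0) (AA psi0 A0),
           uniqueness_class p alpha (Psi psi0 A0) (AA psi0 A0) &
           forall (psi : measurableTypeR R -> measurableTypeR R -> 'cV[R[i]]_2)
                  (A : measurableTypeR R -> measurableTypeR R -> 'cV[R]_2),
             weak_solution m alpha psi0 A0 psi A ->
             uniqueness_class p alpha psi A ->
             same_evolution psi (Psi psi0 A0) /\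
             same_evolution A (AA psi0 A0)])
    /\ lipschitz_solution_map p Psi AA.
Proof.
have [ty qE] := quadf_real alphaE.
pose rT := measurableTypeR R.
(* The solution maps are obtained by choice over all pairs of data; outside [L^p] the value is
   arbitrary, here 0. *)
have sol (D : (rT -> 'cV[R[i]]_2) * (rT -> 'cV[R]_2)) : exists U,
    inLp p D.1 -> inLp p (fun x => cvec (D.2 x)) -> csd_solution p m ty D.1 D.2 U.
  have [[h1 h2]|nL] := pselect (inLp p D.1 /\ inLp p (fun x => cvec (D.2 x))).
    by have [U hU] := csd_solution_exists ty p_ge1 m_gt0 h1 h2; exists U.
  by exists (fun _ _ _ _ => 0) => h1 h2; exfalso; exact: nL.
have [U hU] := choice sol.
exists (fun psi0 A0 t x => spinor (fun s k => U (psi0, A0) s k t x)).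
exists (fun psi0 A0 t x => potential (fun s k => U (psi0, A0) s k t x)).
split.
  move=> psi0 A0 psiL AL.
  have [jU UE Ub] := hU (psi0, A0) psiL AL.
  have [mc mh c0 hc] := Lp_datum p_ge1 psiL AL.
  have h0 z : 0 <= datum_majorant psi0 A0 z by exact: tot_ge0.
  split.
  - exact: (solution_weak p_ge1 m_gt0 c0 qE mh h0 hc jU UE Ub).
  - exact: (solution_class p_ge1 m_gt0 c0 qE mh h0 hc jU UE Ub).
  - move=> psi A ws [cpsi cA _ _].
    have uniq s t : 0 <= t -> {ae lebesgue_measure, forall x : rT, forall k,
        cmp (psi t x) (A t x) s k = U (psi0, A0) s k t x}.
      move=> t0; apply: ae_component => k.
      exact: (class_uniqueness p_ge1 m_gt0 c0 qE mh h0 hc mc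
        (fun s y => n3_le_tot (cmp (psi0 y) (A0 y)) s) jU UE Ub ws cpsi cA s k t0).
    have eqX t : 0 <= t -> {ae lebesgue_measure, forall x : rT,
        cmp (psi t x) (A t x) = (fun s k => U (psi0, A0) s k t x)}.
      move=> t0; apply: filterS2 (uniq false t t0) (uniq true t t0) => x e1 e2.
      by apply/funext => -[]; apply/funext => k; [exact: e2|exact: e1].
    split=> t t0; have := eqX t t0; apply: filterS => x <-.
      by rewrite spinor_cmp.
    by rewrite potential_cmp.
move=> T M.
(* A negative [T] leaves no time and a negative [M] no data, so any constant will do. *)
have [T0|T0] := leP 0 T; last first.
  exists 0 => psi0 psi0' A0 A0' _ _ _ _ _ _ t /andP[t0 tT].
  by have := lt_le_trans T0 (le_trans t0 tT); rewrite ltxx.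
have [M0|M0] := leP 0 M; last first.
  exists 0 => psi0 psi0' A0 A0' _ _ _ _ nM _ t _; exfalso.
  have : (0 <= M%:E)%E by apply: le_trans nM; rewrite adde_ge0// nm_ge0.
  by rewrite lee_fin leNgt M0.
have [L L0 hL] := csd_solution_lipschitz ty p_ge1 m_gt0 T0 M0.
(* 32 is 8 from [tot_cmp_le], times two families, times two norms to be estimated. The 1 makes the
   constant positive, so that an infinite distance of the data gives an infinite bound. *)
exists (32 * L + 1) => psi0 psi0' A0 A0' L1 L2 L1' L2' hM hM' t tT.
set D := dist_Lp p psi0 psi0' A0 A0'.
have L10 : 0 < 32 * L + 1 by rewrite ltr_wpDl// mulr_ge0.
have n1 : (0 <= Lpnorm p (fun x => psi0 x - psi0' x)%R)%E by exact: nm_ge0.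
have n2 : (0 <= Lpnorm p (fun x => cvec (A0 x - A0' x)%R))%E by exact: nm_ge0.
have D0 : (0 <= D)%E by exact: adde_ge0.
have [Dfin|] := boolP (D \is a fin_num); last first.
  rewrite ge0_fin_numE// -leNgt leye_eq => /eqP ->.
  by rewrite gt0_muley ?lte_fin// leey.
have /andP[f1 f2] : (Lpnorm p (fun x => psi0 x - psi0' x)%R \is a fin_num) &&
    (Lpnorm p (fun x => cvec (A0 x - A0' x)%R) \is a fin_num).
  by move: Dfin; rewrite /D /dist_Lp fin_numD.
set a := fine (Lpnorm p (fun x => psi0 x - psi0' x)%R).
set b := fine (Lpnorm p (fun x => cvec (A0 x - A0' x)%R)).
have a0 : 0 <= a by exact: fine_ge0.
have b0 : 0 <= b by exact: fine_ge0.
have DE : D = (a + b)%:E by rewrite EFinD !fineK.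
have mdA : cmeasurable setT (fun x : rT => cvec (A0 x - A0' x)).
  rewrite (_ : (fun x => _) = (fun x => cvec (A0 x) - cvec (A0' x))).
    by apply: cmeasurableB; [case: L2|case: L2'].
  by apply/funext => x; rewrite /cvec map_mxB.
have mdpsi : cmeasurable setT (fun x : rT => psi0 x - psi0' x).
  by apply: cmeasurableB; [case: L1|case: L1'].
have hd : (nm p (fun y => tot (cmp (psi0 y - psi0' y) (A0 y - A0' y))%R) <= (8 * (a + b))%:E)%E.
  by apply: tot_cmp_nm => //; rewrite fineK.
have d0 : 0 <= 8 * (a + b) by rewrite mulr_ge0// addr_ge0.
have S := hU (psi0, A0) L1 L2; have S' := hU (psi0', A0') L1' L2'.
have hs := hL _ _ _ _ _ _ L1 L2 L1' L2' hM hM' S S' t _ tT d0 hd.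
have [jU _ _] := S; have [jU' _ _] := S'.
pose X s k x := U (psi0, A0) s k t x - U (psi0', A0') s k t x.
have mX s k : measurable_fun setT (X s k : rT -> R).
  by apply: measurable_funB; [apply: (jm_comp (jU s k))|apply: (jm_comp (jU' s k))].
have mn s : measurable_fun setT (fun x : rT => n3 (fun k => X s k x)).
  by apply: measurable_n3 => k; exact: mX.
have htot : (nm p (fun x => tot (fun s k => X s k x)) <= (2 * (L * (8 * (a + b))))%:E)%E.
  apply: (le_trans (nmD p_ge1 (mn false) (mn true))).
  rewrite (_ : 2 * (L * (8 * (a + b))) = L * (8 * (a + b)) + L * (8 * (a + b))); last by ring.
  by rewrite EFinD; apply: leeD; exact: hs.
have mtot := measurable_tot mX.
have msp V : (forall s k, jm (V s k)) ->
    cmeasurable setT (fun x : rT => spinor (fun s k => V s k t x)).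
  move=> jV; apply: (cmeasurable_spinor (X := fun s k => V s k t)) => s k.
  by apply: (jm_comp (jV s k)).
have mpot V : (forall s k, jm (V s k)) ->
    cmeasurable setT (fun x : rT => cvec (potential (fun s k => V s k t x))).
  move=> jV; apply: (cmeasurable_potential (X := fun s k => V s k t)) => s k.
  by apply: (jm_comp (jV s k)).
apply: (@le_trans _ _ (2 * (L * (8 * (a + b))) + 2 * (L * (8 * (a + b))))%:E).
  rewrite EFinD; apply: leeD; apply: le_trans htot; rewrite LpnormE; apply: nm_mono => //.
  - exact: (measurable_enorm (cmeasurableB (msp _ jU) (msp _ jU'))).
  - apply: aeW => x; rewrite (ger0_norm (tot_ge0 _)) (ger0_norm (enorm_ge0 _)).
    exact: enorm_spinorB.
  - apply: measurable_enorm.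
    rewrite (_ : (fun x => _) = (fun x => cvec (potential (fun s k => U (psi0, A0) s k t x)) -
       cvec (potential (fun s k => U (psi0', A0') s k t x)))).
      by apply: cmeasurableB; exact: mpot.
    by apply/funext => x; rewrite /cvec map_mxB.
  - apply: aeW => x; rewrite (ger0_norm (tot_ge0 _)) (ger0_norm (enorm_ge0 _)).
    exact: enorm_potentialB.
rewrite DE -EFinM lee_fin.
have := addr_ge0 a0 b0; move: (a + b) => q q0.
by rewrite mulrDl mul1r; lra.
Qed.
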